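(* Let $p>0$, $\omega:=p+1-\lceil p\rceil\in(0,1]$, and let $(X^{(n)}_i)_{i\in T_n}$ be a sequence of mean-zero random fields as in the context, with $\alpha$-mixing coefficients $(\alpha_{\ell,n})_{\ell\ge1}$ (of order $\lceil p\rceil+1$). Suppose that there exists $r\in(p+2,\infty]$ such that $$\liminf_{n\to\infty}\frac{\sigma_n^2}{|T_n|}>0,\qquad \sup_{n,\,i\in T_n}\|X^{(n)}_i\|_r<\infty,\qquad \sup_n\sum_{\ell=1}^{\lfloor |T_n|^{1/d}\rfloor}\ell^{d-1}\alpha_{\ell,n}^{(r-p-2)/r}<\infty .$$ Define $$M_n:=|T_n|^{-p/2}\sum_{\ell=1}^{\lfloor |T_n|^{1/d}\rfloor}\ell^{d(p+1)-\omega}\,\alpha_{\ell,n}^{(r-p-2)/r}.$$ (a) Uniformly over $h\in\Lambda_p$, $$\mathbb E[h(W_n)]-\mathcal N h=\sum_{(a,s_{1:a})\in\Gamma(\lceil p\rceil-1)}(-1)^a\prod_{j=1}^a\frac{\kappa_{s_j+2}(W_n)}{(s_j+1)!}\;\mathcal N\Bigl[(\partial^{s_1+1}\Theta)\circ\cdots\circ(\partial^{s_a+1}\Theta)\,h\Bigr]+\mathcal O(|T_n|^{-p/2})+\mathcal O(M_n).$$ Moreover, for every integer $1\le j\le\lceil p\rceil-1$, $$|\kappa_{j+2}(W_n)|=\mathcal O(|T_n|^{-j/2})+\mathcal O(M_n^{j/p})$$ (this assertion is vacuous when $0<p\le1$). (b) If $p\ge1$ and $M_n\to0$ as $n\to\infty$,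 then $W_n$ converges to $N(0,1)$ in the Wasserstein-$p$ distance, and $$\mathcal W_p(\mathcal L(W_n),N(0,1))=\mathcal O(|T_n|^{-1/2})+\mathcal O(M_n^{1/p}).$$
   Context: Setting. Fix $d\in\mathbb N_+$. $T_1\subseteq T_2\subseteq\cdots$ are finite nonempty subsets of $\mathbb Z^d$ with $|T_n|\to\infty$. For each $n$, $(X^{(n)}_i)_{i\in T_n}$ is a family of real random variables with mean zero and finite second moments (no stationarity is assumed). Put $\sigma_n^2:=\operatorname{Var}(\sum_{i\in T_n}X^{(n)}_i)$ and $W_n:=\sigma_n^{-1}\sum_{i\in T_n}X^{(n)}_i$ (defined when $\sigma_n>0$). $\|X\|_r:=(\mathbb E|X|^r)^{1/r}$ for $r<\infty$, and $\|X\|_\infty$ is the essential supremum norm of $X$. When $r=\infty$, ratios $(r-a)/r$ and $r/(r-a)$ with finite $a$ are read as $1$. $\kappa_j(W_n)$ is the $j$-th cumulant of $W_n$. Mixing coefficients. For sub-$\sigma$-algebras $\mathcal A,\mathcal B$, $\alpha(\mathcal A,\mathcal B):=\sup_{A\in\mathcal A,B\in\mathcal B}|\mathbb P(A\cap B)-\mathbb P(A)\mathbb P(B)|$. For positive integers $\ell,q$, $\alpha^{[q]}_{\ell,n}:=0\vee\sup\{\alpha(\sigma(X^{(n)}_i:i\in U_1),\sigma(X^{(n)}_i:i\in U_2)):U_1,U_2\subseteq T_n,\ |U_1|\le q,\ d(U_1,U_2)\ge\ell\}$, where $d(U_1,U_2)=\min\{\|i_1-i_2\|:i_1\in U_1,i_2\in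 U_2\}$ and $\|\cdot\|$ is the maximum norm. Throughout, $\alpha_{\ell,n}:=\alpha_{\ell,n}^{[\lceil p\rceil+1]}$. Function class. For $k\in\mathbb N$ and $\omega\in(0,1]$, $f\in\mathcal C^{k,\omega}(\mathbb R)$ means $f\in\mathcal C^k(\mathbb R)$ and $|f|_{k,\omega}:=\sup_{x\ne y}|f^{(k)}(x)-f^{(k)}(y)|/|x-y|^\omega<\infty$. For $p>0$, with $\omega=p+1-\lceil p\rceil$, $\Lambda_p:=\{f\in\mathcal C^{\lceil p\rceil-1,\omega}(\mathbb R):|f|_{\lceil p\rceil-1,\omega}\le1\}$. Operators. $\mathcal N h:=\mathbb E[h(Z)]$ with $Z\sim N(0,1)$. $\partial$ is differentiation. $\Theta h$ is the standard solution $f$ of Stein's equation $xf(x)-f'(x)=\mathcal N h-h(x)$, i.e. $\Theta h(x)=e^{x^2/2}\int_{-\infty}^x(h(w)-\mathcal N h)e^{-w^2/2}\,dw$. For an integer $q\ge0$, $\Gamma(q):=\{(a,s_1,\dots,s_a): a,s_1,\dots,s_a\in\mathbb N_+,\ \sum_{j=1}^a s_j\le q\}$, so $\Gamma(0)=\varnothing$; $s_{1:a}$ abbreviates $s_1,\dots,s_a$. Wasserstein distance. $\mathcal W_p(\nu,\mu):=\inf_\gamma(\mathbb E_{(X,Y)\sim\gamma}|X-Y|^p)^{1/p}$, the infimum being over all couplings $\gamma$ of $\nu$ and $\mu$. $\mathcal L(W)$ is the law of $W$. $\mathcal O$-notation is as $n\to\infty$: the implied constants do not depend on $n$ (and, where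 ''uniformly over $h$'' is said, not on $h$), but may depend on $p,d,r$ and the given sequence of fields. *)

(* Defs.v *)
From HB Require Import structures.
From mathcomp Require Import all_boot all_order all_algebra finmap.
From mathcomp Require Import all_classical all_reals all_analysis measurable_realfun.
From mathcomp.real_closed Require Import complex.

Set Implicit Arguments.
Unset Strict Implicit.
Unset Printing Implicit Defensive.

Import Order.TTheory GRing.Theory Num.Theory.
Import numFieldNormedType.Exports.

Local Open Scope classical_set_scope.
Local Open Scope ring_scope.

Section FunctionClasses.
Context {R : realType}.
Implicit Types (p : R) (f h : R -> R) (k : nat).

(* the ceiling of p as a natural number, meaningful for p >= 0 *)
Definition ceiln p : nat := `|Num.ceil p|%N.

Definition omega p : R := p + 1 - (Num.ceil p)%:~R.

Definition Ck k f : Prop :=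
  (forall j, (j < k)%N -> forall x : R, derivable (f^`(j)%classic) x 1) /\
  continuous (f^`(k)%classic).

Definition holder_seminorm k (w : R) f : \bar R :=
  ereal_sup [set e | exists x y : R,
    x != y /\ e = (`|f^`(k)%classic x - f^`(k)%classic y| / `|x - y| `^ w)%:E].

Definition Ckw k (w : R) f : Prop :=
  Ck k f /\ (holder_seminorm k w f < +oo)%E.

Definition Lambda p f : Prop :=
  Ckw (ceiln p).-1 (omega p) f /\
  (holder_seminorm (ceiln p).-1 (omega p) f <= 1)%E.

End FunctionClasses.

Section StandardNormal.
Context {R : realType}.

(* normal_prob lives on measurableTypeR R, whose display is not that of R;
   this is the same set function as a probability on the measurable type R *)
Definition std_normal : set R -> \bar R := normal_prob (0 : R) (1 : R).

Let std_normal0 : std_normal set0 = 0%E.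
Proof. exact: (@measure0 _ _ _ (normal_prob (0 : R) (1 : R))). Qed.

Let std_normal_ge0 A : (0 <= std_normal A)%E.
Proof. exact: (@measure_ge0 _ _ _ (normal_prob (0 : R) (1 : R))). Qed.

Let std_normal_sigma_additive : semi_sigma_additive std_normal.
Proof.
exact: (@measure_semi_sigma_additive _ _ _ (normal_prob (0 : R) (1 : R))).
Qed.

HB.instance Definition _ := isMeasure.Build _ R R std_normal
  std_normal0 std_normal_ge0 std_normal_sigma_additive.

Let std_normal_setT : std_normal setT = 1%E.
Proof. exact: (@probability_setT _ _ _ (normal_prob (0 : R) (1 : R))). Qed.

HB.instance Definition _ :=
  @Measure_isProbability.Build _ R R std_normal std_normal_setT.

End StandardNormal.
Arguments std_normal : clear implicits.

Section SteinOperators.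
Context {R : realType}.
Implicit Types (h : R -> R) (s : seq nat).

Definition gaussE h : R := fine 'E_(std_normal R)[h].

Definition Theta h : R -> R := fun x =>
  expR (x ^+ 2 / 2) *
  \int[lebesgue_measure]_(w in `]-oo, x])
    ((h w - gaussE h) * expR (- (w ^+ 2) / 2)).

(* (d^(s_1+1) Theta) o ... o (d^(s_a+1) Theta) h, with s_1 outermost *)
Definition Theta_comp s h : R -> R :=
  foldr (fun sj g => (Theta g)^`(sj.+1)%classic) h s.

(* the tuple (a, s_1, ..., s_a) is encoded by the sequence [:: s_1; ...; s_a],
   whose size is a *)
Definition Gamma (q : nat) : set (seq nat) :=
  [set s | [/\ (0 < size s)%N, all (fun sj => (0 < sj)%N) s &
               (sumn s <= q)%N]].

(* the finitely supported sum below has junk value 0 on infinite supports;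
   finite_Gamma rules this out *)
Lemma finite_Gamma q : finite_set (Gamma q).
Proof.
pose G := \bigcup_(a in `I_q.+1)
  (range (fun s : a.-tuple 'I_q.+1 => map val s)).
apply: (@sub_finite_set _ _ G); last first.
  apply: bigcup_finite; first exact: finite_II.
  by move=> a _; apply: finite_image; exact: finite_finset.
move=> s [_ s0 sq].
have sz : (size s <= sumn s)%N.
  elim: s s0 {sq} => //= x s IH /andP[x0 s0].
  by rewrite -add1n leq_add// IH.
have bd x : x \in s -> (x < q.+1)%N.
  move=> xs; rewrite ltnS (leq_trans _ sq)//.
  elim: s xs {s0 sq sz} => //= y s IH; rewrite inE => /orP[/eqP ->|/IH].
    exact: leq_addr.
  by move/leq_trans; apply; exact: leq_addl.
exists (size s); first by rewrite /= ltnS (leq_trans sz).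
exists (map_tuple (fun x => inord x : 'I_q.+1) (in_tuple s)) => //=.
rewrite -map_comp -[RHS]map_id; apply/eq_in_map => x xs /=.
by rewrite inordK// bd.
Qed.

Definition edgeworth_sum (q : nat) (kappa : nat -> R) h : R :=
  \sum_(s \in Gamma q)
    ((-1) ^+ size s *
     (\prod_(sj <- s) (kappa (sj + 2)%N / (sj.+1)`!%:R)) *
     gaussE (Theta_comp s h)).

End SteinOperators.

Section Cumulants.
Local Open Scope complex_scope.
Context {d} {Omega : measurableType d} {R : realType}.
Variables (P : probability Omega R) (X : Omega -> R).

Definition charfun (t : R) : R[i] :=
  fine 'E_P[fun w => cos (t * X w)] +i* fine 'E_P[fun w => sin (t * X w)].

(* principal logarithm on the half-plane Re z > 0, where arg (a + ib) =
   atan (b / a); charfun takes its values there in a neighborhood of 0 *)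
Definition clog (z : R[i]) : R[i] :=
  let: a +i* b := z in ln (Num.sqrt (a ^+ 2 + b ^+ 2)) +i* atan (b / a).

(* kappa_j(X) = (-i)^j (d/dt)^j log E[exp(itX)] at t = 0, which is real; it is
   the usual cumulant as soon as E|X|^j < oo *)
Definition cumulant (j : nat) : R :=
  complex.Re ((0 -i* 1) ^+ j *
    ((fun t : R => complex.Re (clog (charfun t)))^`(j)%classic 0 +i*
     (fun t : R => complex.Im (clog (charfun t)))^`(j)%classic 0)).

End Cumulants.

Section Wasserstein.
Context {R : realType}.

Definition coupling (nu mu : probability R R)
    : set (probability (R * R)%type R) :=
  [set g | forall A, measurable A ->
     g (fst @^-1` A) = nu A /\ g (snd @^-1` A) = mu A].

Definition wasserstein (p : R) (nu mu : probability R R) : \bar R :=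
  ereal_inf [set ('E_g[fun z => (`|z.1 - z.2| `^ p)%R] `^ p^-1)%E |
             g in coupling nu mu].

End Wasserstein.

Section PartialSum.
Context {d} {Omega : measurableType d} {R : realType} {I : finType}.
Variables (P : probability Omega R) (X : I -> {RV P >-> R}).

Definition sum_var : R := fine 'V_P[fun w => \sum_i X i w].

Definition normalized_sum : Omega -> R :=
  fun w => (Num.sqrt sum_var)^-1 * \sum_i X i w.

Lemma measurable_normalized_sum : measurable_fun setT normalized_sum.
Proof.
by apply: measurable_funM => //; apply: measurable_sum.
Qed.

HB.instance Definition _ :=
  isMeasurableFun.Build _ _ _ _ normalized_sum measurable_normalized_sum.

(* sigma(X_i : i in U) *)
Definition sigma_gen (U : {set I}) : set (set Omega) :=
  <<s \bigcup_(i in [set` U]) preimage_set_system setT (X i) measurable >>.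

Definition alpha_dep (A B : set (set Omega)) : R :=
  sup [set e | exists a b, [/\ A a, B b &
    e = `|fine (P (a `&` b)) - fine (P a) * fine (P b)|]].

End PartialSum.

Section Mixing.
Context {dim : nat} {d} {Omega : measurableType d} {R : realType}.
Variables (T : {fset 'rV[int]_dim}) (P : probability Omega R).
Variable X : T -> {RV P >-> R}.

Definition maxdist (i j : 'rV[int]_dim) : nat :=
  \max_(k < dim) `|i ord0 k - j ord0 k|%N.

(* d(U1, U2) >= l, where the distance to an empty set is infinite *)
Definition separated (l : nat) (U1 U2 : {set T}) : Prop :=
  forall i1 i2, i1 \in U1 -> i2 \in U2 -> (l <= maxdist (val i1) (val i2))%N.

Definition alpha_mix (q l : nat) : R :=
  Num.max 0 (sup [set e | exists U1 U2 : {set T},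
    [/\ (#|U1| <= q)%N, separated l U1 U2 &
        e = alpha_dep P (sigma_gen X U1) (sigma_gen X U2)]]).

Definition side : nat := Num.truncn ((#|` T|%:R : R) `^ (dim%:R)^-1).

(* (r - p - 2) / r, read as 1 for r = +oo *)
Definition mix_exponent (p : R) (r : \bar R) : R :=
  if r is r'%:E then (r' - p - 2) / r' else 1.

Definition mix_term (p : R) (r : \bar R) (l : nat) : R :=
  alpha_mix (ceiln p).+1 l `^ mix_exponent p r.

Definition mix_sum (p : R) (r : \bar R) : R :=
  \sum_(1 <= l < side.+1) l%:R ^+ dim.-1 * mix_term p r l.

Definition M_coef (p : R) (r : \bar R) : R :=
  #|` T|%:R `^ (- (p / 2)) *
  \sum_(1 <= l < side.+1) l%:R `^ (dim%:R * (p + 1) - omega p) * mix_term p r l.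

End Mixing.

(* Main.v *)
(** Let W be the normalized sum and Z a standard normal variable.

    (a) Fix a site i, telescope G(W) over the shells around i and expand by Taylor's formula.  By
    Davydov's covariance inequality, E[X_i G(W)] is a combination of the E[G^(j)(W)] with
    coefficients that do not depend on G, up to the announced error.  Summing over i and testing
    with polynomials identifies the coefficients of E[W G(W)] as kappa_{j+1}(W) / j!.  Applied to
    the solution G = Theta h of Stein's equation, this expresses E[h(W)] - E[h(Z)] through the
    E[(Theta h)^(s+1)(W)], and the expansion follows by iteration.  The regularity of Theta h is
    obtained from a comparison principle for the equation u' = x u + g.

    (b) Let V be the nondecreasing function such that V(Z) has the law of W.  The derivative of the
    test function h is a sum of bumps of height |I|^(p-1), with the sign of V - id, over maximal
    dyadic intervals I on a neighborhood of which |V - id| >= 4 |I|.  Then h is in the class covered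
    by (a), |h'| <= |V - id|^(p-1), and h(V(z)) - h(z) >= c |V(z) - z|^p (up
    to bounds on the lengths |I|, which are removed in the limit).  By Gaussian integration by
    parts, the terms of the expansion of h are at most C t E[|h'(Z)| (1 + |Z|)^m], where
    t = |T|^(-1/2) + M^(1/p).  Hence w = (E|V(Z) - Z|^p)^(1/p) satisfies
    w^p <= C (t w^(p-1) + t^p), that is w = O(t). *)

From HB Require Import structures.
Require Import Defs.
From mathcomp Require Import all_boot all_order all_algebra finmap zify ring lra.
From mathcomp Require Import all_classical all_reals all_analysis measurable_realfun.
From mathcomp.real_closed Require Import complex.

Set Implicit Arguments.
Unset Strict Implicit.
Unset Printing Implicit Defensive.

Import Order.TTheory GRing.Theory Num.Theory.
Import numFieldNormedType.Exports.

Local Open Scope classical_set_scope.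
Local Open Scope ring_scope.

(** The estimates must be uniform over the whole class of G, while the mixing coefficients let only
    one side of a covariance involve many sites. So the small side of a covariance is always a
    polynomial of degree at most ceil(p) + 1 in the field, and the expansion is first proved with
    unknown coefficients. A polynomial of degree at most q has a constant q-th derivative, so all
    its multiples lie in the class with the same error bound; a quantity whose multiples are all
    bounded by one number vanishes, and the moment recursion then determines the coefficients.

    In (b) a bound C t on the terms of the expansion would give only w^p = O(t). The weight |h'| is
    what improves this, and it can be reached because the polynomial against which a term integrates
    h has Gaussian mean zero, so that one more integration by parts puts a derivative on h. Duality
    for the Wasserstein distance is avoided: V(Z) and Z form a coupling and only an upper bound is
    claimed. The test function changes with n, hence the insistence on constants that depend only on
    bounds on the field. *)

Lemma meas_sum d (Omega : measurableType d) (R : realType) (J : Type) (s : seq J)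
    (F : J -> Omega -> R) (Q : pred J) :
  (forall j, Q j -> measurable_fun setT (F j)) ->
  measurable_fun setT (fun w => \sum_(j <- s | Q j) F j w).
Proof.
move=> FI; elim: s => [|j s IH].
  rewrite (_ : (fun _ => _) = fun=> 0)//.
  by apply/funext => w; rewrite big_nil.
rewrite (_ : (fun _ => _) = fun w => if Q j then F j w + \sum_(j <- s | Q j) F j w
  else \sum_(j <- s | Q j) F j w); last by apply/funext => w; rewrite big_cons.
by case Qj: (Q j) => //; apply: measurable_funD => //; exact: FI.
Qed.

(** * Integration *)

Section Expectation.
Context {d} {Omega : measurableType d} {R : realType}.
Variable mu : {measure set Omega -> \bar R}.
Implicit Types (f g : Omega -> R).

Definition ex f : R := \int[mu]_w f w.
Definition itg f : Prop := mu.-integrable setT (EFin \o f).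

Lemma itg_meas f : itg f -> measurable_fun setT f.
Proof. by move=> /integrableP[/measurable_EFinP]. Qed.

Lemma itg_le f g : measurable_fun setT f -> itg g ->
  (forall w, `|f w| <= g w) -> itg f.
Proof.
move=> mf ig fg; apply: (le_integrable measurableT _ _ ig).
  exact/measurable_EFinP.
move=> w _ /=; rewrite lee_fin (le_trans (fg w))//.
by rewrite ger0_norm// (le_trans _ (fg w)).
Qed.

Lemma itg_norm f : itg f -> itg (fun w => `|f w|).
Proof. by move=> i; exact: (integrable_norm i). Qed.

Lemma itgD f g : itg f -> itg g -> itg (fun w => f w + g w).
Proof. by move=> fi gi; exact: (integrableD measurableT fi gi). Qed.

Lemma itgZ (c : R) f : itg f -> itg (fun w => c * f w).
Proof. by move=> fi; exact: (integrableZl measurableT c fi). Qed.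

Lemma itgN f : itg f -> itg (fun w => - f w).
Proof. by move=> fi; exact: (integrableN fi). Qed.

Lemma itgB f g : itg f -> itg g -> itg (fun w => f w - g w).
Proof. by move=> fi gi; apply: itgD => //; exact: itgN. Qed.

Lemma itg0 : itg (fun=> 0).
Proof. exact: integrable0. Qed.

Lemma itg_sum (J : Type) (s : seq J) (F : J -> Omega -> R) (Q : pred J) :
  (forall j, Q j -> itg (F j)) -> itg (fun w => \sum_(j <- s | Q j) F j w).
Proof.
move=> FI; elim: s => [|j s IH].
  by rewrite (_ : (fun _ => _) = fun=> 0) ?funeqE => [|w]; [exact: itg0|rewrite big_nil].
rewrite (_ : (fun _ => _) = fun w => if Q j then F j w + \sum_(j <- s | Q j) F j w
  else \sum_(j <- s | Q j) F j w); last by apply/funext => w; rewrite big_cons.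
by case Qj: (Q j) => //; apply: itgD => //; exact: FI.
Qed.

Lemma exD f g : itg f -> itg g -> ex (fun w => f w + g w) = ex f + ex g.
Proof. by move=> fi gi; rewrite /ex RintegralD. Qed.

Lemma exB f g : itg f -> itg g -> ex (fun w => f w - g w) = ex f - ex g.
Proof. by move=> fi gi; rewrite /ex RintegralB. Qed.

Lemma exZ (c : R) f : itg f -> ex (fun w => c * f w) = c * ex f.
Proof. by move=> fi; rewrite /ex RintegralZl. Qed.

Lemma exZr (c : R) f : itg f -> ex (fun w => f w * c) = ex f * c.
Proof. by move=> fi; rewrite /ex RintegralZr. Qed.

Lemma exN f : itg f -> ex (fun w => - f w) = - ex f.
Proof.
move=> fi; rewrite (_ : (fun _ => _) = fun w => -1 * f w) ?exZ// ?mulN1r//.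
by apply/funext => w; rewrite mulN1r.
Qed.

Lemma ex0 : ex (fun=> 0) = 0.
Proof. by rewrite /ex Rintegral_cst// mul0r. Qed.

Lemma ex_sum (J : Type) (s : seq J) (F : J -> Omega -> R) (Q : pred J) :
  (forall j, Q j -> itg (F j)) ->
  ex (fun w => \sum_(j <- s | Q j) F j w) = \sum_(j <- s | Q j) ex (F j).
Proof.
move=> FI; elim: s => [|j s IH].
  rewrite big_nil -[RHS]ex0; congr ex; apply/funext => w; exact: big_nil.
rewrite (_ : (fun _ => _) = fun w => if Q j then F j w + \sum_(j <- s | Q j) F j w
  else \sum_(j <- s | Q j) F j w); last by apply/funext => w; rewrite big_cons.
rewrite big_cons; case Qj: (Q j) => //; rewrite exD ?IH//; first exact: FI.
exact: itg_sum.
Qed.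

Lemma ex_le f g : itg f -> itg g -> (forall w, f w <= g w) -> ex f <= ex g.
Proof. by move=> fi gi fg; exact: le_Rintegral. Qed.

Lemma ex_ge0 f : (forall w, 0 <= f w) -> 0 <= ex f.
Proof. by move=> f0; apply: Rintegral_ge0. Qed.

Lemma ex_norm f : itg f -> `|ex f| <= ex (fun w => `|f w|).
Proof. by move=> fi; exact: le_normr_Rintegral. Qed.

Lemma ex_norm_le f g : itg f -> itg g -> (forall w, `|f w| <= g w) ->
  `|ex f| <= ex g.
Proof.
move=> fi gi fg; apply: (le_trans (ex_norm fi)); apply: ex_le => //.
exact: itg_norm.
Qed.

Lemma ex_ae f g : measurable_fun setT f -> measurable_fun setT g ->
  (\forall w \ae mu, f w = g w) -> ex f = ex g.
Proof.
move=> mf mg fg; rewrite /ex /Rintegral; congr fine.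
apply: ae_eq_integral => //; [exact/measurable_EFinP..|].
by apply: filterS fg => w /= ->.
Qed.

End Expectation.

Section ProbabilityExpectation.
Context {d} {Omega : measurableType d} {R : realType}.
Variable P : probability Omega R.
Implicit Types (f g : Omega -> R).

Lemma expectationE f : fine 'E_P[f]%E = ex P f.
Proof. by rewrite unlock. Qed.

Lemma itg_cst (c : R) : itg P (fun=> c).
Proof.
exact: finite_measure_integrable_cst.
Qed.

Lemma ex_cst (c : R) : ex P (fun=> c) = c.
Proof.
transitivity (c * fine (P setT)); first exact: Rintegral_cst.
by rewrite probability_setT mulr1.
Qed.

Lemma itg_bnd f (c : R) : measurable_fun setT f -> (forall w, `|f w| <= c) ->
  itg P f.
Proof. by move=> mf fc; exact: (itg_le mf (itg_cst c) fc). Qed.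

Lemma ex_bnd f (c : R) : measurable_fun setT f -> (forall w, `|f w| <= c) ->
  `|ex P f| <= c.
Proof.
move=> mf fc; rewrite -[leRHS]ex_cst; apply: (ex_norm_le _ _ fc); last exact: itg_cst.
exact: itg_bnd mf fc.
Qed.

Definition cov f g := ex P (fun w => f w * g w) - ex P f * ex P g.

End ProbabilityExpectation.

(** * Davydov's covariance inequality *)

Section PowR.
Context {R : realType}.

Lemma powR_addr (x r s : R) : 0 < x -> x `^ (r + s) = x `^ r * x `^ s.
Proof. by move=> x0; rewrite powRD// (gt_eqF x0) implybT. Qed.

Lemma powR_le1 (x r : R) : 0 <= r -> 0 <= x <= 1 -> x `^ r <= 1.
Proof.
move=> r0 /andP[x0 x1]; apply: (@le_trans _ _ (1 `^ r)); last by rewrite powR1.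
by rewrite ge0_ler_powR// nnegrE.
Qed.

Lemma powR_ge1 (x r : R) : 0 <= r -> 1 <= x -> 1 <= x `^ r.
Proof. by move=> r0 x1; rewrite -(powRr0 x) ler_powR. Qed.

Lemma powR_mono (x y r : R) : 0 <= r -> 0 <= x -> x <= y -> x `^ r <= y `^ r.
Proof.
by move=> r0 x0 xy; rewrite ge0_ler_powR// nnegrE// (le_trans x0).
Qed.

Lemma powR_anti (x y r : R) : r <= 0 -> 0 < x -> x <= y -> y `^ r <= x `^ r.
Proof.
move=> r0 x0 xy; rewrite -[r]opprK [y `^ _]powRN [x `^ _]powRN.
have y0 : 0 < y by exact: lt_le_trans xy.
by rewrite lef_pV2 ?posrE ?invr_gt0 ?powR_gt0// powR_mono ?oppr_ge0// ltW.
Qed.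

End PowR.

Lemma normr_sub_le (R : realType) (x y : R) :
  0 <= x * y -> `|y| <= `|x| -> `|x - y| <= `|x|.
Proof.
have [x0|x0] := ger0P x.
  have [y0|y0] := ger0P y => h h'; first by rewrite ger0_norm ?subr_ge0// gerBl.
  have h2 : x * y <= 0 by rewrite mulr_ge0_le0// ltW.
  have : x * y = 0 by apply/eqP; rewrite eq_le h h2.
  move/eqP; rewrite mulf_eq0 => /orP[/eqP x00|/eqP y00].
    by move: h'; rewrite x00; lra.
  by move: y0; rewrite y00 ltxx.
have [y0|y0] := ger0P y => h h'; last by rewrite ler0_norm; lra.
have h2 : x * y <= 0 by rewrite mulr_le0_ge0// ltW.
have : x * y = 0 by apply/eqP; rewrite eq_le h h2.
move/eqP; rewrite mulf_eq0 => /orP[/eqP x00|/eqP y00].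
  by move: x0; rewrite x00 ltxx.
by rewrite y00 subr0 ltr0_norm.
Qed.

Section Davydov.
Context {d} {Omega : measurableType d} {R : realType}.
Variable P : probability Omega R.
Implicit Types (f g U V : Omega -> R).

(** The sum counts the integers from 1 to N that do not exceed x, so it is the truncation of x: a
    discrete layer-cake formula. *)
Lemma sum_indicator_floor (N : nat) (x : R) : 0 <= x <= N%:R ->
  x - 1 <= \sum_(i < N) (i.+1%:R <= x)%R%:R <= x.
Proof.
move=> /andP[x0 xN].
have E : \sum_(i < N) (i.+1%:R <= x)%R%:R = (minn N (Num.truncn x))%:R :> R.
  rewrite (eq_bigr (fun i : 'I_N => (i < Num.truncn x)%:R)); last first.
    by move=> i _; rewrite -truncn_ge_nat.
  rewrite -natr_sum; congr (_%:R).
  move: (Num.truncn x) => m; elim: N {xN} => [|N IH]; first by rewrite big_ord0 min0n.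
  by rewrite big_ord_recr/= IH; case: ltnP => h; lia.
have /andP[h1 h2] := truncn_itv x0.
have /minn_idPr tN : (Num.truncn x <= N)%N.
  by rewrite -(@ler_nat R) (le_trans h1).
rewrite E tN h1 andbT lerBlDr (le_trans (ltW h2))// -natr1//.
Qed.

Lemma covZD (a b a' b' : R) U V : itg P U -> itg P V ->
  itg P (fun w => U w * V w) ->
  cov P (fun w => a * U w + b) (fun w => a' * V w + b') = a * a' * cov P U V.
Proof.
move=> iU iV iUV; rewrite /cov.
rewrite exD; [|exact: itgZ|exact: itg_cst].
rewrite (exD (itgZ a' iV) (itg_cst P b')) (exZ a iU) (exZ a' iV) !(ex_cst P).
rewrite (_ : (fun w => _) = (fun w => a * a' * (U w * V w) +
   (a * b' * U w + (b * a' * V w + b * b')))); last first.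
  by apply/funext => w; ring.
rewrite exD; [|exact: itgZ|by apply: itgD; [exact: itgZ|apply: itgD; [exact: itgZ|exact: itg_cst]]].
rewrite exD; [|exact: itgZ|by apply: itgD; [exact: itgZ|exact: itg_cst]].
rewrite exD; [|exact: itgZ|exact: itg_cst].
by rewrite (exZ _ iUV) (exZ _ iU) (exZ _ iV) (ex_cst P (b * b')); ring.
Qed.

Section Dependence.
Variables (cA cB : set (set Omega)) (alpha : R).
Hypothesis dep : forall a b, cA a -> cB b ->
  `|fine (P (a `&` b)) - fine (P a) * fine (P b)| <= alpha.

Lemma ex_indic (a : set Omega) : measurable a -> ex P (\1_a) = fine (P a).
Proof. by move=> ma; rewrite -expectationE expectation_indic. Qed.

(** When each function is replaced by the average of the indicators of its level sets at i / (N +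
    1), the covariance becomes an average of covariances of events, each at most alpha in absolute
    value. The replacement is uniform with error 1 / (N + 1) and changes the covariance by at most 4
    / (N + 1). *)
Lemma cov_unit_le U V : measurable_fun setT U -> measurable_fun setT V ->
  (forall y : R, cA [set w | y <= U w]) -> (forall y : R, cB [set w | y <= V w]) ->
  (forall w, 0 <= U w <= 1) -> (forall w, 0 <= V w <= 1) ->
  `|cov P U V| <= alpha.
Proof.
move=> mU mV aU bV U01 V01.
pose D (N : nat) (F : Omega -> R) : Omega -> R := fun w => N.+1%:R^-1 *
  \sum_(i < N.+1) \1_[set w | i.+1%:R / N.+1%:R <= F w] w.
have msr (F : Omega -> R) (y : R) : measurable_fun setT F -> measurable [set w | y <= F w].
  move=> mF; have := mF measurableT [set` `[y, +oo[%R] (measurable_itv _).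
  rewrite setTI; congr measurable; apply/seteqP; split => w /=.
    by rewrite in_itv/= andbT.
  by rewrite in_itv/= andbT.
have Dlim N (F : Omega -> R) w : (forall w, 0 <= F w <= 1) -> F w - N.+1%:R^-1 <= D N F w <= F w.
  move=> /(_ w)/andP[F0 F1].
  have /(sum_indicator_floor) : 0 <= N.+1%:R * F w <= N.+1%:R.
    by rewrite mulr_ge0//= ler_piMr.
  rewrite (eq_bigr (fun i : 'I_N.+1 => \1_[set w | i.+1%:R / N.+1%:R <= F w] w)); last first.
    move=> i _; rewrite indicE; congr (_%:R); congr nat_of_bool.
    apply/idP/idP; rewrite inE/= ler_pdivrMr// mulrC//.
  have N0 : (0 : R) < N.+1%:R by [].
  move=> /andP[l1 l2]; rewrite /D; apply/andP; split.
    by rewrite ler_pdivlMl// mulrBr mulfV// gt_eqF.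
  by rewrite ler_pdivrMl.
have mD N (F : Omega -> R) : measurable_fun setT F -> measurable_fun setT (D N F).
  move=> mF; apply: measurable_funM => //; apply: measurable_sum => i.
  by apply: measurable_indic; exact: msr.
have D01 N (F : Omega -> R) : (forall w, 0 <= F w <= 1) -> forall w, `|D N F w| <= 1.
  move=> F01 w; have /andP[_ DF] := Dlim N F w F01.
  rewrite ger0_norm; first by rewrite (le_trans DF)//; case/andP: (F01 w).
  rewrite mulr_ge0//; apply: sumr_ge0 => i _; rewrite indicE; exact: ler0n.
have itg1 (F : Omega -> R) : measurable_fun setT F -> (forall w, `|F w| <= 1) -> itg P F.
  by move=> mF F1; exact: itg_bnd mF F1.
have F1 (F : Omega -> R) : (forall w, 0 <= F w <= 1) -> forall w, `|F w| <= 1.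
  by move=> F01 w; have /andP[? ?] := F01 w; rewrite ger0_norm.
have prod1 (F G : Omega -> R) : (forall w, `|F w| <= 1) -> (forall w, `|G w| <= 1) ->
    forall w, `|F w * G w| <= 1.
  by move=> hF hG w; rewrite normrM mulr_ile1.
have covD N : `|cov P (D N U) (D N V)| <= alpha.
  have a0 : 0 <= alpha by exact: le_trans (normr_ge0 _) (dep (aU 0) (bV 0)).
  have iI (F : Omega -> R) (i : 'I_N.+1) : measurable_fun setT F ->
      itg P (\1_[set w | i.+1%:R / N.+1%:R <= F w] : Omega -> R).
    move=> mF; apply: itg1; first by apply: measurable_indic; exact: msr.
    by move=> w; rewrite indicE; case: (_ \in _); rewrite /= ?normr0 ?normr1.
  have N0 : (0 : R) < N.+1%:R by [].
  have -> : cov P (D N U) (D N V) = \sum_(i < N.+1) \sum_(j < N.+1)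
     N.+1%:R^-1 ^+ 2 *
     (fine (P ([set w | i.+1%:R / N.+1%:R <= U w] `&` [set w | j.+1%:R / N.+1%:R <= V w]))
      - fine (P [set w | i.+1%:R / N.+1%:R <= U w]) *
        fine (P [set w | j.+1%:R / N.+1%:R <= V w])).
    rewrite /cov /D; rewrite !exZ; [|by apply: itg_sum => j _; exact: iI..].
    rewrite !ex_sum; [|by move=> j _; exact: iI..].
    under [X in ex P X]eq_fun => w.
      rewrite mulrACA big_distrlr/= mulr_sumr.
      under eq_bigr => i _ do rewrite mulr_sumr.
      over.
    have iIJ (i j : 'I_N.+1) : itg P (fun w =>
        \1_[set w | i.+1%:R / N.+1%:R <= U w] w * \1_[set w | j.+1%:R / N.+1%:R <= V w] w).
      rewrite -[X in itg P X]/(\1_[set w | i.+1%:R / N.+1%:R <= U w] \* \1_[set w | j.+1%:R / N.+1%:R <= V w]).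
      rewrite -indicI; apply: itg1.
        by apply: measurable_indic; apply: measurableI; exact: msr.
      by move=> w; rewrite indicE; case: (_ \in _); rewrite /= ?normr0 ?normr1.
    have iII (i j : 'I_N.+1) := itgZ (N.+1%:R^-1 * N.+1%:R^-1) (iIJ i j).
    rewrite ex_sum; last by move=> i _; apply: itg_sum.
    under eq_bigr => i _ do rewrite ex_sum//.
    rewrite mulrACA big_distrlr/= mulr_sumr -sumrB; apply: eq_bigr => i _.
    rewrite mulr_sumr -sumrB; apply: eq_bigr => j _.
    rewrite mulrBr -expr2; congr (_ - _); last by rewrite !ex_indic//; exact: msr.
    rewrite exZ//.
    congr (_ * _); rewrite -ex_indic; last by apply: measurableI; exact: msr.
    by rewrite indicI.
  apply: (le_trans (ler_norm_sum _ _ _)).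
  apply: (@le_trans _ _ (\sum_(i < N.+1) \sum_(j < N.+1) N.+1%:R^-1 ^+ 2 * alpha)).
    apply: ler_sum => i _; apply: (le_trans (ler_norm_sum _ _ _)).
    apply: ler_sum => j _; rewrite normrM ger0_norm ?exprn_ge0// ler_wpM2l//.
    exact: dep.
  rewrite !big_const_ord !iter_addr_0 -mulrnA -[leLHS]mulr_natr natrM mulrAC -expr2 -exprMn.
  by rewrite mulVf ?gt_eqF// expr1n mul1r.
apply/ler_addgt0Pr => e e0.
have [N _ hN] : exists2 N : nat, True & N.+1%:R^-1 <= e / 4.
  exists (Num.truncn (4 / e)) => //.
  rewrite invf_ple ?posrE ?divr_gt0// invf_div.
  by rewrite (le_trans (ltW (truncnS_gt _)))//.
have dU w : `|U w - D N U w| <= N.+1%:R^-1.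
  by have /andP[h1 h2] := Dlim N U w U01; rewrite ger0_norm ?subr_ge0// lerBlDr addrC -lerBlDr.
have dV w : `|V w - D N V w| <= N.+1%:R^-1.
  by have /andP[h1 h2] := Dlim N V w V01; rewrite ger0_norm ?subr_ge0// lerBlDr addrC -lerBlDr.
have iU := itg1 _ mU (F1 _ U01); have iV := itg1 _ mV (F1 _ V01).
have iDU := itg1 _ (mD N _ mU) (D01 N _ U01).
have iDV := itg1 _ (mD N _ mV) (D01 N _ V01).
have iUV : itg P (fun w => U w * V w).
  by apply: itg1; [exact: measurable_funM|exact: prod1 (F1 _ U01) (F1 _ V01)].
have iDD : itg P (fun w => D N U w * D N V w).
  by apply: itg1; [exact: measurable_funM (mD N _ mU) (mD N _ mV)|exact: prod1 (D01 N _ U01) (D01 N _ V01)].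
have key : `|cov P U V - cov P (D N U) (D N V)| <= 4 * N.+1%:R^-1.
  rewrite /cov opprB addrCA !addrA addrAC.
  rewrite (_ : _ + _ = (ex P (fun w => U w * V w) - ex P (fun w => D N U w * D N V w))
     - ((ex P U - ex P (D N U)) * ex P V + ex P (D N U) * (ex P V - ex P (D N V)))); last by ring.
  rewrite -!exB//.
  have e1 : `|ex P (fun w => U w * V w - D N U w * D N V w)| <= 2 * N.+1%:R^-1.
    apply: ex_bnd; first by apply: measurable_funB; apply: measurable_funM => //; exact: mD.
    move=> w; rewrite (_ : _ - _ = (U w - D N U w) * V w + D N U w * (V w - D N V w)); last by ring.
    rewrite (le_trans (ler_normD _ _))// mulr_natl mulr2n lerD// normrM.
      by rewrite -[leRHS]mulr1 ler_pM// F1.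
    by rewrite -[leRHS]mul1r ler_pM// D01.
  have e2 : `|ex P (fun w => U w - D N U w)| <= N.+1%:R^-1.
    by apply: ex_bnd => //; apply: measurable_funB => //; exact: mD.
  have e3 : `|ex P (fun w => V w - D N V w)| <= N.+1%:R^-1.
    by apply: ex_bnd => //; apply: measurable_funB => //; exact: mD.
  have e4 : `|ex P V| <= 1 by apply: ex_bnd => //; exact: F1.
  have e5 : `|ex P (D N U)| <= 1 by apply: ex_bnd; [exact: mD|exact: D01].
  rewrite (le_trans (ler_normB _ _))// (_ : 4 = 2 + 2); last by ring.
  rewrite mulrDl lerD// (le_trans (ler_normD _ _))// mulr_natl mulr2n lerD// normrM.
    by rewrite -[leRHS]mulr1 ler_pM.
  by rewrite -[leRHS]mul1r ler_pM.
rewrite -(subrK (cov P (D N U) (D N V)) (cov P U V)).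
rewrite (le_trans (ler_normD _ _))// addrC lerD//.
by rewrite (le_trans key)// mulrC -ler_pdivlMr.
Qed.

(** Affine maps bring U and V into [0, 1]; undoing them multiplies the covariance by 2 A and by 2
    B. *)
Lemma cov_bounded_le (A B : R) U V : 0 < A -> 0 < B ->
  measurable_fun setT U -> measurable_fun setT V ->
  (forall y : R, cA [set w | y <= U w]) -> (forall y : R, cB [set w | y <= V w]) ->
  (forall w, `|U w| <= A) -> (forall w, `|V w| <= B) ->
  `|cov P U V| <= 4 * alpha * A * B.
Proof.
move=> A0 B0 mU mV aU bV UA VB.
pose u w := (2 * A)^-1 * U w + 2^-1; pose v w := (2 * B)^-1 * V w + 2^-1.
have mulE (C x : R) : 0 < C -> 2 * C * ((2 * C)^-1 * x + 2^-1) + - C = x.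
  by move=> C0; field; rewrite gt_eqF.
have u01 (C x : R) : 0 < C -> `|x| <= C -> 0 <= (2 * C)^-1 * x + 2^-1 <= 1.
  move=> C0; rewrite ler_norml => /andP[h1 h2].
  have C2 : 0 < 2 * C by rewrite mulr_gt0.
  apply/andP; split.
    rewrite -(@pmulr_rge0 _ (2 * C))// mulrDr mulrA divff ?gt_eqF// mul1r.
    by rewrite mulrAC divff// mul1r -lerBlDr sub0r.
  rewrite -(@ler_pM2l _ (2 * C))// mulrDr mulrA divff ?gt_eqF// mul1r.
  rewrite mulrAC divff// mul1r mulr1; lra.
have lev (C x y : R) : 0 < C -> (y <= (2 * C)^-1 * x + 2^-1) = ((y - 2^-1) * (2 * C) <= x).
  by move=> C0; rewrite -lerBlDr [_^-1 * x]mulrC ler_pdivlMr ?mulr_gt0.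
have mu : measurable_fun setT u.
  by apply: measurable_funD => //; apply: measurable_funM.
have mv : measurable_fun setT v.
  by apply: measurable_funD => //; apply: measurable_funM.
have hu w : 0 <= u w <= 1 by exact: u01.
have hv w : 0 <= v w <= 1 by exact: u01.
have /cov_unit_le : forall w, 0 <= u w <= 1 by [].
move=> /(_ v mu mv) h.
have {h}h : `|cov P u v| <= alpha.
  apply: h => // y.
    by rewrite (_ : [set w | _] = [set w | (y - 2^-1) * (2 * A) <= U w])//;
      apply/seteqP; split=> w /=; rewrite lev.
  by rewrite (_ : [set w | _] = [set w | (y - 2^-1) * (2 * B) <= V w])//;
      apply/seteqP; split=> w /=; rewrite lev.
have hn (x : R) : 0 <= x <= 1 -> `|x| <= 1 by move=> /andP[? ?]; rewrite ger0_norm.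
have iu : itg P u by apply: itg_bnd (fun w => hn _ (hu w)).
have iv : itg P v by apply: itg_bnd (fun w => hn _ (hv w)).
have -> : U = (fun w => 2 * A * u w + - A) by apply/funext => w; rewrite mulE.
have -> : V = (fun w => 2 * B * v w + - B) by apply/funext => w; rewrite mulE.
rewrite covZD//; last first.
  apply: itg_bnd (_ : forall w, _ <= 1); first exact: measurable_funM.
  by move=> w; rewrite normrM mulr_ile1// hn.
rewrite normrM ger0_norm; last by rewrite !mulr_ge0// ltW.
rewrite (_ : 4 * alpha * A * B = 2 * A * (2 * B) * alpha); last by ring.
by rewrite ler_wpM2l// !mulr_ge0// ltW.
Qed.

End Dependence.

(** An envelope in L^r: the r-th moment is at most N for finite r, and the function is at most 1
    almost surely for r = +oo. Variables are bounded by powers of envelopes, so that products are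
    handled by taking the maximum of the envelopes instead of Hoelder's inequality. *)
Definition gauge (N : R) (r : \bar R) (a : Omega -> R) : Prop :=
  [/\ measurable_fun setT a, (forall w, 0 <= a w) &
   match r with
   | r'%:E => itg P (fun w => a w `^ r') /\ ex P (fun w => a w `^ r') <= N
   | _ => \forall w \ae P, a w <= 1
   end].

Definition clip (A x : R) : R := Num.max (- A) (Num.min x A).

Lemma clip_le (A x : R) : 0 <= A -> `|clip A x| <= A.
Proof.
move=> A0; rewrite /clip ler_norml le_max lexx/= ge_max.
by rewrite ge_min lexx orbT andbT; lra.
Qed.

Lemma clip_id (A x : R) : `|x| <= A -> clip A x = x.
Proof.
rewrite ler_norml => /andP[h1 h2]; rewrite /clip (min_idPl h2).
by apply/max_idPr.
Qed.

Lemma clip_gt (A x : R) : 0 <= A -> A < `|x| ->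
  `|x - clip A x| <= `|x| /\ `|clip A x| <= `|x| /\ 0 <= x * clip A x.
Proof.
move=> A0; rewrite /clip; case: (ger0P x) => x0 Ax.
  rewrite (min_idPr (ltW Ax)) (@max_r _ _ (- A) A); last by lra.
  rewrite !ger0_norm ?subr_ge0 ?(ltW Ax)//.
  by rewrite gerBl A0 mulr_ge0.
rewrite (@min_l _ _ x A); last by lra.
rewrite (@max_l _ _ (- A) x); last by lra.
rewrite normrN (ger0_norm A0) (ltW Ax) ler_norml nmulr_rge0// oppr_le0 A0.
by split; [lra|split; [lra|lra]].
Qed.

Lemma le_clip (A y x : R) : 0 <= A -> (y <= clip A x) =
  (y <= - A) || ((y <= x) && (y <= A)).
Proof. by move=> A0; rewrite /clip le_max le_min. Qed.

Lemma measurable_clip (A : R) U : measurable_fun setT U ->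
  measurable_fun setT (fun w => clip A (U w)).
Proof. by move=> mU; apply: measurable_maxr => //; apply: measurable_minr. Qed.

Section Covariance.
Variables (cA cB : set (set Omega)) (alpha : R).
Hypothesis sA : sigma_algebra setT cA.
Hypothesis sB : sigma_algebra setT cB.
Hypothesis dep : forall a b, cA a -> cB b ->
  `|fine (P (a `&` b)) - fine (P a) * fine (P b)| <= alpha.

(** A level set of the clipped function is the whole space, a level set of U, or empty; the axioms
    of a sigma-algebra provide the two extreme cases. *)
Lemma clip_sub (cD : set (set Omega)) (A : R) U : 0 <= A -> sigma_algebra setT cD ->
  (forall y : R, cD [set w | y <= U w]) -> forall y : R, cD [set w | y <= clip A (U w)].
Proof.
move=> A0 [s0 sC sU] hU y.
have s1 : cD setT by have := sC _ s0; rewrite setD0.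
have [h|h] := leP y (- A).
  rewrite (_ : [set w | _] = setT)//; apply/seteqP; split => w //= _.
  by rewrite le_clip// h.
have [h'|h'] := leP y A.
  rewrite (_ : [set w | _] = [set w | y <= U w])//; apply/seteqP; split => w /=.
    by rewrite le_clip// leNgt h/= => /andP[].
  by rewrite le_clip// h' => ->; rewrite orbT.
rewrite (_ : [set w | _] = set0)//; apply/seteqP; split => w //=.
by rewrite le_clip// leNgt h/= => /andP[_]; rewrite leNgt h'.
Qed.

Lemma cov_clip_le (t s M : R) U V :
  measurable_fun setT U -> measurable_fun setT V ->
  (forall y : R, cA [set w | y <= U w]) -> (forall y : R, cB [set w | y <= V w]) ->
  0 < M ->
  `|cov P (fun w => clip (M `^ t) (U w)) (fun w => clip (M `^ s) (V w))|
    <= 4 * alpha * M `^ (t + s).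
Proof.
move=> mU mV aU bV M0.
have Mt : 0 < M `^ t by exact: powR_gt0.
have Ms : 0 < M `^ s by exact: powR_gt0.
rewrite powR_addr//.
rewrite mulrA; apply: (cov_bounded_le dep) => //.
- exact: measurable_clip.
- exact: measurable_clip.
- by apply: clip_sub => //; exact: ltW.
- by apply: clip_sub => //; exact: ltW.
- by move=> w; apply: clip_le; exact: ltW.
- by move=> w; apply: clip_le; exact: ltW.
Qed.

(** With c the larger of a and b, c > M and t + s <= r give c^(t+s) <= c^r M^(t+s-r). *)
Lemma powR_max_le (a b t s r M : R) : 0 <= a -> 0 <= b -> 0 <= t -> 0 <= s ->
  t + s <= r -> 0 < M -> M < a \/ M < b ->
  a `^ t * b `^ s <= (a `^ r + b `^ r) * M `^ (t + s - r).
Proof.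
move=> a0 b0 t0 s0 tsr M0 Mab; pose c := Num.max a b.
have Mc : M < c by rewrite lt_max; case: Mab => ->; rewrite ?orbT.
have c0 : 0 < c by exact: lt_trans Mc.
have h1 : a `^ t * b `^ s <= c `^ (t + s).
  rewrite powR_addr//.
  by rewrite ler_pM ?powR_ge0// ge0_ler_powR// ?nnegrE ?(ltW c0)// le_max lexx ?orbT.
have h2 : c `^ r <= a `^ r + b `^ r.
  by rewrite /c; case: (leP a b) => _; rewrite ?lerDl ?lerDr powR_ge0.
apply: (le_trans h1); apply: (le_trans _ (ler_wpM2r (powR_ge0 _ _) h2)).
rewrite -{1}(subrK r (t + s)) addrC (powR_addr _ _ c0).
by rewrite ler_wpM2l ?powR_ge0// powR_anti ?subr_le0// ltW.
Qed.

Lemma gauge_itg (N r t : R) a U : gauge N r%:E a -> 0 <= t <= r ->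
  measurable_fun setT U -> (forall w, `|U w| <= a w `^ t) -> itg P U.
Proof.
move=> [ma a0 [ia _]] /andP[t0 tr] mU Ua.
apply: (itg_le mU (itgD (itg_cst P 1) ia)) => w; apply: (le_trans (Ua w)).
have [h|h] := leP (a w) 1.
  rewrite (@le_trans _ _ 1) ?lerDl ?powR_ge0//.
  have := ge0_ler_powR t0 (a0 w) ler01 h; rewrite powR1; apply; rewrite ?nnegrE//.
by rewrite (@le_trans _ _ (a w `^ r)) ?lerDr// ler_powR// ltW.
Qed.

Lemma cov_gauge_trunc (N r t s M : R) a b U V : 1 <= N ->
  gauge N r%:E a -> gauge N r%:E b -> 0 <= t -> 0 <= s -> t + s <= r ->
  measurable_fun setT U -> measurable_fun setT V ->
  (forall y : R, cA [set w | y <= U w]) -> (forall y : R, cB [set w | y <= V w]) ->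
  (forall w, `|U w| <= a w `^ t) -> (forall w, `|V w| <= b w `^ s) ->
  1 <= M ->
  `|cov P U V| <= 4 * alpha * M `^ (t + s) + 6 * N ^+ 2 * M `^ (t + s - r).
Proof.
move=> N1 ga gb t0 s0 tsr mU mV aU bV Ua Vb M1.
have M0 : 0 < M by exact: lt_le_trans M1.
pose U' w := clip (M `^ t) (U w); pose V' w := clip (M `^ s) (V w).
have mU' : measurable_fun setT U' by exact: measurable_clip.
have mV' : measurable_fun setT V' by exact: measurable_clip.
have tr : t <= r by rewrite (le_trans _ tsr)// lerDl.
have sr : s <= r by rewrite (le_trans _ tsr)// lerDr.
have r0 : 0 <= r by rewrite (le_trans t0).
have iU : itg P U by apply: (gauge_itg ga _ mU Ua); rewrite t0.
have iV : itg P V by apply: (gauge_itg gb _ mV Vb); rewrite s0.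
have bU' w : `|U' w| <= M `^ t by apply: clip_le; exact: powR_ge0.
have bV' w : `|V' w| <= M `^ s by apply: clip_le; exact: powR_ge0.
have iU' : itg P U' := itg_bnd P mU' bU'.
have iV' : itg P V' := itg_bnd P mV' bV'.
have iUV' : itg P (fun w => U' w * V' w).
  apply: itg_bnd (_ : forall w, _ <= M `^ t * M `^ s); first exact: measurable_funM.
  by move=> w; rewrite normrM ler_pM.
case: ga => ma a0 [ia na]; case: gb => mb b0 [ib nb].
have smallU w : M < a w \/ U' w = U w.
  have [h|h] := ltP M (a w); [by left|right; apply: clip_id].
  by rewrite (le_trans (Ua w))// ge0_ler_powR ?nnegrE// ltW.
have smallV w : M < b w \/ V' w = V w.
  have [h|h] := ltP M (b w); [by left|right; apply: clip_id].
  by rewrite (le_trans (Vb w))// ge0_ler_powR ?nnegrE// ltW.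
have clip3 A x : 0 <= A -> `|x - clip A x| <= `|x| /\ `|clip A x| <= `|x| /\ 0 <= x * clip A x.
  move=> A0; have [h|h] := leP `|x| A; last exact: clip_gt.
  by rewrite clip_id// subrr normr0 normr_ge0 lexx -expr2 sqr_ge0.
set e := M `^ (t + s - r).
have e0 : 0 <= e by exact: powR_ge0.
pose G w := (a w `^ r + b w `^ r) * e.
have iG : itg P G.
  rewrite (_ : G = fun w => e * (a w `^ r + b w `^ r)); last by apply/funext => w; rewrite /G mulrC.
  by apply: itgZ; exact: itgD.
have exG : ex P G <= 2 * N * e.
  rewrite /G exZr; last exact: itgD.
  by rewrite ler_wpM2r// (exD ia ib) mulr_natl mulr2n lerD.
have dUV w : `|U w * V w - U' w * V' w| <= G w.
  have [Mab|[-> ->]] : (M < a w \/ M < b w) \/ (U' w = U w /\ V' w = V w).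
    by case: (smallU w) => [|->]; [by left; left|]; case: (smallV w) => [|->]; [left; right|right].
  + apply: (@le_trans _ _ (`|U w| * `|V w|)); last first.
      apply: (le_trans _ (powR_max_le (a0 w) (b0 w) t0 s0 tsr M0 Mab)).
      by rewrite ler_pM.
    have [_ [u1 u2]] := clip3 (M `^ t) (U w) (powR_ge0 _ _).
    have [_ [v1 v2]] := clip3 (M `^ s) (V w) (powR_ge0 _ _).
    have h : 0 <= (U w * V w) * (U' w * V' w) by rewrite mulrACA mulr_ge0.
    have h' : `|U' w * V' w| <= `|U w * V w| by rewrite !normrM ler_pM.
    by rewrite -normrM; exact: normr_sub_le.
  + by rewrite subrr normr0 /G mulr_ge0// addr_ge0// powR_ge0.
have iUV : itg P (fun w => U w * V w).
  apply: (@itg_le _ _ _ _ _ (fun w => G w + `|U' w * V' w|)); first exact: measurable_funM.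
    by apply: itgD => //; exact: itg_norm.
  move=> w; rewrite -{1}(subrK (U' w * V' w) (U w * V w)).
  by rewrite (le_trans (ler_normD _ _))// lerD.
have Ms1 (x : R) : 0 <= x -> 1 <= M `^ x by move=> x0; rewrite -(powRr0 M) ler_powR.
have tail (z : R) (c : Omega -> R) F F' : (forall w, 0 <= c w) -> 0 <= z <= r ->
    M `^ (z - r) <= e ->
    itg P (fun w => c w `^ r) -> ex P (fun w => c w `^ r) <= N ->
    (forall w, `|F w| <= c w `^ z) -> (forall w, `|F w - F' w| <= `|F w|) ->
    (forall w, M < c w \/ F' w = F w) -> itg P F -> itg P F' ->
    `|ex P F - ex P F'| <= N * e.
  move=> c0 /andP[z0 zr] ze ic nc Fc FF small iF iF'; rewrite -exB//.
  apply: (@le_trans _ _ (ex P (fun w => c w `^ r * e))).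
    apply: ex_norm_le; first exact: itgB.
      by rewrite (_ : (fun _ => _) = fun w => e * c w `^ r);
        [exact: itgZ|apply/funext => w; rewrite mulrC].
    move=> w; case: (small w) => [Mc|->]; last by rewrite subrr normr0 mulr_ge0// powR_ge0.
    have cw : 0 < c w by exact: lt_trans Mc.
    apply: (le_trans (FF w)); apply: (le_trans (Fc w)).
    rewrite -{1}(subrK r z) addrC (powR_addr _ _ cw).
    rewrite ler_wpM2l ?powR_ge0//; apply: (le_trans _ ze).
    by rewrite powR_anti ?subr_le0// ltW.
  by rewrite exZr// ler_wpM2r.
have dU : `|ex P U - ex P U'| <= N * e.
  apply: (@tail t a) => //; first by rewrite t0.
    by rewrite /e ler_powR// lerB// lerDl.
  by move=> w; have [] := clip3 (M `^ t) (U w) (powR_ge0 _ _).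
have dV : `|ex P V - ex P V'| <= N * e.
  apply: (@tail s b) => //; first by rewrite s0.
    by rewrite /e ler_powR// lerB// lerDr.
  by move=> w; have [] := clip3 (M `^ s) (V w) (powR_ge0 _ _).
have first (z : R) (c F : Omega -> R) : (forall w, 0 <= c w) -> 0 <= z <= r ->
    itg P (fun w => c w `^ r) -> ex P (fun w => c w `^ r) <= N ->
    (forall w, `|F w| <= c w `^ z) -> itg P F -> `|ex P F| <= 2 * N.
  move=> c0 /andP[z0 zr] ic nc Fc iF.
  apply: (@le_trans _ _ (1 + N)); last by rewrite mulr_natl mulr2n lerD2r.
  apply: (@le_trans _ _ (ex P (fun w => 1 + c w `^ r))); last first.
    by rewrite exD ?ex_cst ?lerD2l//; exact: itg_cst.
  apply: ex_norm_le => //; first by apply: itgD => //; exact: itg_cst.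
  move=> w; apply: (le_trans (Fc w)); have [h|h] := leP (c w) 1.
    rewrite (@le_trans _ _ 1) ?lerDl ?powR_ge0//.
    by rewrite powR_le1// c0.
  by rewrite (@le_trans _ _ (c w `^ r)) ?lerDr// ler_powR// ltW.
have eV : `|ex P V| <= 2 * N by apply: (first s b) => //; rewrite s0.
have eU' : `|ex P U'| <= 2 * N.
  apply: (first t a) => //; first by rewrite t0.
  move=> w; apply: (le_trans _ (Ua w)).
  by have [_ []] := clip3 (M `^ t) (U w) (powR_ge0 _ _).
have main := cov_clip_le t s mU mV aU bV M0.
rewrite -/U' -/V' in main.
have diff : `|cov P U V - cov P U' V'| <= 6 * N ^+ 2 * e.
  rewrite /cov opprB addrCA !addrA addrAC.
  rewrite (_ : _ + _ = (ex P (fun w => U w * V w) - ex P (fun w => U' w * V' w))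
     - ((ex P U - ex P U') * ex P V + ex P U' * (ex P V - ex P V'))); last by clear; ring.
  rewrite -[X in `|X - _|]exB//.
  have e1 : `|ex P (fun w => U w * V w - U' w * V' w)| <= 2 * N ^+ 2 * e.
    apply: (@le_trans _ _ (ex P G)); first by apply: ex_norm_le => //; exact: itgB.
    rewrite (le_trans exG)// ler_wpM2r// ler_wpM2l// expr2 -[leLHS]mulr1 ler_wpM2l//.
    exact: le_trans N1.
  rewrite (le_trans (ler_normB _ _))// (_ : 6 * N ^+ 2 * e =
    2 * N ^+ 2 * e + (N * e * (2 * N) + 2 * N * (N * e))); last by clear; ring.
  rewrite lerD// (le_trans (ler_normD _ _))// lerD// normrM; exact: ler_pM.
rewrite -(subrK (cov P U' V') (cov P U V)) addrC.
by rewrite (le_trans (ler_normD _ _))// lerD.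
Qed.

(** The level M = alpha^(-1/r) balances the two errors of [cov_gauge_trunc]: both become multiples
    of alpha^(1 - (t+s)/r), which is at most alpha^((r-p-2)/r) because t + s <= p + 2 and alpha <=
    1. For infinite r, clipping at 1 changes nothing almost surely. *)
Lemma davydov (N p t s : R) (r : \bar R) a b U V : 1 <= N -> 0 <= p ->
  ((p + 2)%:E < r)%E ->
  gauge N r a -> gauge N r b -> 0 <= t -> 0 <= s -> t + s <= p + 2 ->
  measurable_fun setT U -> measurable_fun setT V ->
  (forall y : R, cA [set w | y <= U w]) -> (forall y : R, cB [set w | y <= V w]) ->
  (forall w, `|U w| <= a w `^ t) -> (forall w, `|V w| <= b w `^ s) ->
  alpha <= 1 ->
  `|cov P U V| <= 10 * N ^+ 2 * alpha `^ (mix_exponent p r).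
Proof.
move=> N1 p0 + ga gb t0 s0 tsp mU mV aU bV Ua Vb al1.
have al0 : 0 <= alpha.
  exact: le_trans (normr_ge0 _) (dep (aU 0) (bV 0)).
have N2 : 1 <= N ^+ 2 by rewrite exprn_ege1.
case: r ga gb => [r|//|//] ga gb; last first.
  move=> _; rewrite /mix_exponent powRr1//.
  case: ga => ma a0 a1; case: gb => mb b0 b1.
  have := cov_clip_le t s mU mV aU bV ltr01; rewrite !powR1 mulr1 => h.
  have clipE (z : R) (c F : Omega -> R) : 0 <= z -> (forall w, 0 <= c w) ->
      (forall w, `|F w| <= c w `^ z) -> (\forall w \ae P, c w <= 1) ->
      \forall w \ae P, F w = clip 1 (F w).
    move=> z0 c0 Fc; apply: filterS => w c1; rewrite clip_id//.
    by rewrite (le_trans (Fc w))// powR_le1// c0.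
  have aeU := clipE t a U t0 a0 Ua a1; have aeV := clipE s b V s0 b0 Vb b1.
  have -> : cov P U V = cov P (fun w => clip 1 (U w)) (fun w => clip 1 (V w)).
    rewrite /cov; congr (_ - _ * _).
    - apply: ex_ae; [exact: measurable_funM|by apply: measurable_funM; exact: measurable_clip|].
      by apply: filterS2 aeU aeV => w hU hV; rewrite -hU -hV.
    - by apply: ex_ae => //; exact: measurable_clip.
    - by apply: ex_ae => //; exact: measurable_clip.
  apply: (le_trans h); apply: ler_wpM2r => //; lra.
rewrite lte_fin => pr; rewrite /mix_exponent; set th := (r - p - 2) / r.
have r0 : 0 < r by lra.
have th0 : 0 < th by rewrite divr_gt0//; lra.
(* The level is built from some al > 0 above alpha because alpha may vanish; in that case al is
   finally taken arbitrarily small. *)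
have key (al : R) : alpha <= al -> 0 < al -> al <= 1 ->
    `|cov P U V| <= 10 * N ^+ 2 * al `^ th.
  move=> aal al0' al1'; pose M := al `^ (- r^-1).
  have M1 : 1 <= M.
    by rewrite /M powRN invf_ge1 ?powR_gt0// -(powRr0 al) ger_powR ?al0'// invr_ge0 ltW.
  have tsr : t + s <= r by lra.
  have h := cov_gauge_trunc N1 ga gb t0 s0 tsr mU mV aU bV Ua Vb M1.
  have E1 : alpha * M `^ (t + s) <= al `^ th.
    apply: (@le_trans _ _ (al * M `^ (t + s))); first by rewrite ler_wpM2r ?powR_ge0.
    rewrite /M -powRrM -{1}(powRr1 (ltW al0')) -powR_addr//.
    apply: ger_powR; first by rewrite al0'.
    rewrite /th -ler_pdivlMr ?invr_gt0// invrK.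
    rewrite mulrDl mul1r mulrAC mulNr mulVf ?gt_eqF//; lra.
  have E2 : M `^ (t + s - r) <= al `^ th.
    rewrite /M -powRrM; apply: ger_powR; first by rewrite al0'.
    rewrite /th -ler_pdivlMr ?invr_gt0// invrK mulrAC mulNr mulVf ?gt_eqF//; lra.
  apply: (le_trans h); set X := alpha * _ in E1; set Y := _ `^ (t + s - r) in E2 *.
  rewrite -mulrA -/X (_ : 10 * _ * _ = 4 * (N ^+ 2 * al `^ th) + 6 * N ^+ 2 * al `^ th); last by ring.
  apply: lerD.
    rewrite ler_wpM2l// (le_trans E1)// -[leLHS]mul1r ler_wpM2r// powR_ge0//.
  by rewrite ler_wpM2l// mulr_ge0// (le_trans _ N2).
have [al00|al00] := ltP 0 alpha; first exact: key.
have -> : alpha = 0 by apply/eqP; rewrite eq_le al00.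
rewrite powR0 ?gt_eqF// mulr0; apply/ler_addgt0Pr => e e0; rewrite add0r.
pose x := e / (10 * N ^+ 2).
have N10 : 0 < 10 * N ^+ 2 by rewrite mulr_gt0// (lt_le_trans _ N2).
have x0 : 0 < x by rewrite divr_gt0.
pose al := Num.min 1 (x `^ (th^-1)).
have alp : 0 < al by rewrite /al lt_min ltr01 powR_gt0.
have /key : alpha <= al by rewrite (le_trans al00)// ltW.
move=> /(_ alp) /(_ _)/le_trans; apply; first by rewrite /al ge_min lexx.
rewrite mulrC -ler_pdivlMr// -/x.
apply: (@le_trans _ _ ((x `^ th^-1) `^ th)).
  by rewrite ge0_ler_powR ?nnegrE ?(ltW th0) ?(ltW alp) ?powR_ge0// /al ge_min lexx orbT.
by rewrite -powRrM mulVf ?gt_eqF// powRr1// ltW.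
Qed.

End Covariance.
End Davydov.

(** * Envelopes in L^r: maxima, averages and moments *)

Section Gauge.
Context {d} {Omega : measurableType d} {R : realType}.
Variable P : probability Omega R.
Implicit Types (a b U V : Omega -> R) (r : \bar R).

Lemma gauge_meas N r a : gauge P N r a -> measurable_fun setT a.
Proof. by case. Qed.

Lemma gauge_pos N r a w : gauge P N r a -> 0 <= a w.
Proof. by case. Qed.

Lemma gauge_le N N' r a : N <= N' -> gauge P N r a -> gauge P N' r a.
Proof.
move=> NN [ma a0]; case: r => [r [ia na]|ha|ha]; split => //.
by split => //; exact: le_trans NN.
Qed.

Lemma gauge0 r : (0 < r)%E -> gauge P 0 r (fun=> 0).
Proof.
case: r => [r r0|_|//]; split => //; last by apply: aeW => w; exact: ler01.
rewrite lte_fin in r0; rewrite powR0 ?gt_eqF//; split; first exact: itg_cst.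
by rewrite ex_cst.
Qed.

Lemma gauge_max N1 N2 r a b : gauge P N1 r a -> gauge P N2 r b ->
  gauge P (N1 + N2) r (fun w => Num.max (a w) (b w)).
Proof.
move=> [ma a0 ha] [mb b0 hb]; split.
- exact: measurable_maxr.
- by move=> w; rewrite le_max a0.
- have ae1 : (\forall w \ae P, a w <= 1) -> (\forall w \ae P, b w <= 1) ->
      \forall w \ae P, Num.max (a w) (b w) <= 1.
    by apply: filterS2 => w ? ?; rewrite ge_max; apply/andP.
  case: r ha hb => [r [ia na] [ib nb]|ha hb|ha hb]; [|exact: ae1..].
  have le w : `|Num.max (a w) (b w) `^ r| <= a w `^ r + b w `^ r.
    rewrite ger0_norm ?powR_ge0//.
    by case: (leP (a w) (b w)) => _; rewrite ?lerDl ?lerDr powR_ge0.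
  have mm : measurable_fun setT (fun w => Num.max (a w) (b w) `^ r).
    by apply: (measurableT_comp (measurable_powR r)); exact: measurable_maxr.
  have im := itg_le mm (itgD ia ib) le; split => //.
  rewrite (le_trans (ler_norm _))// (le_trans (ex_norm_le im (itgD ia ib) le))//.
  by rewrite (exD ia ib) lerD.
Qed.

(** The tangent at m to the convex function y^r lies below it; this is Young's inequality with
    exponents r and r / (r - 1). *)
Lemma powR_tangent (r m y : R) : 1 < r -> 0 <= m -> 0 <= y ->
  r * (y * m `^ (r - 1)) - (r - 1) * m `^ r <= y `^ r.
Proof.
move=> r1 m0 y0; have r0 : 0 < r by lra.
have r1' : 0 < r - 1 by lra.
have := @conjugate_powR R y (m `^ (r - 1)) r (r / (r - 1)) y0 (powR_ge0 _ _) r0.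
have rr0 : 0 < r / (r - 1) by rewrite divr_gt0.
have rr : r^-1 + (r / (r - 1))^-1 = 1 by rewrite invf_div; field; rewrite gt_eqF.
move=> /(_ rr0 rr).
rewrite -powRrM mulrCA divff ?gt_eqF// mulr1 invf_div => h.
have := ler_wpM2l (ltW r0) h; rewrite mulrDr.
rewrite (_ : r * (y `^ r / r) = y `^ r); last by field; rewrite gt_eqF.
rewrite (_ : r * (m `^ r * ((r - 1) / r)) = (r - 1) * m `^ r); last first.
  by field; rewrite gt_eqF.
lra.
Qed.

(** Jensen's inequality: average the tangent inequality taken at the mean m; its left side averages
    to m^r. *)
Lemma powR_mean (J : finType) (A : {set J}) (y : J -> R) (r : R) : 1 < r ->
  (0 < #|A|)%N -> (forall j, 0 <= y j) ->
  ((\sum_(j in A) y j) / #|A|%:R) `^ r <= (\sum_(j in A) y j `^ r) / #|A|%:R.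
Proof.
move=> r1 A0 y0; set m := _ / _.
have n0 : 0 < #|A|%:R :> R by rewrite ltr0n.
have m0 : 0 <= m by rewrite divr_ge0// ?sumr_ge0// ltW.
rewrite ler_pdivlMr//.
have : \sum_(j in A) (r * (y j * m `^ (r - 1)) - (r - 1) * m `^ r) <= \sum_(j in A) y j `^ r.
  by apply: ler_sum => j _; exact: powR_tangent.
apply: le_trans; rewrite sumrB sumr_const -mulr_sumr -mulr_suml -[X in _ - X]mulr_natr.
rewrite (_ : \sum_(i in A) y i = m * #|A|%:R); last by rewrite /m divfK ?gt_eqF.
rewrite mulrAC (mulr_powRB1 m0); last by lra.
by rewrite le_eqVlt; apply/orP; left; apply/eqP; ring.
Qed.

(** By Jensen's inequality an average keeps the constant 1, whatever its number of terms. A sum over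
    A is thus #|A| times an envelope of constant 1, so the size of a shell enters a remainder only
    through this factor. *)
Lemma gauge_mean (J : finType) (A : {set J}) (x : J -> Omega -> R) r :
  (1 < r)%E -> (forall j, gauge P 1 r (x j)) ->
  gauge P 1 r (fun w => (\sum_(j in A) x j w) / #|A|%:R).
Proof.
move=> r1 gx; have [A0|A0] := posnP #|A|.
  rewrite (_ : (fun _ => _) = fun=> 0); last first.
    by apply/funext => w; rewrite A0 invr0 mulr0.
  apply: (@gauge_le 0) => //; apply: gauge0; exact: lt_trans r1.
have n0 : 0 < #|A|%:R :> R by rewrite ltr0n.
have mS : measurable_fun setT (fun w => (\sum_(j in A) x j w) / #|A|%:R).
  apply: measurable_funM => //; apply: meas_sum => j _.
  exact: gauge_meas (gx j).
split => //.
  by move=> w; rewrite divr_ge0 ?sumr_ge0// => j _; exact: gauge_pos (gx j).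
have ae1 : (forall j, \forall w \ae P, x j w <= 1) ->
    \forall w \ae P, (\sum_(j in A) x j w) / #|A|%:R <= 1.
  move=> h; have : \forall w \ae P, forall j, x j w <= 1.
    by apply: filter_forall.
  apply: filterS => w hw; rewrite ler_pdivrMr// mul1r.
  apply: (@le_trans _ _ (\sum_(j in A) 1)); first exact: ler_sum.
  by rewrite sumr_const.
case: r r1 gx => [r| |//] r1 gx; last by apply: ae1 => j; case: (gx j).
rewrite lte_fin in r1.
have ig j : itg P (fun w => x j w `^ r) by case: (gx j) => _ _ [].
pose G w := (\sum_(j in A) x j w `^ r) / #|A|%:R.
have iG : itg P G.
  rewrite (_ : G = fun w => #|A|%:R^-1 * \sum_(j in A) x j w `^ r); last first.
    by apply/funext => w; rewrite /G mulrC.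
  by apply: itgZ; exact: itg_sum.
have le w : `|((\sum_(j in A) x j w) / #|A|%:R) `^ r| <= G w.
  rewrite ger0_norm ?powR_ge0//; apply: powR_mean => // j; exact: gauge_pos (gx j).
have im := itg_le (measurableT_comp (measurable_powR r) mS) iG le.
split => //; apply: (le_trans (ler_norm _)).
apply: (le_trans (ex_norm_le im iG le)); rewrite /G exZr; last exact: itg_sum.
rewrite ex_sum// ler_pdivrMr// mul1r.
apply: (@le_trans _ _ (\sum_(j in A) 1)); last by rewrite sumr_const.
by apply: ler_sum => j _; case: (gx j) => _ _ [].
Qed.

Lemma gauge_ex (N p t : R) r a U : 1 <= N -> ((p + 2)%:E < r)%E -> gauge P N r a ->
  0 <= t <= p + 2 -> measurable_fun setT U -> (forall w, `|U w| <= a w `^ t) ->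
  itg P U /\ `|ex P U| <= 2 * N.
Proof.
move=> N1; case: r => [r| |//] pr ga /andP[t0 tp] mU Ua; last first.
  case: ga => ma a0 a1.
  have U1 : \forall w \ae P, U w = clip 1 (U w).
    apply: filterS a1 => w a1; rewrite clip_id//.
    by rewrite (le_trans (Ua w))// powR_le1// a0.
  have mc : measurable_fun setT (fun w => clip 1 (U w)) by exact: measurable_clip.
  have bc w : `|clip 1 (U w)| <= 1 by exact: clip_le.
  split.
    have := itg_bnd P mc bc; rewrite /itg => ic.
    apply/integrableP; split; first exact/measurable_EFinP.
    move/integrableP : ic => [_]; apply: le_lt_trans.
    rewrite (ae_eq_integral (fun w => `|(clip 1 (U w))%:E|%E))//.
    - by apply/measurable_EFinP; exact: measurableT_comp.
    - by apply/measurable_EFinP; exact: measurableT_comp.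
    - by apply: filterS U1 => w <-.
  rewrite (ex_ae mU mc U1) (le_trans (ex_bnd P mc bc))//.
  by rewrite (le_trans N1)// mulr_natl mulr2n lerDl (le_trans _ N1).
rewrite lte_fin in pr.
have iU : itg P U by apply: (gauge_itg ga _ mU Ua); rewrite t0 (le_trans tp)// ltW.
split => //; case: ga => ma a0 [ia na].
have le w : `|U w| <= 1 + a w `^ r.
  apply: (le_trans (Ua w)); have [h|h] := leP (a w) 1.
    by rewrite (@le_trans _ _ 1) ?lerDl ?powR_ge0// powR_le1// a0.
  rewrite (@le_trans _ _ (a w `^ r)) ?lerDr// ler_powR//; first exact: ltW.
  by rewrite (le_trans tp)// ltW.
have i1 := itgD (itg_cst P 1) ia.
rewrite (le_trans (ex_norm_le iU i1 le))// (exD (itg_cst P 1) ia) (ex_cst P 1).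
by rewrite mulr_natl mulr2n lerD.
Qed.

End Gauge.

(** * Monomials in the field: measurability, integrability, covariances *)

Section Field.
Context {d} {Omega : measurableType d} {R : realType} {I : finType}.
Variables (P : probability Omega R) (x : I -> Omega -> R).
Hypothesis mx : forall j, measurable_fun setT (x j).
Implicit Types (A B U : {set I}) (F G Q rho b : Omega -> R) (tau : R).

Definition gens U : set (set Omega) :=
  \bigcup_(i in [set` U]) preimage_set_system setT (x i) measurable.

(** Measurability with respect to the sigma-algebra generated by the x_i with i in U, expressed as a
    change of measurable structure on the domain so that the closure lemmas for measurable functions
    apply. *)
Definition smeas U F :=
  measurable_fun (setT : set (g_sigma_algebraType (gens U))) F.

Lemma gens_sub U : <<s gens U>> `<=` measurable.
Proof.
apply: smallest_sub; first exact: sigma_algebra_measurable.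
move=> _ [i _] [B mB <-]; exact: mx.
Qed.

Lemma smeas_meas U F : smeas U F -> measurable_fun setT F.
Proof. by move=> mF _ B mB; apply: gens_sub; exact: (mF measurableT B mB). Qed.

Lemma smeas_event U F y : smeas U F -> <<s gens U>> [set w | y <= F w].
Proof.
move=> mF; have := mF measurableT [set` `[y, +oo[%R] (measurable_itv _).
rewrite setTI [X in X -> _](_ : _ = <<s gens U>> (F @^-1` [set` `[y, +oo[%R]))//.
congr (<<s gens U>> _); apply/seteqP; split => w /=; by rewrite in_itv/= andbT.
Qed.

Lemma smeas_x U j : j \in U -> smeas U (x j).
Proof.
move=> jU _ B mB; apply: sub_sigma_algebra; exists j => //.
by exists B.
Qed.

Lemma smeas_mono U U' F : U \subset U' -> smeas U F -> smeas U' F.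
Proof.
move=> UU mF _ B mB.
have h : <<s gens U>> `<=` <<s gens U'>>.
  apply: smallest_sub; first exact: smallest_sigma_algebra.
  move=> C [i iU hC]; apply: sub_sigma_algebra; exists i => //=.
  exact: (fintype.subsetP UU).
by apply: h; exact: (mF measurableT B mB).
Qed.

Lemma smeas_cst U c : smeas U (fun=> c).
Proof. exact: measurable_cst. Qed.

Lemma smeasD U F G : smeas U F -> smeas U G -> smeas U (fun w => F w + G w).
Proof. exact: measurable_funD. Qed.

Lemma smeasM U F G : smeas U F -> smeas U G -> smeas U (fun w => F w * G w).
Proof. exact: measurable_funM. Qed.

Lemma smeasN U F : smeas U F -> smeas U (fun w => - F w).
Proof. by move=> mF; apply: measurableT_comp. Qed.

Lemma smeas_comp U F (g : R -> R) : measurable_fun setT g -> smeas U F ->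
  smeas U (fun w => g (F w)).
Proof. by move=> mg mF; apply: (measurableT_comp mg mF). Qed.

Lemma smeasX U F n : smeas U F -> smeas U (fun w => F w ^+ n).
Proof. by move=> mF; apply: measurable_funX. Qed.

Lemma smeas_sum U (J : Type) (s : seq J) (F : J -> Omega -> R) (Q : pred J) :
  (forall j, Q j -> smeas U (F j)) -> smeas U (fun w => \sum_(j <- s | Q j) F j w).
Proof.
move=> FI; elim: s => [|j s IH].
  rewrite (_ : (fun _ => _) = fun=> 0); first exact: smeas_cst.
  by apply/funext => w; rewrite big_nil.
rewrite (_ : (fun _ => _) = fun w => if Q j then F j w + \sum_(j <- s | Q j) F j w
  else \sum_(j <- s | Q j) F j w); last by apply/funext => w; rewrite big_cons.
by case Qj: (Q j) => //; apply: smeasD => //; exact: FI.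
Qed.

Definition mon (J : seq I) w : R := \prod_(j <- J) x j w.

Lemma mon_cat J J' w : mon (J ++ J') w = mon J w * mon J' w.
Proof. by rewrite /mon big_cat. Qed.

Lemma smeas_mon U J : {subset J <= U} -> smeas U (mon J).
Proof.
elim: J => [|j J IH] JU.
  by rewrite (_ : mon _ = fun=> 1); [exact: smeas_cst|apply/funext => w; rewrite /mon big_nil].
rewrite (_ : mon _ = fun w => x j w * mon J w); last first.
  by apply/funext => w; rewrite /mon big_cons.
apply: smeasM; first by apply: smeas_x; apply: JU; rewrite mem_head.
by apply: IH => i iJ; apply: JU; rewrite inE iJ orbT.
Qed.

(** Homogeneous polynomials of degree t in the x_j with j in A, where c bounds the sum of the
    absolute values of the coefficients. A bound for monomials passes to them with the factor c.
    However large A is, each monomial involves at most t sites, which is the restriction that the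
    mixing coefficient puts on one side. *)
Definition Qp (t : nat) A (c : R) Q : Prop := exists s : seq (R * seq I),
  [/\ (forall w, Q w = \sum_(e <- s) e.1 * mon e.2 w),
      (forall e, e \in s -> size e.2 = t /\ {subset e.2 <= A}) &
      \sum_(e <- s) `|e.1| <= c].

Lemma Qp_smeas t A c Q : Qp t A c Q -> smeas A Q.
Proof.
move=> [s [sE sA _]]; rewrite (_ : Q = fun w => \sum_(e <- s) e.1 * mon e.2 w); last exact/funext.
under eq_fun do rewrite big_seq.
apply: smeas_sum => e es; apply: smeasM; first exact: smeas_cst.
by apply: smeas_mon; have [] := sA _ es.
Qed.

Lemma Qp_ge0 t A c Q : Qp t A c Q -> 0 <= c.
Proof. by move=> [s [_ _]]; apply: le_trans; exact: sumr_ge0. Qed.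

Lemma Qp_mono t A A' c c' Q : A \subset A' -> c <= c' -> Qp t A c Q -> Qp t A' c' Q.
Proof.
move=> AA cc [s [sE sA sc]]; exists s; split => //; last exact: le_trans cc.
move=> e es; have [h1 h2] := sA _ es; split => // j jA.
by apply: (fintype.subsetP AA); exact: h2.
Qed.

Lemma Qp_one A : Qp 0 A 1 (fun=> 1).
Proof.
exists [:: (1, [::])]; split.
- by move=> w; rewrite big_seq1/= /mon big_nil mulr1.
- by move=> e; rewrite inE => /eqP ->.
- by rewrite big_seq1 normr1.
Qed.

Lemma Qp_mul t t' A A' c c' Q Q' : Qp t A c Q -> Qp t' A' c' Q' ->
  Qp (t + t') (A :|: A') (c * c') (fun w => Q w * Q' w).
Proof.
move=> [s [sE sA sc]] [s' [sE' sA' sc']].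
exists [seq (e.1 * e'.1, e.2 ++ e'.2) | e <- s, e' <- s']; split.
- move=> w; rewrite sE sE' big_distrlr/= big_allpairs_dep/=; apply: eq_bigr => e _.
  by apply: eq_bigr => e' _; rewrite mon_cat mulrACA.
- move=> e0 /allpairsP[[e e'] [/= es es' ->]]/=.
  have [h1 h2] := sA _ es; have [h1' h2'] := sA' _ es'.
  rewrite size_cat h1 h1'; split => // j; rewrite mem_cat finset.inE => /orP[/h2 ->|/h2' ->]//.
  by rewrite orbT.
- rewrite big_allpairs_dep/=.
  under eq_bigr => e _ do (under eq_bigr => e' _ do rewrite normrM; rewrite -mulr_sumr).
  by rewrite -mulr_suml ler_pM// sumr_ge0.
Qed.

Lemma Qp_exp A c S v : Qp 1 A c S -> Qp v A (c ^+ v) (fun w => S w ^+ v).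
Proof.
move=> hS; elim: v => [|v IH]; first by rewrite expr0; exact: Qp_one.
have := Qp_mul hS IH; rewrite finset.setUid add1n -exprS.
by rewrite (_ : (fun w => S w * _) = fun w => S w ^+ v.+1)// funeqE => w; rewrite exprS.
Qed.

Lemma Qp_lin A (s : R) : 0 <= s ->
  Qp 1 A (s * #|A|%:R) (fun w => \sum_(j in A) s * x j w).
Proof.
move=> s0; exists [seq (s, [:: j]) | j <- enum A]; split.
- move=> w; rewrite big_map big_enum/=; apply: eq_bigr => j _.
  by rewrite /mon big_seq1.
- move=> e0 /mapP[j]; rewrite mem_enum => jA -> /=; split => // i.
  by rewrite inE => /eqP ->.
- by rewrite big_map/= big_enum/= sumr_const ger0_norm// mulr_natr.
Qed.

Section Bounds.
Variables (p : R) (r : \bar R) (al : nat -> R) (q : nat)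
  (sep : nat -> {set I} -> {set I} -> Prop).
Hypothesis p0 : 0 < p.
Hypothesis pr : ((p + 2)%:E < r)%E.
Hypothesis gx : forall j, gauge P 1 r (fun w => `|x j w|).
Hypothesis dep : forall l U1 U2 (a b : set Omega), (#|U1| <= q)%N -> sep l U1 U2 ->
  <<s gens U1>> a -> <<s gens U2>> b ->
  `|fine (P (a `&` b)) - fine (P a) * fine (P b)| <= al l.
Hypothesis al1 : forall l, 0 <= al l <= 1.
Hypothesis sep_sub : forall l A B A' B', A' \subset A -> B' \subset B ->
  sep l A B -> sep l A' B'.

Lemma r_gt0 : (0 < r)%E.
Proof. by apply: lt_trans pr; rewrite lte_fin addr_gt0. Qed.

Lemma r_gt1 : (1 < r)%E.
Proof. by apply: lt_trans pr; rewrite lte_fin; have := p0; lra. Qed.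

Definition gmax (J : seq I) w : R := \big[Num.max/0]_(j <- J) `|x j w|.

Lemma gauge_gmax J : gauge P (size J)%:R r (gmax J).
Proof.
elim: J => [|j J IH].
  rewrite (_ : gmax _ = fun=> 0); first by apply: gauge0; exact: r_gt0.
  by apply/funext => w; rewrite /gmax big_nil.
rewrite (_ : gmax _ = fun w => Num.max `|x j w| (gmax J w)); last first.
  by apply/funext => w; rewrite /gmax big_cons.
rewrite [size _]/= -addn1 natrD addrC; exact: gauge_max (gx j) IH.
Qed.

Lemma le_gmax J j w : j \in J -> `|x j w| <= gmax J w.
Proof.
rewrite /gmax; elim: J => // i J IH; rewrite inE big_cons le_max.
by move=> /orP[/eqP ->|/IH ->]; rewrite ?lexx ?orbT.
Qed.

Lemma mon_gmax J w : `|mon J w| <= gmax J w ^+ size J.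
Proof.
rewrite /mon /gmax; elim: J => [|j J IH]; first by rewrite !big_nil normr1 expr0.
rewrite !big_cons normrM [size _]/= exprS.
have g0 : 0 <= \big[Num.max/0]_(j <- J) `|x j w|.
  by elim: J {IH} => [|i J IH]; rewrite ?big_nil// big_cons le_max normr_ge0.
apply: ler_pM => //; first by rewrite le_max lexx.
apply: (le_trans IH); apply: lerXn2r; rewrite ?nnegrE//.
  by rewrite le_max normr_ge0.
by rewrite le_max lexx orbT.
Qed.

Lemma powR_natD (g tau : R) n : 0 <= g -> 0 <= tau ->
  g `^ (n%:R + tau) = g ^+ n * g `^ tau.
Proof.
move=> g0 t0; have [/eqP|nt] := eqVneq (n%:R + tau) 0.
  rewrite paddr_eq0// => /andP[/eqP n0 /eqP ->].
  by rewrite addr0 powRr0 mulr1 powR_mulrn.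
by rewrite powRD ?powR_mulrn// (negbTE nt).
Qed.

(** The maximum of b and of the variables of J dominates every factor, so a single envelope carries
    the whole exponent. *)
Lemma mon_gauge J b rho (tau c : R) : 0 <= tau -> 0 <= c ->
  gauge P 1 r b -> (forall w, `|rho w| <= (c * b w) `^ tau) ->
  exists g, gauge P (1 + (size J)%:R) r g /\
    forall w, `|mon J w * rho w| <= c `^ tau * g w `^ ((size J)%:R + tau).
Proof.
move=> t0 c0 gb hb; exists (fun w => Num.max (b w) (gmax J w)); split.
  exact: gauge_max gb (gauge_gmax J).
move=> w; rewrite normrM.
have b0 := gauge_pos w gb; have m0 := gauge_pos w (gauge_gmax J).
set m := Num.max _ _.
have mm : 0 <= m by rewrite le_max b0.
rewrite powR_natD// mulrCA; apply: ler_pM => //.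
  apply: (le_trans (mon_gmax J w)); apply: lerXn2r; rewrite ?nnegrE//.
  by rewrite le_max lexx orbT.
apply: (le_trans (hb w)); rewrite powRM// ler_wpM2l ?powR_ge0//.
by rewrite powR_mono// le_max lexx.
Qed.

Definition env w : R := 1 + \sum_j `|x j w|.

Lemma env_ge1 w : 1 <= env w.
Proof. by rewrite /env lerDl sumr_ge0. Qed.

(** A qualitative growth condition whose constant may depend on the size of the field: it serves to
    justify integrability and the linearity of expectations, whereas the uniform bounds are carried
    by [gauge]. *)
Definition dom (t : R) F := measurable_fun setT F /\
  exists2 C, 0 <= C & forall w, `|F w| <= C * env w `^ t.

Lemma dom_le t t' F : t <= t' -> dom t F -> dom t' F.
Proof.
move=> tt [mF [C C0 hC]]; split => //; exists C => // w.
by rewrite (le_trans (hC w))// ler_wpM2l// ler_powR// env_ge1.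
Qed.

Lemma dom_cst c : dom 0 (fun=> c).
Proof. by split => //; exists `|c| => // w; rewrite powRr0 mulr1. Qed.

Lemma domD t F G : dom t F -> dom t G -> dom t (fun w => F w + G w).
Proof.
move=> [mF [C C0 hC]] [mG [D D0 hD]]; split; first exact: measurable_funD.
exists (C + D); first exact: addr_ge0.
by move=> w; rewrite (le_trans (ler_normD _ _))// mulrDl lerD.
Qed.

Lemma domM t s F G : dom t F -> dom s G -> dom (t + s) (fun w => F w * G w).
Proof.
move=> [mF [C C0 hC]] [mG [D D0 hD]]; split; first exact: measurable_funM.
exists (C * D); first exact: mulr_ge0.
move=> w; rewrite normrM powR_addr; last by rewrite (lt_le_trans _ (env_ge1 w)).
by rewrite mulrACA ler_pM.
Qed.

Lemma dom_sum t (J : Type) (s : seq J) (F : J -> Omega -> R) (Q : pred J) : 0 <= t ->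
  (forall j, Q j -> dom t (F j)) -> dom t (fun w => \sum_(j <- s | Q j) F j w).
Proof.
move=> t0 FI; elim: s => [|j s IH].
  rewrite (_ : (fun _ => _) = fun=> 0); first exact: dom_le (dom_cst 0).
  by apply/funext => w; rewrite big_nil.
rewrite (_ : (fun _ => _) = fun w => if Q j then F j w + \sum_(j <- s | Q j) F j w
  else \sum_(j <- s | Q j) F j w); last by apply/funext => w; rewrite big_cons.
by case Qj: (Q j) => //; apply: domD => //; exact: FI.
Qed.

Lemma dom_bnd t F G : measurable_fun setT F -> dom t G ->
  (forall w, `|F w| <= `|G w|) -> dom t F.
Proof.
by move=> mF [mG [C C0 hC]] FG; split => //; exists C => // w; exact: le_trans (hC w).
Qed.

Lemma dom_pow (t s : R) F : 0 <= s -> dom t F -> dom (t * s) (fun w => `|F w| `^ s).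
Proof.
move=> s0 [mF [C C0 hC]]; split.
  apply: (measurableT_comp (measurable_powR s)); exact: measurableT_comp.
exists (C `^ s); first exact: powR_ge0.
move=> w; rewrite ger0_norm ?powR_ge0// powRrM -powRM//; last exact: powR_ge0.
exact: powR_mono.
Qed.

Lemma dom_x j : dom 1 (x j).
Proof.
split => //; exists 1 => // w; rewrite mul1r powRr1; last by rewrite (le_trans _ (env_ge1 w)).
by rewrite /env (bigD1 j)//= addrCA lerDl addr_ge0// sumr_ge0.
Qed.

Lemma dom_itg t F : 0 <= t -> t <= p + 2 -> dom t F -> itg P F.
Proof.
move=> t0 tp hF; have {hF t0 tp}[mF [C C0 hC]] := dom_le tp hF.
pose n : R := 1 + #|I|%:R.
have n1 : 1 <= n by rewrite /n lerDl.
have n0 : 0 < n by exact: lt_le_trans n1.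
pose g w := Num.max 1 (gmax (enum I) w).
have g1 : gauge P 1 r (fun=> 1).
  split => //; case: r r_gt0 => [r' _|_|//]; last by apply: aeW => w.
  by rewrite powR1; split; [exact: itg_cst|rewrite ex_cst].
have ge : gauge P n r g.
  by rewrite /n cardT; apply: gauge_max => //; exact: gauge_gmax.
have gE w : env w <= n * g w.
  rewrite /n mulrDl mul1r; apply: lerD; first by rewrite le_max lexx.
  apply: (@le_trans _ _ (\sum_(j : I) g w)); last by rewrite sumr_const mulr_natl.
  apply: ler_sum => j _; rewrite le_max le_gmax ?orbT// mem_enum//.
pose F' w := (C * n `^ (p + 2))^-1 * F w.
have [C00|C00] := eqVneq C 0.
  rewrite (_ : F = fun=> 0); first exact: itg0.
  apply/funext => w; apply/eqP; rewrite -normr_le0.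
  by rewrite (le_trans (hC w))// C00 mul0r.
have Cn : 0 < C * n `^ (p + 2).
  by rewrite mulr_gt0 ?powR_gt0// lt_neqAle eq_sym C00.
have mF' : measurable_fun setT F' by exact: measurable_funM.
have p20 : 0 <= p + 2 <= p + 2 by rewrite lexx andbT addr_ge0// ltW.
have [w|iF' _] := gauge_ex n1 pr ge p20 mF'.
  rewrite /F' normrM gtr0_norm ?invr_gt0// ler_pdivrMl//.
  rewrite (le_trans (hC w))// -mulrA ler_wpM2l// -powRM ?(ltW n0)//; last exact: gauge_pos ge.
  by rewrite powR_mono ?(le_trans _ (env_ge1 w))//; case/andP: p20.
rewrite (_ : F = fun w => (C * n `^ (p + 2)) * F' w); first exact: itgZ.
by apply/funext => w; rewrite /F' mulrA divff ?gt_eqF// mul1r.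
Qed.

Lemma dom_mon J : dom (size J)%:R (mon J).
Proof.
elim: J => [|j J IH].
  rewrite (_ : mon _ = fun=> 1); first exact: dom_cst.
  by apply/funext => w; rewrite /mon big_nil.
rewrite (_ : mon _ = fun w => x j w * mon J w); last first.
  by apply/funext => w; rewrite /mon big_cons.
by rewrite [size _]/= -addn1 natrD addrC; exact: domM (dom_x j) IH.
Qed.

Lemma Qp_dom t A c Q : Qp t A c Q -> dom t%:R Q.
Proof.
move=> [s [sE sA _]]; rewrite (_ : Q = fun w => \sum_(e <- s) e.1 * mon e.2 w); last exact/funext.
under eq_fun do rewrite big_seq.
apply: dom_sum => // e es; have [<- _] := sA _ es.
rewrite -[X in dom X]add0r; exact: domM (dom_cst _) (dom_mon _).
Qed.

Definition bexp := mix_exponent p r.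
(** Davydov's constant 10 N^2 for N = p + 3, which bounds the constants of the envelopes of
    monomials because total degrees do not exceed p + 2. *)
Definition KC := 10 * (p + 3) ^+ 2.

Lemma KC_ge0 : 0 <= KC.
Proof. by rewrite /KC mulr_ge0// sqr_ge0. Qed.

(** The first sigma-algebra is generated by the variables of J, at most q of them, while A' is
    unrestricted. Dividing by c^tau makes the second function comparable with a power of an envelope
    that does not involve c; if c^tau = 0 that function vanishes. *)
Lemma mon_cov l J J' A' rho b c tau : 0 <= tau -> 0 <= c -> (size J <= q)%N ->
  (size J)%:R + (size J')%:R + tau <= p + 2 ->
  sep l [set j in J] A' -> {subset J' <= A'} -> smeas A' rho ->
  gauge P 1 r b -> (forall w, `|rho w| <= (c * b w) `^ tau) ->
  `|cov P (mon J) (fun w => mon J' w * rho w)| <= KC * c `^ tau * al l `^ bexp.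
Proof.
move=> t0 c0 Jq tot sJA J'A srho gb hb.
have p3 : 1 <= p + 3 by have := p0; lra.
have [g [gg hg]] := mon_gauge J' t0 c0 gb hb.
have gg3 : gauge P (p + 3) r g.
  apply: gauge_le gg; have : 0 <= (size J)%:R :> R by []; lra.
have gJ : gauge P (p + 3) r (gmax J).
  apply: gauge_le (gauge_gmax J); have : 0 <= (size J')%:R :> R by []; lra.
have sJ : smeas [set j in J] (mon J) by apply: smeas_mon => j; rewrite finset.inE.
have sV : smeas A' (fun w => mon J' w * rho w) by apply: smeasM => //; exact: smeas_mon.
have [ct0|ct0] := eqVneq (c `^ tau) 0.
  rewrite ct0 mulr0 mul0r (_ : (fun w => _) = fun=> 0); last first.
    apply/funext => w; apply/eqP; rewrite -normr_le0 (le_trans (hg w))//.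
    by rewrite ct0 mul0r.
  rewrite /cov (_ : (fun w => _) = fun=> 0); last by apply/funext => w; rewrite mulr0.
  by rewrite ex0 mulr0 subrr normr0.
have ctp : 0 < c `^ tau by rewrite lt_neqAle eq_sym ct0 powR_ge0.
pose V w := (c `^ tau)^-1 * (mon J' w * rho w).
have mJ : measurable_fun setT (mon J) := smeas_meas sJ.
have mV : measurable_fun setT V by apply: measurable_funM => //; exact: smeas_meas sV.
have -> : (fun w => mon J' w * rho w) = (fun w => c `^ tau * V w + 0).
  by apply/funext => w; rewrite /V addr0 mulrA divff// mul1r.
have p20 : 0 <= p by exact: ltW.
have hV w : `|V w| <= g w `^ ((size J')%:R + tau).
  by rewrite /V normrM gtr0_norm ?invr_gt0// ler_pdivrMl.
have hJ w : `|mon J w| <= gmax J w `^ (size J)%:R.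
  by rewrite powR_mulrn ?mon_gmax//; exact: gauge_pos (gauge_gmax J).
have t1 : (size J)%:R + ((size J')%:R + tau) <= p + 2 by rewrite addrA.
have t2 : (0 : R) <= (size J)%:R <= p + 2.
  by rewrite ler0n/= (le_trans _ t1)// lerDl addr_ge0.
have t3 : 0 <= (size J')%:R + tau <= p + 2.
  by rewrite addr_ge0//= (le_trans _ t1)// lerDr.
have iJ := (gauge_ex p3 pr gJ t2 mJ hJ).1.
have iV := (gauge_ex p3 pr gg3 t3 mV hV).1.
have iJV : itg P (fun w => mon J w * V w).
  have gJV := gauge_max gJ gg3.
  have N1 : 1 <= p + 3 + (p + 3) by rewrite (le_trans p3)// lerDl (le_trans _ p3).
  have t4 : 0 <= (size J)%:R + ((size J')%:R + tau) <= p + 2.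
    by rewrite addr_ge0//; case/andP: t3.
  apply: (gauge_ex N1 pr gJV t4 _ _).1; first exact: measurable_funM.
  move=> w; set m := Num.max _ _.
  have mm : 0 <= m by rewrite le_max (gauge_pos w gg3) orbT.
  rewrite normrM powR_natD//; last by case/andP: t3.
  rewrite -powR_mulrn// ler_pM//.
    by rewrite (le_trans (hJ w))// powR_mono// ?(gauge_pos w gJ)// le_max lexx.
  rewrite (le_trans (hV w))// powR_mono//; first by case/andP: t3.
    exact: gauge_pos gg3.
  by rewrite le_max lexx orbT.
have -> : mon J = (fun w => 1 * mon J w + 0) by apply/funext => w; rewrite mul1r addr0.
rewrite covZD// mul1r normrM (gtr0_norm ctp) mulrAC [_ * c `^ tau]mulrC ler_wpM2l ?(ltW ctp)//.
have cJ : (#|[set j in J]| <= q)%N.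
  by rewrite (leq_trans _ Jq)// cardsE; exact: card_size.
apply: (davydov (cA := <<s gens [set j in J]>>) (cB := <<s gens A'>>)
  _ _ _ p3 p20 pr gJ gg3 (ler0n _ _) _ t1 mJ mV _ _ hJ hV).
- exact: smallest_sigma_algebra.
- exact: smallest_sigma_algebra.
- by move=> a b0 ha hb0; apply: (dep cJ sJA).
- by case/andP: t3.
- by move=> y; exact: smeas_event.
- move=> y; apply: smeas_event; apply: smeasM => //; exact: smeas_cst.
- by case/andP: (al1 l).
Qed.

Lemma cov_suml (s : seq (R * seq I)) (G : Omega -> R) :
  (forall e, e \in s -> itg P (mon e.2)) -> itg P G ->
  (forall e, e \in s -> itg P (fun w => mon e.2 w * G w)) ->
  cov P (fun w => \sum_(e <- s) e.1 * mon e.2 w) G =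
  \sum_(e <- s) e.1 * cov P (mon e.2) G.
Proof.
move=> i1 iG i2; rewrite /cov.
under [X in ex P X]eq_fun do rewrite mulr_suml big_seq.
rewrite ex_sum; last first.
  move=> e es; have := itgZ e.1 (i2 _ es).
  by under [X in itg P X -> _]eq_fun do rewrite mulrA.
under [X in _ - ex P X * _]eq_fun do rewrite big_seq.
rewrite ex_sum; last by move=> e es; exact: itgZ (i1 _ es).
rewrite [RHS]big_seq mulr_suml -sumrB; apply: eq_bigr => e es.
rewrite (exZ _ (i1 _ es)) mulrBr mulrA; congr (_ - _).
by rewrite -exZ; [congr ex; apply/funext => w; rewrite mulrA|exact: i2].
Qed.

Lemma covC F G : cov P F G = cov P G F.
Proof.
by rewrite /cov mulrC; congr (_ - _); congr ex; apply/funext => w; rewrite mulrC.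
Qed.

Lemma rho_dom rho b tau c : 0 <= tau -> 0 <= c -> measurable_fun setT rho ->
  dom 1 b -> (forall w, 0 <= b w) -> (forall w, `|rho w| <= (c * b w) `^ tau) -> dom tau rho.
Proof.
move=> t0 c0 mrho db b0 hb; rewrite -[tau]mul1r.
have d1 : dom 1 (fun w => c * b w) by rewrite -[1]add0r; apply: domM => //; exact: dom_cst.
apply: (dom_bnd mrho (dom_pow t0 d1)) => w.
rewrite [leRHS]ger0_norm ?powR_ge0// [X in X `^ _]ger0_norm//.
by rewrite mulr_ge0.
Qed.

Lemma Qp_cov l t t' A A' B c c' Q Q' rho b cr tau : 0 <= tau -> 0 <= cr -> (t <= q)%N ->
  t%:R + t'%:R + tau <= p + 2 -> Qp t A c Q -> Qp t' A' c' Q' ->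
  sep l A B -> A' \subset B -> smeas B rho -> gauge P 1 r b -> dom 1 b ->
  (forall w, `|rho w| <= (cr * b w) `^ tau) ->
  `|cov P Q (fun w => Q' w * rho w)| <= KC * c * c' * cr `^ tau * al l `^ bexp.
Proof.
move=> t0 cr0 tq tot hQ hQ' sAB AB srho gb db hb.
have dr : dom tau rho.
  exact: rho_dom t0 cr0 (smeas_meas srho) db (fun w => gauge_pos w gb) hb.
have := hQ => -[s [sE sA sc]]; have := hQ' => -[s' [sE' sA' sc']].
have T : (t%:R + (t'%:R + tau) : R) <= p + 2 by rewrite addrA.
have iQ' : itg P (fun w => Q' w * rho w).
  apply: (dom_itg _ _ (domM (Qp_dom hQ') dr)); first by rewrite addr_ge0.
  by rewrite (le_trans _ T)// lerDr.
rewrite (_ : Q = fun w => \sum_(e <- s) e.1 * mon e.2 w); last exact/funext.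
have dm e : e \in s -> dom t%:R (mon e.2).
  by move=> es; have [<- _] := sA _ es; exact: dom_mon.
have dm' e : e \in s' -> dom t'%:R (mon e.2).
  by move=> es; have [<- _] := sA' _ es; exact: dom_mon.
have im e : e \in s -> itg P (mon e.2).
  by move=> es; apply: (dom_itg _ _ (dm _ es)) => //; rewrite (le_trans _ T)// lerDl addr_ge0.
rewrite cov_suml//; last first.
  move=> e es; apply: (dom_itg _ _ (domM (dm _ es) (domM (Qp_dom hQ') dr))) => //.
  by rewrite !addr_ge0.
have one e : e \in s -> `|cov P (mon e.2) (fun w => Q' w * rho w)|
    <= KC * c' * cr `^ tau * al l `^ bexp.
  move=> es; have [se sAe] := sA _ es.
  rewrite covC (_ : (fun w => Q' w * rho w) =
      fun w => \sum_(e' <- s') e'.1 * (mon e'.2 w * rho w)); last first.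
    apply/funext => w; rewrite sE' mulr_suml; by apply: eq_bigr => e' _; rewrite mulrA.
  have -> : cov P (fun w => \sum_(e' <- s') e'.1 * (mon e'.2 w * rho w)) (mon e.2) =
      \sum_(e' <- s') e'.1 * cov P (fun w => mon e'.2 w * rho w) (mon e.2).
    have i1 e' : e' \in s' -> itg P (fun w => mon e'.2 w * rho w).
      move=> es'; apply: (dom_itg _ _ (domM (dm' _ es') dr)); first by rewrite addr_ge0.
      by rewrite (le_trans _ T)// lerDr.
    have i2 e' : e' \in s' -> itg P (fun w => mon e'.2 w * rho w * mon e.2 w).
      move=> es'; apply: (dom_itg _ _ (domM (domM (dm' _ es') dr) (dm _ es))).
        by rewrite !addr_ge0.
      by rewrite addrC.
    rewrite /cov; under [X in ex P X]eq_fun do rewrite mulr_suml big_seq.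
    rewrite ex_sum; last first.
      move=> e' es'; have := itgZ e'.1 (i2 _ es').
      by under [X in itg P X -> _]eq_fun do rewrite mulrA.
    under [X in _ - ex P X * _]eq_fun do rewrite big_seq.
    rewrite ex_sum; last by move=> e' es'; exact: itgZ (i1 _ es').
    rewrite [RHS]big_seq mulr_suml -sumrB; apply: eq_bigr => e' es'.
    rewrite (exZ _ (i1 _ es')) mulrBr mulrA; congr (_ - _).
    rewrite -(exZ _ (i2 _ es')); congr ex; apply/funext => w; by rewrite !mulrA.
  rewrite (le_trans (ler_norm_sum _ _ _))// big_seq.
  apply: (@le_trans _ _ (\sum_(e' <- s' | e' \in s') `|e'.1| * (KC * cr `^ tau * al l `^ bexp))).
    apply: ler_sum => e' es'; have [se' sAe'] := sA' _ es'.
    rewrite normrM ler_wpM2l// covC; apply: (@mon_cov _ _ _ B _ b) => //.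
    - by rewrite se.
    - by rewrite se se'.
    - apply: sep_sub sAB => //; apply/fintype.subsetP => j; rewrite finset.inE; exact: sAe.
    - by move=> j /sAe'; exact: (fintype.subsetP AB).
  rewrite -big_seq -mulr_suml (_ : KC * c' * _ * _ = c' * (KC * cr `^ tau * al l `^ bexp)); last by clear; ring.
  by apply: ler_wpM2r => //; apply: mulr_ge0; [apply: mulr_ge0; [exact: KC_ge0|]|]; exact: powR_ge0.
rewrite (le_trans (ler_norm_sum _ _ _))// big_seq.
apply: (@le_trans _ _ (\sum_(e <- s | e \in s) `|e.1| * (KC * c' * cr `^ tau * al l `^ bexp))).
  by apply: ler_sum => e es; rewrite normrM ler_wpM2l// one.
rewrite -big_seq -mulr_suml (_ : KC * c * c' * _ * _ = c * (KC * c' * cr `^ tau * al l `^ bexp)); last by clear; ring.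
apply: ler_wpM2r => //; apply: mulr_ge0; last exact: powR_ge0.
by apply: mulr_ge0; [apply: mulr_ge0; [exact: KC_ge0|exact: Qp_ge0 hQ']|exact: powR_ge0].
Qed.

Lemma Qp_ex t A c Q rho b cr tau : 0 <= tau -> 0 <= cr ->
  t%:R + tau <= p + 2 -> Qp t A c Q -> measurable_fun setT rho ->
  gauge P 1 r b -> dom 1 b -> (forall w, `|rho w| <= (cr * b w) `^ tau) ->
  `|ex P (fun w => Q w * rho w)| <= KC * c * cr `^ tau.
Proof.
move=> t0 cr0 tot hQ mrho gb db hb.
have dr : dom tau rho by exact: rho_dom t0 cr0 mrho db (fun w => gauge_pos w gb) hb.
have := hQ => -[s [sE sA sc]].
have p3 : 1 <= p + 3 by have := p0; lra.
have im e : e \in s -> itg P (fun w => mon e.2 w * rho w).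
  move=> es; have [se _] := sA _ es.
  apply: (dom_itg _ _ (domM (dom_mon e.2) dr)); first by rewrite addr_ge0.
  by rewrite se.
rewrite (_ : (fun w => _) = fun w => \sum_(e <- s | e \in s) e.1 * (mon e.2 w * rho w)); last first.
  apply/funext => w; rewrite sE mulr_suml -big_seq; apply: eq_bigr => e _.
  by rewrite mulrA.
rewrite ex_sum; last by move=> e es; apply: itgZ; exact: im.
rewrite (le_trans (ler_norm_sum _ _ _))//.
apply: (@le_trans _ _ (\sum_(e <- s | e \in s) `|e.1| * (KC * cr `^ tau))).
  apply: ler_sum => e es; rewrite exZ; last exact: im.
  rewrite normrM ler_wpM2l//; have [se _] := sA _ es.
  have [g [gg hg]] := mon_gauge e.2 t0 cr0 gb hb.
  have N1 : (1 : R) <= 1 + (size e.2)%:R by rewrite lerDl.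
  have [ct0|ct0] := eqVneq (cr `^ tau) 0.
    rewrite ct0 mulr0 (_ : (fun w => _) = fun=> 0) ?ex0 ?normr0//.
    apply/funext => w; apply/eqP; rewrite -normr_le0 (le_trans (hg w))//.
    by rewrite ct0 mul0r.
  have ctp : 0 < cr `^ tau by rewrite lt_neqAle eq_sym ct0 powR_ge0.
  pose V w := (cr `^ tau)^-1 * (mon e.2 w * rho w).
  have mV : measurable_fun setT V.
    apply: measurable_funM => //; apply: measurable_funM => //; exact: (dom_mon e.2).1.
  have hV w : `|V w| <= g w `^ ((size e.2)%:R + tau).
    by rewrite /V normrM gtr0_norm ?invr_gt0// ler_pdivrMl.
  have t3 : 0 <= (size e.2)%:R + tau <= p + 2 by rewrite se addr_ge0.
  have [iV bV] := gauge_ex N1 pr gg t3 mV hV.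
  rewrite (_ : (fun w => _) = fun w => cr `^ tau * V w); last first.
    by apply/funext => w; rewrite /V mulrA divff// mul1r.
  rewrite exZ// normrM gtr0_norm// mulrC ler_wpM2r ?(ltW ctp)//.
  apply: (le_trans bV); apply: (@le_trans _ _ (2 * (p + 3))).
    have : (size e.2)%:R <= p + 2 by rewrite se (le_trans _ tot)// lerDl.
    lra.
  rewrite /KC expr2 mulrA ler_wpM2r//; [lra|].
  by rewrite -[leLHS]mulr1 ler_pM//; lra.
rewrite -big_seq -mulr_suml (_ : KC * c * _ = c * (KC * cr `^ tau)); last by clear; ring.
by rewrite ler_wpM2r// mulr_ge0 ?powR_ge0 ?KC_ge0.
Qed.

End Bounds.
End Field.

(** * Functions with a Hoelder derivative *)

Section HolderClass.
Context {R : realType}.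
Implicit Types (om : R) (G : nat -> R -> R).

(** G 0 is the function and G j its j-th derivative, the q-th being Hoelder of order om with
    constant 1. Carrying the derivatives as data turns differentiation into a shift of the index. *)
Definition cls (q : nat) om G : Prop :=
  (forall j, (j < q)%N -> forall x : R, is_derive x 1 (G j) (G j.+1 x)) /\
  (forall x y : R, `|G q x - G q y| <= `|x - y| `^ om).

Lemma cls_shift q v om G : (v <= q)%N -> cls q om G ->
  cls (q - v) om (fun j => G (j + v)%N).
Proof.
move=> vq [dG hG]; split; last by rewrite subnK.
by move=> j jq x; rewrite addSn; apply: dG; lia.
Qed.

Lemma derive_continuous (f : R -> R) (x df : R) : is_derive x 1 f df -> {for x, continuous f}.
Proof. by move=> [h _]; apply: differentiable_continuous; exact/derivable1_diffP. Qed.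

Lemma holder_continuous (f : R -> R) om : 0 < om ->
  (forall x y : R, `|f x - f y| <= `|x - y| `^ om) -> continuous f.
Proof.
move=> om0 hf x; apply/cvgrPdist_le => e e0.
near=> y; apply: (le_trans (hf x y)).
have : `|x - y| <= e `^ om^-1.
  near: y.
  have e1 : 0 < e `^ om^-1 by exact: powR_gt0.
  by apply/nbhs_ballP; exists (e `^ om^-1) => //= y; rewrite /ball/= => /ltW.
move=> h; apply: (@le_trans _ _ ((e `^ om^-1) `^ om)).
  by rewrite powR_mono// ltW.
by rewrite -powRrM mulVf ?gt_eqF// powRr1// ltW.
Unshelve. all: by end_near. Qed.

Lemma cls_continuous q om G j : 0 < om -> cls q om G -> (j <= q)%N -> continuous (G j).
Proof.
move=> om0 [dG hG]; rewrite leq_eqVlt => /predU1P[->|jq]; first exact: holder_continuous hG.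
move=> x; exact: derive_continuous (dG j jq x).
Qed.

Lemma cls_meas q om G j : 0 < om -> cls q om G -> (j <= q)%N -> measurable_fun setT (G j).
Proof.
by move=> om0 hG jq; apply: continuous_measurable_fun; exact: cls_continuous hG jq.
Qed.

Lemma MVT_any (f f' : R -> R) (a b : R) : (forall x : R, is_derive x 1 f (f' x)) ->
  exists2 c, `|c - a| <= `|b - a| & f b - f a = f' c * (b - a).
Proof.
move=> df; have cf : continuous f by move=> x; exact: derive_continuous (df x).
have [ab|ba|->] := ltgtP a b.
- have [c] := @MVT R f f' a b ab (fun x _ => df x) (continuous_subspaceT cf).
  rewrite in_itv/= => /andP[ac cb] ->; exists c => //.
  by rewrite !gtr0_norm ?subr_gt0// lerD2r ltW.
- have [c] := @MVT R f f' b a ba (fun x _ => df x) (continuous_subspaceT cf).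
  rewrite in_itv/= => /andP[ac cb] h; exists c.
    by rewrite !ltr0_norm ?subr_lt0// lerN2 lerD2r ltW.
  by rewrite -[LHS]opprB h -mulrN opprB.
- by exists b; rewrite ?subrr ?mulr0// lexx.
Qed.

Lemma is_derive_pow n (x : R) : is_derive x 1 (fun s : R => s ^+ n.+1) (n.+1%:R * x ^+ n).
Proof.
have := @is_deriveX R R id n.+1 x 1 1 (is_derive_id x 1).
by rewrite exprfctE; move=> H; apply: (is_derive_eq H); rewrite /GRing.scale/= mulr1.
Qed.

Lemma is_derive_scale (c : R) (f : R -> R) (x df : R) :
  is_derive x 1 f df -> is_derive x 1 (fun s => c * f s) (c * df).
Proof. by move=> h; exact: (is_deriveZ c h). Qed.

(** Induction on q by the mean value theorem: the derivative in h of the remainder is the remainder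
    of order q - 1 of the derivative. The factorial that a finer argument would gain is given up. *)
Lemma holder_taylor q om G (x h : R) : 0 < om -> cls q om G ->
  `|G 0%N (x + h) - \sum_(v < q.+1) h ^+ v / v`!%:R * G v x| <= `|h| `^ (q%:R + om).
Proof.
move=> om0; elim: q G h => [|q IH] G h hG.
  rewrite big_ord1 expr0 divr1 mul1r add0r; case: hG => _ /(_ (x + h) x).
  by rewrite addrAC subrr add0r.
pose F s := G 0%N (x + s) - \sum_(v < q.+2) s ^+ v / v`!%:R * G v x.
pose F' s := G 1%N (x + s) - \sum_(v < q.+1) s ^+ v / v`!%:R * G v.+1 x.
have dF (s : R) : is_derive s 1 F (F' s).
  apply: is_deriveB.
    have h1 := hG.1 0%N isT (x + s).
    have h2 : is_derive s 1 (fun s => x + s) (0 + 1) by apply: is_deriveD.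
    have := @is_derive1_comp R (G 0%N) (fun s => x + s) s _ _ h1 h2.
    by rewrite add0r mulr1.
  under eq_fun do rewrite big_ord_recl.
  rewrite [X in is_derive _ _ _ X](_ : _ = 0 + \sum_(v < q.+1) s ^+ v / v`!%:R * G v.+1 x); last by rewrite add0r.
  apply: is_deriveD.
    rewrite (_ : (fun _ => _) = fun=> G 0%N x); first exact: is_derive_cst.
    by apply/funext => u; rewrite expr0 divr1 mul1r.
  have := @is_derive_sum R R R q.+1 (fun (v : 'I_q.+1) s => s ^+ v.+1 / v.+1`!%:R * G v.+1 x) s 1
     (fun v => s ^+ v / v`!%:R * G v.+1 x).
  rewrite fct_sumE; apply => v.
  have H := is_derive_scale (G v.+1 x / v.+1`!%:R) (is_derive_pow v s).
  rewrite (_ : (fun s0 : R => _) = (fun u => G v.+1 x / v.+1`!%:R * u ^+ v.+1)); last first.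
    by apply/funext => u; rewrite mulrC mulrA mulrAC.
  apply: (is_derive_eq H); rewrite factS natrM.
  have v0 : v.+1%:R != 0 :> R by rewrite pnatr_eq0.
  have f0 : v`!%:R != 0 :> R by rewrite pnatr_eq0 -lt0n fact_gt0.
  by move: v.+1%:R v0 => a a0; field; rewrite a0 f0.
have F0 : F 0 = 0.
  rewrite /F addr0 big_ord_recl expr0 divr1 mul1r big1 ?addr0 ?subrr// => v _.
  by rewrite expr0n/= mul0r mul0r.
have [c ch] := MVT_any 0 h dF; rewrite -/(F h) F0 !subr0 => ->.
have : `|F' c| <= `|c| `^ (q%:R + om).
  have := IH (fun j => G j.+1) c; apply; split; last exact: hG.2.
  by move=> j jq y; apply: hG.1.
move=> h1; rewrite normrM -natr1 -addrA [1 + _]addrC addrA.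
have qo : 0 <= q%:R + om by rewrite addr_ge0// ltW.
rewrite powRD ?powRr1//; last by rewrite gt_eqF// ltr_wpDl.
rewrite !subr0 in ch; rewrite ler_wpM2r//; apply: (le_trans h1); exact: powR_mono.
Qed.

Lemma cls_growth q om G : 0 < om -> cls q om G ->
  exists2 C, 0 <= C & forall x, `|G 0%N x| <= C * (1 + `|x|) `^ (q%:R + om).
Proof.
move=> om0 hG; exists (1 + \sum_(v < q.+1) `|G v 0|); first by rewrite addr_ge0// sumr_ge0.
move=> x; have := holder_taylor 0 x om0 hG; rewrite add0r => h.
have qo : 0 <= q%:R + om by rewrite addr_ge0// ltW.
have x1 : 1 <= 1 + `|x| by rewrite lerDl.
rewrite -(subrK (\sum_(v < q.+1) x ^+ v / v`!%:R * G v 0) (G 0%N x)).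
rewrite (le_trans (ler_normD _ _))// mulrDl mul1r; apply: lerD.
  by apply: (le_trans h); rewrite powR_mono// lerDr.
rewrite (le_trans (ler_norm_sum _ _ _))// mulr_suml; apply: ler_sum => v _.
rewrite normrM mulrC ler_wpM2l// normrM normrX.
rewrite -[leRHS]mulr1 ler_pM//; last first.
  by rewrite ger0_norm ?invr_ge0// invf_le1 ?ltr0n ?fact_gt0// ler1n fact_gt0.
apply: (@le_trans _ _ ((1 + `|x|) ^+ v)).
  by rewrite lerXn2r ?nnegrE ?addr_ge0// lerDr.
rewrite -powR_mulrn ?addr_ge0// ler_powR//.
have : v%:R <= q%:R :> R by rewrite ler_nat -ltnS.
lra.
Qed.

End HolderClass.

Lemma le_sum4 (R : realType) (a b c d : R) : 0 <= a -> 0 <= b -> 0 <= c -> 0 <= d ->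
  [/\ a <= a + b + c + d, b <= a + b + c + d, c <= a + b + c + d & d <= a + b + c + d].
Proof. by move=> *; split; lra. Qed.

(** * Expansion around one site *)

Section Centre.
Context {d} {Omega : measurableType d} {R : realType} {I : finType}.
Variables (P : probability Omega R) (x : I -> Omega -> R).
Hypothesis mx : forall j, measurable_fun setT (x j).
Variables (p om : R) (r : \bar R) (al : nat -> R) (k2 : nat)
  (sep : nat -> {set I} -> {set I} -> Prop).
Hypothesis p0 : 0 < p.
Hypothesis pr : ((p + 2)%:E < r)%E.
Hypothesis om01 : 0 < om <= 1.
Hypothesis k2p : k2%:R + om <= p + 2.
Hypothesis gx : forall j, gauge P 1 r (fun w => `|x j w|).
Hypothesis dep : forall l (U1 U2 : {set I}) (a b : set Omega), (#|U1| <= k2)%N -> sep l U1 U2 ->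
  <<s gens x U1>> a -> <<s gens x U2>> b ->
  `|fine (P (a `&` b)) - fine (P a) * fine (P b)| <= al l.
Hypothesis al1 : forall l, 0 <= al l <= 1.
Hypothesis al_anti : forall l l', (l <= l')%N -> al l' <= al l.
Hypothesis sep_sub : forall l (A B A' B' : {set I}), A' \subset A -> B' \subset B ->
  sep l A B -> sep l A' B'.
(* rad j stands for the distance from j to a fixed site, truncated at N *)
Variables (rad : I -> nat) (N : nat).
Hypothesis radN : forall j, (rad j <= N)%N.
Definition Btwn a c : {set I} := [set j | (a <= rad j <= c)%N].
Hypothesis rad_sep : forall a l, sep (l - a) (Btwn 0 a) (Btwn l N).
Variables (s Dl : R) (b : nat -> R).
Hypothesis s0 : 0 <= s.
Hypothesis bB : forall l, s * #|Btwn 0 l|%:R <= b l.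
Hypothesis b_mono : forall l l', (l <= l')%N -> b l <= b l'.
Hypothesis b_double : forall l, b (2 * l)%N <= Dl * b l.
Hypothesis Dl1 : 1 <= Dl.
Implicit Types (A B : {set I}) (Q : Omega -> R) (G : nat -> R -> R)
  (Psi : (nat -> R -> R) -> R).

Let om0 : 0 < om. Proof. by case/andP: om01. Qed.
Let om1 : om <= 1. Proof. by case/andP: om01. Qed.

Definition lin A w : R := \sum_(j in A) s * x j w.
Definition Wout a w : R := lin (Btwn a.+1 N) w.
Definition Wall w : R := \sum_j s * x j w.

Lemma WallE w : Wall w = lin finset.setT w.
Proof. by rewrite /lin; apply: eq_bigl => j; rewrite finset.inE. Qed.

Lemma lin_split A B w : A :&: B = finset.set0 -> lin (A :|: B) w = lin A w + lin B w.
Proof.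
move=> AB; rewrite /lin [LHS](big_setID A)/= finset.setIUl finset.setIid.
rewrite [in X in \sum_(_ in X) _ + _]finset.setIC AB finset.setU0; congr (_ + _).
apply: eq_bigl => j; move/setP/(_ j): AB; rewrite !finset.inE.
by case: (j \in A); case: (j \in B).
Qed.

Lemma Wout_split a c w : (a <= c)%N -> Wout a w = Wout c w + lin (Btwn a.+1 c) w.
Proof.
move=> ac; rewrite /Wout -lin_split; last first.
  by apply/setP => j; rewrite !finset.inE; lia.
by congr lin; apply/setP => j; rewrite !finset.inE; have := radN j; lia.
Qed.

Lemma Wall_split c w : Wall w = Wout c w + lin (Btwn 0 c) w.
Proof.
rewrite WallE /Wout -lin_split; last first.
  by apply/setP => j; rewrite !finset.inE; lia.
by congr lin; apply/setP => j; rewrite !finset.inE; have := radN j; lia.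
Qed.

Lemma WoutN c w : (N <= c)%N -> Wout c w = 0.
Proof.
move=> Nc; rewrite /Wout /lin big_pred0// => j; rewrite finset.inE.
by have := radN j; lia.
Qed.

Lemma lin_Qp A : Qp x 1 A (s * #|A|%:R) (lin A).
Proof. exact: Qp_lin. Qed.

Lemma lin_smeas A : smeas x A (lin A).
Proof. exact: Qp_smeas (lin_Qp A). Qed.

Lemma lin_dom A : dom x 1 (lin A).
Proof. exact: Qp_dom (lin_Qp A). Qed.

Lemma lin_bound A : exists g, [/\ gauge P 1 r g, dom x 1 g &
  forall w, `|lin A w| <= s * #|A|%:R * g w].
Proof.
exists (fun w => (\sum_(j in A) `|x j w|) / #|A|%:R); split.
- exact: gauge_mean (r_gt1 p0 pr) gx.
- rewrite -[1]addr0; apply: domM; last exact: dom_cst.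
  apply: dom_sum => // j _; apply: (dom_bnd _ (dom_x mx j)).
    exact: measurableT_comp.
  by move=> w; rewrite normr_id.
- move=> w; rewrite /lin -mulr_sumr normrM (ger0_norm s0) -mulrA ler_wpM2l//.
  have [A0|A0] := posnP #|A|.
    by rewrite A0 mul0r big_pred0 ?normr0// => j; move/eqP: A0; rewrite cards_eq0 => /eqP ->; rewrite finset.inE.
  by rewrite mulrC divfK ?ler_norm_sum// pnatr_eq0 -lt0n.
Qed.

Lemma cardB_le A c : A \subset Btwn 0 c -> s * #|A|%:R <= b c.
Proof.
move=> Ac; apply: le_trans (bB c); rewrite ler_wpM2l// ler_nat.
exact: subset_leq_card.
Qed.

Lemma b_ge0 c : 0 <= b c.
Proof. by apply: le_trans (bB c); rewrite mulr_ge0. Qed.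

Lemma cls_dom q G v B : (v <= q)%N -> cls q om G ->
  dom x ((q - v)%:R + om) (fun w => G v (lin B w)).
Proof.
move=> vq hG; have hs := cls_shift vq hG.
have [C C0 hC] := cls_growth om0 hs.
split.
  apply: (measurableT_comp (cls_meas om0 hG vq)).
  exact: (lin_dom B).1.
have dB : dom x 1 (fun w => 1 + `|lin B w|).
  apply: domD; first by apply: (dom_le _ (dom_cst x 1)); exact: ler01.
  apply: (dom_bnd _ (lin_dom B)); last by move=> w; rewrite normr_id.
  by apply: measurableT_comp => //; exact: (lin_dom B).1.
have qo : 0 <= (q - v)%:R + om by rewrite addr_ge0// ltW.
have [_ [D D0 hD]] := dom_pow qo dB; rewrite mul1r in hD.
exists (C * D); first exact: mulr_ge0.
move=> w; apply: (le_trans (hC _)); rewrite -mulrA ler_wpM2l//.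
apply: le_trans (hD w); rewrite [leRHS]ger0_norm ?powR_ge0//.
by rewrite [X in _ <= X `^ _]ger0_norm// addr_ge0.
Qed.

Definition rem q G A B w : R := G 0%N (lin B w + lin A w) -
  \sum_(v < q.+1) lin A w ^+ v / v`!%:R * G v (lin B w).

Lemma rem_smeas q G A B (C : {set I}) : cls q om G -> A \subset C -> B \subset C ->
  smeas x C (rem q G A B).
Proof.
move=> hG AC BC.
have sA := smeas_mono AC (@lin_smeas A); have sB := smeas_mono BC (@lin_smeas B).
apply: smeasD.
  by apply: (smeas_comp (cls_meas om0 hG (leq0n q))); exact: smeasD.
apply: smeasN; apply: smeas_sum => v _; apply: smeasM.
  by apply: smeasM; [exact: smeasX|exact: smeas_cst].
apply: (smeas_comp (cls_meas om0 hG _)) => //; by rewrite -ltnS.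
Qed.

Lemma rem_le q G A B : cls q om G -> exists g, [/\ gauge P 1 r g, dom x 1 g &
  forall w, `|rem q G A B w| <= (s * #|A|%:R * g w) `^ (q%:R + om)].
Proof.
move=> hG; have [g [gg dg hg]] := lin_bound A; exists g; split => // w.
apply: (le_trans (holder_taylor _ _ om0 hG)).
by rewrite powR_mono// addr_ge0// ltW.
Qed.

(* the coefficients may depend on Psi but not on G *)
Definition good q Psi (e : R) : Prop := exists c : nat -> R, forall G, cls q om G ->
  `|Psi G - \sum_(j < q.+1) c j * ex P (fun w => G j (Wall w))| <= e.

Lemma good_le q Psi e e' : e <= e' -> good q Psi e -> good q Psi e'.
Proof. by move=> ee [c hc]; exists c => G /hc/le_trans; apply. Qed.

Lemma good_approx q Psi Psi' e e' : (forall G, cls q om G -> `|Psi G - Psi' G| <= e) ->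
  good q Psi' e' -> good q Psi (e + e').
Proof.
move=> h [c hc]; exists c => G hG; rewrite -(subrK (Psi' G) (Psi G)) -addrA.
by rewrite (le_trans (ler_normD _ _))// lerD// ?h// hc.
Qed.

Lemma good_eq q Psi Psi' e : (forall G, cls q om G -> Psi G = Psi' G) ->
  good q Psi' e -> good q Psi e.
Proof. by move=> h [c hc]; exists c => G hG; rewrite h// hc. Qed.

Lemma good0 q : good q (fun=> 0) 0.
Proof.
exists (fun=> 0) => G _; rewrite big1 ?subrr ?normr0// => i _; exact: mul0r.
Qed.

Lemma goodD q Psi Psi' e e' : good q Psi e -> good q Psi' e' ->
  good q (fun G => Psi G + Psi' G) (e + e').
Proof.
move=> [c hc] [c' hc']; exists (fun j => c j + c' j) => G hG.
under eq_bigr do rewrite mulrDl; rewrite big_split/= opprD addrACA.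
by rewrite (le_trans (ler_normD _ _))// lerD ?hc ?hc'.
Qed.

Lemma goodZ q Psi e l : good q Psi e -> good q (fun G => l * Psi G) (`|l| * e).
Proof.
move=> [c hc]; exists (fun j => l * c j) => G hG.
under eq_bigr do rewrite -mulrA; rewrite -mulr_sumr -mulrBr normrM ler_wpM2l//.
exact: hc.
Qed.

Lemma goodN q Psi e : good q Psi e -> good q (fun G => - Psi G) e.
Proof.
move=> /(goodZ (-1)); rewrite normrN normr1 mul1r; apply: good_eq => G _.
by rewrite mulN1r.
Qed.

Lemma good_sum (J : Type) q (t : seq J) (Q : pred J) (Psi : J -> (nat -> R -> R) -> R) e :
  (forall i, Q i -> good q (Psi i) (e i)) ->
  good q (fun G => \sum_(i <- t | Q i) Psi i G) (\sum_(i <- t | Q i) e i).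
Proof.
move=> h; elim: t => [|i t IH].
  by rewrite big_nil; apply: good_eq (good0 q) => G _; rewrite big_nil.
rewrite big_cons; have E G : \sum_(i <- i :: t | Q i) Psi i G =
  if Q i then Psi i G + \sum_(i <- t | Q i) Psi i G else \sum_(i <- t | Q i) Psi i G.
  by rewrite big_cons.
case Qi: (Q i) in E *.
  by apply: good_eq (goodD (h _ Qi) IH) => G _.
by apply: good_eq IH => G _.
Qed.

(** A coefficient of the j-th derivative of the shifted family is a coefficient of the (j + v)-th
    derivative of G; those below v are set to 0. *)
Lemma good_shift q v Psi e : (v <= q)%N -> good (q - v) Psi e ->
  good q (fun G => Psi (fun j => G (j + v)%N)) e.
Proof.
move=> vq [c hc]; exists (fun j => if (v <= j)%N then c (j - v)%N else 0) => G hG.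
have := hc _ (cls_shift vq hG).
rewrite (_ : \sum_(j < (q - v).+1) _ = \sum_(j < q.+1)
  (if (v <= j)%N then c (j - v)%N else 0) * ex P (fun w => G j (Wall w)))//.
rewrite -(big_mkord xpredT (fun j => c j * ex P (fun w => G (j + v)%N (Wall w)))).
rewrite -(big_mkord xpredT (fun j => (if (v <= j)%N then c (j - v)%N else 0) * ex P (fun w => G j (Wall w)))).
rewrite [RHS](@big_cat_nat _ _ _ v)//=; last by lia.
rewrite [X in _ = X + _]big_nat [X in _ = X + _]big1 ?add0r; last first.
  by move=> j /andP[_ jv]; rewrite leqNgt jv/= mul0r.
rewrite -[X in \sum_(X <= _ < q.+1) _]add0n big_addn subSn//; apply: eq_bigr => j _.
by rewrite leq_addl addnK.
Qed.

Lemma good_E q : good q (fun G => ex P (fun w => G 0%N (Wall w))) 0.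
Proof.
exists (fun j => (j == 0%N)%:R) => G _.
by rewrite big_ord_recl/= mul1r big1 ?addr0 ?subrr ?normr0// => i _; rewrite mul0r.
Qed.

Lemma dom_itg' t F : 0 <= t -> t <= p + 2 -> dom x t F -> itg P F.
Proof. exact: (dom_itg p0 pr gx). Qed.

Lemma cov_sumr t u (J : Type) (S : seq J) (Qd : pred J) Q (F : J -> Omega -> R) :
  0 <= t -> 0 <= u -> t + u <= p + 2 -> dom x t Q ->
  (forall i, Qd i -> dom x u (F i)) ->
  cov P Q (fun w => \sum_(i <- S | Qd i) F i w) = \sum_(i <- S | Qd i) cov P Q (F i).
Proof.
move=> t0 u0 tu dQ dF.
have iF i : Qd i -> itg P (F i).
  by move=> Qi; apply: (dom_itg' u0 _ (dF _ Qi)); rewrite (le_trans _ tu)// lerDr.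
have iQF i : Qd i -> itg P (fun w => Q w * F i w).
  move=> Qi; apply: (dom_itg' (addr_ge0 t0 u0) tu); apply: domM => //; exact: dF.
rewrite /cov sumrB; congr (_ - _); last by rewrite ex_sum// mulr_sumr.
by under [X in ex P X]eq_fun do rewrite mulr_sumr; rewrite ex_sum.
Qed.

Lemma covDr t u Q F F' : 0 <= t -> 0 <= u -> t + u <= p + 2 -> dom x t Q ->
  dom x u F -> dom x u F' ->
  cov P Q (fun w => F w + F' w) = cov P Q F + cov P Q F'.
Proof.
move=> t0 u0 tu dQ dF dF'.
have := @cov_sumr t u bool [:: true; false] xpredT Q (fun i => if i then F else F') t0 u0 tu dQ.
rewrite !big_cons big_nil addr0 => <-; last by case.
congr (cov P Q _); apply/funext => w.
by rewrite !big_cons big_nil addr0.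
Qed.

Lemma covZr t u Q F l : 0 <= t -> 0 <= u -> t + u <= p + 2 -> dom x t Q ->
  dom x u F -> cov P Q (fun w => l * F w) = l * cov P Q F.
Proof.
move=> t0 u0 tu dQ dF; rewrite /cov exZ; last first.
  by apply: (dom_itg' u0 _ dF); rewrite (le_trans _ tu)// lerDr.
rewrite mulrBr mulrCA; congr (_ - _); rewrite -exZ.
  by congr ex; apply/funext => w; rewrite mulrCA.
by apply: (dom_itg' (addr_ge0 t0 u0) tu); exact: domM.
Qed.

(** If 2 a <= l, the sites within radius a and those beyond radius l are at distance at least l -
    l/2. The mixing coefficient is taken there so as to depend on l alone. *)
Definition Aw l : R := al (l - l./2)%N `^ bexp p r.

Lemma Aw_ge0 l : 0 <= Aw l. Proof. exact: powR_ge0. Qed.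

Lemma bexp_gt0 : 0 < bexp p r.
Proof.
rewrite /bexp /mix_exponent; case: r pr => [r'| |]//; rewrite lte_fin => h.
by rewrite divr_gt0//; have := p0; lra.
Qed.

Lemma Aw_le1 l : Aw l <= 1.
Proof. by rewrite powR_le1// ltW// bexp_gt0. Qed.

Lemma al_Aw a l : (2 * a <= l)%N -> al (l - a)%N `^ bexp p r <= Aw l.
Proof.
move=> al2; apply: powR_mono; first by rewrite ltW// bexp_gt0.
  by case/andP: (al1 (l - a)).
by apply: al_anti; lia.
Qed.

Definition yr l : R := s * #|Btwn l l|%:R.

Lemma yr_ge0 l : 0 <= yr l. Proof. by rewrite mulr_ge0. Qed.

Lemma yr_le l l' : (l <= l')%N -> yr l <= b l'.
Proof.
move=> ll; apply: cardB_le; apply/fintype.subsetP => j; rewrite !finset.inE.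
by move=> /andP[_ h]; exact: leq_trans ll.
Qed.

Lemma sum_yr_le m l : \sum_(m <= i < l.+1) yr i <= b l.
Proof.
rewrite /yr -mulr_sumr -natr_sum; apply: le_trans (bB l); rewrite ler_wpM2l// ler_nat.
elim: l => [|l IH].
  have [m0|m0] := leqP m 0; last by rewrite big_geq.
  rewrite (_ : m = 0%N) ?big_nat1; last by lia.
  by [].
have [ml|ml] := leqP m l.+1; last by rewrite big_geq.
rewrite big_nat_recr//= (leq_trans (leq_add IH (leqnn _)))//.
have E : Btwn 0 l :&: Btwn l.+1 l.+1 = finset.set0.
  by apply/setP => j; rewrite !finset.inE; lia.
rewrite -cardsUI E cards0 addn0.
by apply: subset_leq_card; apply/fintype.subsetP => j; rewrite !finset.inE; lia.
Qed.

Lemma sum_yr_cond m n l : \sum_(m <= i < n | (i < l.+1)%N) yr i <= b l.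
Proof.
have [ln|nl] := leqP l.+1 n.
  by rewrite -(@big_nat_widen _ _ _ m l.+1 n xpredT)//; exact: sum_yr_le.
rewrite (_ : \sum_(m <= i < n | _) _ = \sum_(m <= i < n) yr i); last first.
  by rewrite big_nat_cond [RHS]big_nat_cond; apply: eq_bigl => i; lia.
case: n nl => [|n] nl; first by rewrite big_geq// b_ge0.
by apply: (le_trans (sum_yr_le m n)); apply: b_mono; lia.
Qed.

(** The error due to the shell of radius l at level q: the size of the shell to the power om, q
    factors bounded by the size of the ball, and the mixing coefficient. Keeping the shell rather
    than the ball in the first factor is what produces the term - omega in the exponent of M. *)
Definition tau q l : R := yr l `^ om * b l ^+ q * Aw l.

Lemma tau_ge0 q l : 0 <= tau q l.
Proof. by rewrite /tau !mulr_ge0 ?powR_ge0 ?Aw_ge0// exprn_ge0// b_ge0. Qed.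

Definition mixtail c q : R := \sum_(0 <= l < N.+1 | (c < l)%N) tau q l.

Lemma mixtail_ge0 c q : 0 <= mixtail c q.
Proof. by apply: sumr_ge0 => l _; exact: tau_ge0. Qed.

Lemma mixtailE c q : mixtail c q = \sum_(c <= k < N) tau q k.+1.
Proof.
rewrite -(big_add1 _ _ c N.+1 xpredT (tau q)) (big_nat_widenl c.+1 0)//.
Qed.

Lemma mixtail_anti c c' q : (c <= c')%N -> mixtail c' q <= mixtail c q.
Proof.
move=> cc; rewrite /mixtail big_mkcond [leRHS]big_mkcond; apply: ler_sum => l _.
case: ifPn => h; first by rewrite (leq_ltn_trans cc h).
by case: ifP => // _; exact: tau_ge0.
Qed.

Lemma mixtail_mul c q v : b c ^+ v * mixtail c q <= mixtail c (q + v).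
Proof.
rewrite /mixtail mulr_sumr; apply: ler_sum => l cl.
have -> : tau (q + v) l = b l ^+ v * tau q l by rewrite /tau exprD; clear; ring.
rewrite ler_wpM2r//; first exact: tau_ge0.
by rewrite lerXn2r ?nnegrE ?b_ge0// b_mono// ltnW.
Qed.

Definition bq c q : R := b c `^ (q%:R + om).

Lemma bq_ge0 c q : 0 <= bq c q. Proof. exact: powR_ge0. Qed.

Lemma bq_mul c q v : b c ^+ v * bq c q = bq c (q + v).
Proof.
rewrite /bq !powR_natD ?b_ge0 ?ltW//; rewrite exprD; clear; ring.
Qed.

Definition Dlq q : R := Dl `^ (q%:R + om).

Lemma qom_ge0 q : 0 <= q%:R + om. Proof. by rewrite addr_ge0// ltW. Qed.

Lemma Dlq_ge1 q : 1 <= Dlq q.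
Proof. by rewrite powR_ge1// qom_ge0. Qed.

Lemma bq_double c q : bq (2 * c) q <= Dlq q * bq c q.
Proof.
rewrite /bq /Dlq -powRM ?b_ge0// ?(le_trans ler01)//.
by rewrite powR_mono ?qom_ge0 ?b_ge0.
Qed.

(** Since v >= 1 >= om, the power v - om of the shell size is bounded by the ball size and only the
    power om is kept. *)
Lemma yr_bq l v q : (0 < v <= q)%N -> yr l ^+ v * bq l (q - v) <= yr l `^ om * b l ^+ q.
Proof.
move=> /andP[v0 vq]; have y0 := yr_ge0 l; have yb := yr_le (leqnn l).
have [->|yn0] := eqVneq (yr l) 0.
  by rewrite expr0n (gtn_eqF v0) mul0r mulr_ge0 ?powR_ge0 ?exprn_ge0 ?b_ge0.
have yp : 0 < yr l by rewrite lt_neqAle eq_sym yn0.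
have bp : 0 < b l by exact: lt_le_trans yb.
have vom : 0 <= v%:R - om by rewrite subr_ge0 (le_trans om1)// ler1n.
rewrite -powR_mulrn// -(subrK om v%:R) addrC powR_addr// -mulrA ler_wpM2l ?powR_ge0//.
apply: (@le_trans _ _ (b l `^ (v%:R - om) * bq l (q - v))).
  by rewrite ler_wpM2r ?bq_ge0// powR_mono.
rewrite /bq -powR_addr// natrB// (_ : v%:R - om + (q%:R - v%:R + om) = q%:R); last by clear; ring.
by rewrite powR_mulrn// ltW.
Qed.

Lemma yr_tau l q : yr l `^ (q%:R + om) <= yr l `^ om * b l ^+ q.
Proof.
rewrite powR_natD ?yr_ge0 ?(ltW om0)// mulrC ler_wpM2l ?powR_ge0//.
by rewrite lerXn2r ?nnegrE ?yr_ge0 ?b_ge0// yr_le.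
Qed.

(** After the sums are interchanged, the shells inside radius l add up to at most b l for one of the
    v factors, and each of the other v - 1 factors is at most b l; finally b l ^ v times the summand
    of level q - v is that of level q. *)
Lemma sum_yr_T c q v : (0 < v <= q)%N ->
  \sum_(c <= k < N) yr k.+1 ^+ v * mixtail k.+1 (q - v) <= mixtail c q.
Proof.
move=> /andP[v0 vq]; rewrite /mixtail.
under eq_bigr => k _ do rewrite mulr_sumr big_mkcond/=.
rewrite exchange_big_nat/= [leRHS]big_mkcond/=; apply: ler_sum => l _.
rewrite -big_mkcond/=.
have [cl|lc] := ltnP c l; last first.
  rewrite big_nat_cond big_pred0// => k; lia.
apply: (@le_trans _ _ (\sum_(c <= k < N | (k.+1 < l)%N) yr k.+1 * (b l ^+ v.-1 * tau (q - v) l))).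
  apply: ler_sum => k kl; rewrite mulrA ler_wpM2r ?tau_ge0//.
  rewrite -{1}(prednK v0) exprS ler_wpM2l ?yr_ge0//.
  by rewrite lerXn2r ?nnegrE ?yr_ge0 ?b_ge0// yr_le// ltnW.
rewrite -mulr_suml.
have -> : tau q l = b l * (b l ^+ v.-1 * tau (q - v) l).
  rewrite /tau mulrA -exprS prednK// -[in LHS](subnK vq) exprD; clear; ring.
rewrite ler_wpM2r//; first by rewrite mulr_ge0 ?tau_ge0// exprn_ge0// b_ge0.
apply: le_trans (sum_yr_cond c.+1 N.+1 l); rewrite big_add1/=.
rewrite [leRHS]big_mkcond [leLHS]big_mkcond; apply: ler_sum => k _.
case: ifPn => h; first by rewrite ltnS ltnW.
by case: ifP => // _; exact: yr_ge0.
Qed.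

Lemma rem_dom q G A B : cls q om G -> dom x (q%:R + om) (rem q G A B).
Proof.
move=> hG; have [g [gg dg hg]] := rem_le A B hG.
have mr := smeas_meas mx (rem_smeas hG (finset.subsetUl A B) (finset.subsetUr A B)).
apply: (rho_dom _ _ mr dg _ hg); first exact: qom_ge0.
  by rewrite mulr_ge0.
by move=> w; exact: gauge_pos gg.
Qed.

Lemma taylorE q G A B w : G 0%N (lin B w + lin A w) =
  \sum_(v < q.+1) v`!%:R^-1 * (lin A w ^+ v * G v (lin B w)) + rem q G A B w.
Proof.
rewrite /rem -[LHS](subrK (\sum_(v < q.+1) lin A w ^+ v / v`!%:R * G v (lin B w))) [LHS]addrC.
congr (_ + _); apply: eq_bigr => v _; by rewrite mulrA [_^-1 * _]mulrC.
Qed.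

Lemma k2_dom t q : (t + q <= k2)%N -> t%:R + (q%:R + om) <= p + 2.
Proof.
by move=> tq; apply: le_trans k2p; rewrite addrA lerD2r -natrD ler_nat.
Qed.

Lemma linX_dom A v : dom x v%:R (fun w => lin A w ^+ v).
Proof. exact: Qp_dom (Qp_exp v (lin_Qp A)). Qed.

Lemma term_dom q G A B t2 Q2 v : cls q om G -> (v <= q)%N -> dom x t2%:R Q2 ->
  dom x (t2%:R + (q%:R + om)) (fun w => Q2 w * lin A w ^+ v * G v (lin B w)).
Proof.
move=> hG vq dQ2; have := domM (domM dQ2 (linX_dom A v)) (cls_dom B vq hG).
by apply: dom_le; rewrite natrB//; lra.
Qed.

Lemma taylor_cov q G A B t t2 Q Q2 : cls q om G -> (t + t2 + q <= k2)%N ->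
  dom x t%:R Q -> dom x t2%:R Q2 ->
  cov P Q (fun w => Q2 w * G 0%N (lin B w + lin A w)) =
  \sum_(v < q.+1) v`!%:R^-1 * cov P Q (fun w => Q2 w * lin A w ^+ v * G v (lin B w))
  + cov P Q (fun w => Q2 w * rem q G A B w).
Proof.
move=> hG tq dQ dQ2.
pose u : R := t2%:R + (q%:R + om).
have u0 : 0 <= u by rewrite addr_ge0// qom_ge0.
have t0 : 0 <= t%:R :> R by [].
have tu : t%:R + u <= p + 2.
  by have := k2_dom tq; rewrite /u natrD -addrA.
have d1 (v : 'I_q.+1) : dom x u (fun w => Q2 w * lin A w ^+ v * G v (lin B w)).
  by apply: term_dom => //; rewrite -ltnS.
have d1' (v : 'I_q.+1) : dom x u (fun w => v`!%:R^-1 * (Q2 w * lin A w ^+ v * G v (lin B w))).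
  by rewrite -[u]add0r; apply: domM => //; exact: dom_cst.
have d2 : dom x u (fun w => Q2 w * rem q G A B w) by apply: domM => //; exact: rem_dom.
have := covDr t0 u0 tu dQ (dom_sum (index_enum 'I_q.+1) u0 (fun (v : 'I_q.+1) (_ : xpredT v) => d1' v)) d2.
move=> H; rewrite (eq_bigr (fun v : 'I_q.+1 => cov P Q (fun w => v`!%:R^-1 * (Q2 w * lin A w ^+ v * G v (lin B w))))); last first.
  by move=> v _; rewrite (covZr _ t0 u0 tu dQ (d1 v)).
rewrite -(cov_sumr _ t0 u0 tu dQ (fun v _ => d1' v)) -H; congr (cov P Q _).
apply/funext => w; rewrite (taylorE q) mulrDr mulr_sumr; congr (_ + _).
by apply: eq_bigr => v _; rewrite mulrCA !mulrA.
Qed.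

Lemma taylor_ex q G A B t Q : cls q om G -> (t + q <= k2)%N -> dom x t%:R Q ->
  ex P (fun w => Q w * G 0%N (lin B w + lin A w)) =
  \sum_(v < q.+1) v`!%:R^-1 * ex P (fun w => Q w * lin A w ^+ v * G v (lin B w))
  + ex P (fun w => Q w * rem q G A B w).
Proof.
move=> hG tq dQ.
pose u : R := t%:R + (q%:R + om).
have u0 : 0 <= u by rewrite addr_ge0// qom_ge0.
have up : u <= p + 2 by exact: k2_dom.
have d1 (v : 'I_q.+1) : dom x u (fun w => Q w * lin A w ^+ v * G v (lin B w)).
  by apply: term_dom => //; rewrite -ltnS.
have d2 : dom x u (fun w => Q w * rem q G A B w) by apply: domM => //; exact: rem_dom.
have i1 (v : 'I_q.+1) := dom_itg' u0 up (d1 v).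
rewrite (eq_bigr (fun v : 'I_q.+1 => ex P (fun w => v`!%:R^-1 * (Q w * lin A w ^+ v * G v (lin B w))))); last first.
  by move=> v _; rewrite exZ.
rewrite -ex_sum; last by move=> v _; exact: itgZ.
rewrite -exD; last 2 first.
- by apply: itg_sum => v _; exact: itgZ.
- exact: dom_itg' d2.
congr ex; apply/funext => w; rewrite (taylorE q) mulrDr mulr_sumr; congr (_ + _).
by apply: eq_bigr => v _; rewrite mulrCA !mulrA.
Qed.

Lemma Wout_taylor c c' w : (c <= c')%N ->
  Wout c w = lin (Btwn c'.+1 N) w + lin (Btwn c.+1 c') w.
Proof. exact: Wout_split. Qed.

Lemma cov_cst Q k : itg P Q -> cov P Q (fun=> k) = 0.
Proof.
by move=> iQ; rewrite /cov exZr// ex_cst subrr.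
Qed.

Lemma fact_inv_le1 v : `|v`!%:R^-1 : R| <= 1.
Proof. by rewrite ger0_norm ?invr_ge0// invf_le1 ?ltr0n ?fact_gt0// ler1n fact_gt0. Qed.

Variable K : R.
Hypothesis K_KC : KC p <= K.
Let K0 : 0 <= K. Proof. by apply: le_trans K_KC; exact: KC_ge0. Qed.

(* The three estimates are proved together by induction on q: a Taylor term of order v >= 1
   replaces G by its v-th derivative, which lowers q by v. *)
Definition PC C q := forall t a c cQ Q, (t + q <= k2)%N -> (2 * a <= c)%N ->
  Qp x t (Btwn 0 a) cQ Q ->
  good q (fun G => cov P Q (fun w => G 0%N (Wout c w))) (C * cQ * mixtail c q).

Definition PE C q := forall t c cQ Q, (t + q <= k2)%N -> Qp x t (Btwn 0 c) cQ Q ->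
  good q (fun G => ex P (fun w => Q w * G 0%N (Wout c w))) (C * cQ * (bq c q + mixtail c q)).

Definition PC2 C q := forall t t2 a l c cQ c2 Q Q2, (t + t2 + q <= k2)%N ->
  (2 * a <= l)%N -> (l <= c)%N -> Qp x t (Btwn 0 a) cQ Q -> Qp x t2 (Btwn l c) c2 Q2 ->
  good q (fun G => cov P Q (fun w => Q2 w * G 0%N (Wout c w)))
    (C * cQ * c2 * (Aw l * bq c q + mixtail c q)).

Lemma lin_btwn_Qp v c c' : Qp x v (Btwn c c') (b c' ^+ v) (fun w => lin (Btwn c c') w ^+ v).
Proof.
apply: Qp_exp; apply: Qp_mono (lin_Qp _) => //; apply: cardB_le.
by apply/fintype.subsetP => j; rewrite !finset.inE => /andP[].
Qed.

Lemma rem_cov q G A B t t2 a l c cQ c2 Q Q2 : cls q om G -> (t + t2 + q <= k2)%N ->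
  (2 * a <= l)%N -> Qp x t (Btwn 0 a) cQ Q -> Qp x t2 (Btwn l N) c2 Q2 ->
  A \subset Btwn l N -> B \subset Btwn l N -> s * #|A|%:R <= c ->
  `|cov P Q (fun w => Q2 w * rem q G A B w)| <= K * cQ * c2 * (c `^ (q%:R + om) * Aw l).
Proof.
move=> hG tq al2 hQ hQ2 Al Bl Ac.
have [g [gg dg hg]] := rem_le A B hG.
have A0 : 0 <= s * #|A|%:R by rewrite mulr_ge0.
have tk : (t <= k2)%N by clear -tq; lia.
have tt : t%:R + t2%:R + (q%:R + om) <= p + 2 by have := k2_dom tq; rewrite natrD.
have := Qp_cov mx p0 pr gx dep al1 sep_sub (qom_ge0 q) A0 tk tt hQ hQ2 (rad_sep a l)
  (fintype.subxx _) (rem_smeas hG Al Bl) gg dg hg.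
move=> /le_trans; apply; rewrite -mulrA.
apply: (@le_trans _ _ (K * cQ * c2 * ((s * #|A|%:R) `^ (q%:R + om) * al (l - a) `^ bexp p r))).
  rewrite ler_wpM2r ?mulr_ge0 ?powR_ge0// ler_wpM2r ?(Qp_ge0 hQ2)// ler_wpM2r ?(Qp_ge0 hQ)//.
rewrite ler_wpM2l//.
  by rewrite !mulr_ge0 ?(Qp_ge0 hQ) ?(Qp_ge0 hQ2).
apply: ler_pM; [exact: powR_ge0|exact: powR_ge0|by apply: powR_mono => //; exact: qom_ge0|exact: al_Aw].
Qed.

Lemma Btwn_sub l c l' c' : (l' <= l)%N -> (c <= c')%N -> Btwn l c \subset Btwn l' c'.
Proof. by move=> h1 h2; apply/fintype.subsetP => j; rewrite !finset.inE; lia. Qed.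

Lemma Btwn_subN l c l' : (l' <= l)%N -> Btwn l c \subset Btwn l' N.
Proof.
by move=> h1; apply/fintype.subsetP => j; rewrite !finset.inE; have := radN j; lia.
Qed.

(** The covariance telescopes over the radii from c to N, since [Wout N] is 0 and a constant has
    zero covariance with Q. In Taylor's formula for one shell the term of order 0 is the next
    covariance; the terms of order v >= 1 fall under [PC2] at level q - v, and each order costs 2 C,
    once for either half of the error there. *)
Lemma stepPC C q : 0 <= C -> (forall q', (q' < q)%N -> PC2 C q') ->
  PC (2 * q%:R * C + K) q.
Proof.
move=> C0 hC t a c cQ Q tq ac hQ.
have cQ0 := Qp_ge0 hQ; have dQ := Qp_dom mx hQ.
have iQ : itg P Q.
  by apply: (dom_itg' _ _ dQ) => //; have := k2_dom tq; have := qom_ge0 q; lra.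
have [Nc|cN] := leqP N c.
  apply: (good_le _ (good_eq _ (good0 q))).
    rewrite !mulr_ge0 ?mixtail_ge0// addr_ge0// !mulr_ge0//.
  move=> G _; rewrite (_ : (fun w => _) = fun=> G 0%N 0) ?cov_cst//.
  by apply/funext => w; rewrite WoutN.
pose e k : R := \sum_(1 <= v < q.+1)
   C * cQ * yr k.+1 ^+ v * (Aw k.+1 * bq k.+1 (q - v) + mixtail k.+1 (q - v))
   + K * cQ * 1 * (yr k.+1 `^ (q%:R + om) * Aw k.+1).
pose Ps k G : R := \sum_(1 <= v < q.+1) v`!%:R^-1 *
   cov P Q (fun w => lin (Btwn k.+1 k.+1) w ^+ v * G v (Wout k.+1 w)).
apply: (@good_le _ _ (\sum_(c <= k < N) e k)).
  rewrite /e big_split/=.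
  have h1 : \sum_(c <= k < N) K * cQ * 1 * (yr k.+1 `^ (q%:R + om) * Aw k.+1) <= K * cQ * mixtail c q.
    rewrite -mulr_sumr mulr1 ler_wpM2l ?mulr_ge0//.
    rewrite mixtailE.
    by apply: ler_sum => k _; rewrite /tau ler_wpM2r ?Aw_ge0// yr_tau.
  have h2 : \sum_(c <= k < N) \sum_(1 <= v < q.+1)
      C * cQ * yr k.+1 ^+ v * (Aw k.+1 * bq k.+1 (q - v) + mixtail k.+1 (q - v))
      <= 2 * q%:R * C * cQ * mixtail c q.
    rewrite exchange_big_nat/=.
    apply: (@le_trans _ _ (\sum_(1 <= v < q.+1) 2 * C * cQ * mixtail c q)); last first.
      rewrite big_const_nat subn1/= iter_addr_0 -mulr_natl le_eqVlt; apply/orP; left.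
      by apply/eqP; clear; ring.
    rewrite big_nat_cond [leRHS]big_nat_cond; apply: ler_sum => v /andP[/andP[v1 vq] _].
    under eq_bigr do rewrite -mulrA mulrDr mulrDr.
    rewrite big_split/= -!mulr_sumr.
    rewrite (_ : 2 * C * cQ * mixtail c q = C * cQ * mixtail c q + C * cQ * mixtail c q); last by clear; ring.
    apply: lerD; rewrite ler_wpM2l ?mulr_ge0//; last by apply: sum_yr_T; rewrite v1.
    rewrite mixtailE.
    apply: ler_sum => k _; rewrite /tau mulrCA mulrC ler_wpM2r ?Aw_ge0//.
    by apply: yr_bq; rewrite v1.
  rewrite (_ : _ * cQ * mixtail c q = 2 * q%:R * C * cQ * mixtail c q + K * cQ * mixtail c q); last by clear; ring.
  exact: lerD.
apply: (@good_eq _ _ (fun G => \sum_(c <= k < N)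
    (Ps k G + cov P Q (fun w => 1 * rem q G (Btwn k.+1 k.+1) (Btwn k.+2 N) w)))).
  move=> G hG; pose u k : R := cov P Q (fun w => G 0%N (Wout k w)).
  have uN : u N = 0.
    rewrite /u (_ : (fun w => _) = fun=> G 0%N 0) ?cov_cst//.
    by apply/funext => w; rewrite WoutN.
  have -> : cov P Q (fun w => G 0%N (Wout c w)) = \sum_(c <= k < N) (u k - u k.+1).
    under eq_bigr do rewrite -opprB.
    by rewrite sumrN telescope_sumr ?(ltnW cN)// uN sub0r opprK.
  apply: eq_bigr => k _.
  have tq0 : (t + 0 + q <= k2)%N by rewrite addn0.
  have := taylor_cov (Btwn k.+1 k.+1) (Btwn k.+2 N) hG tq0 dQ (dom_cst x 1).
  rewrite (_ : (fun w => 1 * G 0%N _) = fun w => G 0%N (Wout k w)); last first.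
    by apply/funext => w; rewrite mul1r -Wout_taylor.
  rewrite -/(u k) => ->; rewrite addrAC; congr (_ + _).
  rewrite -(big_mkord xpredT (fun v => v`!%:R^-1 * cov P Q (fun w => 1 * lin (Btwn k.+1 k.+1) w ^+ v * G v (lin (Btwn k.+2 N) w)))).
  rewrite big_ltn//= fact0 invr1 mul1r.
  rewrite (_ : (fun w => 1 * lin _ w ^+ 0 * _) = fun w => G 0%N (Wout k.+1 w)); last first.
    by apply/funext => w; rewrite expr0 !mul1r.
  rewrite -/(u k.+1) addrAC subrr add0r; apply: eq_bigr => v _; congr (_ * cov P Q _).
  by apply/funext => w; rewrite mul1r.
rewrite [X in good _ _ X]big_nat_cond.
apply: (@good_eq _ _ (fun G => \sum_(c <= k < N | (c <= k < N)%N && true)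
    (Ps k G + cov P Q (fun w => 1 * rem q G (Btwn k.+1 k.+1) (Btwn k.+2 N) w)))).
  by move=> G _; rewrite -big_nat_cond.
apply: good_sum => k /andP[/andP[ck kN] _]; rewrite [e k]addrC.
apply: (@good_approx _ _ (Ps k)).
  move=> G hG; rewrite addrAC subrr add0r.
  apply: (@rem_cov q G (Btwn k.+1 k.+1) (Btwn k.+2 N) t 0 a k.+1 (yr k.+1) cQ 1 Q
    (fun=> 1) hG _ _ hQ (Qp_one x _)).
  - by rewrite addn0.
  - by rewrite (leq_trans ac)// (leq_trans ck).
  - exact: Btwn_subN.
  - exact: Btwn_subN.
  - exact: lexx.
rewrite /Ps.
rewrite [X in good _ _ X]big_nat_cond.
apply: (@good_eq _ _ (fun G => \sum_(1 <= v < q.+1 | (1 <= v < q.+1)%N && true)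
   v`!%:R^-1 * cov P Q (fun w => lin (Btwn k.+1 k.+1) w ^+ v * G v (Wout k.+1 w)))).
  by move=> G _; rewrite -big_nat_cond.
apply: good_sum => v /andP[/andP[v1 vq] _].
have E : good (q - v) (fun G => cov P Q (fun w => lin (Btwn k.+1 k.+1) w ^+ v * G 0%N (Wout k.+1 w)))
    (C * cQ * yr k.+1 ^+ v * (Aw k.+1 * bq k.+1 (q - v) + mixtail k.+1 (q - v))).
  apply: (hC (q - v)%N _ t v a k.+1 k.+1 cQ _ Q _ _ _ _ hQ).
  - by clear -v1 vq; lia.
  - by clear -vq tq; lia.
  - by rewrite (leq_trans ac)// (leq_trans ck).
  - by [].
  - by apply: Qp_exp; exact: lin_Qp.
have := goodZ v`!%:R^-1 (good_shift _ E); move=> /(_ vq).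
apply: good_le; rewrite -[leRHS]mul1r ler_wpM2r// ?fact_inv_le1//.
by rewrite !mulr_ge0 ?exprn_ge0 ?yr_ge0// addr_ge0 ?mixtail_ge0// mulr_ge0 ?Aw_ge0 ?bq_ge0.
Qed.

Lemma ex_Qp_le t A cQ Q : t%:R <= p + 2 -> Qp x t A cQ Q -> `|ex P Q| <= K * cQ.
Proof.
move=> tp hQ; have [g [gg dg _]] := lin_bound finset.set0.
have tp' : t%:R + 0 <= p + 2 by rewrite addr0.
have := Qp_ex mx p0 pr gx (lexx 0) ler01 tp' hQ (measurable_cst (1 : R)) gg dg.
rewrite powRr0 mulr1 (_ : (fun w => Q w * cst 1 w) = Q); last first.
  by apply/funext => w; rewrite /= mulr1.
move=> H; apply: le_trans (H _) _; first by move=> w; rewrite powRr0 /= normr1.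
by rewrite ler_wpM2r ?(Qp_ge0 hQ).
Qed.

Lemma cov_Qp_le t t2 a l cQ c2 Q Q2 : (t <= k2)%N -> t%:R + t2%:R <= p + 2 ->
  (2 * a <= l)%N -> Qp x t (Btwn 0 a) cQ Q -> Qp x t2 (Btwn l N) c2 Q2 ->
  `|cov P Q Q2| <= K * cQ * c2 * Aw l.
Proof.
move=> tk tp al2 hQ hQ2; have [g [gg dg _]] := lin_bound finset.set0.
have tp' : t%:R + t2%:R + 0 <= p + 2 by rewrite addr0.
have := Qp_cov mx p0 pr gx dep al1 sep_sub (lexx 0) ler01 tk tp' hQ hQ2 (rad_sep a l)
  (fintype.subxx _) (@smeas_cst _ _ _ _ x (Btwn l N) 1) gg dg.
rewrite powRr0 mulr1 (_ : (fun w => Q2 w * 1) = Q2); last first.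
  by apply/funext => w; rewrite /= mulr1.
move=> H; apply: le_trans (H _) _; first by move=> w; rewrite powRr0 /= normr1.
have Q0 := Qp_ge0 hQ; have Q20 := Qp_ge0 hQ2.
apply: ler_pM.
- by apply: mulr_ge0 => //; apply: mulr_ge0 => //; exact: KC_ge0.
- exact: powR_ge0.
- by rewrite ler_wpM2r// ler_wpM2r.
- exact: al_Aw.
Qed.

Lemma rem_ex q G A B t cQ c Q A' : cls q om G -> (t + q <= k2)%N -> Qp x t A' cQ Q ->
  s * #|A|%:R <= c ->
  `|ex P (fun w => Q w * rem q G A B w)| <= K * cQ * c `^ (q%:R + om).
Proof.
move=> hG tq hQ Ac; have [g [gg dg hg]] := rem_le A B hG.
have A0 : 0 <= s * #|A|%:R by rewrite mulr_ge0.
have mr := smeas_meas mx (rem_smeas hG (finset.subsetUl A B) (finset.subsetUr A B)).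
have := Qp_ex mx p0 pr gx (qom_ge0 q) A0 (k2_dom tq) hQ mr gg dg hg.
have Q0 := Qp_ge0 hQ.
move=> /le_trans; apply; apply: ler_pM.
- by apply: mulr_ge0 => //; exact: KC_ge0.
- exact: powR_ge0.
- by rewrite ler_wpM2r.
- by apply: powR_mono => //; exact: qom_ge0.
Qed.

Definition errE c q := bq c q + mixtail c q.

Lemma errE_ge0 c q : 0 <= errE c q.
Proof. by rewrite addr_ge0 ?mixtail_ge0 ?bq_ge0. Qed.

Lemma errE_mul c q v : b c ^+ v * errE c q <= errE c (q + v).
Proof. by rewrite /errE mulrDr bq_mul lerD2l mixtail_mul. Qed.

Lemma errE_double c q : errE (2 * c) q <= Dlq q * errE c q.
Proof.
rewrite /errE mulrDr lerD ?bq_double// (le_trans (mixtail_anti _ (_ : c <= 2 * c)%N)) ?leq_pmull//.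
by rewrite -[leLHS]mul1r ler_wpM2r ?mixtail_ge0// Dlq_ge1.
Qed.

Lemma sum_cst1 q (c : R) : \sum_(1 <= v < q.+1) c = q%:R * c.
Proof. by rewrite big_const_nat subn1/= iter_addr_0 mulr_natl. Qed.

(** Taylor's formula for [Wall] around [Wout c] is solved for its term of order 0: the left side
    E[G(Wall)] is already of the required form, and the terms of order v >= 1 fall under [PE] at
    level q - v. *)
Lemma stepEW C q c : 0 <= C -> (q <= k2)%N -> (forall q', (q' < q)%N -> PE C q') ->
  good q (fun G => ex P (fun w => G 0%N (Wout c w))) ((q%:R * C + K) * errE c q).
Proof.
move=> C0 qk hC.
pose S v (G : nat -> R -> R) : R := v`!%:R^-1 * ex P (fun w => lin (Btwn 0 c) w ^+ v * G v (Wout c w)).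
apply: (@good_le _ _ (K * 1 * bq c q + (0 + \sum_(1 <= v < q.+1) C * errE c q))).
  rewrite add0r sum_cst1 mulrDl addrC lerD//; first by rewrite mulrA.
  by rewrite mulr1 ler_wpM2l// lerDl mixtail_ge0.
apply: (@good_approx _ _ (fun G => ex P (fun w => G 0%N (Wall w)) + \sum_(1 <= v < q.+1) - S v G)).
  move=> G hG; have qk0 : (0 + q <= k2)%N by rewrite add0n.
  have := taylor_ex (Btwn 0 c) (Btwn c.+1 N) hG qk0 (dom_cst x 1).
  rewrite (_ : (fun w => 1 * G 0%N _) = fun w => G 0%N (Wall w)); last first.
    by apply/funext => w; rewrite mul1r (Wall_split c).
  rewrite -(big_mkord xpredT (fun v => v`!%:R^-1 * ex P (fun w => 1 * lin (Btwn 0 c) w ^+ v * G v (lin (Btwn c.+1 N) w)))).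
  rewrite big_ltn//= fact0 invr1 mul1r => ->.
  rewrite (_ : (fun w => 1 * lin _ w ^+ 0 * _) = fun w => G 0%N (Wout c w)); last first.
    by apply/funext => w; rewrite expr0 !mul1r.
  rewrite (_ : \sum_(1 <= v < q.+1) v`!%:R^-1 * ex P _ = \sum_(1 <= v < q.+1) S v G); last first.
    apply: eq_bigr => v _; rewrite /S; congr (_ * ex P _); apply/funext => w; by rewrite mul1r.
  rewrite sumrN; set e1 := ex P _; set e2 := ex P (fun w => 1 * rem _ _ _ _ _); set S1 := \sum_(_ <= _ < _) _.
  rewrite (_ : e1 - _ = - e2); last by clear; ring.
  rewrite normrN; apply: (rem_ex _ hG qk0 (Qp_one x finset.set0)).
  exact: cardB_le.
apply: goodD; first exact: good_E.
rewrite big_nat_cond; apply: (@good_eq _ _ (fun G => \sum_(1 <= v < q.+1 | (1 <= v < q.+1)%N && true) - S v G)).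
  by move=> G _; rewrite -big_nat_cond.
apply: good_sum => v /andP[/andP[v1 vq] _]; apply: goodN.
have E := hC (q - v)%N _ v c (b c ^+ v) _ _ (lin_btwn_Qp v 0 c).
have {}E : good (q - v) (fun G => ex P (fun w => lin (Btwn 0 c) w ^+ v * G 0%N (Wout c w)))
    (C * b c ^+ v * (bq c (q - v) + mixtail c (q - v))).
  by apply: E; clear -v1 vq qk; lia.
have := goodZ v`!%:R^-1 (good_shift (_ : v <= q)%N E) => /(_ vq).
apply: good_le; rewrite -[leRHS]mul1r ler_pM ?fact_inv_le1//.
  by rewrite !mulr_ge0 ?exprn_ge0 ?b_ge0// errE_ge0.
by rewrite -mulrA ler_wpM2l// (le_trans (errE_mul c (q - v) v))// subnK.
Qed.

Lemma errE2_mul c q v : (v <= q)%N ->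
  b (2 * c) ^+ v * errE (2 * c) (q - v) <= Dlq q * errE c q.
Proof.
move=> vq; apply: (le_trans (errE_mul _ _ _)); rewrite subnK//; exact: errE_double.
Qed.

Lemma Aerr_mul c q v l : (v <= q)%N ->
  b (2 * c) ^+ v * (Aw l * bq (2 * c) (q - v) + mixtail (2 * c) (q - v)) <=
  Dlq q * (Aw l * bq c q + mixtail c q).
Proof.
move=> vq; rewrite !mulrDr; apply: lerD.
  by rewrite mulrCA bq_mul subnK// mulrCA ler_wpM2l ?Aw_ge0 ?bq_double.
rewrite (le_trans (mixtail_mul _ _ _))// subnK// (le_trans (mixtail_anti _ (_ : c <= 2 * c)%N)) ?leq_pmull//.
by rewrite -[leLHS]mul1r ler_wpM2r ?mixtail_ge0// Dlq_ge1.
Qed.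

(** [PC] needs a gap between Q and the remaining sum, so the shells between c and 2 c are first
    removed by Taylor's formula. The term of order 0 is then a covariance, to which [PC] applies,
    plus a product of two expectations. *)
Lemma stepPE C C1 q : 0 <= C -> 0 <= C1 -> (forall q', (q' < q)%N -> PE C q') -> PC C1 q ->
  PE (Dlq q * (K + q%:R * C + C1 + K * (q%:R * C + K))) q.
Proof.
move=> C0 C10 hC hC1 t c cQ Q tq hQ.
have Q0 := Qp_ge0 hQ; have dQ := Qp_dom mx hQ.
pose c' := (2 * c)%N.
pose S v (G : nat -> R -> R) : R := v`!%:R^-1 * ex P (fun w => Q w * lin (Btwn c.+1 c') w ^+ v * G v (Wout c' w)).
have cc : (c <= c')%N by rewrite /c' leq_pmull.
have EE := errE_double c q; have E0 := errE_ge0 c q.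
have b0 : bq c' q <= Dlq q * errE c q.
  by apply: le_trans EE; rewrite lerDl mixtail_ge0.
apply: (@good_le _ _ (K * cQ * bq c' q + (\sum_(1 <= v < q.+1) C * cQ * (Dlq q * errE c q) +
    (C1 * cQ * mixtail c' q + K * cQ * ((q%:R * C + K) * errE c' q))))).
  rewrite sum_cst1.
  rewrite (_ : _ * _ * (bq c q + mixtail c q) = K * cQ * (Dlq q * errE c q) + (q%:R * (C * cQ * (Dlq q * errE c q))
    + (C1 * cQ * (Dlq q * errE c q) + K * cQ * ((q%:R * C + K) * (Dlq q * errE c q))))); last first.
    by rewrite /errE; clear; ring.
  apply: lerD; first by rewrite ler_wpM2l ?mulr_ge0.
  rewrite lerD2l; apply: lerD.
    by rewrite ler_wpM2l ?mulr_ge0// (le_trans _ EE)// lerDr bq_ge0.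
  by rewrite ler_wpM2l ?mulr_ge0// ler_wpM2l// addr_ge0// mulr_ge0.
apply: (@good_approx _ _ (fun G => \sum_(1 <= v < q.+1) S v G +
   (cov P Q (fun w => G 0%N (Wout c' w)) + ex P Q * ex P (fun w => G 0%N (Wout c' w))))).
  move=> G hG.
  have := taylor_ex (Btwn c.+1 c') (Btwn c'.+1 N) hG tq dQ.
  rewrite (_ : (fun w => Q w * G 0%N _) = fun w => Q w * G 0%N (Wout c w)); last first.
    by apply/funext => w; rewrite (Wout_taylor w cc).
  rewrite -(big_mkord xpredT (fun v => v`!%:R^-1 * ex P (fun w => Q w * lin (Btwn c.+1 c') w ^+ v * G v (lin (Btwn c'.+1 N) w)))).
  rewrite big_ltn//= fact0 invr1 mul1r => ->.
  rewrite (_ : (fun w => Q w * lin _ w ^+ 0 * _) = fun w => Q w * G 0%N (Wout c' w)); last first.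
    by apply/funext => w; rewrite expr0 mulr1.
  rewrite -/(Wout c') /cov subrK; set e1 := ex P _; set e2 := ex P (fun w => Q w * rem _ _ _ _ _).
  rewrite (_ : e1 + _ + e2 - _ = e2); last by rewrite /S; clear; ring.
  apply: (rem_ex _ hG tq hQ); apply: cardB_le; exact: Btwn_sub.
apply: goodD; last apply: goodD.
- rewrite big_nat_cond; apply: (@good_eq _ _ (fun G => \sum_(1 <= v < q.+1 | (1 <= v < q.+1)%N && true) S v G)).
    by move=> G _; rewrite -big_nat_cond.
  apply: good_sum => v /andP[/andP[v1 vq] _].
  have hQv : Qp x (t + v) (Btwn 0 c') (cQ * b c' ^+ v) (fun w => Q w * lin (Btwn c.+1 c') w ^+ v).
    apply: (Qp_mono _ (lexx _) (Qp_mul hQ (lin_btwn_Qp v c.+1 c'))).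
    by rewrite finset.subUset !Btwn_sub.
  have E : good (q - v) (fun G => ex P (fun w => Q w * lin (Btwn c.+1 c') w ^+ v * G 0%N (Wout c' w)))
      (C * (cQ * b c' ^+ v) * (bq c' (q - v) + mixtail c' (q - v))).
    by apply: hC hQv; clear -v1 vq tq; lia.
  have := goodZ v`!%:R^-1 (good_shift (_ : v <= q)%N E) => /(_ vq).
  apply: good_le; rewrite -[leRHS]mul1r ler_pM ?fact_inv_le1//.
    by rewrite !mulr_ge0 ?exprn_ge0 ?b_ge0// errE_ge0.
  rewrite mulrA -[leLHS]mulrA ler_wpM2l ?mulr_ge0//; exact: errE2_mul.
- by apply: hC1 hQ.
- have qk : (q <= k2)%N by clear -tq; lia.
  have := goodZ (ex P Q) (stepEW c' C0 qk hC).
  apply: good_le; apply: ler_wpM2r.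
    by rewrite mulr_ge0 ?errE_ge0// addr_ge0// mulr_ge0.
  apply: ex_Qp_le hQ; have := k2_dom tq; apply: le_trans.
  by rewrite lerDl qom_ge0.
Qed.

(** The radius is again doubled, this time to separate Q2 from the remaining sum; the factor Q is
    already separated from Q2. The doubling constant [Dlq] pays for the larger balls. *)
Lemma stepPC2 C C1 C2 q : 0 <= C -> 0 <= C1 -> 0 <= C2 ->
  (forall q', (q' < q)%N -> PC2 C q') -> PC C1 q -> PE C2 q ->
  PC2 (Dlq q * (K + q%:R * C + K * C2 + C1 + K * C1)) q.
Proof.
move=> C0 C10 C20 hC hC1 hC2 t t2 a l c cQ c2 Q Q2 tq al2 lc hQ hQ2.
have Q0 := Qp_ge0 hQ; have Q20 := Qp_ge0 hQ2.
have dQ := Qp_dom mx hQ; have dQ2 := Qp_dom mx hQ2.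
pose c' := (2 * c)%N.
have cc : (c <= c')%N by rewrite /c' leq_pmull.
pose S v (G : nat -> R -> R) : R := v`!%:R^-1 *
  cov P Q (fun w => Q2 w * lin (Btwn c.+1 c') w ^+ v * G v (Wout c' w)).
pose X := Aw l * bq c q + mixtail c q.
have X0 : 0 <= X by rewrite addr_ge0 ?mixtail_ge0// mulr_ge0 ?Aw_ge0 ?bq_ge0.
have D1 := Dlq_ge1 q; have D0 : 0 <= Dlq q by exact: le_trans D1.
have Tc : mixtail c' q <= Dlq q * X.
  rewrite (le_trans (mixtail_anti _ cc))// -[leLHS]mul1r ler_pM ?mixtail_ge0//.
  by rewrite /X lerDr mulr_ge0 ?Aw_ge0 ?bq_ge0.
have AX : Aw l * bq c' q <= Dlq q * X.
  apply: (@le_trans _ _ (Aw l * (Dlq q * bq c q))).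
    by rewrite ler_wpM2l ?Aw_ge0 ?bq_double.
  by rewrite mulrCA ler_wpM2l// /X lerDl mixtail_ge0.
have AE : Aw l * errE c' q <= Dlq q * X.
  apply: (@le_trans _ _ (Aw l * (Dlq q * errE c q))).
    by rewrite ler_wpM2l ?Aw_ge0 ?errE_double.
  rewrite mulrCA ler_wpM2l// /X /errE mulrDr lerD2l.
  by rewrite -[leRHS]mul1r ler_wpM2r ?mixtail_ge0 ?Aw_le1.
have hQN : Qp x t2 (Btwn l N) c2 Q2 by apply: Qp_mono hQ2 => //; exact: Btwn_subN.
have hQ2c : Qp x t2 (Btwn 0 c) c2 Q2 by apply: Qp_mono hQ2 => //; exact: Btwn_sub.
have ac : (a <= c)%N by clear -al2 lc; lia.
have hQc : Qp x t (Btwn 0 c) cQ Q by apply: Qp_mono hQ => //; exact: Btwn_sub.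
have hQQ : Qp x (t + t2) (Btwn 0 c) (cQ * c2) (fun w => Q w * Q2 w).
  by have := Qp_mul hQc hQ2c; rewrite finset.setUid.
have tk : (t <= k2)%N by clear -tq; lia.
have ttp : t%:R + t2%:R <= p + 2.
  by have := k2_dom tq; rewrite natrD; apply: le_trans; rewrite lerDl qom_ge0.
have tp : t%:R <= p + 2 by apply: le_trans ttp; rewrite lerDl.
apply: (@good_le _ _ (K * cQ * c2 * (Aw l * bq c' q) + (\sum_(1 <= v < q.+1) C * cQ * c2 * (Dlq q * X) +
    ((K * cQ * c2 * Aw l) * (C2 * 1 * errE c' q) + (C1 * (cQ * c2) * mixtail c' q + K * cQ * (C1 * c2 * mixtail c' q)))))).
  rewrite sum_cst1.
  rewrite (_ : _ * _ * _ * (Aw l * bq c q + mixtail c q) = K * cQ * c2 * (Dlq q * X) +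
    (q%:R * (C * cQ * c2 * (Dlq q * X)) + (K * C2 * cQ * c2 * (Dlq q * X) +
    (C1 * (cQ * c2) * (Dlq q * X) + K * cQ * C1 * c2 * (Dlq q * X))))); last first.
    by rewrite /X; clear; ring.
  apply: lerD; first by rewrite ler_wpM2l// !mulr_ge0.
  rewrite lerD2l; apply: lerD.
    rewrite (_ : _ * _ = K * C2 * cQ * c2 * (Aw l * errE c' q)); last by clear; ring.
    by rewrite ler_wpM2l// !mulr_ge0.
  apply: lerD; first by rewrite ler_wpM2l// !mulr_ge0.
  rewrite (_ : K * cQ * (C1 * c2 * mixtail c' q) = K * cQ * C1 * c2 * mixtail c' q); last by clear; ring.
  by rewrite ler_wpM2l// !mulr_ge0.
(* With Y = G(Wout c'), this is cov(Q, Q2 Y) = cov(Q, Q2) E[Y] + cov(Q Q2, Y) - E[Q] cov(Q2, Y),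
   whose last two covariances fall under [PC]. *)
pose F G := cov P Q Q2 * ex P (fun w => 1 * G 0%N (Wout c' w)) +
     (cov P (fun w => Q w * Q2 w) (fun w => G 0%N (Wout c' w)) -
      ex P Q * cov P Q2 (fun w => G 0%N (Wout c' w))).
apply: (@good_approx _ _ (fun G => \sum_(1 <= v < q.+1) S v G + F G)).
  move=> G hG.
  have := taylor_cov (Btwn c.+1 c') (Btwn c'.+1 N) hG tq dQ dQ2.
  rewrite (_ : (fun w => Q2 w * G 0%N _) = fun w => Q2 w * G 0%N (Wout c w)); last first.
    by apply/funext => w; rewrite (Wout_taylor w cc).
  rewrite -(big_mkord xpredT (fun v => v`!%:R^-1 * cov P Q (fun w => Q2 w * lin (Btwn c.+1 c') w ^+ v * G v (lin (Btwn c'.+1 N) w)))).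
  rewrite big_ltn//= fact0 invr1 mul1r => ->.
  rewrite (_ : (fun w => Q2 w * lin _ w ^+ 0 * _) = fun w => Q2 w * G 0%N (Wout c' w)); last first.
    by apply/funext => w; rewrite expr0 mulr1.
  have -> : cov P Q (fun w => Q2 w * G 0%N (Wout c' w)) = F G.
    have E1 : ex P (fun w => 1 * G 0%N (Wout c' w)) = ex P (fun w => G 0%N (Wout c' w)).
      by congr ex; apply/funext => w; rewrite mul1r.
    have E2 : ex P (fun w => Q w * (Q2 w * G 0%N (Wout c' w))) =
        ex P (fun w => Q w * Q2 w * G 0%N (Wout c' w)).
      by congr ex; apply/funext => w; rewrite mulrA.
    by rewrite /F /cov E1 E2; clear; ring.
  rewrite -/(Wout c'); set e1 := F G; set e2 := cov P Q (fun w => Q2 w * rem _ _ _ _ _).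
  rewrite (_ : e1 + _ + e2 - _ = e2); last by rewrite /S; clear; ring.
  have := @rem_cov q G (Btwn c.+1 c') (Btwn c'.+1 N) t t2 a l (b c') cQ c2 Q Q2 hG tq al2 hQ hQN.
  rewrite [_ * Aw l]mulrC; apply.
  - by apply: Btwn_subN; clear -lc; lia.
  - by apply: Btwn_subN; clear -lc cc; lia.
  - by apply: cardB_le; exact: Btwn_sub.
apply: goodD; last apply: goodD; last apply: goodD.
- rewrite [X in good _ _ X]big_nat_cond; apply: (@good_eq _ _ (fun G => \sum_(1 <= v < q.+1 | (1 <= v < q.+1)%N && true) S v G)).
    by move=> G _; rewrite -big_nat_cond.
  apply: good_sum => v /andP[/andP[v1 vq] _].
  have hQv : Qp x (t2 + v) (Btwn l c') (c2 * b c' ^+ v) (fun w => Q2 w * lin (Btwn c.+1 c') w ^+ v).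
    apply: (Qp_mono _ (lexx _) (Qp_mul hQ2 (lin_btwn_Qp v c.+1 c'))).
    by rewrite finset.subUset !Btwn_sub// (leq_trans lc).
  have E : good (q - v) (fun G => cov P Q (fun w => Q2 w * lin (Btwn c.+1 c') w ^+ v * G 0%N (Wout c' w)))
      (C * cQ * (c2 * b c' ^+ v) * (Aw l * bq c' (q - v) + mixtail c' (q - v))).
    apply: (hC _ _ _ _ _ _ _ _ _ _ _ _ al2 _ hQ hQv); [clear -v1 vq|clear -v1 vq tq|clear -lc cc]; lia.
  have := goodZ v`!%:R^-1 (good_shift (_ : v <= q)%N E) => /(_ vq).
  apply: good_le; rewrite -[leRHS]mul1r ler_pM ?fact_inv_le1//.
    rewrite mulr_ge0 ?mulr_ge0 ?exprn_ge0 ?b_ge0//.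
    by rewrite addr_ge0 ?mixtail_ge0// mulr_ge0 ?Aw_ge0 ?bq_ge0.
  rewrite (_ : C * cQ * (c2 * _) * _ = C * cQ * c2 * (b c' ^+ v * (Aw l * bq c' (q - v) + mixtail c' (q - v)))); last by clear; ring.
  by rewrite ler_wpM2l ?mulr_ge0// Aerr_mul.
- have := goodZ (cov P Q Q2) (hC2 0%N c' 1 (fun=> 1) _ (Qp_one x _)).
  move=> H; apply: (good_le _ (H _)); last by clear -tq; lia.
  apply: ler_wpM2r; first by rewrite mulr_ge0 ?mulr1// errE_ge0.
  exact: (cov_Qp_le tk ttp al2 hQ hQN).
- apply: hC1 hQQ => //.
- apply: goodN; have := goodZ (ex P Q) (hC1 t2 c c' c2 Q2 _ _ hQ2c).
  move=> H; apply: (good_le _ (H _ _)) => //; last by clear -tq; lia.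
  by apply: ler_wpM2r; rewrite ?mulr_ge0 ?mixtail_ge0// (ex_Qp_le tp hQ).
Qed.

Lemma PC_le C C' q : C <= C' -> PC C q -> PC C' q.
Proof.
move=> CC h t a c cQ Q tq ac hQ; apply: good_le (h _ _ _ _ _ tq ac hQ).
by rewrite ler_wpM2r ?mixtail_ge0// ler_wpM2r// (Qp_ge0 hQ).
Qed.

Lemma PE_le C C' q : C <= C' -> PE C q -> PE C' q.
Proof.
move=> CC h t c cQ Q tq hQ; apply: good_le (h _ _ _ _ tq hQ).
by rewrite ler_wpM2r ?errE_ge0// ler_wpM2r// (Qp_ge0 hQ).
Qed.

Lemma PC2_le C C' q : C <= C' -> PC2 C q -> PC2 C' q.
Proof.
move=> CC h t t2 a l c cQ c2 Q Q2 tq al2 lc hQ hQ2.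
apply: good_le (h _ _ _ _ _ _ _ _ _ tq al2 lc hQ hQ2).
rewrite ler_wpM2r// ?ler_wpM2r ?(Qp_ge0 hQ) ?(Qp_ge0 hQ2)//.
by rewrite addr_ge0 ?mixtail_ge0// mulr_ge0 ?Aw_ge0 ?bq_ge0.
Qed.

Definition step1 q C := 2 * q%:R * C + K.
Definition step2 q C := Dlq q * (K + q%:R * C + step1 q C + K * (q%:R * C + K)).
Definition step3 q C :=
  Dlq q * (K + q%:R * C + K * step2 q C + step1 q C + K * step1 q C).
Fixpoint stepC q : R := if q is q'.+1 then
  stepC q' + step1 q' (stepC q') + step2 q' (stepC q') + step3 q' (stepC q') else 0.

Lemma step_ge0 q C : 0 <= C -> [/\ 0 <= step1 q C, 0 <= step2 q C & 0 <= step3 q C].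
Proof.
move=> C0; have D0 : 0 <= Dlq q by rewrite (le_trans _ (Dlq_ge1 q)).
have h1 : 0 <= step1 q C by rewrite addr_ge0// !mulr_ge0.
have h2 : 0 <= step2 q C by rewrite mulr_ge0// !addr_ge0// !mulr_ge0// addr_ge0// mulr_ge0.
split => //; rewrite /step3.
move: (step1 q C) (step2 q C) h1 h2 => s1 s2 h1 h2.
by rewrite mulr_ge0// !addr_ge0// !mulr_ge0.
Qed.

Lemma stepC_ge0 q : 0 <= stepC q.
Proof.
elim: q => [|q IH] //=; have [] := step_ge0 q IH.
move: (step1 _ _) (step2 _ _) (step3 _ _) => c1 c2 c3 h1 h2 h3.
by rewrite !addr_ge0.
Qed.

(** At a given level [PC] uses only [PC2] below it, [PE] uses [PC] at the level itself, and [PC2]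
    uses both, so they are obtained in this order. The constants are added up so that one of them
    serves all lower levels. *)
Lemma levels q q' : (q' < q)%N -> [/\ PC (stepC q) q', PE (stepC q) q' & PC2 (stepC q) q'].
Proof.
elim: q q' => // q IH q'; rewrite ltnS => qq.
have C0 := stepC_ge0 q; have [h1 h2 h3] := step_ge0 q C0.
have p1 : (forall j, (j < q)%N -> PC2 (stepC q) j) -> PC (step1 q (stepC q)) q.
  exact: stepPC.
have p2 : (forall j, (j < q)%N -> PE (stepC q) j) -> PC (step1 q (stepC q)) q ->
    PE (step2 q (stepC q)) q by exact: stepPE.
have p3 : (forall j, (j < q)%N -> PC2 (stepC q) j) -> PC (step1 q (stepC q)) q ->
    PE (step2 q (stepC q)) q -> PC2 (step3 q (stepC q)) q by exact: stepPC2.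
rewrite [stepC q.+1]/=; move: (step1 _ _) (step2 _ _) (step3 _ _) h1 h2 h3 p1 p2 p3.
move=> c1 c2 c3 h1 h2 h3 p1 p2 p3.
have {}p1 : PC c1 q by apply: p1 => j /IH[].
have {}p2 : PE c2 q by apply: p2 => // j /IH[].
have {}p3 : PC2 c3 q by apply: p3 => // j /IH[].
set C' := _ + c3; have [l0 l1 l2 l3] : [/\ stepC q <= C', c1 <= C', c2 <= C' & c3 <= C'].
  exact: le_sum4.
move: qq; rewrite leq_eqVlt => /predU1P[->|qq].
  by split; [exact: PC_le l1 p1|exact: PE_le l2 p2|exact: PC2_le l3 p3].
have [? ? ?] := IH _ qq.
by split; [exact: PC_le l0 _|exact: PE_le l0 _|exact: PC2_le l0 _].
Qed.

(** The site j lies in the ball of radius 0. Taylor's formula removes that ball from the sum, and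
    x_j times the v-th power of its sum is a polynomial of degree 1 + v to which [PE] applies at
    level q - v. *)
Lemma centre_expansion q j : (q.+1 <= k2)%N -> rad j = 0%N ->
  good q (fun G => ex P (fun w => x j w * G 0%N (Wall w)))
    ((K + q.+1%:R * stepC q.+1) * errE 0 q).
Proof.
move=> qk rj.
have hQ : Qp x 1 (Btwn 0 0) 1 (x j).
  exists [:: (1, [:: j])]; split.
  - by move=> w; rewrite big_seq1/= /mon big_seq1 mul1r.
  - by move=> e; rewrite inE => /eqP -> /=; split => // i; rewrite inE => /eqP ->; rewrite finset.inE rj.
  - by rewrite big_seq1 normr1.
have dQ := Qp_dom mx hQ; have C0 := stepC_ge0 q.+1.
have tq : (1 + q <= k2)%N by [].
pose S v (G : nat -> R -> R) : R := v`!%:R^-1 * ex P (fun w => x j w * lin (Btwn 0 0) w ^+ v * G v (Wout 0 w)).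
apply: (@good_le _ _ (K * 1 * bq 0 q + \sum_(v < q.+1) stepC q.+1 * errE 0 q)).
  rewrite big_const_ord iter_addr_0 [leRHS]mulrDl; apply: lerD.
    by rewrite mulr1 ler_wpM2l// lerDl mixtail_ge0.
  by rewrite -mulrA -[leLHS]mulr_natl.
apply: (@good_approx _ _ (fun G => \sum_(v < q.+1) S v G)).
  move=> G hG; have := taylor_ex (Btwn 0 0) (Btwn 1 N) hG tq dQ.
  rewrite (_ : (fun w => x j w * G 0%N _) = fun w => x j w * G 0%N (Wall w)); last first.
    by apply/funext => w; rewrite (Wall_split 0).
  rewrite -/(Wout 0) => ->; rewrite addrAC subrr add0r.
  by apply: (rem_ex _ hG tq hQ); exact: cardB_le.
apply: good_sum => v _; have vq : (v <= q)%N by rewrite -ltnS.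
have hQv : Qp x (1 + v) (Btwn 0 0) (1 * b 0 ^+ v) (fun w => x j w * lin (Btwn 0 0) w ^+ v).
  by have := Qp_mul hQ (lin_btwn_Qp v 0 0); rewrite finset.setUid.
have [_ hE _] := @levels q.+1 (q - v) (leq_subr _ _ : q - v < q.+1)%N.
have E := hE (1 + v)%N 0%N _ _ _ hQv.
have := goodZ v`!%:R^-1 (good_shift vq (E _)) => H.
apply: (good_le _ (H _)); last by clear -vq qk; lia.
rewrite -[leRHS]mul1r ler_pM ?fact_inv_le1//.
  by rewrite !mulr_ge0 ?exprn_ge0 ?b_ge0// errE_ge0.
by rewrite mul1r -mulrA ler_wpM2l// (le_trans (errE_mul _ _ _))// subnK.
Qed.

End Centre.

Lemma leq_expW m n e : (m <= n -> m ^ e <= n ^ e)%N.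
Proof. by case: e => // e mn; rewrite leq_exp2r. Qed.

(** * Random fields on the lattice *)

Section Lattice.
Context {dim : nat}.

Lemma maxdist_le (i j : 'rV[int]_dim) a :
  (maxdist i j <= a)%N = [forall k, (`|(i ord0 k - j ord0 k)%R|%N <= a)%N].
Proof.
rewrite /maxdist; apply/bigmax_leqP/forallP => h k; first exact: h.
by move=> _; exact: h.
Qed.

Lemma maxdist_trans (i j k : 'rV[int]_dim) : (maxdist i k <= maxdist i j + maxdist j k)%N.
Proof.
apply/bigmax_leqP => l _.
apply: (@leq_trans (`|(i ord0 l - j ord0 l)%R| + `|(j ord0 l - k ord0 l)%R|)%N).
  lia.
apply: leq_add.
  exact: (@leq_bigmax_cond _ xpredT (fun l => `|(i ord0 l - j ord0 l)%R|%N)).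
exact: (@leq_bigmax_cond _ xpredT (fun l => `|(j ord0 l - k ord0 l)%R|%N)).
Qed.

Variable T : {fset 'rV[int]_dim}.
Variable i : T.

(** Coordinates relative to i, shifted by a; within distance a they lie in [0, 2 a] and [inord]
    loses nothing. *)
Definition box_code a (j : T) : {ffun 'I_dim -> 'I_(2 * a).+1} :=
  [ffun k => inord `|(val j ord0 k - val i ord0 k + a%:Z)%R|%N].

Lemma box_codeE a (j : T) k : (maxdist (val i) (val j) <= a)%N ->
  box_code a j k = `|(val j ord0 k - val i ord0 k + a%:Z)%R|%N :> nat.
Proof.
rewrite maxdist_le => /forallP/(_ k)/=; rewrite ffunE.
move: (val i ord0 k) (val j ord0 k) => u v h; rewrite inordK//; lia.
Qed.

Lemma box_code_inj a : {in [set j : T | (maxdist (val i) (val j) <= a)%N]%SET &,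
  injective (box_code a)}.
Proof.
move=> j j'; rewrite !finset.inE => ja ja' jj; apply/val_inj/rowP => k.
have := box_codeE k ja; have := box_codeE k ja'; rewrite jj => -> h.
move: ja ja'; rewrite !maxdist_le => /forallP/(_ k)/= + /forallP/(_ k)/=; move: h.
rewrite -[0]/ord0; move: (val i ord0 k) (val j ord0 k) (val j' ord0 k) => u v v'; lia.
Qed.

Lemma card_ball a :
  (#|[set j : T | (maxdist (val i) (val j) <= a)%N]%SET| <= (2 * a).+1 ^ dim)%N.
Proof.
rewrite -(card_in_imset (@box_code_inj a)) (leq_trans (max_card _))//.
by rewrite card_ffun !card_ord.
Qed.

(** At distance exactly a some coordinate of the code is 0 or 2 a, so the code avoids the inner
    cube. The count is the difference of the d-th powers of 2 a + 1 and 2 a - 1, which factors as 2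
    times a sum of d products. *)
Lemma card_ring a : (0 < a)%N ->
  (#|[set j : T | maxdist (val i) (val j) == a]%SET|
     <= 2 * dim * (2 * a).+1 ^ dim.-1)%N.
Proof.
move=> a0.
have sub : [set j : T | maxdist (val i) (val j) == a]%SET \subset
    [set j : T | (maxdist (val i) (val j) <= a)%N]%SET.
  by apply/fintype.subsetP => j; rewrite !finset.inE => /eqP ->.
have inj : {in [set j : T | maxdist (val i) (val j) == a]%SET &, injective (box_code a)}.
  by move=> j j' hj hj'; apply: box_code_inj; exact: (fintype.subsetP sub).
rewrite -(card_in_imset inj).
pose B : pred 'I_(2 * a).+1 := fun x => (0 < val x < 2 * a)%N.
pose D : pred {ffun 'I_dim -> 'I_(2 * a).+1} := [predC ffun_on B].
have h : (#|[set box_code a j | j in [set j : T | maxdist (val i) (val j) == a]%SET]%SET|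
   <= #|D|)%N.
  apply: subset_leq_card; apply/fintype.subsetP => f0 /imsetP[j].
  rewrite finset.inE => /eqP ja ->; rewrite /D !inE; apply/negP => /ffun_onP hB.
  have ja' : (maxdist (val i) (val j) <= a)%N by rewrite ja.
  suff : (maxdist (val i) (val j) <= a.-1)%N by rewrite ja; move: a0; clear; lia.
  rewrite maxdist_le; apply/forallP => k; have : (0 < box_code a j k < 2 * a)%N by exact: (hB k).
  rewrite (box_codeE k ja').
  move: ja'; rewrite maxdist_le => /forallP/(_ k)/=; move: (val i ord0 k) (val j ord0 k) a0 => u v; clear; lia.
apply: (leq_trans h); rewrite -(leq_add2l #|(ffun_on B : pred {ffun 'I_dim -> 'I_(2 * a).+1})|) cardC card_ffun !card_ord.
have cB : #|B| = (2 * a).-1.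
  pose f (x : 'I_(2 * a).-1) : 'I_(2 * a).+1 := inord x.+1.
  have fE x : f x = x.+1 :> nat.
    by rewrite /f inordK//; have := ltn_ord x; move: (nat_of_ord x) => y; clear; lia.
  have finj : injective f.
    by move=> x y /(congr1 (@nat_of_ord _)); rewrite !fE => -[/val_inj].
  rewrite -[RHS]card_ord -(card_codom finj); apply: eq_card => x.
  rewrite unfold_in; apply/idP/codomP => [/andP[x0 xa]|[y ->]].
    have yl : (x.-1 < (2 * a).-1)%N.
      by case: (x) x0 xa => y ? /=; clear; lia.
    by exists (Ordinal yl); apply/val_inj; rewrite /= fE /= prednK.
  have -> : \val (f y) = y.+1 by exact: fE.
  by have := ltn_ord y; move: (nat_of_ord y) => z; clear; lia.
rewrite card_ffun_on card_ord cB.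
case: dim => [|n]; first by rewrite !expn0.
rewrite -leq_subLR subn_exp.
have -> : ((2 * a).+1 - (2 * a).-1 = 2)%N by lia.
rewrite -mulnA leq_mul2l/= (@leq_trans (\sum_(m < n.+1) (2 * a).+1 ^ n))//; last first.
  by rewrite sum_nat_const card_ord.
apply: leq_sum => m _; have mn : (m <= n)%N by rewrite -ltnS.
rewrite ?subSS -[in X in (_ <= X)%N](subnK mn) expnD leq_mul//.
by rewrite leq_expW //; lia.
Qed.

End Lattice.

(** * Mixing coefficients as bounds on dependence *)

Section MixingCoefficients.
Context {dim : nat} {d} {Omega : measurableType d} {R : realType}.
Variables (T : {fset 'rV[int]_dim}) (P : probability Omega R).
Variable X : T -> {RV P >-> R}.

Lemma prob_fine (A : set Omega) : measurable A -> 0 <= fine (P A) <= 1.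
Proof.
move=> mA; rewrite fine_ge0//= -lee_fin fineK ?probability_le1//.
exact: fin_num_measure.
Qed.

Lemma dep_le1 (a b : set Omega) : measurable a -> measurable b ->
  `|fine (P (a `&` b)) - fine (P a) * fine (P b)| <= 1.
Proof.
move=> ma mb.
have /andP[a0 a1] := prob_fine ma; have /andP[b0 b1] := prob_fine mb.
have /andP[c0 c1] := prob_fine (measurableI _ _ ma mb).
have p0 : 0 <= fine (P a) * fine (P b) by exact: mulr_ge0.
have p1 : fine (P a) * fine (P b) <= 1 by rewrite mulr_ile1.
by move: p0 p1; move: (fine (P a) * _) => z z0 z1; rewrite ler_norml; apply/andP; split; lra.
Qed.

Lemma sigma_gen_sub (U : {set T}) : sigma_gen X U `<=` measurable.
Proof. by apply: (@gens_sub _ _ _ _ (fun j => X j : Omega -> R)) => j. Qed.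

Lemma alpha_dep_le (U V : {set T}) a b : sigma_gen X U a -> sigma_gen X V b ->
  `|fine (P (a `&` b)) - fine (P a) * fine (P b)| <=
  alpha_dep P (sigma_gen X U) (sigma_gen X V).
Proof.
move=> ha hb; apply: ub_le_sup; last by exists a, b.
by exists 1 => _ [a' [b' [ha' hb' ->]]]; apply: dep_le1; [exact: sigma_gen_sub ha'|exact: sigma_gen_sub hb'].
Qed.

Lemma alpha_dep_le1 (U V : {set T}) :
  0 <= alpha_dep P (sigma_gen X U) (sigma_gen X V) <= 1.
Proof.
have s0 (W : {set T}) : sigma_gen X W set0 by exact: sigma_algebra0.
apply/andP; split; first by apply: le_trans (alpha_dep_le (s0 U) (s0 V)).
apply: ge_sup.
  by exists `|fine (P (set0 `&` set0)) - fine (P set0) * fine (P set0)|; exists set0, set0.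
by move=> _ [a' [b' [ha' hb' ->]]]; apply: dep_le1; [exact: sigma_gen_sub ha'|exact: sigma_gen_sub hb'].
Qed.

Definition amix_set q l := [set e | exists (U1 U2 : {set T}),
    [/\ (#|U1| <= q)%N, Defs.separated l U1 U2 &
        e = alpha_dep P (sigma_gen X U1) (sigma_gen X U2)]].

Lemma amix_ub q l : has_ubound (amix_set q l).
Proof. by exists 1 => _ [U1 [U2 [_ _ ->]]]; case/andP: (alpha_dep_le1 U1 U2). Qed.

Lemma amix_neq0 q l : amix_set q l !=set0.
Proof.
exists (alpha_dep P (sigma_gen X finset.set0) (sigma_gen X finset.set0)).
exists finset.set0, finset.set0; split => //; first by rewrite cards0.
by move=> i1 i2; rewrite finset.inE.
Qed.

Lemma alpha_mix01 q l : 0 <= alpha_mix X q l <= 1.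
Proof.
rewrite /alpha_mix le_max lexx/= ge_max ler01/=; apply: ge_sup; first exact: amix_neq0.
by move=> _ [U1 [U2 [_ _ ->]]]; case/andP: (alpha_dep_le1 U1 U2).
Qed.

Lemma alpha_mix_anti q l l' : (l <= l')%N -> alpha_mix X q l' <= alpha_mix X q l.
Proof.
move=> ll; rewrite /alpha_mix ge_max le_max lexx/= le_max; apply/orP; right.
apply: ge_sup; first exact: amix_neq0.
move=> _ [U1 [U2 [h1 h2 ->]]]; apply: ub_le_sup; first exact: amix_ub.
by exists U1, U2; split => // i1 i2 hi1 hi2; rewrite (leq_trans ll)// h2.
Qed.

Lemma alpha_mix_dep q l (U1 U2 : {set T}) a b : (#|U1| <= q)%N -> Defs.separated l U1 U2 ->
  sigma_gen X U1 a -> sigma_gen X U2 b ->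
  `|fine (P (a `&` b)) - fine (P a) * fine (P b)| <= alpha_mix X q l.
Proof.
move=> hq hs ha hb; apply: (le_trans (alpha_dep_le ha hb)).
rewrite /alpha_mix le_max; apply/orP; right; apply: ub_le_sup; first exact: amix_ub.
by exists U1, U2.
Qed.

End MixingCoefficients.

Section NormGauge.
Context {d} {Omega : measurableType d} {R : realType}.
Variables (P : probability Omega R) (X : {RV P >-> R}).

Lemma Lnorm_gauge (r : \bar R) (K : R) : (1 < r)%E -> 0 < K ->
  ('N[P]_r[EFin \o X] <= K%:E)%E -> gauge P 1 r (fun w => `|K^-1 * X w|).
Proof.
move=> r1 K0 hN.
have mk : measurable_fun setT (fun w => `|K^-1 * X w|).
  by apply: measurableT_comp => //; apply: measurable_funM.
split => //; case: r r1 hN => [r|_|//].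
  rewrite lte_fin => r1 hN; have r0 : 0 < r by lra.
  have E : (\int[P]_w (`|X w| `^ r)%:E <= (K `^ r)%:E)%E.
    have := poweR_Lnorm P (EFin \o X) (lt0r_neq0 r0).
    rewrite (_ : (\int[P]_x _ = \int[P]_w (`|X w| `^ r)%:E)%E) => [<-|//].
    rewrite -poweR_EFin; apply: gt0_ler_poweR => //; first exact: ltW.
    - by rewrite in_itv/= Lnorm_ge0 leey.
    - by rewrite in_itv/= lee_fin (ltW K0) leey.
  have mX : measurable_fun setT (fun w => `|X w| `^ r).
    by apply: (measurableT_comp (measurable_powR r)); exact: measurableT_comp.
  have iX : itg P (fun w => `|X w| `^ r).
    apply/integrableP; split; first exact/measurable_EFinP.
    under eq_integral do rewrite /= ger0_norm ?powR_ge0//.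
    by apply: (le_lt_trans E); exact: ltry.
  have Eq : (fun w => `|K^-1 * X w| `^ r) = (fun w => (K^-1) `^ r * `|X w| `^ r).
    by apply/funext => w; rewrite normrM gtr0_norm ?invr_gt0// powRM// invr_ge0 ltW.
  rewrite Eq; split; first exact: itgZ.
  rewrite exZ//; have eX : ex P (fun w => `|X w| `^ r) <= K `^ r.
    rewrite -lee_fin; apply: le_trans E; rewrite le_eqVlt; apply/orP; left; apply/eqP.
    by rewrite /ex /Rintegral fineK//; exact: integrable_fin_num.
  rewrite (le_trans (ler_wpM2l (powR_ge0 _ _) eX))//.
  rewrite -powRM ?(ltW K0) ?invr_ge0 ?(ltW K0)//.
  by rewrite mulVf ?gt_eqF// powR1.
rewrite unlock /= probability_setT lte01 => hN.
have := @ess_sup_inf.ess_sup_ge _ _ _ P (abse \o (EFin \o X)).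
apply: filterS => w /= hw.
rewrite normrM gtr0_norm ?invr_gt0// ler_pdivrMl// mulr1 -lee_fin.
exact: le_trans hw hN.
Qed.

End NormGauge.

(** * Sums of halved mixing coefficients *)

Section Numeric.
Context {R : realType}.
Variables (A : nat -> R) (e : R) (L : nat).
Hypothesis A0 : forall l, 0 <= A l.
Hypothesis A_anti : forall l l', (l <= l')%N -> A l' <= A l.
Hypothesis e0 : 0 <= e.
Hypothesis L0 : (0 < L)%N.

Let S : R := \sum_(1 <= l < L.+1) l%:R `^ e * A l.

(** Each m is the value of l - l/2 for exactly two indices, l = 2 m - 1 and l = 2 m. *)
Lemma sum_half (F : nat -> R) n :
  \sum_(1 <= l < (2 * n).+1) F (l - l./2)%N = 2 * \sum_(1 <= m < n.+1) F m.
Proof.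
elim: n => [|n IH]; first by rewrite muln0 !big_geq// mulr0.
rewrite (_ : (2 * n.+1).+1 = (2 * n).+3); last by lia.
have recr m (H : nat -> R) : \sum_(1 <= l < m.+2) H l = \sum_(1 <= l < m.+1) H l + H m.+1.
  by rewrite big_nat_recr.
rewrite !recr IH mulrDr -addrA; congr (_ + _).
have -> : ((2 * n).+1 - (2 * n).+1./2)%N = n.+1 by lia.
have -> : ((2 * n).+2 - (2 * n).+2./2)%N = n.+1 by lia.
by rewrite mulr_natl mulr2n.
Qed.

Lemma half_shift_sum :
  \sum_(1 <= l < L.+1) l%:R `^ e * A (l - l./2)%N <= 2 * 2 `^ e * S.
Proof.
pose F m : R := (2 * m%:R) `^ e * A m.
have F0 m : 0 <= F m by rewrite mulr_ge0 ?powR_ge0.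
apply: (@le_trans _ _ (\sum_(1 <= l < L.+1) F (l - l./2)%N)).
  apply: ler_sum => l _; rewrite ler_wpM2r// powR_mono// -natrM ler_nat; lia.
apply: (@le_trans _ _ (\sum_(1 <= l < (2 * L).+1) F (l - l./2)%N)).
  rewrite (@big_cat_nat _ _ _ L.+1 1 (2 * L).+1)//=; last by lia.
  by rewrite lerDl sumr_ge0.
rewrite sum_half -mulrA ler_wpM2l// /S mulr_sumr; apply: ler_sum => m _.
by rewrite /F powRM// mulrA.
Qed.

(** In the sum added to its reversal, m is paired with n + 1 - m, and one of the two is at least n /
    2. *)
Lemma sum_pow_ge n : (0 < n)%N -> n%:R * (n%:R / 2) `^ e <= 2 * \sum_(1 <= m < n.+1) m%:R `^ e :> R.
Proof.
move=> n0; rewrite [leRHS]mulr_natl [leRHS]mulr2n [X in _ + X]big_nat_rev/= -big_split/=.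
rewrite (_ : n%:R * (n%:R / 2) `^ e = \sum_(1 <= m < n.+1) (n%:R / 2) `^ e); last first.
  by rewrite big_const_nat subn1/= iter_addr_0 mulr_natl.
apply: ler_sum_nat => m /andP[m1 mn].
have [h|h] := leqP n (2 * m).
  apply: (@le_trans _ _ (m%:R `^ e)); last by rewrite lerDl powR_ge0.
  by rewrite powR_mono// ?divr_ge0// ler_pdivrMr// -natrM ler_nat; lia.
apply: (@le_trans _ _ ((1 + n.+1 - m.+1)%:R `^ e)); last by rewrite lerDr powR_ge0.
by rewrite powR_mono// ?divr_ge0// ler_pdivrMr// -natrM ler_nat; lia.
Qed.

(** This is for the shell of radius L + 1, which collects all sites farther than L and may have the
    size of a ball: hence the additional exponent om. As A is nonincreasing, A m0 times the sum of
    m^e up to m0 is at most S, and that sum is of order m0^(e+1), which suffices because om <= 1. *)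
Lemma last_term (om : R) : 0 <= om <= 1 ->
  L.+1%:R `^ (e + om) * A (L.+1 - L.+1./2)%N <= 4 * 4 `^ e * S.
Proof.
move=> /andP[om0 om1]; set m0 := (L.+1 - L.+1./2)%N.
have m00 : (0 < m0)%N by rewrite /m0; lia.
have m0L : (m0 <= L)%N by rewrite /m0; lia.
have Lm : (L.+1 <= 2 * m0)%N by rewrite /m0; lia.
have mp : 0 < m0%:R :> R by rewrite ltr0n.
have S1 : A m0 * \sum_(1 <= m < m0.+1) m%:R `^ e <= S.
  rewrite /S (@big_cat_nat _ _ _ m0.+1 1 L.+1)//= mulr_sumr.
  rewrite -[leLHS]addr0 lerD//; last first.
    by apply: sumr_ge0 => l _; rewrite mulr_ge0 ?powR_ge0.
  apply: ler_sum_nat => m /andP[m1 mm].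
  by rewrite mulrC ler_wpM2l ?powR_ge0// A_anti.
have h1 : L.+1%:R `^ (e + om) <= 2 * m0%:R * (2 * m0%:R) `^ e.
  apply: (@le_trans _ _ (L.+1%:R `^ (e + 1))).
    by rewrite ler_powR ?lerD2l// ler1n.
  rewrite mulrC powR_addr ?ltr0n// powRr1//.
  by apply: ler_pM; rewrite ?powR_ge0 ?powR_mono// -natrM ler_nat.
have h2 : (2 * m0%:R) `^ e = 4 `^ e * (m0%:R / 2) `^ e :> R.
  rewrite -powRM ?divr_ge0//; congr (_ `^ _); lra.
apply: (@le_trans _ _ (2 * (4 `^ e * (m0%:R * (m0%:R / 2) `^ e)) * A m0)).
  rewrite ler_wpM2r// (le_trans h1)// h2 le_eqVlt; apply/orP; left; apply/eqP; ring.
apply: (@le_trans _ _ (2 * (4 `^ e * (2 * \sum_(1 <= m < m0.+1) m%:R `^ e)) * A m0)).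
  by rewrite ler_wpM2r// ler_wpM2l// ler_wpM2l ?powR_ge0// sum_pow_ge.
rewrite (_ : _ * A m0 = 4 * 4 `^ e * (A m0 * \sum_(1 <= m < m0.+1) m%:R `^ e)); last by ring.
by rewrite ler_wpM2l// mulr_ge0 ?powR_ge0.
Qed.

End Numeric.

(** * Summation over the sites of the lattice *)

Section FieldExpansion.
Context {R : realType} {dim : nat} {d : measure_display} {Omega : measurableType d}.
Variables (T : {fset 'rV[int]_dim}) (P : probability Omega R)
  (X : T -> {RV P >-> R}).
Variables (p om K : R) (r : \bar R) (q : nat).
Hypothesis dim0 : (0 < dim)%N.
Hypothesis T0 : T != fset0.
Hypothesis p0 : 0 < p.
Hypothesis pr : ((p + 2)%:E < r)%E.
Hypothesis om01 : 0 < om <= 1.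
Hypothesis qp : q.+1%:R + om <= p + 2.
Hypothesis qc : (q.+1 <= (ceiln p).+1)%N.
Hypothesis K0 : 0 < K.
Hypothesis XK : forall i, ('N[P]_r[EFin \o X i] <= K%:E)%E.
Hypothesis sv0 : 0 < sum_var X.

Let sg := Num.sqrt (sum_var X).
Let sg0 : 0 < sg. Proof. by rewrite sqrtr_gt0. Qed.
Let s := K / sg.
Let s0 : 0 < s. Proof. exact: divr_gt0. Qed.
Let om0 : 0 < om. Proof. by case/andP: om01. Qed.
Let om1 : om <= 1. Proof. by case/andP: om01. Qed.
Let L := @side dim R T.

Lemma card_fset_gt0 : 1 <= #|` T|%:R :> R.
Proof. by rewrite ler1n cardfs_gt0. Qed.

Lemma side_ge1 : (0 < L)%N.
Proof.
by rewrite /L /side truncn_gt_nat powR_ge1 ?card_fset_gt0.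
Qed.

Lemma card_le_side : (#|` T| <= L.+1 ^ dim)%N.
Proof.
have h : (#|` T|%:R : R) `^ dim%:R^-1 < L.+1%:R by exact: truncnS_gt.
rewrite -(@ler_nat R) natrX -powR_mulrn//.
have c0 : 0 <= #|` T|%:R :> R by [].
have -> : #|` T|%:R = (#|` T|%:R `^ dim%:R^-1) `^ dim%:R :> R.
  by rewrite -powRrM mulVf ?powRr1// pnatr_eq0 -lt0n.
by rewrite powR_mono ?powR_ge0// ltW.
Qed.

Let x (j : T) (w : Omega) : R := K^-1 * X j w.
Let mx j : measurable_fun setT (x j).
Proof. by apply: measurable_funM. Qed.
Let gx j : gauge P 1 r (fun w => `|x j w|).
Proof. by apply: Lnorm_gauge (XK j) => //; exact: r_gt1 p0 pr. Qed.

Let sub_gens (U : {set T}) : <<s gens x U>> `<=` sigma_gen X U.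
Proof.
apply: smallest_sub; first exact: smallest_sigma_algebra.
move=> C [i iU [B mB <-]].
have mX : measurable_fun (setT : set (g_sigma_algebraType (gens (fun j => X j : Omega -> R) U))) (X i).
  exact: (@smeas_x _ _ _ _ (fun j => X j : Omega -> R) U i iU).
have h : measurable_fun (setT : set (g_sigma_algebraType (gens (fun j => X j : Omega -> R) U))) (x i).
  by apply: measurable_funM => //; exact: measurable_cst.
by have := h measurableT B mB.
Qed.

Let al l := alpha_mix X (ceiln p).+1 l.

Let dep l (U1 U2 : {set T}) (a b : set Omega) : (#|U1| <= q.+1)%N -> Defs.separated l U1 U2 ->
  <<s gens x U1>> a -> <<s gens x U2>> b ->
  `|fine (P (a `&` b)) - fine (P a) * fine (P b)| <= al l.
Proof.
move=> hU hs ha hb; apply: (alpha_mix_dep _ hs (sub_gens ha) (sub_gens hb)).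
exact: leq_trans qc.
Qed.

Let sep_sub l (A B A' B' : {set T}) : A' \subset A -> B' \subset B ->
  Defs.separated l A B -> Defs.separated l A' B'.
Proof.
move=> AA BB h i1 i2 hi1 hi2; apply: h; first exact: (fintype.subsetP AA).
exact: (fintype.subsetP BB).
Qed.

Let card_T_le (A : {set T}) : (#|A| <= L.+1 ^ dim)%N.
Proof.
apply: leq_trans card_le_side; rewrite (leq_trans (max_card _))//.
by rewrite cardfE.
Qed.

Section AtSite.
Variable i : T.

Let rad (j : T) : nat := minn (maxdist (val i) (val j)) L.+1.

Let radN j : (rad j <= L.+1)%N. Proof. exact: geq_minr. Qed.

Let rad_sep_aux m1 m2 m3 M a l : (m2 <= m1 + m3 -> minn m1 M <= a -> l <= minn m2 M -> l - a <= m3)%N.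
Proof. clear; lia. Qed.

Let rad_sep a l : Defs.separated (l - a) (Btwn rad 0 a) (Btwn rad l L.+1).
Proof.
move=> i1 i2; rewrite !finset.inE => /= h1 /andP[h2 _].
exact: (rad_sep_aux (maxdist_trans (val i) (val i1) (val i2)) h1 h2).
Qed.

Let b (l : nat) : R := s * (2 * l).+1%:R ^+ dim.

Let maxdist_self : maxdist (val i) (val i) = 0%N.
Proof.
by apply/eqP; rewrite -leqn0 maxdist_le; apply/forallP => k; rewrite subrr.
Qed.

Let bB l : s * #|Btwn rad 0 l|%:R <= b l.
Proof.
rewrite ler_wpM2l ?(ltW s0)// -natrX ler_nat.
(* Beyond L the truncated ball may be all of T, and the cardinal of T is at most (L + 1)^dim. *)
have [lL|Ll] := leqP l L; last first.
  by apply: (leq_trans (card_T_le _)); rewrite leq_exp2r//; move: Ll; clear; lia.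
apply: leq_trans (card_ball i l); apply: subset_leq_card.
by apply/fintype.subsetP => j; rewrite !finset.inE /rad /=; move: lL; clear; lia.
Qed.

Let b_mono l l' : (l <= l')%N -> b l <= b l'.
Proof.
move=> ll; rewrite ler_wpM2l ?(ltW s0)// lerXn2r ?nnegrE// ler_nat; move: ll; clear; lia.
Qed.

Let b_double l : b (2 * l)%N <= 2 ^+ dim * b l.
Proof.
rewrite mulrCA ler_wpM2l ?(ltW s0)// -exprMn lerXn2r ?nnegrE// -natrM ler_nat; clear; lia.
Qed.

Lemma site_expansion : exists c : nat -> R, forall G, cls q om G ->
  `|ex P (fun w => x i w * G 0%N (Wall x s w)) -
    \sum_(j < q.+1) c j * ex P (fun w => G j (Wall x s w))| <=
  (KC p + q.+1%:R * stepC om (2 ^+ dim) (KC p) q.+1) * errE p om r al (fun j : T => minn (maxdist (val i) (val j)) L.+1) L.+1 s (fun l => s * (2 * l).+1%:R ^+ dim) 0 q.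
Proof.
have D1 : 1 <= 2 ^+ dim :> R by rewrite exprn_ege1// ler1n.
have ri : rad i = 0%N by rewrite /rad maxdist_self.
exact: (@centre_expansion _ _ _ _ P x mx p om r al q.+1 _ p0 pr om01 qp gx dep
  (alpha_mix01 X _) (alpha_mix_anti X _) sep_sub rad L.+1 radN rad_sep s (2 ^+ dim) b
  (ltW s0) bB b_mono b_double D1 (KC p) (lexx _) q i (leqnn _) ri).
Qed.

End AtSite.

Let A l := mix_term X p r l.
(** The exponent (d - 1) om + d q: a shell of radius l has order l^(d-1) sites and enters to the
    power om, a ball has order l^d sites and enters to the power q. For q = ceil p and om = omega p
    this is d (p + 1) - omega, the exponent in M. *)
Let e := dim%:R * (q%:R + om) - om.
Let D3 : R := (2 * dim * 3 ^ dim)%:R.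

Definition mixS : R := \sum_(1 <= l < L.+1) l%:R `^ e * A l.

Definition errC : R := 1 + D3 `^ (q%:R + om) * (6 * 4 `^ e).

Let e0_aux (a dm o : R) : 0 <= a -> 1 <= dm -> 0 < o -> 0 <= dm * (a + o) - o.
Proof. by move=> a0 d1 o0; nra. Qed.

Let e0 : 0 <= e. Proof. by apply: e0_aux; rewrite ?ler1n. Qed.

Let A0 l : 0 <= A l. Proof. exact: powR_ge0. Qed.

Lemma mixS_ge0 : 0 <= mixS.
Proof. by apply: sumr_ge0 => l _; rewrite mulr_ge0 ?powR_ge0. Qed.

Let A_anti l l' : (l <= l')%N -> A l' <= A l.
Proof.
move=> ll; rewrite /A /mix_term powR_mono//; last exact: alpha_mix_anti.
  exact: (ltW (bexp_gt0 p0 pr)).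
by case/andP: (alpha_mix01 X (ceiln p).+1 l').
Qed.

Let D30 : 0 < D3.
Proof. by rewrite ltr0n !muln_gt0 dim0 expn_gt0. Qed.

Let D31 : 3 ^+ dim <= D3.
Proof. by rewrite /D3 -natrX ler_nat leq_pmull// muln_gt0 dim0. Qed.

Let sD0 : 0 < s * D3. Proof. exact: mulr_gt0 s0 D30. Qed.

Let ln0 l n : (0 < l)%N -> 0 < l%:R ^+ n :> R. Proof. by move=> l0; rewrite exprn_gt0// ltr0n. Qed.

Let pow_pair (y z u v : R) : 0 < u -> 0 <= y -> y <= u -> 0 <= z -> z <= v ->
  y `^ om * z ^+ q <= u `^ om * v ^+ q.
Proof.
move=> u0 y0 yu z0 zv; apply: ler_pM; rewrite ?powR_ge0 ?exprn_ge0//.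
  by rewrite powR_mono// ltW.
by rewrite lerXn2r ?nnegrE// (le_trans z0).
Qed.

Let pow_mul (c l : R) : 0 < c -> 0 < l ->
  (c * l ^+ dim.-1) `^ om * (c * l ^+ dim) ^+ q = c `^ (q%:R + om) * l `^ e.
Proof.
move=> c0 l0; have lw := ltW l0; have cw := ltW c0.
rewrite powRM ?exprn_ge0// exprMn powR_natD ?(ltW om0)//.
rewrite [in LHS]mulrACA; congr (_ * _); first by rewrite mulrC.
rewrite -exprM -!powR_mulrn// -powRrM -powR_addr//; congr (_ `^ _).
rewrite /e -subn1 natrB// natrM; ring.
Qed.

Let pow_mul_last (c l : R) : 0 < c -> 0 < l ->
  (c * l ^+ dim) `^ om * (c * l ^+ dim) ^+ q = c `^ (q%:R + om) * l `^ (e + om).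
Proof.
move=> c0 l0; have lw := ltW l0; have cw := ltW c0.
rewrite powRM ?exprn_ge0// exprMn powR_natD ?(ltW om0)//.
rewrite [in LHS]mulrACA; congr (_ * _); first by rewrite mulrC.
rewrite -exprM -!powR_mulrn// -powRrM -powR_addr//; congr (_ `^ _).
rewrite /e natrM; ring.
Qed.

Section ErrAtSite.
Variable i : T.
Let rad (j : T) : nat := minn (maxdist (val i) (val j)) L.+1.
Let b (l : nat) : R := s * (2 * l).+1%:R ^+ dim.

Let b_le l : (0 < l)%N -> b l <= s * D3 * l%:R ^+ dim.
Proof.
move=> l0; rewrite -mulrA ler_wpM2l ?(ltW s0)//.
apply: (@le_trans _ _ ((3 * l%:R) ^+ dim)).
  by rewrite lerXn2r ?nnegrE// -natrM ler_nat; move: l0; clear; lia.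
by rewrite exprMn ler_wpM2r ?exprn_ge0.
Qed.

Let b_pos l : 0 <= b l.
Proof. by rewrite mulr_ge0 ?(ltW s0). Qed.

Let yr_pos l : 0 <= yr rad s l.
Proof. by rewrite mulr_ge0 ?(ltW s0). Qed.

Let yr_bound l : (0 < l <= L)%N -> yr rad s l <= s * D3 * l%:R ^+ dim.-1.
Proof.
move=> /andP[l0 lL]; rewrite -mulrA ler_wpM2l ?(ltW s0)// -natrX -natrM ler_nat.
have h : (#|Btwn rad l l| <= 2 * dim * (2 * l).+1 ^ dim.-1)%N.
  apply: leq_trans (card_ring i l0); apply: subset_leq_card.
  apply/fintype.subsetP => j; rewrite !finset.inE /rad /=; move: lL; clear; lia.
apply: (leq_trans h); rewrite -[X in (_ <= X)%N]mulnA leq_mul2l; apply/orP; right.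
apply: (@leq_trans ((3 * l) ^ dim.-1)).
  by rewrite leq_expW//; move: l0; clear; lia.
by rewrite expnMn leq_mul2r leq_exp2l// leq_pred orbT.
Qed.

Let yr_last : yr rad s L.+1 <= s * D3 * L.+1%:R ^+ dim.
Proof.
rewrite -mulrA ler_wpM2l ?(ltW s0)//; apply: (@le_trans _ _ (L.+1%:R ^+ dim)).
  by rewrite -natrX ler_nat; exact: card_T_le.
by rewrite ler_peMl ?exprn_ge0// (le_trans _ D31)// exprn_ege1// ler1n.
Qed.

Let tau_le l : (0 < l <= L)%N ->
  tau p om r al rad s b q l <= (s * D3) `^ (q%:R + om) * (l%:R `^ e * A (l - l./2)%N).
Proof.
move=> lL; rewrite /tau mulrA ler_wpM2r ?powR_ge0//.
have l0 : (0 < l)%N by case/andP: lL.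
have lr : 0 < l%:R :> R by rewrite ltr0n.
rewrite -(pow_mul sD0 lr); apply: pow_pair; first exact: mulr_gt0 sD0 (ln0 _ l0).
- exact: yr_pos.
- exact: yr_bound.
- exact: b_pos.
- exact: b_le.
Qed.

Let tau_last :
  tau p om r al rad s b q L.+1 <=
  (s * D3) `^ (q%:R + om) * (L.+1%:R `^ (e + om) * A (L.+1 - L.+1./2)%N).
Proof.
rewrite /tau mulrA ler_wpM2r ?powR_ge0//.
have lr : 0 < L.+1%:R :> R by rewrite ltr0n.
rewrite -(pow_mul_last sD0 lr); apply: pow_pair; first exact: mulr_gt0 sD0 (ln0 _ _).
- exact: yr_pos.
- exact: yr_last.
- exact: b_pos.
- exact: b_le.
Qed.

Lemma errE_bound : errE p om r al rad L.+1 s b 0 q <= errC * (s `^ (q%:R + om) * (1 + mixS)).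
Proof.
have rec m (H : nat -> R) : \sum_(1 <= l < m.+2) H l = \sum_(1 <= l < m.+1) H l + H m.+1.
  by rewrite big_nat_recr.
have -> : errE p om r al rad L.+1 s b 0 q =
   s `^ (q%:R + om) + (\sum_(1 <= l < L.+1) tau p om r al rad s b q l + tau p om r al rad s b q L.+1).
  rewrite /errE /bq /b muln0 expr1n mulr1; congr (_ + _).
  rewrite -rec /mixtail [LHS]big_mkcond big_ltn//= add0r.
  by apply: eq_big_nat => l /andP[->].
have S0 := mixS_ge0.
have h1 := half_shift_sum A0 e0 side_ge1.
have h2 := @last_term _ A e L A0 A_anti e0 side_ge1 om _.
have h : \sum_(1 <= l < L.+1) tau p om r al rad s b q l + tau p om r al rad s b q L.+1 <=
   (s * D3) `^ (q%:R + om) * (6 * 4 `^ e * mixS).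
  apply: (@le_trans _ _ ((s * D3) `^ (q%:R + om) * (2 * 2 `^ e * mixS + 4 * 4 `^ e * mixS))).
    rewrite mulrDr; apply: lerD.
      apply: (le_trans (ler_sum_nat (G := fun l => (s * D3) `^ (q%:R + om) * (l%:R `^ e * A (l - l./2)%N)) _)).
        by move=> l lL; apply: tau_le; rewrite ltnS in lL.
      by rewrite -mulr_sumr ler_wpM2l ?powR_ge0.
    apply: (le_trans tau_last); rewrite ler_wpM2l ?powR_ge0//.
    by apply: h2; rewrite (ltW om0) om1.
  rewrite ler_wpM2l ?powR_ge0// -mulrDl ler_wpM2r//.
  have : 2 `^ e <= 4 `^ e :> R by rewrite powR_mono// ler_nat.
  move: (2 `^ e) (4 `^ e) => u v uv.
  rewrite (_ : 6 * v = 2 * v + 4 * v); last by clear; ring.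
  by rewrite lerD2r ler_wpM2l.
apply: (le_trans (lerD (lexx _) h)).
rewrite powRM ?(ltW s0) ?(ltW D30)// /errC.
have : 0 <= s `^ (q%:R + om) by exact: powR_ge0.
have : 0 <= D3 `^ (q%:R + om) * (6 * 4 `^ e) by rewrite mulr_ge0 ?mulr_ge0 ?powR_ge0.
move: S0; move: (s `^ _) (D3 `^ _) (4 `^ e) mixS => a b' c S S0 h3 a0.
rewrite -subr_ge0 (_ : _ - _ = a * S + a * (b' * (6 * c))); last by clear; ring.
by rewrite addr_ge0// mulr_ge0.
Qed.

End ErrAtSite.

Let CC : R := (KC p + q.+1%:R * stepC om (2 ^+ dim) (KC p) q.+1) * errC.

(** Each site contributes s times its own expansion. The coefficients are summed over the sites and
    the error is multiplied by s and by their number. *)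
Lemma field_expansion : exists c : nat -> R, forall G, cls q om G ->
  `|ex P (fun w => normalized_sum X w * G 0%N (normalized_sum X w)) -
    \sum_(j < q.+1) c j * ex P (fun w => G j (normalized_sum X w))| <=
  CC * (#|` T|%:R * s `^ (q%:R + om + 1) * (1 + mixS)).
Proof.
have WE : Wall x s = normalized_sum X.
  apply/funext => w; rewrite /Wall /normalized_sum mulr_sumr; apply: eq_bigr => j _.
  by rewrite /x mulrA; congr (_ * _); rewrite /s mulrAC divff ?mul1r// gt_eqF.
pose cc i := projT1 (cid (site_expansion i)).
have ccP i := projT2 (cid (site_expansion i)).
exists (fun j => \sum_i s * cc i j) => G hG.
have gi i : itg P (fun w => x i w * G 0%N (normalized_sum X w)).
  apply: (dom_itg p0 pr gx (t := 1 + (q%:R + om))).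
  - by rewrite !addr_ge0// ltW.
  - by rewrite addrA [1 + _]addrC natr1.
  - apply: domM; first exact: dom_x.
    rewrite (_ : (fun w => _) = fun w => G 0%N (lin x s finset.setT w)); last first.
      by apply/funext => w; rewrite -WE WallE.
    by have := @cls_dom _ _ _ _ x mx om om01 s (ltW s0) q G 0%N finset.setT (leq0n _) hG; rewrite subn0.
have -> : ex P (fun w => normalized_sum X w * G 0%N (normalized_sum X w)) =
   \sum_i s * ex P (fun w => x i w * G 0%N (normalized_sum X w)).
  rewrite (_ : (fun w => _) = fun w => \sum_i s * (x i w * G 0%N (normalized_sum X w))).
    rewrite (@ex_sum _ _ _ _ _ _ (fun i w => s * (x i w * G 0%N (normalized_sum X w)))).
      by apply: eq_bigr => i _; rewrite exZ.
    by move=> i _; apply: itgZ.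
  apply/funext => w; rewrite -{1}WE /Wall mulr_suml; apply: eq_bigr => i _.
  by rewrite mulrA.
rewrite (_ : \sum_(j < q.+1) _ = \sum_i s * \sum_(j < q.+1) cc i j * ex P (fun w => G j (normalized_sum X w))); last first.
  under [RHS]eq_bigr do rewrite mulr_sumr.
  rewrite exchange_big/=; apply: eq_bigr => j _; rewrite mulr_suml.
  by apply: eq_bigr => i _; rewrite mulrA.
rewrite -sumrB (le_trans (ler_norm_sum _ _ _))//.
apply: (@le_trans _ _ (\sum_(i : T) s * (CC * (s `^ (q%:R + om) * (1 + mixS))))).
  apply: ler_sum => i _; rewrite -mulrBr normrM (ger0_norm (ltW s0)) ler_wpM2l ?(ltW s0)//.
  have := ccP i G hG; rewrite -/(cc i) WE => /le_trans; apply.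
  rewrite /CC -mulrA ler_wpM2l ?errE_bound//.
  apply: addr_ge0; first exact: KC_ge0.
  by rewrite mulr_ge0//; apply: (stepC_ge0 om01 _ (lexx _)); rewrite exprn_ege1// ler1n.
rewrite sumr_const -cardfE -mulr_natl [s `^ (_ + 1)]powR_addr// powRr1 ?(ltW s0)//.
by rewrite le_eqVlt; apply/orP; left; apply/eqP; clear; ring.
Qed.

End FieldExpansion.

(** * Cumulants and moments *)

Section NearDerivatives.
Context {R : realType}.
Implicit Types f g : R -> R.

(** Differentiability n times in a neighbourhood of 0 only: the principal logarithm of the
    characteristic function is under control only where that function has positive real part. *)
Fixpoint Cn n f : Prop :=
  if n is n'.+1 then exists2 g, (\forall t \near (0 : R), is_derive (t : R) 1 f (g t)) & Cn n' g
  else True.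

Lemma Cn_pred n f : Cn n.+1 f -> Cn n f.
Proof.
elim: n f => [//|n IH] f [g hg Cg]; exists g => //; exact: IH.
Qed.

Lemma Cn_le m n f : (m <= n)%N -> Cn n f -> Cn m f.
Proof.
move=> /subnK <-; elim: (n - m)%N => [//|k IH]; rewrite addSn => /Cn_pred; exact: IH.
Qed.

Lemma near_derive f g : (\forall t \near (0 : R), f t = g t) ->
  \forall t \near (0 : R), \forall s \near t, f s = g s.
Proof. exact: near_join. Qed.

Lemma CnD n f g : Cn n f -> Cn n g -> Cn n (fun t => f t + g t).
Proof.
elim: n f g => [//|n IH] f g [f1 hf Cf] [g1 hg Cg].
exists (fun t => f1 t + g1 t); last exact: IH.
near=> t; apply: is_deriveD; near: t; [exact: hf|exact: hg].
Unshelve. all: by end_near. Qed.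

Lemma CnN n f : Cn n f -> Cn n (fun t => - f t).
Proof.
elim: n f => [//|n IH] f [f1 hf Cf].
exists (fun t => - f1 t); last exact: IH.
near=> t; apply: is_deriveN; near: t; exact: hf.
Unshelve. all: by end_near. Qed.

Lemma CnM n f g : Cn n f -> Cn n g -> Cn n (fun t => f t * g t).
Proof.
elim: n f g => [//|n IH] f g Cf Cg; have Cf' := Cn_pred Cf; have Cg' := Cn_pred Cg.
case: Cf => f1 hf Cf; case: Cg => g1 hg Cg.
exists (fun t => f1 t * g t + f t * g1 t); last by apply: CnD; exact: IH.
near=> t; have h1 : is_derive t 1 f (f1 t) by near: t; exact: hf.
have h2 : is_derive t 1 g (g1 t) by near: t; exact: hg.
apply: (is_derive_eq (is_deriveM h1 h2)); rewrite /GRing.scale/= addrC; congr (_ + _).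
by rewrite mulrC.
Unshelve. all: by end_near. Qed.

Lemma CnV n f : (\forall t \near (0 : R), f t != 0) -> Cn n f -> Cn n (fun t => (f t)^-1).
Proof.
move=> f0; elim: n f f0 => [//|n IH] f f0 Cf; have Cf' := Cn_pred Cf.
case: Cf => f1 hf Cf.
exists (fun t => - ((f t)^-1 * (f t)^-1 * f1 t)); last first.
  by apply: CnN; apply: CnM => //; apply: CnM; exact: IH.
near=> t; have h1 : is_derive t 1 f (f1 t) by near: t; exact: hf.
have ft : f t != 0 by near: t.
apply: (is_derive_eq (is_deriveV ft h1)).
by rewrite /GRing.scale/= -mulNr -exprVn expr2.
Unshelve. all: by end_near. Qed.

Lemma derive1n_near n f g : (\forall t \near (0 : R), f t = g t) ->
  \forall t \near (0 : R), f^`(n)%classic t = g^`(n)%classic t.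
Proof.
elim: n => [//|n IH] h; rewrite !derive1nS.
have := near_derive (IH h); apply: filterS => t ht.
by rewrite !derive1E; apply: near_eq_derive => //; rewrite oner_neq0.
Qed.

Lemma derive1n_near0 n f g : (\forall t \near (0 : R), f t = g t) ->
  f^`(n)%classic 0 = g^`(n)%classic 0.
Proof. by move=> h; exact: (nbhs_singleton (derive1n_near n h)). Qed.

Lemma derive1nSr n f : f^`(n.+1)%classic = (f^`()%classic)^`(n)%classic.
Proof. by elim: n => [//|n IH]; rewrite derive1nS IH -derive1nS. Qed.

Lemma derive1n_step n f g : (\forall t \near (0 : R), is_derive (t : R) 1 f (g t)) ->
  f^`(n.+1)%classic 0 = g^`(n)%classic 0.
Proof.
move=> h; rewrite derive1nSr; apply: derive1n_near0.
by apply: filterS h => t ht; rewrite derive1E; exact: derive_val.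
Qed.

Lemma derive1nD0 n f g : Cn n f -> Cn n g ->
  (fun t => f t + g t)^`(n)%classic 0 = f^`(n)%classic 0 + g^`(n)%classic 0.
Proof.
elim: n f g => [|n IH] f g; first by rewrite !derive1n0.
move=> [f1 hf Cf] [g1 hg Cg]; rewrite (derive1n_step _ hf) (derive1n_step _ hg) -IH//.
apply: derive1n_step; near=> t; apply: is_deriveD; near: t; [exact: hf|exact: hg].
Unshelve. all: by end_near. Qed.

Lemma derive1nN0 n f : Cn n f -> (fun t => - f t)^`(n)%classic 0 = - f^`(n)%classic 0.
Proof.
elim: n f => [|n IH] f; first by rewrite !derive1n0.
move=> [f1 hf Cf]; rewrite (derive1n_step _ hf) -IH//.
apply: derive1n_step; near=> t; apply: is_deriveN; near: t; exact: hf.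
Unshelve. all: by end_near. Qed.

Lemma pascal_sum n (a b : nat -> R) :
  \sum_(j < n.+1) 'C(n, j)%:R * a j.+1 * b (n - j)%N +
  \sum_(j < n.+1) 'C(n, j)%:R * a j * b (n - j).+1 =
  \sum_(j < n.+2) 'C(n.+1, j)%:R * a j * b (n.+1 - j)%N.
Proof.
rewrite [RHS]big_ord_recl/= bin0 subn0.
under [X in _ = _ + X]eq_bigr => j _ do
  rewrite /bump/= add1n binS natrD mulrDl mulrDl subSS.
rewrite big_split/= [RHS]addrA [RHS]addrC; congr (_ + _).
rewrite [LHS]big_ord_recl/= bin0 subn0; congr (_ + _).
rewrite [RHS]big_ord_recr/= bin_small// !mul0r addr0; apply: eq_bigr => j _.
by rewrite /bump/= add1n subnSK.
Qed.

Lemma leibniz n f g : Cn n f -> Cn n g ->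
  (fun t => f t * g t)^`(n)%classic 0 =
  \sum_(j < n.+1) 'C(n, j)%:R * f^`(j)%classic 0 * g^`(n - j)%classic 0.
Proof.
elim: n f g => [|n IH] f g Cf Cg.
  by rewrite big_ord_recl big_ord0 !derive1n0 bin0 mul1r addr0.
have Cf' := Cn_pred Cf; have Cg' := Cn_pred Cg.
case: Cf => f1 hf Cf; case: Cg => g1 hg Cg.
have h : \forall t \near (0 : R), is_derive (t : R) 1 (fun t => f t * g t) (f1 t * g t + f t * g1 t).
  near=> t; have h1 : is_derive t 1 f (f1 t) by near: t; exact: hf.
  have h2 : is_derive t 1 g (g1 t) by near: t; exact: hg.
  apply: (is_derive_eq (is_deriveM h1 h2)); rewrite /GRing.scale/= addrC; congr (_ + _).
  by rewrite mulrC.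
rewrite (derive1n_step _ h) derive1nD0; [|exact: CnM..].
rewrite !IH// -(pascal_sum n (fun j => f^`(j)%classic 0) (fun j => g^`(j)%classic 0)).
congr (_ + _); apply: eq_bigr => j _; congr (_ * _ * _); first by rewrite (derive1n_step _ hf).
by rewrite (derive1n_step _ hg).
Unshelve. all: by end_near. Qed.

Lemma Cn_cont n f : Cn n.+1 f -> {for 0, continuous f}.
Proof. by move=> [g hg _]; exact: derive_continuous (nbhs_singleton hg). Qed.

Lemma derive1n_seq n (F : nat -> R -> R) :
  (forall j, (j < n)%N -> forall t : R, is_derive t 1 (F j) (F j.+1 t)) ->
  (Cn n (F 0%N)) /\ (forall j, (j <= n)%N -> (F 0%N)^`(j)%classic = F j).
Proof.
move=> h; split.
  elim: n F h => [//|n IH] F h; exists (F 1%N).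
    by near=> t; exact: h.
  by apply: (IH (fun j => F j.+1)) => j jn; exact: h.
elim=> [|j IH] jn; first exact: derive1n0.
rewrite derive1nS IH ?(ltnW jn)//; apply/funext => t; rewrite derive1E.
by have := h j jn t => ?; exact: derive_val.
Unshelve. all: by end_near. Qed.

End NearDerivatives.

Section MomentCumulant.
Context {d} {Omega : measurableType d} {R : realType}.
Variables (P : probability Omega R) (W : {RV P >-> R}) (N : nat).
Hypothesis WN : itg P (fun w => `|W w| ^+ N).

Let mW : measurable_fun setT (W : Omega -> R). Proof. by []. Qed.

Let mWn j : measurable_fun setT (fun w => W w ^+ j).
Proof. exact: measurable_funX. Qed.

Lemma itg_pow j : (j <= N)%N -> itg P (fun w => `|W w| ^+ j).
Proof.
move=> jN; apply: (itg_le (g := fun w => 1 + `|W w| ^+ N)).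
- by apply: measurable_funX; exact: measurableT_comp.
- by apply: itgD => //; exact: itg_cst.
move=> w; rewrite ger0_norm ?exprn_ge0//.
have [h|h] := leP 1 `|W w|.
  by rewrite (le_trans (ler_weXn2l h jN))// lerDr.
have h1 : `|W w| ^+ j <= 1 by rewrite exprn_ile1// ltW.
by rewrite (le_trans h1)// lerDl exprn_ge0.
Qed.

Lemma itg_Wpow j : (j <= N)%N -> itg P (fun w => W w ^+ j).
Proof.
by move=> jN; apply: (itg_le _ (itg_pow jN)) => // w; rewrite normrX.
Qed.

(* differentiating in t multiplies by W and shifts the phase th by pi/2 *)
Definition cosmom (j : nat) (th t : R) : R := ex P (fun w => W w ^+ j * cos (t * W w + th)).

Let mcos j (th t : R) : measurable_fun setT (fun w => W w ^+ j * cos (t * W w + th)).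
Proof.
apply: measurable_funM => //; apply: measurableT_comp.
  by apply: continuous_measurable_fun; exact: continuous_cos.
by apply: measurable_funD => //; exact: measurable_funM.
Qed.

Let cos_le (u : R) : `|cos u| <= 1.
Proof. by rewrite ler_norml cos_geN1 cos_le1. Qed.

Let icos j (th t : R) : (j <= N)%N -> itg P (fun w => W w ^+ j * cos (t * W w + th)).
Proof.
move=> jN; apply: (itg_le _ (itg_pow jN)) => // w.
by rewrite normrM normrX ler_piMr// exprn_ge0.
Qed.

Let dcos (c th t : R) : is_derive t 1 (fun s : R => cos (s * c + th)) (c * cos (t * c + (th + pi / 2))).
Proof.
have h : is_derive t 1 (fun s : R => s * c + th) c.
  have h1 : is_derive t 1 (fun s : R => s * c) c.
    have h := is_deriveM (is_derive_id t (1 : R)) (is_derive_cst c t (1 : R)).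
    by apply: (is_derive_eq h); rewrite /GRing.scale/= mulr0 add0r mulr1.
  have h2 := is_deriveD h1 (is_derive_cst th t (1 : R)).
  by apply: (is_derive_eq h2); rewrite addr0.
have := @is_derive1_comp _ cos (fun s : R => s * c + th) t _ _ (is_derive_cos _) h.
move=> h'; apply: (is_derive_eq h').
by rewrite addrA cosDpihalf mulrC.
Qed.

Lemma cosmom_derive j (th t : R) : (j < N)%N ->
  is_derive t 1 (cosmom j th) (cosmom j.+1 (th + pi / 2) t).
Proof.
move=> jN.
pose f (s : R) w := W w ^+ j * cos (s * W w + th).
have df (s : R) w : is_derive s 1 (f ^~ w) (W w ^+ j.+1 * cos (s * W w + (th + pi / 2))).
  have := is_deriveM (is_derive_cst (W w ^+ j) s (1 : R)) (dcos (W w) th s).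
  by move=> h; apply: (is_derive_eq h); rewrite /GRing.scale/= mulr0 addr0 mulrA -exprSr.
have d1 s w : partial1of2 f s w = W w ^+ j.+1 * cos (s * W w + (th + pi / 2)).
  by rewrite partial1of2E; have := df s w => ?; exact: derive_val.
have It : `]t - 1, t + 1[%classic t by rewrite /= in_itv/= ltrDl gtrBl ltr01.
have h1 x : `]t - 1, t + 1[%classic x -> P.-integrable setT (EFin \o f x).
  by move=> _; exact: (icos _ _ (ltnW jN)).
have h2 x w : `]t - 1, t + 1[%classic x -> setT w -> derivable (f ^~ w) x 1.
  by move=> _ _; have := df x w => -[].
have G0 w : 0 <= `|W w| ^+ j.+1 by rewrite exprn_ge0.
have iG : P.-integrable setT (EFin \o (fun w => `|W w| ^+ j.+1)) by exact: itg_pow.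
have h3 x w : `]t - 1, t + 1[%classic x -> setT w -> `|partial1of2 f x w| <= `|W w| ^+ j.+1.
  by move=> _ _; rewrite d1 normrM normrX ler_piMr// exprn_ge0.
have D := @derivable_under_integral _ _ _ P f setT measurableT t _ _ It h1 h2 _ G0 iG h3.
have E := @differentiation_under_integral _ _ _ P f setT measurableT t _ _ It h1 h2 _ G0 iG h3.
split; first exact: D.
rewrite -derive1E; apply: (etrans E); rewrite /cosmom /ex.
by apply: eq_Rintegral => w _; rewrite d1.
Qed.

Definition mom j : R := ex P (fun w => W w ^+ j).

Let u := cosmom 0 0.
Let v := cosmom 0 (- (pi / 2)).

Let ph (th : R) j : R := th + j%:R * (pi / 2).

Let cosmom_Cn th : Cn N (cosmom 0 th) /\
  (forall j, (j <= N)%N -> (cosmom 0 th)^`(j)%classic = cosmom j (ph th j)).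
Proof.
have := @derive1n_seq _ N (fun j => cosmom j (ph th j)).
have -> : ph th 0 = th by rewrite /ph mul0r addr0.
apply=> j jN t.
have -> : ph th j.+1 = ph th j + pi / 2 by rewrite /ph -natr1 mulrDl mul1r addrA.
exact: cosmom_derive.
Qed.

Let cosmom0 j th : (j <= N)%N -> cosmom j th 0 = mom j * cos th.
Proof.
move=> jN; rewrite /cosmom /mom -exZr; last exact: itg_Wpow.
by congr (ex P _); apply/funext => w; rewrite mul0r add0r.
Qed.

Let cj j : R := cos (j%:R * (pi / 2)).
Let sj j : R := sin (j%:R * (pi / 2)).

Let u_der j : (j <= N)%N -> u^`(j)%classic 0 = mom j * cj j.
Proof. by move=> jN; rewrite (cosmom_Cn 0).2// cosmom0// /ph add0r. Qed.

Let v_der j : (j <= N)%N -> v^`(j)%classic 0 = mom j * sj j.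
Proof.
move=> jN; rewrite (cosmom_Cn _).2// cosmom0// /ph addrC /sj -cosBpihalf//.
Qed.

Let A t : R := complex.Re (clog (charfun P W t)).
Let B t : R := complex.Im (clog (charfun P W t)).

Let charfunE t : charfun P W t = (u t +i* v t)%C.
Proof.
rewrite /charfun; congr (Complex _ _).
  rewrite expectationE /u /cosmom; congr (ex P _); apply/funext => w.
  by rewrite expr0 mul1r addr0.
rewrite expectationE /v /cosmom; congr (ex P _); apply/funext => w.
by rewrite expr0 mul1r cosBpihalf.
Qed.

Let AE t : A t = ln (Num.sqrt (u t ^+ 2 + v t ^+ 2)).
Proof. by rewrite /A charfunE. Qed.

Let BE t : B t = atan (v t / u t).
Proof. by rewrite /B charfunE. Qed.

(** (-i)^j is written with the cosine and sine of j pi / 2, the phases that also occur in the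
    derivatives at 0 of the two parts of the characteristic function. *)
Lemma cumulantE j : cumulant P W j = cj j * A^`(j)%classic 0 + sj j * B^`(j)%classic 0.
Proof.
have h : ((0 -i* 1) ^+ j = cj j -i* sj j :> R[i])%C.
  rewrite /cj /sj; elim: j => [|j IH]; first by rewrite expr0 mul0r cos0 sin0 oppr0.
  have -> : j.+1%:R * (pi / 2) = j%:R * (pi / 2) + pi / 2 :> R by rewrite -natr1 mulrDl mul1r.
  rewrite exprS IH cosDpihalf sinDpihalf.
  rewrite /GRing.mul/=; congr (Complex _ _); rewrite !mul0r ?mulN1r ?mulrN ?mul1r ?sub0r ?add0r ?opprK ?addr0 ?oppr0 //.
by rewrite /cumulant h -/A -/B /= mulNr opprK.
Qed.

Hypothesis N0 : (0 < N)%N.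

Let u_pos : \forall t \near (0 : R), 0 < u t.
Proof.
have cu : {for (0 : R), continuous u}.
  by case: (N) N0 (cosmom_Cn 0).1 => // n _; exact: Cn_cont.
have u0 : u 0 = 1 by rewrite /u cosmom0// cos0 mulr1 /mom (_ : (fun w => _) = cst 1) ?ex_cst.
have := cvgr_gt _ cu; apply; by rewrite u0.
Qed.

(** Differentiating phi' = (log phi)' phi m times at 0 by Leibniz' rule gives the recursion. The
    parts u + i v of phi and A + i B of log phi are treated as real functions. *)
Lemma moment_cumulant m : (m < N)%N ->
  mom m.+1 = \sum_(j < m.+1) 'C(m, j)%:R * cumulant P W j.+1 * mom (m - j)%N.
Proof.
move=> mN; have Cu := (cosmom_Cn 0).1; have Cv := (cosmom_Cn (- (pi / 2))).1.
rewrite -/u in Cu; rewrite -/v in Cv.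
have Cu1 := Cn_le mN Cu; have Cv1 := Cn_le mN Cv.
have Cum := Cn_pred Cu1; have Cvm := Cn_pred Cv1.
case: Cu1 => u' du Cu'; case: Cv1 => v' dv Cv'.
pose D t := u t * u t + v t * v t.
have D0 : \forall t \near (0 : R), 0 < D t.
  near=> t; have ut : 0 < u t by near: t; exact: u_pos.
  by rewrite ltr_pwDl ?mulr_gt0// -expr2 sqr_ge0.
have CD : Cn m D by apply: CnD; apply: CnM.
have CDV : Cn m (fun t => (D t)^-1).
  by apply: CnV => //; apply: filterS D0 => t; exact: lt0r_neq0.
(* [a] and [b] are the real and imaginary parts of phi' / phi, with D the square of the modulus of
   phi. *)
pose a t := (u t * u' t + v t * v' t) * (D t)^-1.
pose b t := (u t * v' t - v t * u' t) * (D t)^-1.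
have Ca : Cn m a by apply: CnM => //; apply: CnD; apply: CnM.
have Cb : Cn m b by apply: CnM => //; apply: CnD; [|apply: CnN]; apply: CnM.
have dA : \forall t \near (0 : R), is_derive (t : R) 1 A (a t).
  have -> : A = @ln R \o (Num.sqrt \o D) by apply/funext => t; rewrite AE !expr2.
  near=> t; have Dt : 0 < D t by near: t.
  have hu : is_derive t 1 u (u' t) by near: t; exact: du.
  have hv : is_derive t 1 v (v' t) by near: t; exact: dv.
  have hD := is_deriveD (is_deriveM hu hu) (is_deriveM hv hv).
  have sD : 0 < Num.sqrt (D t) by rewrite sqrtr_gt0.
  have h1 := @is_derive1_comp _ Num.sqrt D t _ _ (is_derive1_sqrt Dt) hD.
  have h2 := @is_derive1_comp _ (@ln R) (Num.sqrt \o D) t _ _ (is_derive1_ln sD) h1.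
  apply: (is_derive_eq h2); rewrite /a /GRing.scale/= -[in RHS](sqr_sqrtr (ltW Dt)).
  by field; exact: lt0r_neq0.
have dB : \forall t \near (0 : R), is_derive (t : R) 1 B (b t).
  have -> : B = @atan R \o (fun t => v t * (u t)^-1) by apply/funext => t; rewrite BE.
  near=> t; have Dt : 0 < D t by near: t.
  have ut : u t != 0 by rewrite lt0r_neq0//; near: t; exact: u_pos.
  have hu : is_derive t 1 u (u' t) by near: t; exact: du.
  have hv : is_derive t 1 v (v' t) by near: t; exact: dv.
  have hq := is_deriveM hv (is_deriveV ut hu).
  have h2 := @is_derive1_comp _ (@atan R) (fun t => v t * (u t)^-1) t _ _ (is_derive1_atan _) hq.
  apply: (is_derive_eq h2); rewrite /b /D /GRing.scale/=.
  field; rewrite ut/=; move: (lt0r_neq0 Dt); rewrite /D => ->.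
  by [].
have eu : \forall t \near (0 : R), is_derive (t : R) 1 u (a t * u t + - (b t * v t)).
  near=> t; have h : is_derive t 1 u (u' t) by near: t; exact: du.
  have Dt : 0 < D t by near: t.
  apply: (is_derive_eq h); rewrite /a /b; apply/(mulIf (lt0r_neq0 Dt)).
  have -> : u' t * D t = (u t * u' t + v t * v' t) * u t - (u t * v' t - v t * u' t) * v t.
    by rewrite /D; ring.
  by field; exact: lt0r_neq0.
have ev : \forall t \near (0 : R), is_derive (t : R) 1 v (b t * u t + a t * v t).
  near=> t; have h : is_derive t 1 v (v' t) by near: t; exact: dv.
  have Dt : 0 < D t by near: t.
  apply: (is_derive_eq h); rewrite /a /b; apply/(mulIf (lt0r_neq0 Dt)).
  have -> : v' t * D t = (u t * v' t - v t * u' t) * u t + (u t * u' t + v t * v' t) * v t.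
    by rewrite /D; ring.
  by field; exact: lt0r_neq0.
have dAj j : A^`(j.+1)%classic 0 = a^`(j)%classic 0 by exact: derive1n_step.
have dBj j : B^`(j.+1)%classic 0 = b^`(j)%classic 0 by exact: derive1n_step.
have hu : mom m.+1 * cj m.+1 = \sum_(j < m.+1) 'C(m, j)%:R * mom (m - j)%N *
    (A^`(j.+1)%classic 0 * cj (m - j)%N - B^`(j.+1)%classic 0 * sj (m - j)%N).
  rewrite -u_der// (derive1n_step _ eu) derive1nD0; [|exact: CnM|by apply: CnN; exact: CnM].
  rewrite derive1nN0; last exact: CnM.
  rewrite !leibniz// -sumrB; apply: eq_bigr => j _.
  have jm : (m - j <= N)%N by rewrite (leq_trans (leq_subr _ _))// ltnW.
  by rewrite u_der// v_der// -dAj -dBj ?derive1nS; ring.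
have hv : mom m.+1 * sj m.+1 = \sum_(j < m.+1) 'C(m, j)%:R * mom (m - j)%N *
    (B^`(j.+1)%classic 0 * cj (m - j)%N + A^`(j.+1)%classic 0 * sj (m - j)%N).
  rewrite -v_der// (derive1n_step _ ev) derive1nD0; [|exact: CnM..].
  rewrite !leibniz// -big_split/=; apply: eq_bigr => j _.
  have jm : (m - j <= N)%N by rewrite (leq_trans (leq_subr _ _))// ltnW.
  by rewrite u_der// v_der// -dAj -dBj ?derive1nS; ring.
(* The two real identities give the moment times the cosine and times the sine of (m + 1) pi / 2.
   Multiplied by these again and added, they return the moment, and the addition formulas turn the
   derivatives of A and B into the cumulant. *)
have -> : mom m.+1 = mom m.+1 * cj m.+1 * cj m.+1 + mom m.+1 * sj m.+1 * sj m.+1.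
  by rewrite -!mulrA -mulrDr -!expr2 cos2Dsin2 mulr1.
rewrite hu hv !mulr_suml -big_split/=; apply: eq_bigr => j _.
have jm : (j <= m)%N by rewrite -ltnS.
rewrite cumulantE.
have ce : cj j.+1 = cj m.+1 * cj (m - j)%N + sj m.+1 * sj (m - j)%N.
  rewrite -cosB -mulrBl -natrB; last by rewrite (leq_trans (leq_subr _ _)).
  by rewrite (_ : (m.+1 - (m - j))%N = j.+1)//; move: jm; clear; lia.
have se : sj j.+1 = sj m.+1 * cj (m - j)%N - cj m.+1 * sj (m - j)%N.
  rewrite -sinB -mulrBl -natrB; last by rewrite (leq_trans (leq_subr _ _)).
  by rewrite (_ : (m.+1 - (m - j))%N = j.+1)//; move: jm; clear; lia.
by rewrite ce se ?derive1nS; ring.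
Unshelve. all: by end_near. Qed.

End MomentCumulant.

(** * Gaussian integrals *)

Section StdNormalDensity.
Context {R : realType}.
Local Notation mu := (@lebesgue_measure R).
Local Notation phi := (normal_pdf (0 : R) 1).

Lemma normal_prob_ge0_integral (f : R -> \bar R) : measurable_fun (setT : set (measurableTypeR R)) f ->
  (forall x, (0 <= f x)%E) ->
  (\int[normal_prob (0 : R) 1]_x f x = \int[mu]_x (f x * (phi x)%:E))%E.
Proof.
move=> mf f0.
rewrite -(@Radon_Nikodym_SigmaFinite.change_of_variables _ _ _ _ _ (@normal_prob_dominates R 0 1) f setT)//.
apply: ae_eq_integral => //.
- apply: emeasurable_funM => //; apply: (measurable_int mu).
  exact: Radon_Nikodym_SigmaFinite.f_integrable (normal_prob_dominates _ _).
- apply: emeasurable_funM => //=; apply/measurableT_comp => //=.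
  exact: measurable_normal_pdf.
- apply: ae_eqe_mul2l => /=.
  apply: integral_ae_eq => //=.
  + exact: Radon_Nikodym_SigmaFinite.f_integrable (normal_prob_dominates _ _).
  + by apply/measurableT_comp =>//; exact: measurable_normal_pdf.
  + by move=> E E01 mE; rewrite -Radon_Nikodym_SigmaFinite.f_integral//; exact: normal_prob_dominates.
Qed.

Lemma std_normal_ge0_integral (f : R -> \bar R) : measurable_fun setT f ->
  (forall x, (0 <= f x)%E) ->
  (\int[std_normal R]_x f x = \int[mu]_x (f x * (phi x)%:E))%E.
Proof.
move=> mf f0; rewrite -(normal_prob_ge0_integral mf f0).
have mid : measurable_fun (setT : set (measurableTypeR R)) (@id R : measurableTypeR R -> R) by [].
exact: (ge0_integral_pushforward mid (normal_prob (0 : R) 1) measurableT mf (fun x _ => f0 x)).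
Qed.

Lemma std_normal_integrable (f : R -> R) : measurable_fun setT f ->
  itg (std_normal R) f <-> mu.-integrable setT (fun x => (f x * phi x)%:E).
Proof.
move=> mf; have mphi := measurable_normal_pdf (0 : R) 1.
have mabs : measurable_fun setT (fun x => `|f x|%:E).
  by apply/measurable_EFinP; exact: measurableT_comp.
have E : (\int[std_normal R]_x `|f x|%:E = \int[mu]_x `|(f x * phi x)%:E|)%E.
  rewrite (std_normal_ge0_integral mabs); last by move=> x; rewrite lee_fin.
  by apply: eq_integral => x _; rewrite /= normrM (ger0_norm (normal_pdf_ge0 _ _ _)).
split=> [/integrableP[_ h]|/integrableP[_ h]]; apply/integrableP; split.
- by apply/measurable_EFinP; apply: measurable_funM.
- by rewrite -E.
- exact/measurable_EFinP.
- by move: h; rewrite -E.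
Qed.

Lemma std_normal_ex (f : R -> R) : itg (std_normal R) f ->
  ex (std_normal R) f = (\int[mu]_x (f x * phi x))%R.
Proof.
move=> itf; have mf := itg_meas itf.
have iphi := (std_normal_integrable mf).1 itf.
have pos (g : R -> R) : measurable_fun setT g -> (forall x, 0 <= g x) -> 
    (\int[std_normal R]_x (g x)%:E = \int[mu]_x (g x * phi x)%:E)%E.
  by move=> mg g0; rewrite std_normal_ge0_integral//; exact/measurable_EFinP.
have ia := itg_norm itf.
have iaphi := (std_normal_integrable (itg_meas ia)).1 ia.
have ifa : itg (std_normal R) (fun x => f x + `|f x|) by exact: itgD.
(* A difference of two nonnegative integrable functions, for which the formula is known. *)
have -> : f = fun x => (f x + `|f x|) - `|f x| by apply/funext => x; rewrite addrK.
have ifaphi := (std_normal_integrable (itg_meas ifa)).1 ifa.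
have pfa x : 0 <= f x + `|f x| by rewrite addrC -lerBlDr sub0r lerNl -normrN -[X in X <= _]opprK lerNl opprK ler_norm.
rewrite exB// /ex /Rintegral (pos _ (itg_meas ifa) pfa) (pos _ (itg_meas ia) (fun=> normr_ge0 _)).
rewrite -fineB; [|exact: integrable_fin_num..].
congr fine; rewrite -integralB//.
by apply: eq_integral => x _; rewrite -EFinB mulrBl.
Qed.

Definition gker (x : R) : R := expR (- (x ^+ 2) / 2).

Definition gcst : R := normal_peak (1 : R).

Lemma gcst_gt0 : 0 < gcst. Proof. by rewrite normal_peak_gt0// oner_neq0. Qed.

Lemma normal_pdf01 x : phi x = gcst * gker x.
Proof. by rewrite normal_pdfE ?oner_neq0// /normal_fun subr0 expr1n. Qed.

Lemma gker_gt0 x : 0 < gker x. Proof. exact: expR_gt0. Qed.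

Lemma std_normal_gker (f : R -> R) : itg (std_normal R) f ->
  itg mu (fun x => f x * gker x) /\ ex (std_normal R) f = gcst * ex mu (fun x => f x * gker x).
Proof.
move=> itf; have h := (std_normal_integrable (itg_meas itf)).1 itf.
have E : (fun x => f x * gker x) = fun x => gcst^-1 * (f x * phi x).
  by apply/funext => x; rewrite normal_pdf01; field; exact: lt0r_neq0 gcst_gt0.
have i : itg mu (fun x => f x * gker x) by rewrite E; exact: itgZ.
split=> //; rewrite std_normal_ex// -exZ//; congr (fine (integral _ _ _)).
by apply/funext => x /=; rewrite normal_pdf01 mulrCA.
Qed.

End StdNormalDensity.

Section Moments.
Context {R : realType}.

Lemma expR_quad_lb (n : nat) (x : R) : 0 <= x ->
  (1 + x ^+ 2 / (2 * n.+1%:R)) ^+ n.+1 <= expR (x ^+ 2 / 2).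
Proof.
move=> x0; have -> : x ^+ 2 / 2 = (x ^+ 2 / (2 * n.+1%:R)) * n.+1%:R :> R.
  by field.
rewrite expRM_natr lerXn2r ?nnegrE ?addr_ge0 ?expR_ge0 ?divr_ge0 ?sqr_ge0 ?mulr_ge0//.
by rewrite expR_ge1Dx.
Qed.

(** With c = n + 1, exp(x^2/2) >= (1 + x^2/(2c))^c and 1 + |x| <= 8 c (1 + x^2/(2c)), whence the
    constant (8 c)^c. *)
Lemma pow_gker (n : nat) : exists2 C : R, 0 < C & forall x : R, (1 + `|x|) ^+ n * gker x <= C / (1 + `|x|).
Proof.
pose K : R := (8 * n.+1%:R) ^+ n.+1.
have K0 : 0 < K by rewrite exprn_gt0.
exists K => // x; set y := 1 + `|x|.
have y1 : 1 <= y by rewrite lerDl.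
have y0 : 0 < y by exact: lt_le_trans y1.
rewrite ler_pdivlMr// mulrAC -exprSr /gker -real_normK ?num_real// mulNr expRN ler_pdivrMr ?expR_gt0//.
apply: (@le_trans _ _ (K * (1 + `|x| ^+ 2 / (2 * n.+1%:R)) ^+ n.+1)); last first.
  by rewrite ler_wpM2l ?(ltW K0)// expR_quad_lb.
rewrite -exprMn lerXn2r ?nnegrE ?(ltW y0)//.
rewrite mulrDr mulr1 (_ : 8 * n.+1%:R * (_ / _) = 4 * `|x| ^+ 2); last by field.
have n1 : 1 <= n.+1%:R :> R by rewrite ler1n.
rewrite /y; move: (normr_ge0 x) n1; move: (n.+1%:R : R) `|x| => c z z0 c1; nra.
Qed.

Lemma gker_split (x : R) : gker x = gker (x / Num.sqrt 2) * gker (x / Num.sqrt 2).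
Proof.
rewrite /gker -expRD; congr expR; rewrite exprMn exprVn sqr_sqrtr//; by field.
Qed.

Lemma itg_gker_half : itg (@lebesgue_measure R) (fun x => gker (x / Num.sqrt 2)).
Proof.
have s2 : Num.sqrt 2 != 0 :> R by rewrite gt_eqF// sqrtr_gt0.
have h := @integrable_normal_pdf R 0 (Num.sqrt 2).
have E : (fun x => gker (x / Num.sqrt 2)) = (fun x => (normal_peak (Num.sqrt 2 : R))^-1 * normal_pdf 0 (Num.sqrt 2) x).
  apply/funext => x; rewrite normal_pdfE// mulKf ?gt_eqF ?normal_peak_gt0//.
  rewrite /gker /normal_fun subr0; congr expR; rewrite exprMn exprVn sqr_sqrtr//.
  by rewrite mulNr; field.
by rewrite E; exact: itgZ.
Qed.

(** [gker x] is the square of [gker (x / Num.sqrt 2)]: one factor absorbs the polynomial, the other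
    is a multiple of the normal density of variance 2. *)
Lemma itg_pow_gker (n : nat) : itg (@lebesgue_measure R) (fun x => (1 + `|x|) ^+ n * gker x).
Proof.
have [C C0 hC] := pow_gker n.
have mg : measurable_fun (setT : set (measurableTypeR R)) (fun x : R => (1 + `|x|) ^+ n * gker x).
  apply: measurable_funM.
    by apply: measurable_funX; apply: measurable_funD => //; exact: measurableT_comp.
  apply: measurableT_comp => //; apply: measurable_funM => //.
  by apply: measurableT_comp => //; exact: measurable_funX.
apply: (itg_le mg (itgZ (2 ^+ n * C) itg_gker_half)) => x.
have s2 : 0 < Num.sqrt 2 :> R by rewrite sqrtr_gt0.
have s22 : Num.sqrt 2 <= 2 :> R.
  have : Num.sqrt 2 ^+ 2 = 2 :> R by rewrite sqr_sqrtr.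
  by move: s2; move: (Num.sqrt (2 : R)) => z z0 z2; nra.
set y := x / Num.sqrt 2.
have xy : 1 + `|x| <= 2 * (1 + `|y|).
  rewrite /y normrM normfV (ger0_norm (ltW s2)).
  have : `|x| <= 2 * (`|x| / Num.sqrt 2) by rewrite mulrCA ler_peMr// ler_pdivlMr// mul1r.
  move: (`|x| / _) => z; lra.
rewrite ger0_norm ?mulr_ge0 ?exprn_ge0 ?addr_ge0 ?(ltW (gker_gt0 _))//.
rewrite (gker_split x) -/y mulrA ler_wpM2r ?(ltW (gker_gt0 _))//.
apply: (@le_trans _ _ (2 ^+ n * ((1 + `|y|) ^+ n * gker y))).
  rewrite mulrA ler_wpM2r ?(ltW (gker_gt0 _))// -exprMn lerXn2r ?nnegrE ?mulr_ge0 ?addr_ge0//.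
rewrite ler_wpM2l ?exprn_ge0// (le_trans (hC y))// ler_pdivrMr ?ltr_pwDl//.
by rewrite ler_peMr ?(ltW C0)// lerDl.
Qed.

Lemma std_normal_itg_pow (n : nat) : itg (std_normal R) (fun x => (1 + `|x|) ^+ n).
Proof.
apply/std_normal_integrable.
  by apply: measurable_funX; apply: measurable_funD => //; exact: measurableT_comp.
rewrite (_ : (fun x => _) = EFin \o (fun x => gcst * ((1 + `|x|) ^+ n * gker x))).
  exact: itgZ (itg_pow_gker n).
by apply/funext => x /=; rewrite normal_pdf01 mulrCA.
Qed.

End Moments.

(** * Regularity of the solution of Stein's equation *)

Section Barrier.
Context {R : realType}.
Implicit Types (u v g k : R -> R).

(* singles out, among the solutions of u' = x u + g, the one of polynomial growth at +oo *)
Definition small u : Prop := (u n%:R * gker n%:R : R) @[n --> \oo] --> (0 : R).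

Lemma smallD u v : small u -> small v -> small (fun x => u x + v x).
Proof.
move=> su sv; pose f (w : R -> R) (n : nat) := w n%:R * gker n%:R.
have h : (f u + f v) n @[n --> \oo] --> (0 + 0 : R) := cvgD su sv.
rewrite addr0 in h; rewrite /small (_ : (fun n : nat => _) = f u + f v).
  exact: h.
by apply/funext => n; rewrite !fctE /f mulrDl.
Qed.

Lemma smallN u : small u -> small (fun x => - u x).
Proof.
move=> su; pose f (w : R -> R) (n : nat) := w n%:R * gker n%:R.
have h : (- f u) n @[n --> \oo] --> (- 0 : R) := cvgN su.
rewrite oppr0 in h; rewrite /small (_ : (fun n : nat => _) = - f u).
  exact: h.
by apply/funext => n; rewrite !fctE /f mulNr.
Qed.

Lemma small_growth u (C : R) m : (forall x : R, 0 <= x -> `|u x| <= C * (1 + `|x|) ^+ m) -> small u.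
Proof.
move=> hu; have [K K0 hK] := @pow_gker R m.
have C0 : 0 <= C.
  have := hu 0 (lexx _); rewrite normr0 addr0 expr1n mulr1; exact: le_trans.
apply/cvgr0Pnorm_le => e e0; near=> n.
have n0 : 0 <= n%:R :> R by [].
rewrite normrM (ger0_norm (ltW (gker_gt0 _))).
apply: (@le_trans _ _ (C * (K / (1 + n%:R)))).
  apply: (@le_trans _ _ (C * (1 + `|n%:R|) ^+ m * gker n%:R)).
    by rewrite ler_wpM2r ?(ltW (gker_gt0 _))// hu.
  by rewrite -mulrA ler_wpM2l// (le_trans (hK _))// ger0_norm.
rewrite mulrA ler_pdivrMr ?ltr_pwDl//.
apply: (@le_trans _ _ (e * n%:R)); last by rewrite ler_wpM2l ?(ltW e0)// lerDr.
rewrite [leRHS]mulrC -ler_pdivrMr// mulrC.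
near: n; exact: nbhs_infty_ger.
Unshelve. all: by end_near. Qed.

Lemma is_derive_gker (x : R) : is_derive x 1 (@gker R) (- x * gker x).
Proof.
have h : is_derive x 1 (fun y : R => - (y ^+ 2) / 2) (- x).
  have h1 := is_deriveM (is_deriveN (is_derive_pow 1 x)) (is_derive_cst (2^-1 : R) x (1 : R)).
  by apply: (is_derive_eq h1); rewrite /GRing.scale/=; field.
have h2 := @is_derive1_comp _ (@expR R) _ x _ _ (is_derive_expR _) h.
by apply: (is_derive_eq h2); rewrite mulrC.
Qed.

Lemma MVT_le (f f' : R -> R) (a b : R) : a <= b ->
  (forall x : R, a <= x <= b -> is_derive x 1 f (f' x)) ->
  (forall x : R, a <= x <= b -> f' x <= 0) -> f b <= f a.
Proof.
rewrite le_eqVlt => /predU1P[->//|ab] df f0.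
have [x||c] := @MVT R f f' a b ab.
- by rewrite in_itv/= => /andP[h1 h2]; apply: df; rewrite !ltW.
- apply: derivable_within_continuous => x; rewrite in_itv/= => hx.
  by have [] := df x hx.
rewrite in_itv/= => /andP[ac cb] E; rewrite -subr_le0 E mulr_le0_ge0//.
  by apply: f0; rewrite !ltW.
by rewrite subr_ge0 ltW.
Qed.

Lemma small_ge u (x e : R) : small u -> 0 < e -> exists2 y : R, x <= y & `|u y| * gker y < e.
Proof.
move=> su e0.
have h : \forall n \near \oo, `|u n%:R * gker n%:R| < e.
  by move/cvgr0_norm_lt: su => /(_ _ e0).
near \oo => n; exists n%:R; first by near: n; exact: nbhs_infty_ger.
rewrite -[gker _]ger0_norm ?(ltW (gker_gt0 _))// -normrM.
by near: n.
Unshelve. all: by end_near. Qed.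

(** The derivative of (v - u) gker is - (k + g) gker <= 0. If v < u at some point, this product
    stays below a negative number from there on; as v >= 0, u gker is then bounded away from 0,
    against [small u]. *)
Lemma barrier_half u v g k :
  (forall x : R, 0 <= x -> is_derive x 1 u (x * u x + g x)) ->
  (forall x : R, 0 <= x -> is_derive x 1 v (x * v x - k x)) ->
  (forall x : R, 0 <= x -> - g x <= k x) -> (forall x : R, 0 <= x -> 0 <= v x) -> small u ->
  forall x : R, 0 <= x -> u x <= v x.
Proof.
move=> du dv gk v0 su x x0; rewrite leNgt; apply/negP => vu.
have e0 : 0 < (u x - v x) * gker x by rewrite mulr_gt0 ?gker_gt0// subr_gt0.
have [y xy hy] := small_ge x su e0.
have := @MVT_le (fun z => (v z - u z) * gker z) (fun z => (- k z - g z) * gker z) x y xy.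
have -> : ((v y - u y) * gker y <= (v x - u x) * gker x) = false.
  apply/negbTE; rewrite -ltNge; rewrite -opprB mulNr ltrNl.
  apply: le_lt_trans hy; rewrite -mulNr opprB ler_wpM2r ?(ltW (gker_gt0 _))//.
  by rewrite lerBlDr (le_trans (ler_norm _))// lerDl v0// (le_trans x0).
move=> H; suff : false by []; apply: H => z /andP[xz zy]; have z0 := le_trans x0 xz.
  have h := is_deriveM (is_deriveB (dv z z0) (du z z0)) (is_derive_gker z).
  by apply: (is_derive_eq h); rewrite /GRing.scale/= !fctE; ring.
by rewrite mulr_le0_ge0 ?(ltW (gker_gt0 _))// -opprD oppr_le0 -lerBlDr sub0r gk.
Qed.

Lemma barrier u v g k :
  (forall x : R, 0 <= x -> is_derive x 1 u (x * u x + g x)) ->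
  (forall x : R, 0 <= x -> is_derive x 1 v (x * v x - k x)) ->
  (forall x : R, 0 <= x -> `|g x| <= k x) -> (forall x : R, 0 <= x -> 0 <= v x) -> small u ->
  forall x : R, 0 <= x -> `|u x| <= v x.
Proof.
move=> du dv gk v0 su x x0; rewrite ler_norml; apply/andP; split; last first.
  apply: (barrier_half du dv _ v0 su x0) => y y0.
  by rewrite (le_trans _ (gk y y0))// -normrN ler_norm.
rewrite lerNl.
apply: (@barrier_half (fun y => - u y) v (fun y => - g y) k _ dv _ v0 (smallN su) _ x0) => y y0.
  by apply: (is_derive_eq (is_deriveN (du y y0))); rewrite opprD mulrN.
by rewrite opprK (le_trans _ (gk y y0))// ler_norm.
Qed.

Lemma is_derive_pow1 n (x : R) : -1 < x ->
  is_derive x 1 (fun s : R => (1 + s) ^+ n) (n%:R * (1 + x) ^+ n / (1 + x)).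
Proof.
move=> x1; have y0 : 1 + x != 0 by rewrite gt_eqF// -ltrBlDl sub0r.
have h1 : is_derive x 1 (fun s : R => 1 + s) 1.
  by apply: (is_derive_eq (is_deriveD (is_derive_cst (1 : R) x (1 : R)) (is_derive_id x (1 : R)))); rewrite add0r.
case: n => [|n].
  rewrite mul0r mul0r; under eq_fun do rewrite expr0; exact: is_derive_cst.
have := @is_derive1_comp _ _ (fun s : R => 1 + s) x _ _ (is_derive_pow n (1 + x)) h1.
by move=> h; apply: (is_derive_eq h); rewrite mulr1 exprSr mulrA mulfK.
Qed.

Definition growC m : R := 2 * (1 + 2 * (2 * m.+1%:R) ^+ m.+1).

Lemma growC_ge0 m : 0 <= growC m.
Proof. by rewrite /growC mulr_ge0// addr_ge0// mulr_ge0// exprn_ge0// mulr_ge0. Qed.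

Lemma barrier_arith (a b P Q S Q' K : R) : 3 / 4 * K <= P + S -> Q <= Q' ->
  Q' + b <= a / 2 + 3 / 4 * K -> a / 2 <= a - b + P - Q + S.
Proof. by move=> *; lra. Qed.

(** The inequality that makes y^m + K / y a barrier, with y = 1 + x. For y >= 2 (m + 1) the
    derivative of y^m is dominated by y^(m+1) / 2; for smaller y the term K / y makes up for it, and
    K is chosen for the worst case y = 2 (m + 1). *)
Lemma barrier_ineq m (y : R) : 1 <= y ->
  y ^+ m.+1 / 2 <= (y - 1) * y ^+ m + (y - 1) * (2 * (2 * m.+1%:R) ^+ m.+1) / y
    - m%:R * y ^+ m / y + 2 * (2 * m.+1%:R) ^+ m.+1 / y ^+ 2.
Proof.
move=> y1; have y0 : 0 < y by exact: lt_le_trans y1.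
set c : R := m.+1%:R; have c1 : 1 <= c by rewrite ler1n.
have cm : c = m%:R + 1 by rewrite /c natr1.
set K := 2 * (2 * c) ^+ m.+1.
have K0 : 0 <= K by rewrite mulr_ge0// exprn_ge0// mulr_ge0// (le_trans _ c1).
have h1 : 3 / 4 * K <= (y - 1) * K / y + K / y ^+ 2.
  rewrite (_ : _ + _ = K * ((y ^+ 2 - y + 1) / y ^+ 2)); last by field; exact: lt0r_neq0.
  rewrite mulrC ler_wpM2l// ler_pdivlMr ?exprn_gt0//.
  have := sqr_ge0 (y / 2 - 1); rewrite !expr2; clear; nra.
have h2 : m%:R * y ^+ m / y <= m%:R * y ^+ m.
  by rewrite ler_pdivrMr// ler_peMr// mulr_ge0// exprn_ge0// ltW.
have h3 : c * y ^+ m <= y ^+ m.+1 / 2 + 3 / 4 * K.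
  have [yc|yc] := leP (2 * c) y.
    have : c * y ^+ m <= y ^+ m.+1 / 2.
      by rewrite exprS mulrAC ler_wpM2r ?exprn_ge0 ?(ltW y0)// ler_pdivlMr// mulrC.
    by move=> h; rewrite (le_trans h)// lerDl mulr_ge0.
  have : c * y ^+ m <= K / 4.
    rewrite /K exprS (_ : _ / 4 = c * (2 * c) ^+ m); last by field.
    by rewrite ler_wpM2l ?(le_trans _ c1)// lerXn2r ?nnegrE ?(ltW y0) ?(ltW yc)// mulr_ge0// (le_trans _ c1).
  have : 0 <= y ^+ m.+1 / 2 by rewrite divr_ge0// exprn_ge0// ltW.
  move: K0; clear -K; move: (y ^+ m.+1 / 2) (c * y ^+ m) => a b; rewrite -/K; move: (K) => k; lra.
have h4 : (y - 1) * y ^+ m = y ^+ m.+1 - y ^+ m by rewrite mulrBl mul1r exprS.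
rewrite h4; move: h3; rewrite cm mulrDl mul1r.
move: h1 h2; move: (y ^+ m.+1) (y ^+ m) => a b h1 h2 h3.
exact: barrier_arith h1 h2 h3.
Qed.

(** The solution that is small at infinity grows one power slower than g because x u has to balance
    g; the barrier 2 C ((1 + x)^m + K / (1 + x)) makes this quantitative. *)
Lemma growth_half m (C : R) u g :
  (forall x : R, 0 <= x -> is_derive x 1 u (x * u x + g x)) ->
  (forall x : R, 0 <= x -> `|g x| <= C * (1 + x) ^+ m.+1) -> small u ->
  forall x : R, 0 <= x -> `|u x| <= C * growC m * (1 + x) ^+ m.
Proof.
move=> du hg su x x0.
have C0 : 0 <= C by have := hg 0 (lexx _); rewrite addr0 expr1n mulr1; exact: le_trans.
pose K : R := 2 * (2 * m.+1%:R) ^+ m.+1.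
have K0 : 0 <= K by rewrite mulr_ge0// exprn_ge0// mulr_ge0.
pose v (y : R) : R := 2 * C * ((1 + y) ^+ m + K / (1 + y)).
pose k (y : R) : R := 2 * C * ((1 + y - 1) * (1 + y) ^+ m + (1 + y - 1) * K / (1 + y)
    - m%:R * (1 + y) ^+ m / (1 + y) + K / (1 + y) ^+ 2).
have yp (y : R) : 0 <= y -> 0 < 1 + y by move=> y0; rewrite ltr_pwDl.
have dv (y : R) : 0 <= y -> is_derive y 1 v (y * v y - k y).
  move=> y0; have y1 : -1 < y by rewrite (lt_le_trans _ y0)// ltrN10.
  have yn : 1 + y != 0 by rewrite gt_eqF// yp.
  have h1 : is_derive y 1 (fun s : R => 1 + s) 1.
    by apply: (is_derive_eq (is_deriveD (is_derive_cst (1 : R) y (1 : R)) (is_derive_id y (1 : R)))); rewrite add0r.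
  have h2 := is_deriveM (is_derive_cst K y (1 : R)) (is_deriveV yn h1).
  have h3 := is_deriveM (is_derive_cst (2 * C) y (1 : R)) (is_deriveD (is_derive_pow1 m y1) h2).
  apply: (is_derive_eq h3); rewrite /v /k /GRing.scale/=.
  by move: yn; clear; move=> yn; field.
have gk (y : R) : 0 <= y -> `|g y| <= k y.
  move=> y0; apply: (le_trans (hg y y0)).
  have h := @barrier_ineq m (1 + y) _.
  apply: (@le_trans _ _ (2 * C * ((1 + y) ^+ m.+1 / 2))).
    by rewrite le_eqVlt; apply/orP; left; apply/eqP; field.
  by rewrite /k ler_wpM2l ?mulr_ge0// h// lerDl.
have v0 (y : R) : 0 <= y -> 0 <= v y.
  move=> y0; rewrite /v mulr_ge0 ?mulr_ge0// addr_ge0 ?exprn_ge0 ?(ltW (yp y y0))//.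
  by rewrite divr_ge0 ?(ltW (yp y y0)).
apply: (le_trans (barrier du dv gk v0 su x0)).
rewrite /v /growC -/K (_ : C * (2 * (1 + K)) = 2 * C * (1 + K)); last by ring.
rewrite -[leRHS]mulrA ler_wpM2l ?mulr_ge0// mulrDl mul1r lerD2l ler_pdivrMr ?yp//.
by rewrite -mulrA ler_peMr// -exprSr exprn_ege1// lerDl.
Qed.

(* rfl u solves the same equation as u, with g(-x) in place of g(x) *)
Definition rfl u : R -> R := fun x => - u (- x).

Lemma is_derive_rfl u (x du : R) : is_derive (- x) 1 u du -> is_derive x 1 (rfl u) du.
Proof.
move=> h; have h1 : is_derive x 1 (fun y : R => - y) (-1) by exact: is_deriveN.
have h2 := is_deriveN (@is_derive1_comp _ u (fun y : R => - y) x _ _ h h1).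
by apply: (is_derive_eq h2); rewrite mulrN1 opprK.
Qed.

Lemma growth m (C : R) u g :
  (forall x : R, is_derive x 1 u (x * u x + g x)) ->
  (forall x : R, `|g x| <= C * (1 + `|x|) ^+ m.+1) -> small u -> small (rfl u) ->
  forall x : R, `|u x| <= C * growC m * (1 + `|x|) ^+ m.
Proof.
move=> du hg su sr x; have [x0|x0] := leP 0 x.
  rewrite [X in 1 + X]ger0_norm//; apply: (growth_half (fun y _ => du y) _ su x0) => y y0.
  by rewrite (le_trans (hg y))// ger0_norm.
rewrite [X in 1 + X]ltr0_norm//; have x0' : 0 <= - x by rewrite oppr_ge0 ltW.
have -> : `|u x| = `|rfl u (- x)| by rewrite /rfl opprK normrN.
apply: (growth_half (g := fun y => g (- y)) _ _ sr x0') => y y0.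
  by apply: (is_derive_eq (is_derive_rfl (du (- y)))); rewrite /rfl mulNr mulrN.
by rewrite (le_trans (hg _))// normrN ger0_norm.
Qed.

(** The increment D(z) = u(z + e) - u(z) solves the same equation with a right-hand side of order
    e^om. The barrier A / (1 + z) with A = 4 C e^om gives x |D(x)| <= A, the estimate required
    because u' contains the unbounded factor x; the right-hand side adds 2 C e^om. *)
Lemma local_holder (om C : R) u g : om <= 1 ->
  (forall x : R, is_derive x 1 u (x * u x + g x)) ->
  (forall x : R, `|u x| <= C) -> small u ->
  (forall x y : R, `|x - y| <= 1 -> `|g x - g y| <= C * `|x - y| `^ om) ->
  forall x y : R, 0 <= x -> x <= y -> y <= x + 1 ->
    `|(x * u x + g x) - (y * u y + g y)| <= 6 * C * `|x - y| `^ om.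
Proof.
move=> om1 du uC su hg x y x0 xy yx1.
have C0 : 0 <= C by exact: le_trans (uC 0).
have [->|xny] := eqVneq x y; first by rewrite !subrr normr0 mulr_ge0 ?powR_ge0 ?mulr_ge0.
pose e := y - x; have e0 : 0 < e by rewrite subr_gt0 lt_neqAle xny.
have e1 : e <= 1 by rewrite lerBlDl.
have -> : `|x - y| = e by rewrite distrC ger0_norm// ltW.
have ep : e <= e `^ om by rewrite ger1_powR// e0.
pose D (z : R) := u (z + e) - u z.
pose G (z : R) := e * u (z + e) + (g (z + e) - g z).
have dD (z : R) : is_derive z 1 D (z * D z + G z).
  have h1 : is_derive z 1 (fun s : R => s + e) 1.
    by apply: (is_derive_eq (is_deriveD (is_derive_id z (1 : R)) (is_derive_cst e z (1 : R)))); rewrite addr0.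
  have h2 := @is_derive1_comp _ u (fun s : R => s + e) z _ _ (du (z + e)) h1.
  by apply: (is_derive_eq (is_deriveB h2 (du z))); rewrite /D /G mulr1; ring.
have hG (z : R) : `|G z| <= 2 * C * e `^ om.
  rewrite /G (le_trans (ler_normD _ _))// mulr2n [2 * C]mulrDl mul1r [leRHS]mulrDl; apply: lerD.
    by rewrite normrM (ger0_norm (ltW e0)) mulrC; apply: ler_pM => //; exact: ltW.
  have := hg (z + e) z; rewrite addrC addKr (ger0_norm (ltW e0)); exact.
have sD : small D.
  apply: (@small_growth _ (2 * C) 0) => z _; rewrite expr0 mulr1 /D.
  by rewrite (le_trans (ler_normB _ _))// mulr2n mulrDl mul1r lerD.
pose A := 4 * C * e `^ om; have A0 : 0 <= A by rewrite mulr_ge0 ?powR_ge0// mulr_ge0.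
pose v (z : R) := A * (1 + z)^-1.
pose k (z : R) := A * (z / (1 + z) + (1 + z)^-1 ^+ 2).
have dv (z : R) : 0 <= z -> is_derive z 1 v (z * v z - k z).
  move=> z0; have zn : 1 + z != 0 by rewrite gt_eqF// ltr_pwDl.
  have h1 : is_derive z 1 (fun s : R => 1 + s) 1.
    by apply: (is_derive_eq (is_deriveD (is_derive_cst (1 : R) z (1 : R)) (is_derive_id z (1 : R)))); rewrite add0r.
  have h3 := is_deriveM (is_derive_cst A z (1 : R)) (is_deriveV zn h1).
  apply: (is_derive_eq h3); rewrite /v /k /GRing.scale/=.
  by move: zn; clear; move=> zn; field.
have Gk (z : R) : 0 <= z -> `|G z| <= k z.
  move=> z0; apply: (le_trans (hG z)).
  apply: (@le_trans _ _ (A * (1 / 2))).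
    by rewrite le_eqVlt; apply/orP; left; apply/eqP; rewrite /A; field.
  rewrite /k ler_wpM2l//.
  have zp : 0 < 1 + z by rewrite ltr_pwDl.
  rewrite (_ : z / (1 + z) + _ = (z * (1 + z) + 1) / (1 + z) ^+ 2); last by field; exact: lt0r_neq0.
  rewrite ler_pdivlMr ?exprn_gt0//; move: z0; rewrite !expr2; clear; nra.
have v0 (z : R) : 0 <= z -> 0 <= v z.
  by move=> z0; rewrite /v mulr_ge0// invr_ge0 addr_ge0.
have hD := barrier (fun z _ => dD z) dv Gk v0 sD x0.
have -> : (x * u x + g x) - (y * u y + g y) = - (x * D x + G x).
  by rewrite /D /G (_ : x + e = y); [rewrite /e; ring|rewrite /e addrC subrK].
rewrite normrN (le_trans (ler_normD _ _))//.
rewrite (_ : 6 * C * e `^ om = A + 2 * C * e `^ om); last by rewrite /A; ring.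
apply: lerD => //; rewrite normrM (ger0_norm x0).
apply: (@le_trans _ _ (x * v x)); first by rewrite ler_wpM2l.
rewrite /v mulrCA ler_piMr// ler_pdivrMr ?ltr_pwDl// mul1r.
by rewrite lerDr.
Qed.

(** Reflection gives the negative half-line and two points on either side of 0 are compared through
    0, which yields 12 C at distance at most 1. The mean value theorem finds near any x a point
    where |u'| <= 2 C, so |u'| <= 14 C everywhere; this settles larger distances with 28 C. *)
Lemma final_holder (om C : R) u g : 0 <= om <= 1 ->
  (forall x : R, is_derive x 1 u (x * u x + g x)) ->
  (forall x : R, `|u x| <= C) ->
  (forall x y : R, `|x - y| <= 1 -> `|g x - g y| <= C * `|x - y| `^ om) ->
  forall x y : R, `|(x * u x + g x) - (y * u y + g y)| <= 28 * C * `|x - y| `^ om.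
Proof.
move=> /andP[om0 om1] du uC hg.
have C0 : 0 <= C by exact: le_trans (uC 0).
have su : small u by apply: (@small_growth _ C 0) => z _; rewrite expr0 mulr1.
have pos := local_holder om1 du uC su hg.
have neg (x y : R) : y <= 0 -> x <= y -> y <= x + 1 ->
    `|(x * u x + g x) - (y * u y + g y)| <= 6 * C * `|x - y| `^ om.
  move=> y0 xy yx1.
  have h1 (z : R) : is_derive z 1 (rfl u) (z * rfl u z + g (- z)).
    by apply: (is_derive_eq (is_derive_rfl (du (- z)))); rewrite /rfl mulNr mulrN.
  have h2 (z : R) : `|rfl u z| <= C by rewrite normrN.
  have h3 : small (rfl u) by apply: (@small_growth _ C 0) => z _; rewrite expr0 mulr1.
  have h4 (z t : R) : `|z - t| <= 1 -> `|g (- z) - g (- t)| <= C * `|z - t| `^ om.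
    move=> zt; have -> : `|z - t| = `|- z - - t| by rewrite -opprD normrN.
    by apply: hg; rewrite -opprD normrN.
  have e1 : 0 <= - y by rewrite oppr_ge0.
  have e2 : - y <= - x by rewrite lerN2.
  have e3 : - x <= - y + 1 by move: yx1; clear; lra.
  have := @local_holder om C (rfl u) (fun z => g (- z)) om1 h1 h2 h3 h4 (- y) (- x) e1 e2 e3.
  by rewrite /rfl !opprK !mulrNN [- y + x]addrC distrC.
have loc (x y : R) : x <= y -> y <= x + 1 ->
    `|(x * u x + g x) - (y * u y + g y)| <= 12 * C * `|x - y| `^ om.
  move=> xy yx1; have p0 := powR_ge0 `|x - y| om.
  have h6 : 6 * C * `|x - y| `^ om <= 12 * C * `|x - y| `^ om.
    by rewrite ler_wpM2r// ler_wpM2r// ler_nat.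
  have [x0|x0] := leP 0 x; first by rewrite (le_trans (pos x y x0 xy yx1)).
  have [y0|y0] := leP y 0; first by rewrite (le_trans (neg x y y0 xy yx1)).
  apply: (le_trans (ler_distD (0 * u 0 + g 0) _ _)).
  rewrite (_ : 12 * C * `|x - y| `^ om = 6 * C * `|x - y| `^ om + 6 * C * `|x - y| `^ om); last by ring.
  have nxy : `|x - y| = y - x by rewrite distrC ger0_norm// subr_ge0.
  apply: lerD.
    apply: (le_trans (neg x 0 (lexx _) (ltW x0) _)); first by rewrite (le_trans (ltW y0)).
    rewrite ler_wpM2l ?mulr_ge0// powR_mono// subr0 nxy ltr0_norm//.
    by rewrite -[leLHS]add0r lerD2r ltW.
  apply: (le_trans (pos 0 y (lexx _) (ltW y0) _)); first by rewrite (le_trans yx1)// lerD2r ltW.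
  by rewrite ler_wpM2l ?mulr_ge0// powR_mono// sub0r normrN nxy gtr0_norm// lerDl oppr_ge0 ltW.
have bd (x : R) : `|x * u x + g x| <= 14 * C.
  have [c hc E] := @MVT_any _ u (fun z => z * u z + g z) x (x + 1) du.
  move: hc E; rewrite addrAC subrr add0r normr1 mulr1 => hc E.
  have Ec : `|c * u c + g c| <= 2 * C.
    by rewrite -E (le_trans (ler_normB _ _))// mulr2n mulrDl mul1r lerD.
  have Ed : `|(x * u x + g x) - (c * u c + g c)| <= 12 * C.
    apply: (@le_trans _ _ (12 * C * `|x - c| `^ om)); last first.
      rewrite ler_piMr ?mulr_ge0// powR_le1//.
      by rewrite normr_ge0/= distrC.
    have [xc|cx] := leP x c.
      apply: loc => //; rewrite -lerBlDl; exact: le_trans (ler_norm _) hc.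
    rewrite distrC [X in _ * X `^ _]distrC; apply: loc; first exact: ltW.
    by rewrite -lerBlDl; apply: le_trans (ler_norm _) _; rewrite distrC.
  rewrite -(subrK (c * u c + g c) (x * u x + g x)) (le_trans (ler_normD _ _))//.
  rewrite (_ : 14 * C = 12 * C + 2 * C); last by ring.
  exact: lerD.
move=> x y.
have [xy|xy] := leP `|x - y| 1.
  apply: (@le_trans _ _ (12 * C * `|x - y| `^ om)); last first.
    by rewrite ler_wpM2r ?powR_ge0// ler_wpM2r// ler_nat.
  have [h|h] := leP x y.
    by apply: loc => //; rewrite -lerBlDl (le_trans _ xy)// distrC ler_norm.
  rewrite distrC [X in _ * X `^ _]distrC; apply: loc; first exact: ltW.
  by rewrite -lerBlDl (le_trans _ xy)// ler_norm.
apply: (@le_trans _ _ (28 * C)).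
  rewrite (_ : 28 * C = 14 * C + 14 * C); last by ring.
  by rewrite (le_trans (ler_normB _ _))// lerD.
by rewrite ler_peMr ?mulr_ge0// powR_ge1// ltW.
Qed.

End Barrier.

Section RealDominatedConvergence.
Context {d} {T : measurableType d} {R : realType} (mu : {measure set T -> \bar R}).

Lemma ex_dct (F : nat -> T -> R) (f g : T -> R) :
  (forall n, measurable_fun setT (F n)) -> measurable_fun setT f -> itg mu g ->
  (forall x, (F n x : R) @[n --> \oo] --> f x) -> (forall n x, `|F n x| <= g x) ->
  (ex mu (F n) : R) @[n --> \oo] --> ex mu f.
Proof.
move=> mF mf ig cF bF.
have iF n : itg mu (F n) by exact: itg_le (mF n) ig (bF n).
have [] := @dominated_convergence _ _ _ mu setT measurableT (fun n x => (F n x)%:E)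
  (fun x => (f x)%:E) (fun x => (g x)%:E).
- by move=> n; exact/measurable_EFinP.
- exact/measurable_EFinP.
- by apply: aeW => x _; apply: cvg_EFin; [exact: nearW|exact: cF].
- exact: ig.
- by apply: aeW => x n _; rewrite lee_fin.
move=> if_ _ cv; rewrite /ex /Rintegral.
apply: fine_cvg; rewrite fineK; first exact: cv.
exact: integrable_fin_num.
Qed.

End RealDominatedConvergence.

(** * The solution of Stein's equation and its derivatives *)

Section SteinSolution.
Context {R : realType}.
Local Notation mu := (@lebesgue_measure R).
Local Notation gauss := (std_normal R).
Implicit Types (h u : R -> R).

Lemma gaussE_ex h : gaussE h = ex gauss h.
Proof. exact: expectationE. Qed.

Definition pgrow (n : nat) h := exists C : R, forall x : R, `|h x| <= C * (1 + `|x|) ^+ n.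

Lemma pgrow_itg n h : continuous h -> pgrow n h -> itg gauss h.
Proof.
move=> ch [C hC]; apply: (itg_le _ (itgZ C (@std_normal_itg_pow R n))) => //.
exact: continuous_measurable_fun.
Qed.

Section Base.
Variables (h : R -> R) (N : nat).
Hypothesis ch : continuous h.
Hypothesis hn : pgrow N h.

Let c := gaussE h.
Let hg (x : R) := (h x - c) * gker x.

Let ihc : itg gauss (fun x => h x - c).
Proof. by apply: itgB; [exact: pgrow_itg hn|exact: itg_cst]. Qed.

Let ihg : itg mu hg.
Proof. exact: (std_normal_gker ihc).1. Qed.

Let ex_hg : ex mu hg = 0.
Proof.
have := (std_normal_gker ihc).2; rewrite exB; [|exact: pgrow_itg hn|exact: itg_cst].
rewrite ex_cst /c -gaussE_ex subrr => /esym/eqP; rewrite mulf_eq0 gt_eqF ?gcst_gt0//=.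
by move/eqP.
Qed.

Let cgker : continuous (@gker R).
Proof. by move=> x; exact: derive_continuous (is_derive_gker x). Qed.

Let chg : continuous hg.
Proof.
move=> x; apply: cvgM; last exact: cgker.
by apply: cvgB; [exact: ch|exact: cvg_cst].
Qed.

Definition cumg (x : R) : R := (\int[mu]_(w in `]-oo, x]) hg w)%R.

Lemma is_derive_cumg (x : R) : is_derive x 1 cumg (hg x).
Proof.
have i : mu.-integrable `]-oo, (x + 1)] (EFin \o hg).
  by apply: (integrableS measurableT _ _ ihg).
have xx : x < x + 1 by rewrite ltrDl.
have cx : {for x, continuous hg} by exact: chg.
have [d1 d2] := @continuous_FTC1 R hg -oo%O x (x + 1) xx i (ltNyr _) cx.
split; first exact: d1.
by rewrite -derive1E.
Qed.

Let mhg : measurable_fun (setT : set (measurableTypeR R)) hg.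
Proof. exact: continuous_measurable_fun. Qed.

Lemma cumg_ind (x : R) : cumg x = ex mu (fun w => if w <= x then hg w else 0).
Proof.
rewrite /cumg Rintegral_mkcond; congr (fine (integral _ _ _)).
apply/funext => w; congr EFin; rewrite patchE.
by case: ifPn; rewrite ?notin_setE ?inE/= in_itv/=; [move=> ->|move=> /negP/negbTE ->].
Qed.

Let mind (x : R) : measurable_fun (setT : set (measurableTypeR R)) (fun w => if w <= x then hg w else 0).
Proof.
apply: measurable_fun_ifT => //.
exact: measurable_fun_ler.
Qed.

(** Centring by [gaussE h] makes the integral over the whole line vanish, so that [Theta h] is
    negligible at +oo as well as at -oo. *)
Lemma cumg_pinfty : (cumg n%:R : R) @[n --> \oo] --> (0 : R).
Proof.
rewrite -ex_hg; under eq_fun do rewrite cumg_ind.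
apply: (@ex_dct _ _ _ mu _ _ (fun w => `|hg w|)) => //.
- exact: itg_norm ihg.
- move=> w; apply: cvg_near_cst; near=> n.
  by case: ifPn => // /negP; case; near: n; exact: nbhs_infty_ger.
- by move=> n w; case: ifPn; rewrite ?normr0.
Unshelve. all: by end_near. Qed.

Lemma cumg_ninfty : (cumg (- n%:R) : R) @[n --> \oo] --> (0 : R).
Proof.
rewrite -(ex0 mu); under eq_fun do rewrite cumg_ind.
apply: (@ex_dct _ _ _ mu _ _ (fun w => `|hg w|)) => //.
- exact: itg_norm ihg.
- move=> w; apply: cvg_near_cst; near=> n.
  case: ifPn => //; rewrite leNgt => /negP; case; rewrite ltrNl.
  by near: n; exact: nbhs_infty_gtr.
- by move=> n w; case: ifPn; rewrite ?normr0.
Unshelve. all: by end_near. Qed.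

Lemma ThetaE x : Theta h x = expR (x ^+ 2 / 2) * cumg x.
Proof. by []. Qed.

Lemma expR_gker (x : R) : expR (x ^+ 2 / 2) * gker x = 1.
Proof. by rewrite /gker -expRD mulNr subrr expR0. Qed.

Lemma is_derive_Theta (x : R) : is_derive x 1 (Theta h) (x * Theta h x + (h x - gaussE h)).
Proof.
have h1 : is_derive x 1 (fun y : R => y ^+ 2 / 2) x.
  have h1 := is_deriveM (is_derive_pow 1 x) (is_derive_cst (2^-1 : R) x (1 : R)).
  by apply: (is_derive_eq h1); rewrite /GRing.scale/=; field.
have h2 := @is_derive1_comp _ (@expR R) _ x _ _ (is_derive_expR _) h1.
have := is_deriveM h2 (is_derive_cumg x).
move=> h3; apply: (is_derive_eq h3); rewrite ThetaE /GRing.scale/= /hg -/c.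
transitivity (x * (expR (x ^+ 2 / 2) * cumg x) + (h x - c) * (expR (x ^+ 2 / 2) * gker x)).
  by ring.
by rewrite expR_gker mulr1.
Qed.

Lemma Theta_gker x : Theta h x * gker x = cumg x.
Proof. by rewrite ThetaE mulrAC expR_gker mul1r. Qed.

Lemma small_Theta : small (Theta h).
Proof.
have := cumg_pinfty; rewrite /small.
by rewrite (_ : (fun n : nat => cumg n%:R) = fun n : nat => Theta h n%:R * gker n%:R)//; apply/funext => n; rewrite Theta_gker.
Qed.

Lemma gkerN (x : R) : gker (- x) = gker x.
Proof. by rewrite /gker sqrrN. Qed.

Lemma small_rfl_Theta : small (rfl (Theta h)).
Proof.
have h0 : small (fun x => Theta h (- x)).
  have := cumg_ninfty; rewrite /small.
  by rewrite (_ : (fun n : nat => cumg (- n%:R)) = fun n : nat => Theta h (- n%:R) * gker n%:R)//; apply/funext => n; rewrite -gkerN Theta_gker.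
exact: smallN.
Qed.

End Base.

(** The derivative of u gker is e gker, of constant sign, so u gker is monotone; as it tends to 0
    along both ends, it vanishes. This uniqueness is used wherever [Theta] has to be identified. *)
Lemma small_const0 u (e : R) : (forall x : R, is_derive x 1 u (x * u x + e)) ->
  small u -> small (rfl u) -> forall x, u x = 0.
Proof.
wlog e0 : u e / 0 <= e => [hw|].
  move=> du su sr x; have [e0|e0] := leP 0 e; first exact: hw e0 du su sr x.
  have e0' : 0 <= - e by rewrite oppr_ge0 ltW.
  have du' (z : R) : is_derive z 1 (fun y => - u y) (z * - u z + - e).
    by apply: (is_derive_eq (is_deriveN (du z))); rewrite opprD mulrN.
  by apply: oppr_inj; rewrite oppr0; exact: (hw _ _ e0' du' (smallN su) (smallN sr) x).
move=> du su sr x.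
have mono (a b : R) : a <= b -> u a * gker a <= u b * gker b.
  move=> ab; rewrite -lerN2.
  apply: (@MVT_le R (fun z => - (u z * gker z)) (fun z => - (e * gker z)) a b ab) => z _.
    have h := is_deriveN (is_deriveM (du z) (is_derive_gker z)).
    by apply: (is_derive_eq h); rewrite /GRing.scale/=; ring.
  by rewrite oppr_le0 mulr_ge0// ltW// gker_gt0.
have nx : 0 <= `|x| by [].
have le0 : u x * gker x <= 0.
  rewrite leNgt; apply/negP => p0.
  have [y xy hy] := small_ge x su p0.
  have := le_lt_trans (ler_wpM2r (ltW (gker_gt0 y)) (ler_norm (u y))) hy.
  by rewrite ltNge mono.
have ge0 : 0 <= u x * gker x.
  rewrite leNgt; apply/negP => p0; rewrite -oppr_gt0 in p0.
  have [y xy hy] := small_ge (- x) sr p0.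
  have := le_lt_trans (ler_wpM2r (ltW (gker_gt0 y)) (ler_norm (rfl u y))) hy.
  by rewrite /rfl mulNr ltrN2 ltNge -(gkerN y) mono// lerNl.
apply: (mulIf (lt0r_neq0 (gker_gt0 x))); rewrite mul0r.
by apply/eqP; rewrite eq_le le0 ge0.
Qed.

(** The derivatives of a solution f, read off from the equation differentiated j times: F_(j+1) = x
    F_j + j F_(j-1) + H_j. *)
Fixpoint stF (H : nat -> R -> R) (f : R -> R) (c : R) (j : nat) : R -> R :=
  match j with
  | 0%N => f
  | j'.+1 => fun x => x * stF H f c j' x +
      (match j' with
       | 0%N => H 0%N x - c
       | j''.+1 => j'%:R * stF H f c j'' x + H j' x
       end)
  end.

Definition stG H f (c : R) (j : nat) (x : R) : R :=
  if j is j'.+1 then j%:R * stF H f c j' x + H j x else H 0%N x - c.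

Lemma stFS H f c j (x : R) : stF H f c j.+1 x = x * stF H f c j x + stG H f c j x.
Proof. by case: j. Qed.

Lemma stF_derive k H f (c : R) :
  (forall x : R, is_derive x 1 f (x * f x + (H 0%N x - c))) ->
  (forall j, (j < k)%N -> forall x : R, is_derive x 1 (H j) (H j.+1 x)) ->
  forall j, (j <= k)%N -> forall x : R, is_derive x 1 (stF H f c j) (stF H f c j.+1 x).
Proof.
move=> df dH; elim/ltn_ind => -[_ _ x|j IH jk x]; first exact: df.
have hj : is_derive x 1 (stF H f c j) (stF H f c j.+1 x) by apply: IH => //; exact: ltnW.
have hx := is_deriveM (is_derive_id x (1 : R)) hj.
have -> : stF H f c j.+1 = fun y => y * stF H f c j y + stG H f c j y.
  by apply/funext => y; exact: stFS.
have hG : is_derive x 1 (stG H f c j) (j%:R * stF H f c j x + H j.+1 x).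
  case: j IH jk {hj hx} => [|j] IH jk.
    have := is_deriveB (dH 0%N jk x) (is_derive_cst c x (1 : R)).
    by move=> h; apply: (is_derive_eq h); rewrite subr0 mul0r add0r.
  have hj : is_derive x 1 (stF H f c j) (stF H f c j.+1 x).
    by apply: IH; [exact: leqW|exact: ltnW (ltnW jk)].
  have h := is_deriveD (is_deriveM (is_derive_cst (j.+1%:R : R) x (1 : R)) hj) (dH _ jk x).
  by apply: (is_derive_eq h); rewrite /GRing.scale/= mulr0 addr0.
have h := is_deriveD hx hG.
rewrite (stFS _ _ _ j.+1) /stG; apply: (is_derive_eq h).
move: (stF H f c j.+1 x) (stF H f c j x) (H j.+1 x) => a b e.
by rewrite /GRing.scale/= -natr1; ring.
Qed.

Section Regularity.
Variables (k : nat) (om : R).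
Hypothesis om01 : 0 < om <= 1.

Let om0 : 0 < om. Proof. by case/andP: om01. Qed.
Let om1 : om <= 1. Proof. by case/andP: om01. Qed.

(** The class controls only the k-th derivative, so bounds uniform over it require the Taylor
    polynomial at 0 to be removed. It is put back in [stein_regular]. *)
Definition normalized H := cls k om H /\ forall j, (j <= k)%N -> H j 0 = 0.

Lemma normalized_growth H j (x : R) : normalized H -> (j <= k)%N ->
  `|H j x| <= `|x| `^ ((k - j)%:R + om).
Proof.
move=> [cH H0] jk; have := @holder_taylor _ (k - j) om _ 0 x om0 (cls_shift jk cH).
rewrite add0r big1 ?subr0 ?add0n// => v _.
rewrite H0 ?mulr0//; have := ltn_ord v; move: jk; move: (nat_of_ord v) => w; clear; lia.
Qed.

Lemma normalized_growth1 H j (x : R) : normalized H -> (j <= k)%N ->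
  `|H j x| <= (1 + `|x|) ^+ (k - j).+1.
Proof.
move=> nH jk; apply: (le_trans (normalized_growth x nH jk)).
have x1 : 1 <= 1 + `|x| by rewrite lerDl.
apply: (@le_trans _ _ ((1 + `|x|) `^ ((k - j)%:R + om))).
  by rewrite powR_mono ?addr_ge0 ?(ltW om0)// lerDr.
rewrite -powR_mulrn ?(le_trans _ x1)// ler_powR//.
by rewrite -natr1 lerD2l.
Qed.

Definition sol H j := stF H (Theta (H 0%N)) (gaussE (H 0%N)) j.

Lemma normalized_pgrow H : normalized H -> pgrow k.+1 (H 0%N).
Proof.
by move=> nH; exists 1 => x; rewrite mul1r (le_trans (normalized_growth1 x nH (leq0n _)))// subn0.
Qed.

Lemma normalized_cont H : normalized H -> continuous (H 0%N).
Proof. by move=> [cH _]; exact: cls_continuous om0 cH (leq0n _). Qed.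

Lemma normalized_gaussE H : normalized H ->
  `|gaussE (H 0%N)| <= ex gauss (fun x => (1 + `|x|) ^+ k.+1).
Proof.
move=> nH; rewrite gaussE_ex; apply: ex_norm_le.
- exact: pgrow_itg (normalized_cont nH) (normalized_pgrow nH).
- exact: std_normal_itg_pow.
- by move=> x; rewrite (le_trans (normalized_growth1 x nH (leq0n _)))// subn0.
Qed.

Lemma sol_derive H j (x : R) : normalized H -> (j <= k)%N ->
  is_derive x 1 (sol H j) (sol H j.+1 x).
Proof.
move=> nH jk; apply: (stF_derive (k := k)) => //; last by case: nH => -[].
by move=> y; exact: is_derive_Theta (normalized_cont nH) (normalized_pgrow nH) y.
Qed.

Definition solG H j := stG H (Theta (H 0%N)) (gaussE (H 0%N)) j.

(** The j-th derivative of the solution solves an equation of the same type whose right-hand side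
    involves the derivative of order j - 1 and H j. Both grow with exponent k - j + 1 at most, and
    the solution gains one power by [growth]. *)
Lemma sol_bound j : (j <= k)%N -> exists2 B, 0 <= B &
  forall H, normalized H -> [/\ small (sol H j), small (rfl (sol H j)),
    (forall x : R, `|sol H j x| <= B * (1 + `|x|) ^+ (k - j)) &
    (forall x : R, `|solG H j x| <= B * (1 + `|x|) ^+ (k - j).+1)].
Proof.
elim/ltn_ind: j => j IH jk.
have key : exists2 B, 0 <= B & forall H, normalized H ->
   forall x : R, `|solG H j x| <= B * (1 + `|x|) ^+ (k - j).+1.
  case: j IH jk => [|j] IH jk.
    exists (1 + ex gauss (fun x => (1 + `|x|) ^+ k.+1)).
      by rewrite addr_ge0// ex_ge0// => x; rewrite exprn_ge0// addr_ge0.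
    move=> H nH x; rewrite /solG /stG (le_trans (ler_normB _ _))// mulrDl mul1r.
    apply: lerD; first exact: normalized_growth1.
    apply: (le_trans (normalized_gaussE nH)); rewrite ler_peMr//.
      by rewrite ex_ge0// => y; rewrite exprn_ge0// addr_ge0.
    by rewrite exprn_ege1// lerDl.
  have [B B0 hB] := IH j (ltnSn j) (ltnW jk).
  exists (j.+1%:R * B + 1); first by rewrite addr_ge0// mulr_ge0.
  move=> H nH x; rewrite /solG /stG (le_trans (ler_normD _ _))// mulrDl mul1r.
  apply: lerD; last exact: normalized_growth1.
  rewrite normrM ger0_norm// -mulrA ler_wpM2l//.
  by have [_ _ h _] := hB H nH; rewrite subnSK// (le_trans (h x)).
have [B B0 hB] := key.
have Bg : 0 <= B * growC (k - j) by rewrite mulr_ge0// growC_ge0.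
exists (B + B * growC (k - j)); first by rewrite addr_ge0.
move=> H nH.
have [s1 s2] : small (sol H j) /\ small (rfl (sol H j)).
  case: j IH jk key hB Bg => [|j] IH jk key hB Bg.
    split; first exact: small_Theta (normalized_cont nH) (normalized_pgrow nH).
    exact: small_rfl_Theta (normalized_cont nH) (normalized_pgrow nH).
  have [B' B'0 hB'] := IH j (ltnSn j) (ltnW jk).
  have [_ _ h1 h2] := hB' H nH.
  have hB'' (x : R) : `|sol H j.+1 x| <= (2 * B') * (1 + `|x|) ^+ (k - j).+1.
    rewrite /sol stFS (le_trans (ler_normD _ _))// mulrDl mul1r mulrDl; apply: lerD; last exact: h2.
    rewrite normrM exprSr mulrA mulrC; apply: ler_pM => //; first exact: h1.
    by rewrite lerDr.
  split; apply: (@small_growth _ _ (2 * B') (k - j).+1) => x _; first exact: hB''.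
  by rewrite /rfl normrN (le_trans (hB'' _))// normrN.
split => //.
  move=> x; apply: (@le_trans _ _ (B * growC (k - j) * (1 + `|x|) ^+ (k - j))); last first.
    by rewrite ler_wpM2r ?exprn_ge0 ?addr_ge0// lerDr.
  apply: (growth _ _ s1 s2 (g := solG H j)); last exact: hB.
  by move=> y; apply: (is_derive_eq (sol_derive y nH jk)); exact: stFS.
by move=> x; rewrite (le_trans (hB _ nH x))// ler_wpM2r ?exprn_ge0 ?addr_ge0// lerDl.
Qed.

(** The k-th derivative of the solution is bounded, and the right-hand side of its equation is
    Hoelder of order om at distances up to 1: the lower derivative in it has a bounded derivative.
    So [final_holder] applies. *)
Lemma sol_holder : exists2 A, 0 < A & forall H, normalized H ->
  forall x y : R, `|sol H k.+1 x - sol H k.+1 y| <= A * `|x - y| `^ om.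
Proof.
have [B B0 hB] := sol_bound (leqnn k).
pose C := 1 + k%:R * B + B.
have C0 : 0 < C by rewrite /C -addrA ltr_pwDl// addr_ge0// mulr_ge0.
exists (28 * C); first by rewrite mulr_gt0.
move=> H nH x y; have [_ _ hs _] := hB H nH.
have bd (z : R) : `|sol H k z| <= B by rewrite (le_trans (hs z))// subnn expr0 mulr1.
rewrite /sol !stFS.
apply: (@final_holder _ om C (sol H k) (solG H k)).
- by rewrite (ltW om0) om1.
- by move=> z; apply: (is_derive_eq (sol_derive z nH (leqnn k))); exact: stFS.
- by move=> z; rewrite (le_trans (bd z))// /C lerDr addr_ge0// mulr_ge0.
move=> {}x {}y xy.
have [->|xny] := eqVneq x y; first by rewrite !subrr normr0 mulr_ge0 ?powR_ge0// ltW.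
have d0 : 0 < `|x - y| by rewrite normr_gt0 subr_eq0.
have dom : `|x - y| <= `|x - y| `^ om by rewrite ger1_powR// d0.
have hH : `|H k x - H k y| <= `|x - y| `^ om by case: nH => -[_ h] _; exact: h.
have p0 := powR_ge0 `|x - y| om.
have key : `|solG H k x - solG H k y| <= `|x - y| `^ om + k%:R * B * `|x - y| `^ om.
  rewrite /solG /stG; case E : k hH => [|j] hH.
    rewrite !mul0r addr0 (_ : _ - _ - _ = H 0%N x - H 0%N y)//; ring.
  have jk : (j <= k)%N by rewrite E.
  have [c _ hc] := MVT_any y x (fun z => sol_derive z nH jk).
  rewrite (_ : _ - _ = (H j.+1 x - H j.+1 y) + j.+1%:R * (sol H j x - sol H j y)); last by rewrite /sol; ring.
  rewrite (le_trans (ler_normD _ _))// lerD// normrM ger0_norm// -mulrA ler_wpM2l//.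
  by rewrite hc normrM -E; apply: ler_pM.
rewrite /C !mulrDl mul1r; apply: (le_trans key).
by rewrite lerDl mulr_ge0.
Qed.

(** Induction on the degree: the term -a X^n in the solution cancels the leading term a X^(n+1) of q
    and leaves a n X^(n-1), of lower degree. The constant c is the Gaussian mean of q. *)
Lemma poly_stein n (q : {poly R}) : (size q <= n.+1)%N ->
  exists (s : {poly R}) (c : R), (size s <= n)%N /\ forall x : R, s^`().[x] = x * s.[x] + (q.[x] - c).
Proof.
elim/ltn_ind: n q => -[|n] IH q sq.
  exists 0, q.[0]; rewrite size_poly0; split => // x.
  by rewrite deriv0 !horner0 mulr0 add0r (size1_polyC sq) !hornerC subrr.
pose a := q`_n.+1.
pose q2 : {poly R} := q - a *: 'X^(n.+1) + (a * n%:R) *: 'X^(n.-1).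
have sq2 : (size q2 <= n.+1)%N.
  apply/leq_sizeP => j jn; rewrite !coefD coefN !coefZ !coefXn.
  have [->|jn1] := eqVneq j n.+1.
    have -> : (n.+1 == n.-1) = false by clear; lia.
    by rewrite mulr1 mulr0 addr0 subrr.
  rewrite (gtn_eqF (_ : n.-1 < j)%N) ?mulr0 ?subr0 ?addr0; last by move: jn; clear; lia.
  move/leq_sizeP: sq => -> //; move: jn jn1; clear; lia.
have [s [c [ss hs]]] := IH n (ltnSn n) q2 sq2.
exists (s - a *: 'X^n), c; split.
  rewrite (leq_trans (size_polyD _ _))// geq_max (leq_trans ss)//= size_polyN.
  by rewrite (leq_trans (size_scale_leq _ _))// size_polyXn.
move=> x; rewrite derivB derivZ derivXn !(hornerD, hornerN, hornerZ, hornerMn) hs /q2.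
rewrite !(hornerD, hornerN, hornerZ, hornerMn, hornerXn) -[in LHS]mulr_natl exprS; ring.
Qed.

Lemma derivn_is_derive (s : {poly R}) j (x : R) :
  is_derive x 1 (fun y => s^`(j).[y]) s^`(j.+1).[x].
Proof. by rewrite derivnS; exact: is_derive_poly. Qed.

Lemma poly_pgrow (s : {poly R}) : exists C, forall x : R, `|s.[x]| <= C * (1 + `|x|) ^+ size s.
Proof.
exists (\sum_(i < size s) `|s`_i|) => x; rewrite horner_coef (le_trans (ler_norm_sum _ _ _))//.
rewrite mulr_suml; apply: ler_sum => i _; rewrite normrM ler_wpM2l// normrX.
have x1 : 1 <= 1 + `|x| by rewrite lerDl.
apply: (@le_trans _ _ ((1 + `|x|) ^+ i)).
  by rewrite lerXn2r ?nnegrE ?addr_ge0// lerDr.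
by rewrite ler_weXn2l// ltnW.
Qed.

Lemma poly_small (s : {poly R}) : small (fun x => s.[x]) /\ small (rfl (fun x => s.[x])).
Proof.
have [C hC] := poly_pgrow s; split; apply: (@small_growth _ _ C (size s)) => x _ //.
by rewrite /rfl normrN (le_trans (hC _))// normrN.
Qed.

Lemma smallB u v : small u -> small v -> small (fun x => u x - v x).
Proof. by move=> su sv; apply: smallD => //; exact: smallN. Qed.

(** Subtracting the Taylor polynomial at 0 does not change the increments of the k-th derivative.
    The polynomial part is solved by a polynomial of degree at most k, whose (k + 1)-th derivative
    is 0 and does not disturb the Hoelder bound. *)
Theorem stein_regular : exists2 A, 0 < A & forall H, cls k om H ->
  exists F, [/\ F 0%N = Theta (H 0%N),
    (forall j, (j < k.+1)%N -> forall x : R, is_derive x 1 (F j) (F j.+1 x)) &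
    (forall x y : R, `|F k.+1 x - F k.+1 y| <= A * `|x - y| `^ om)].
Proof.
have [A A0 hA] := sol_holder; exists A => // H cH.
pose Q : {poly R} := \poly_(v < k.+1) (H v 0 / v`!%:R).
have sQ : (size Q <= k.+1)%N by exact: size_poly.
pose H' j x := H j x - Q^`(j).[x].
have nH' : normalized H'.
  split; first split.
  - move=> j jk x; case: cH => dH _.
    exact: (is_deriveB (dH j jk x) (derivn_is_derive Q j x)).
  - move=> x y; rewrite /H'.
    have -> : Q^`(k) = (Q^`(k)`_0)%:P.
      apply: size1_polyC; apply/leq_sizeP => j j1.
      rewrite coef_derivn nth_default ?mul0rn// (leq_trans sQ)//.
      by move: j1; clear; lia.
    rewrite !hornerC (_ : _ - _ = H k x - H k y); last by ring.
    by case: cH => _; exact.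
  - move=> j jk; rewrite /H' horner_coef0 coef_derivn addn0 coef_poly ltnS jk.
    by rewrite ffactnn -[X in _ - X]mulr_natr divfK ?subrr// pnatr_eq0 -lt0n fact_gt0.
have [s [c [ss hs]]] := poly_stein sQ.
exists (fun j x => sol H' j x + s^`(j).[x]); split.
- apply/funext => x; rewrite /sol/=; symmetry.
  have pH : pgrow k.+1 (H 0%N).
    have [C C0 hC] := cls_growth om0 cH; exists C => z; rewrite (le_trans (hC z))// ler_wpM2l//.
    have x1 : 1 <= 1 + `|z| by rewrite lerDl.
    by rewrite -powR_mulrn ?(le_trans _ x1)// ler_powR// -natr1 lerD2l.
  have cH0 : continuous (H 0%N) by exact: cls_continuous om0 cH (leq0n _).
  pose u x := Theta (H 0%N) x - (Theta (H' 0%N) x + s.[x]).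
  apply/eqP; rewrite -subr_eq0; apply/eqP; rewrite -/(u x).
  (* The difference of the two candidates solves u' = x u + constant and is negligible at both ends,
     so it is 0. *)
  apply: (@small_const0 u (c - gaussE (H 0%N) + gaussE (H' 0%N))).
  + move=> z.
    have h1 := is_derive_Theta cH0 pH z.
    have h2 := is_derive_Theta (normalized_cont nH') (normalized_pgrow nH') z.
    have h3 := derivn_is_derive s 0 z.
    have h := is_deriveB h1 (is_deriveD h2 h3).
    have e : H' 0%N z = H 0%N z - Q.[z] by rewrite /H' derivn0.
    by apply: (is_derive_eq h); rewrite derivnS derivn0 hs e /u; ring.
  + apply: smallB; first exact: small_Theta cH0 pH.
    apply: smallD; first exact: small_Theta (normalized_cont nH') (normalized_pgrow nH').
    exact: (poly_small s).1.
  + rewrite (_ : rfl u = fun x => rfl (Theta (H 0%N)) x - (rfl (Theta (H' 0%N)) x + rfl (fun x => s.[x]) x)).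
      apply: smallB; first exact: small_rfl_Theta cH0 pH.
      apply: smallD; last exact: (poly_small s).2.
      exact: small_rfl_Theta (normalized_cont nH') (normalized_pgrow nH').
    by apply/funext => z; rewrite /rfl /u; ring.
- move=> j jk x; have h := sol_derive x nH' jk.
  exact: (is_deriveD h (derivn_is_derive s j x)).
- move=> x y; rewrite (_ : s^`(k.+1) = 0) ?horner0 ?addr0; first exact: hA.
  by rewrite derivn_poly0// (leq_trans ss).
Qed.

End Regularity.

End SteinSolution.

(** * The expansion with cumulants *)

Section GoodField.
Context {R : realType} {dim : nat}.
Variables (p K c0 B : R) (r : \bar R).
Hypothesis dim0 : (0 < dim)%N.
Hypothesis p0 : 0 < p.
Hypothesis pr : ((p + 2)%:E < r)%E.
Hypothesis K0 : 0 < K.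
Hypothesis c00 : 0 < c0.

(** The hypotheses on one field in quantitative form. All constants below depend only on p, K, c0,
    B, r and the dimension, which makes the estimates uniform along the sequence. *)
Definition good_field (d : measure_display) (Omega : measurableType d)
    (T : {fset 'rV[int]_dim}) (P : probability Omega R) (X : T -> {RV P >-> R}) : Prop :=
  [/\ T != fset0, (forall i, ('N[P]_r[EFin \o X i] <= K%:E)%E),
      c0 * #|` T|%:R <= sum_var X, mix_sum X p r <= B &
      forall i, ('E_P[X i] = 0)%E].

(** The power of the cardinal comes from |T| sites, each with weights s of order |T|^(-1/2), through
    |T| s^(q+om+1). For q = ceil p and om = omega p the whole is |T|^(-p/2) + M. *)
Definition Eerr (d : measure_display) (Omega : measurableType d)
    (T : {fset 'rV[int]_dim}) (P : probability Omega R) (X : T -> {RV P >-> R})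
    (om : R) (q : nat) : R :=
  #|` T|%:R `^ (- ((q%:R + om - 1) / 2)) * (1 + mixS X p om r q).

Section OneField.
Context {d : measure_display} {Omega : measurableType d}.
Variables (T : {fset 'rV[int]_dim}) (P : probability Omega R) (X : T -> {RV P >-> R}).
Hypothesis gX : good_field X.

Let T0 : T != fset0. Proof. by case: gX. Qed.
Let card1 : 1 <= #|` T|%:R :> R. Proof. exact: card_fset_gt0. Qed.
Let card0 : 0 < #|` T|%:R :> R. Proof. exact: lt_le_trans card1. Qed.

Lemma good_var_gt0 : 0 < sum_var X.
Proof. by case: gX => _ _ h _ _; apply: lt_le_trans h; exact: mulr_gt0. Qed.

Let sg := Num.sqrt (sum_var X).
Let sg0 : 0 < sg. Proof. by rewrite sqrtr_gt0 good_var_gt0. Qed.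
Let s := K / sg.
Let s0 : 0 < s. Proof. exact: divr_gt0. Qed.
Let x (j : T) (w : Omega) : R := K^-1 * X j w.
Let mx j : measurable_fun setT (x j).
Proof. by apply: measurable_funM. Qed.
Let gx j : gauge P 1 r (fun w => `|x j w|).
Proof. by case: gX => _ XK _ _ _; apply: Lnorm_gauge (XK j) => //; exact: r_gt1 p0 pr. Qed.

Local Notation W := (normalized_sum X).
Local Notation WV := (normalized_sum X : {RV P >-> R}).

Let WE : W = lin x s finset.setT.
Proof.
apply/funext => w; rewrite -WallE /Wall /normalized_sum mulr_sumr; apply: eq_bigr => j _.
by rewrite /x mulrA; congr (_ * _); rewrite /s mulrAC divff ?mul1r// gt_eqF.
Qed.

Lemma itg_W_powR (t : R) : 0 <= t <= p + 2 -> itg P (fun w => (1 + `|W w|) `^ t).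
Proof.
move=> /andP[t0 tp]; apply: (dom_itg p0 pr gx t0 tp).
have h : dom x 1 (fun w => 1 + `|W w|).
  apply: domD; first by apply: (dom_le _ (dom_cst x 1)); exact: ler01.
  rewrite WE; apply: (dom_bnd _ (lin_dom mx (ltW s0) finset.setT)).
    by apply: measurableT_comp => //; exact: (lin_dom mx (ltW s0) finset.setT).1.
  by move=> w; rewrite normr_id.
have := dom_pow t0 h; rewrite mul1r.
rewrite (_ : (fun w => `|1 + `|W w| | `^ t) = (fun w => (1 + `|W w|) `^ t))//.
by apply/funext => w; rewrite ger0_norm// addr_ge0.
Qed.

Lemma itg_W_pow N : N%:R <= p + 2 -> itg P (fun w => `|W w| ^+ N).
Proof.
move=> Np; have h : (0 : R) <= N%:R <= p + 2 by apply/andP; split.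
apply: (itg_le _ (itg_W_powR h)).
  by apply: measurable_funX; exact: measurableT_comp.
move=> w; rewrite ger0_norm ?exprn_ge0// powR_mulrn ?addr_ge0//.
by rewrite lerXn2r ?nnegrE ?addr_ge0// lerDr.
Qed.

Lemma itg_W_cls q om G j : 0 < om -> q%:R + om <= p + 2 -> cls q om G -> (j <= q)%N ->
  itg P (fun w => G j (W w)).
Proof.
move=> om0 qp hG jq; have [C C0 hC] := cls_growth om0 (cls_shift jq hG).
rewrite add0n in hC.
have h : 0 <= (q - j)%:R + om <= p + 2.
  rewrite addr_ge0 ?(ltW om0)//= (le_trans _ qp)// lerD2r ler_nat; exact: leq_subr.
apply: (itg_le _ (itgZ C (itg_W_powR h))) => //.
by apply: (measurableT_comp (cls_meas om0 hG jq)).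
Qed.

Lemma itg_WW_cls q om G : 0 < om -> q.+1%:R + om <= p + 2 -> cls q om G ->
  itg P (fun w => W w * G 0%N (W w)).
Proof.
move=> om0 qp hG; have [C C0 hC] := cls_growth om0 hG.
have h : 0 <= q.+1%:R + om <= p + 2 by rewrite addr_ge0 ?(ltW om0)//=.
apply: (itg_le _ (itgZ C (itg_W_powR h))).
  by apply: measurable_funM => //; apply: (measurableT_comp (cls_meas om0 hG (leq0n _))).
move=> w; rewrite normrM -natr1 addrAC powR_addr ?ltr_pwDl// powRr1 ?addr_ge0//.
rewrite mulrA mulrC; apply: ler_pM => //; by rewrite lerDr.
Qed.

Lemma mom0 : mom WV 0 = 1.
Proof. by rewrite /mom (_ : (fun w => _) = cst 1) ?ex_cst. Qed.

Lemma mom1 : mom WV 1 = 0.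
Proof.
have iX i : itg P (X i).
  have p1 : 1 <= p + 2 by have := p0; lra.
  have := dom_itg p0 pr gx ler01 p1 (dom_x mx i).
  move=> /(itgZ K); rewrite (_ : (fun w => _) = X i)//.
  by apply/funext => w; rewrite /x mulVKf ?gt_eqF.
rewrite /mom (_ : (fun w => _) = fun w => sg^-1 * \sum_i X i w).
  rewrite exZ; last by apply: itg_sum => i _.
  rewrite ex_sum; last by move=> i _.
  rewrite big1 ?mulr0// => i _; rewrite -expectationE.
  by case: gX => _ _ _ _ ->.
by apply/funext => w; rewrite expr1.
Qed.

Lemma mom2 : mom WV 2 = 1.
Proof.
have s20 := good_var_gt0.
pose S w := \sum_i X i w.
have SW w : S w = sg * W w by rewrite /normalized_sum mulVKf// gt_eqF.
have eS : fine 'E_P[S]%E = 0.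
  rewrite expectationE (_ : S = fun w => sg * W w ^+ 1); last by apply/funext => w; rewrite expr1 SW.
  have iW : itg P (fun w => W w ^+ 1).
    apply: (itg_Wpow (N := 1)) => //; apply: itg_W_pow; have := p0; lra.
  by rewrite exZ//; have := mom1; rewrite /mom => ->; rewrite mulr0.
have E : sum_var X = ex P (fun w => S w ^+ 2).
  rewrite /sum_var -/S /variance unlock eS expectationE; congr (ex P _).
  apply/funext => w; rewrite [LHS](_ : _ = (S w - 0) * (S w - 0))//.
  by rewrite subr0 expr2.
have iW2 : itg P (fun w => W w ^+ 2).
  apply: (itg_Wpow (N := 2)) => //; apply: itg_W_pow; have := p0; lra.
have : ex P (fun w => S w ^+ 2) = sum_var X * mom WV 2.
  rewrite (_ : (fun w => S w ^+ 2) = fun w => sum_var X * W w ^+ 2); first exact: exZ.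
  by apply/funext => w; rewrite SW exprMn sqr_sqrtr// ltW.
rewrite -E => h; apply: (mulfI (lt0r_neq0 s20)).
by rewrite mulr1 -h.
Qed.

Definition fieldC om q : R :=
  (KC p + q.+1%:R * stepC om (2 ^+ dim) (KC p) q.+1) * @errC R dim om q *
  (K / Num.sqrt c0) `^ (q%:R + om + 1).

Let mixS0 om q : 0 <= mixS X p om r q. Proof. exact: mixS_ge0. Qed.

Lemma Eerr_ge0 om q : 0 <= Eerr X om q.
Proof. by rewrite /Eerr mulr_ge0 ?powR_ge0// addr_ge0. Qed.

Lemma fieldC_pos om q : 0 < om <= 1 -> 0 <= (KC p + q.+1%:R * stepC om (2 ^+ dim) (KC p) q.+1) * @errC R dim om q.
Proof.
move=> om01; apply: mulr_ge0; last by rewrite /errC addr_ge0// mulr_ge0 ?powR_ge0// mulr_ge0 ?powR_ge0.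
apply: addr_ge0; first exact: KC_ge0.
by rewrite mulr_ge0//; apply: (stepC_ge0 om01 _ (lexx _)); rewrite exprn_ege1// ler1n.
Qed.

Lemma fieldC_ge0 om q : 0 < om <= 1 -> 0 <= fieldC om q.
Proof. by move=> om01; rewrite mulr_ge0 ?fieldC_pos ?powR_ge0. Qed.

Lemma scale_bound (e : R) : 0 <= e ->
  #|` T|%:R * s `^ (e + 1) <= (K / Num.sqrt c0) `^ (e + 1) * #|` T|%:R `^ (- ((e - 1) / 2)).
Proof.
move=> e0; have e1 : 0 <= e + 1 by rewrite addr_ge0.
have sc0 : 0 < Num.sqrt c0 by rewrite sqrtr_gt0.
have sT : 0 < Num.sqrt (#|` T|%:R : R) by rewrite sqrtr_gt0.
have sle : s <= K / Num.sqrt c0 * (Num.sqrt #|` T|%:R)^-1.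
  rewrite /s -mulrA -invfM ler_wpM2l ?(ltW K0)//.
  rewrite lef_pV2 ?posrE ?mulr_gt0//.
  rewrite mulrC -sqrtrM ?(ltW c00)//.
  rewrite ler_sqrt; first by rewrite mulrC; case: gX.
  exact: ltW good_var_gt0.
apply: (@le_trans _ _ (#|` T|%:R * (K / Num.sqrt c0 * (Num.sqrt #|` T|%:R)^-1) `^ (e + 1))).
  by rewrite ler_wpM2l// powR_mono// ltW.
rewrite powRM ?invr_ge0 ?(ltW sT)//; last by rewrite ltW// divr_gt0.
rewrite mulrCA ler_wpM2l ?powR_ge0// -powR12_sqrt// -powRN -powRrM.
rewrite -[X in X * _]powRr1// -powR_addr// le_eqVlt; apply/orP; left; apply/eqP.
congr (_ `^ _); by field.
Qed.

Section Coefficients.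
Variables (om : R) (q : nat).
Hypothesis om01 : 0 < om <= 1.
Hypothesis qp : q.+1%:R + om <= p + 2.
Hypothesis qc : (q < (ceiln p).+1)%N.

Let om0 : 0 < om. Proof. by case/andP: om01. Qed.

Lemma field_expansion_E : exists c : nat -> R, forall G, cls q om G ->
  `|ex P (fun w => W w * G 0%N (W w)) - \sum_(j < q.+1) c j * ex P (fun w => G j (W w))|
  <= fieldC om q * Eerr X om q.
Proof.
have [_ XK _ _ _] := gX.
have [c hc] := field_expansion dim0 T0 p0 pr om01 qp qc K0 XK good_var_gt0.
exists c => G hG; apply: (le_trans (hc G hG)).
rewrite -[leRHS]mulrA ler_wpM2l ?fieldC_pos//.
rewrite /Eerr [leRHS]mulrA ler_wpM2r ?addr_ge0//.
by rewrite scale_bound// addr_ge0// ltW.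
Qed.

Let monG (l : R) (m j : nat) (y : R) : R := l * ((m ^_ j)%:R * y ^+ (m - j)).

Let monG_cls l m : (m <= q)%N -> cls q om (monG l m).
Proof.
move=> mq; split.
  move=> j jq y.
  have h : is_derive y 1 (fun y : R => y ^+ (m - j)) ((m - j)%:R * y ^+ (m - j.+1)).
    case E : (m - j)%N => [|n].
      by rewrite mul0r; under eq_fun do rewrite expr0; exact: is_derive_cst.
    by have := is_derive_pow n y; rewrite -E subnS E.
  have h2 := is_derive_scale (l * (m ^_ j)%:R) h.
  rewrite /monG (_ : (fun y : R => _) = (fun y : R => l * (m ^_ j)%:R * y ^+ (m - j))); last first.
    by apply/funext => z; rewrite mulrA.
  apply: (is_derive_eq h2); rewrite ffactnSr natrM; ring.
move=> y z; rewrite /monG.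
have -> : (m - q = 0)%N by move: mq; clear; lia.
by rewrite !expr0 subrr normr0 powR_ge0.
Qed.

Lemma le_all0 (a D : R) : (forall l : R, `|l * a| <= D) -> a = 0.
Proof.
move=> h; have [//|a0] := eqVneq a 0.
have := h ((D + 1) / a); rewrite divfK// => /(le_trans (ler_norm _)).
by move=> hh; exfalso; move: hh; rewrite leNgt ltrDl ltr01.
Qed.

(** The multiples l y^m with m <= q have a constant q-th derivative, so all of them obey the same
    error bound, and the defect of the identity times any l stays bounded. *)
Lemma coef_moment (c : nat -> R) : (forall G, cls q om G ->
  `|ex P (fun w => W w * G 0%N (W w)) - \sum_(j < q.+1) c j * ex P (fun w => G j (W w))|
  <= fieldC om q * Eerr X om q) ->
  forall m, (m <= q)%N -> mom WV m.+1 = \sum_(j < m.+1) c j * (m ^_ j)%:R * mom WV (m - j).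
Proof.
move=> hc m mq.
have Nq : itg P (fun w => `|W w| ^+ q.+1).
  by apply: itg_W_pow; rewrite (le_trans _ qp)// lerDl ltW.
have iW j : (j <= q.+1)%N -> itg P (fun w => W w ^+ j) by exact: (itg_Wpow (W := WV) Nq).
apply/eqP; rewrite -subr_eq0; apply/eqP.
apply: (@le_all0 _ (fieldC om q * Eerr X om q)) => l.
have := hc _ (monG_cls l mq).
have -> : ex P (fun w => W w * monG l m 0 (W w)) = l * mom WV m.+1.
  rewrite /mom -exZ; last by exact: iW.
  congr (ex P _); apply/funext => w.
  have E (y : R) : y * monG l m 0 y = l * y ^+ m.+1.
    by rewrite /monG ffactn0 mul1r subn0 exprS; ring.
  exact: E.
have -> : \sum_(j < q.+1) c j * ex P (fun w => monG l m j (W w)) =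
   l * \sum_(j < m.+1) c j * (m ^_ j)%:R * mom WV (m - j).
  have mq1 : (m.+1 <= q.+1)%N by [].
  rewrite mulr_sumr (big_ord_widen _ (fun j => l * (c j * (m ^_ j)%:R * mom WV (m - j))) mq1).
  rewrite [RHS]big_mkcond/=; apply: eq_bigr => j _.
  have mj : (m - j <= q.+1)%N by rewrite (leq_trans (leq_subr _ _))// ltnW.
  have e : ex P (fun w => monG l m j (W w)) = l * (m ^_ j)%:R * mom WV (m - j).
    rewrite /mom -exZ; last by exact: iW.
  congr (ex P _); apply/funext => w.
    by rewrite /monG mulrA.
  rewrite e; case: ltnP => [_|mj']; first by ring.
  by rewrite ffact_small// mulr0 !mul0r mulr0.
by rewrite -mulrBr.
Qed.

(** [coef_moment] and [moment_cumulant] are the same triangular system, in which c m appears with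
    the nonzero factor m!. *)
Lemma coef_cumulant (c : nat -> R) : (forall G, cls q om G ->
  `|ex P (fun w => W w * G 0%N (W w)) - \sum_(j < q.+1) c j * ex P (fun w => G j (W w))|
  <= fieldC om q * Eerr X om q) ->
  forall m, (m <= q)%N -> c m = cumulant P W m.+1 / m`!%:R.
Proof.
move=> hc; elim/ltn_ind => m IH mq.
have Nq : itg P (fun w => `|WV w| ^+ q.+1).
  by apply: itg_W_pow; rewrite (le_trans _ qp)// lerDl ltW.
have mq1 : (m < q.+1)%N by [].
have h1 := coef_moment hc mq; have h2 := moment_cumulant Nq (ltn0Sn q) mq1.
move: h1; rewrite h2 !big_ord_recr/= subnn mom0 !mulr1 binn mul1r ffactnn.
rewrite (_ : \sum_(j < m) _ = \sum_(j < m) c j * (m ^_ j)%:R * mom WV (m - j)).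
  by move/addrI => ->; rewrite mulfK// pnatr_eq0 -lt0n fact_gt0.
apply: eq_bigr => j _; rewrite IH//; last by rewrite (leq_trans (ltnW (ltn_ord j))).
rewrite -bin_ffact natrM; have : (j`!%:R : R) != 0 by rewrite pnatr_eq0 -lt0n fact_gt0.
by move: (j`!%:R : R) => f f0; field.
Qed.

Lemma cumulant_expansion G : cls q om G ->
  `|ex P (fun w => W w * G 0%N (W w)) -
    \sum_(j < q.+1) cumulant P W j.+1 / j`!%:R * ex P (fun w => G j (W w))|
  <= fieldC om q * Eerr X om q.
Proof.
move=> hG; have [c hc] := field_expansion_E; have := hc G hG.
rewrite (eq_bigr (fun j : 'I_q.+1 => cumulant P W j.+1 / j`!%:R * ex P (fun w => G j (W w))))//.
by move=> j _; rewrite (coef_cumulant hc)// -ltnS.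
Qed.

End Coefficients.

Lemma cumulant1 : cumulant P W 1 = 0.
Proof.
have N1 : itg P (fun w => `|WV w| ^+ 1) by apply: itg_W_pow; have := p0; lra.
have := moment_cumulant N1 (ltn0Sn 0) (ltn0Sn 0).
by rewrite big_ord1 bin0 mul1r mom0 mulr1 mom1.
Qed.

Lemma cumulant2 : cumulant P W 2 = 1.
Proof.
have N2 : itg P (fun w => `|WV w| ^+ 2) by apply: itg_W_pow; have := p0; lra.
have := moment_cumulant N2 (ltn0Sn 1) (ltnSn 1).
rewrite big_ord_recr big_ord1/= cumulant1 mulr0 mul0r add0r binn mul1r subnn mom0 mulr1.
by rewrite mom2.
Qed.

(** The test function y^(j+1) / (j+1)! has the identity as its j-th derivative, so it belongs to
    level j with Hoelder exponent 1. By the moment recursion all terms of its expansion cancel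
    except kappa_(j+2) / (j+1)!, which is therefore bounded by the error. *)
Lemma cumulant_bound j : (0 < j)%N -> (j < ceiln p)%N -> j%:R <= p ->
  `|cumulant P W (j + 2)| <= j.+1`!%:R * fieldC 1 j * Eerr X 1 j.
Proof.
move=> j0 jc jp; have o1 : 0 < (1 : R) <= 1 by rewrite ltr01 lexx.
have qp : j.+1%:R + 1 <= p + 2 by rewrite -natr1; move: jp; lra.
pose G (i : nat) (y : R) := y ^+ (j.+1 - i) / (j.+1 - i)`!%:R.
have cG : cls j 1 G.
  split; last first.
    by move=> y z; rewrite /G subSnn !expr1 !divr1 powRr1.
  move=> i ij y; rewrite /G.
  have -> : (j.+1 - i = (j - i).+1)%N by rewrite subSn// ltnW.
  have h := is_derive_scale ((j - i).+1`!%:R^-1) (is_derive_pow (j - i) y).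
  rewrite (_ : (fun y : R => _) = (fun y : R => (j - i).+1`!%:R^-1 * y ^+ (j - i).+1)); last first.
    by apply/funext => z; rewrite mulrC.
  apply: (is_derive_eq h); rewrite subSS factS natrM.
  have f0 : ((j - i)`!%:R : R) != 0 by rewrite pnatr_eq0 -lt0n fact_gt0.
  move: ((j - i)`!%:R : R) f0 => f f0; field; rewrite f0/=.
  by rewrite addrC natr1 pnatr_eq0.
have jc1 : (j < (ceiln p).+1)%N by rewrite ltnS ltnW.
have := cumulant_expansion o1 qp jc1 cG.
have N2 : itg P (fun w => `|WV w| ^+ j.+2).
  by apply: itg_W_pow; rewrite (le_trans _ qp)// natr1.
have h := moment_cumulant N2 (ltn0Sn _) (ltnSn _).
have iW i : (i <= j.+2)%N -> itg P (fun w => W w ^+ i) by exact: (itg_Wpow (W := WV) N2).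
have F0 n : (n`!%:R : R) != 0 by rewrite pnatr_eq0 -lt0n fact_gt0.
have -> : ex P (fun w => W w * G 0%N (W w)) = (j.+1`!%:R)^-1 * mom WV j.+2.
  rewrite /mom -exZ; last by exact: iW.
  congr (ex P _); apply/funext => w.
  have E (y : R) : y * G 0%N y = j.+1`!%:R^-1 * y ^+ j.+2.
    by rewrite /G subn0 [in RHS]exprS; ring.
  exact: E.
rewrite h big_ord_recr/= subnn mom0 binn mulr1 mul1r mulrDr.
rewrite mulr_sumr addrAC -sumrB big1 ?add0r; last first.
  move=> i _; have ij : (i <= j.+1)%N by rewrite ltnW.
  have -> : ex P (fun w => G i (W w)) = (j.+1 - i)`!%:R^-1 * mom WV (j.+1 - i).
    rewrite /mom -exZ; last by apply: iW; rewrite (leq_trans (leq_subr _ _)).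
    by congr (ex P _); apply/funext => w; rewrite /G mulrC.
  have := bin_fact ij => /(congr1 (fun n => n%:R : R)); rewrite !natrM => <-.
  have := F0 i; have := F0 (j.+1 - i)%N.
  have b0 : ('C(j.+1, i)%:R : R) != 0 by rewrite pnatr_eq0 -lt0n bin_gt0.
  move: b0; move: (i`!%:R : R) ((j.+1 - i)`!%:R : R) ('C(j.+1, i)%:R : R) => a b c c0' b0 a0.
  by field; rewrite c0' b0 a0.
rewrite addn2 normrM ger0_norm ?invr_ge0// => hh.
by rewrite -mulrA -ler_pdivrMl ?ltr0n ?fact_gt0.
Qed.

End OneField.
End GoodField.

(** * Products and interpolation of weighted mixing sums *)

Section WeightedSums.
Context {R : realType}.
Variables (A : nat -> R) (L : nat).
Hypothesis A0 : forall l, 0 <= A l.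

Definition wsum (u : R) : R := \sum_(1 <= l < L.+1) l%:R `^ u * A l.

Lemma wsum_ge0 u : 0 <= wsum u.
Proof. by apply: sumr_ge0 => l _; rewrite mulr_ge0 ?powR_ge0. Qed.

Lemma wsum_mono u v : u <= v -> wsum u <= wsum v.
Proof.
move=> uv; apply: ler_sum_nat => l /andP[l1 _].
by rewrite ler_wpM2r// ler_powR// ler1n.
Qed.

(** For each pair of indices l^u m^v is at most l^(u+v) + m^(u+v), and in either case the other
    index is left with the weight D. *)
Lemma wsum_prod D u v : 0 <= u -> 0 <= v ->
  wsum (D + u) * wsum (D + v) <= 2 * wsum D * wsum (D + (u + v)).
Proof.
move=> u0 v0.
pose g l : R := l%:R `^ D * A l.
have g0 l : 0 <= g l by rewrite mulr_ge0 ?powR_ge0.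
have E w : wsum (D + w) = \sum_(1 <= l < L.+1) g l * l%:R `^ w.
  apply: eq_big_nat => l /andP[l1 _]; rewrite powR_addr ?ltr0n// /g; ring.
rewrite !E big_distrlr/=.
have -> : 2 * wsum D * (\sum_(1 <= l < L.+1) g l * l%:R `^ (u + v)) =
   \sum_(1 <= l < L.+1) \sum_(1 <= m < L.+1) g l * g m * (l%:R `^ (u + v) + m%:R `^ (u + v)).
  have W0 : wsum D = \sum_(1 <= l < L.+1) g l by [].
  set Q := \sum_(1 <= l < L.+1) g l * _.
  have h1 : \sum_(1 <= l < L.+1) \sum_(1 <= m < L.+1) g l * g m * l%:R `^ (u + v) = wsum D * Q.
    rewrite W0 mulrC /Q big_distrlr/=; apply: eq_bigr => l _; apply: eq_bigr => m _; ring.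
  have h2 : \sum_(1 <= l < L.+1) \sum_(1 <= m < L.+1) g l * g m * m%:R `^ (u + v) = wsum D * Q.
    rewrite W0 /Q big_distrlr/=; apply: eq_bigr => l _; apply: eq_bigr => m _; ring.
  rewrite -mulrA mulr2n mulrDl mul1r -{1}h1 -h2 -big_split/=; apply: eq_bigr => l _.
  by rewrite -big_split/=; apply: eq_bigr => m _; rewrite mulrDr.
apply: ler_sum_nat => l /andP[l1 _]; apply: ler_sum_nat => m /andP[m1 _].
rewrite mulrACA ler_wpM2l ?mulr_ge0//.
have [lm|ml] := leP (l%:R : R) m%:R.
  apply: (@le_trans _ _ (m%:R `^ (u + v))); last by rewrite lerDr powR_ge0.
  by rewrite powR_addr ?ltr0n// ler_wpM2r ?powR_ge0// powR_mono.
apply: (@le_trans _ _ (l%:R `^ (u + v))); last by rewrite lerDl powR_ge0.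
by rewrite powR_addr ?ltr0n// ler_wpM2l ?powR_ge0// powR_mono// ltW.
Qed.

Lemma powR_le1D (t la : R) : 0 <= t -> 0 <= la <= 1 -> t `^ la <= 1 + t.
Proof.
move=> t0 /andP[l0 l1]; have [t1|t1] := leP 1 t.
  apply: (@le_trans _ _ (t `^ 1)); first by rewrite ler_powR.
  by rewrite powRr1// lerDr.
by rewrite (le_trans (powR_le1 l0 _)) ?lerDl// t0 ltW.
Qed.

(** A weak form of Hoelder's inequality, from the pointwise bound l^(la z) <= Y^la (1 + l^z / Y)
    with Y the sum of weight D + z. If Y = 0, every A l in the range vanishes. *)
Lemma wsum_interp D z la : 0 <= la <= 1 ->
  wsum (D + la * z) <= (1 + wsum D) * wsum (D + z) `^ la.
Proof.
move=> la01; set Y := wsum (D + z).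
have Y0 : 0 <= Y by exact: wsum_ge0.
have [Yp|Yn] := ltP 0 Y; last first.
  have YE : Y = 0 by apply/eqP; rewrite eq_le Yn Y0.
  have h0 l : (0 < l < L.+1)%N -> A l = 0.
    move=> lL; have : l%:R `^ (D + z) * A l <= Y.
      rewrite /Y /wsum (big_rem l)/=; last by rewrite mem_index_iota.
      by rewrite lerDl sumr_ge0// => m _; rewrite mulr_ge0 ?powR_ge0.
    rewrite YE => h; have l0 : 0 < l%:R :> R by rewrite ltr0n; case/andP: lL.
    by apply/eqP; rewrite eq_le A0 andbT -(pmulr_rle0 _ (powR_gt0 (D + z) l0)).
  rewrite /wsum (eq_big_nat _ _ (F2 := fun=> 0)) ?big1_eq; last by move=> l lL; rewrite h0 ?mulr0.
  by rewrite mulr_ge0 ?powR_ge0// addr_ge0 ?wsum_ge0.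
apply: (@le_trans _ _ (\sum_(1 <= l < L.+1) Y `^ la * (l%:R `^ D * A l + l%:R `^ (D + z) * A l / Y))).
  apply: ler_sum_nat => l /andP[l1 _]; have l0 : 0 < l%:R :> R by rewrite ltr0n.
  rewrite !powR_addr// mulrC powRrM.
  have lz : 0 <= l%:R `^ z :> R by exact: powR_ge0.
  have -> : l%:R `^ la `^ z = (l%:R `^ z / Y * Y) `^ la :> R.
    by rewrite (divfK (lt0r_neq0 Yp)) -powRrM [la * z]mulrC powRrM.
  rewrite powRM ?divr_ge0//.
  have := powR_le1D (divr_ge0 lz Y0) la01.
  move: (powR_ge0 l%:R D) (A0 l) (powR_ge0 Y la) => a0 b0 c0 h.
  apply: (@le_trans _ _ (A l * (l%:R `^ D * ((1 + l%:R `^ z / Y) * Y `^ la)))).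
    by rewrite ler_wpM2l// ler_wpM2l// ler_wpM2r.
  by rewrite le_eqVlt; apply/orP; left; apply/eqP; ring.
rewrite -mulr_sumr big_split/= -mulr_suml -/(wsum D) -/(wsum (D + z)) -/Y divff ?gt_eqF//.
by rewrite mulrC addrC.
Qed.

End WeightedSums.

(** * The Edgeworth expansion *)

Section Compositions.

(* Gamma k and the empty sequence, grouped by the last entry, which is the operator applied first; f is fuel *)
Fixpoint cs (f k : nat) : seq (seq nat) :=
  if f is f'.+1 then [::] :: [seq rcons t s | s <- iota 1 k, t <- cs f' (k - s)]
  else [:: [::]].

Lemma cs_mem f k t : (k <= f)%N -> (t \in cs f k) = all (fun s => 0 < s)%N t && (sumn t <= k)%N.
Proof.
elim: f k t => [|f IH] k t kf.
  move: kf; rewrite leqn0 => /eqP ->; rewrite inE; case: t => [//|a t] /=.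
  by case: a => [|a] //=; rewrite andbF.
rewrite /= inE; case/lastP: t => [//|t s].
have -> : (rcons t s == [::]) = false by case: t.
rewrite /= all_rcons sumn_rcons; apply/allpairsPdep/idP => [[s' [t' []]]|].
  rewrite mem_iota => /andP[s0 sk] ht /rcons_inj[-> ->].
  move: ht; rewrite IH; last by move: s0 sk kf; clear; lia.
  by case/andP=> -> /=; move: s0 sk; clear; lia.
case/andP => /andP[s0 ht] hs; exists s, t.
have h1 : (k - s <= f)%N by move: s0 kf; clear; lia.
by rewrite mem_iota IH// ht/=; split => //; move: s0 hs; clear; lia.
Qed.

Lemma cs_uniq f k : uniq (cs f k).
Proof.
elim: f k => [//|f IH] k /=; apply/andP; split.
  by apply/negP => /allpairsPdep[s [t [_ _]]]; case: t.
apply: allpairs_uniq_dep; [exact: iota_uniq|by move=> s _; exact: IH|].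
by move=> [s t] [s' t'] _ _ /= /rcons_inj[-> ->].
Qed.

Lemma sum_cs {V : zmodType} f k (F : seq nat -> V) :
  \sum_(t <- cs f.+1 k) F t = F [::] + \sum_(j < k) \sum_(t <- cs f (k - j.+1)) F (rcons t j.+1).
Proof.
rewrite /= big_cons; congr (_ + _); rewrite big_allpairs_dep.
have -> : iota 1 k = index_iota 1 k.+1 by rewrite /index_iota subn1.
by rewrite big_add1 big_mkord.
Qed.

Lemma Gamma_cs {R : realType} f k (kappa : nat -> R) h : (k <= f)%N ->
  gaussE h + edgeworth_sum k kappa h =
  \sum_(s <- cs f k) ((-1) ^+ size s *
     (\prod_(sj <- s) (kappa (sj + 2)%N / (sj.+1)`!%:R)) * gaussE (Theta_comp s h)).
Proof.
move=> kf; have [r E] : exists r, cs f k = [::] :: r by case: (f) => [|f'] /=; eexists.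
have ur : uniq ([::] :: r) by rewrite -E cs_uniq.
rewrite E big_cons expr0 big_nil !mul1r; congr (_ + _).
rewrite /edgeworth_sum (_ : Gamma k = [set` r]); first by rewrite -fsbig_seq//; case/andP: ur.
apply/seteqP; split => t.
  case=> st at_ sk; have : t \in cs f k by rewrite cs_mem// at_ sk.
  by rewrite E inE => /predU1P[tE|//]; rewrite tE in st.
move=> tr; have : t \in cs f k by rewrite E inE tr orbT.
rewrite cs_mem// => /andP[at_ sk]; split => //.
by case: t tr {at_ sk} => // tr; move: ur => /=; rewrite tr.
Qed.

End Compositions.

Section EdgeworthExpansion.
Context {R : realType} {dim : nat}.
Variables (p K c0 B : R) (r : \bar R).
Hypothesis dim0 : (0 < dim)%N.
Hypothesis p0 : 0 < p.
Hypothesis pr : ((p + 2)%:E < r)%E.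
Hypothesis K0 : 0 < K.
Hypothesis c00 : 0 < c0.
Local Notation good := (good_field p K c0 B r).

Section OneField.
Context {d : measure_display} {Omega : measurableType d}.
Variables (T : {fset 'rV[int]_dim}) (P : probability Omega R) (X : T -> {RV P >-> R}).
Hypothesis gX : good X.

Let L := @side dim R T.
Let A l := mix_term X p r l.
Let A0 l : 0 <= A l. Proof. exact: powR_ge0. Qed.
Let D : R := dim%:R - 1.
Let card1 : 1 <= #|` T|%:R :> R.
Proof. by apply: card_fset_gt0; case: gX. Qed.
Let card0 : 0 < #|` T|%:R :> R. Proof. exact: lt_le_trans card1. Qed.

Lemma mixSE om q : mixS X p om r q = wsum A L (dim%:R * (q%:R + om) - om).
Proof. by []. Qed.

Lemma wsumD : wsum A L D <= B.
Proof.
case: gX => _ _ _ h _; apply: le_trans h; rewrite /mix_sum /wsum.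
rewrite le_eqVlt; apply/orP; left; apply/eqP; apply: eq_bigr => l _; congr (_ * _).
by rewrite /D -powR_mulrn// -subn1 natrB.
Qed.

(** In the iteration the bound on a cumulant of order s + 2 multiplies the error of an expansion
    that has lost s derivatives. The powers of |T| add up exactly, and [wsum_prod] bounds the
    product of the mixing sums by B times the sum of the full level. *)
Lemma Eerr_prod (k s : nat) (om : R) : 0 < om <= 1 -> (0 < s <= k)%N ->
  Eerr p r X 1 s * Eerr p r X om (k - s).+1 <= (3 + 2 * B) * Eerr p r X om k.+1.
Proof.
move=> /andP[om0 om1] /andP[s0 sk].
have d1 : 1 <= dim%:R :> R by rewrite ler1n.
have ks : (k - s)%:R = k%:R - s%:R :> R by rewrite natrB.
have ks0 : 0 <= k%:R - s%:R :> R by rewrite -ks.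
rewrite /Eerr mulrACA -powR_addr//.
rewrite (_ : _ + - _ = - ((k.+1%:R + om - 1) / 2)); last by rewrite -(natr1 (k - s)%N) ks -(natr1 k); field.
rewrite [leRHS]mulrCA ler_wpM2l ?powR_ge0// !mixSE.
pose u : R := dim%:R * s%:R; pose v : R := dim%:R * (k%:R - s%:R + om) + 1 - om.
have u0 : 0 <= u by rewrite mulr_ge0.
have v0 : 0 <= v.
  by rewrite /v -addrA addr_ge0// ?subr_ge0// mulr_ge0// addr_ge0// ltW.
have -> : dim%:R * (s%:R + 1) - 1 = D + u by rewrite /D /u; ring.
have -> : dim%:R * ((k - s).+1%:R + om) - om = D + v by rewrite -(natr1 (k - s)%N) ks /D /v; ring.
have -> : dim%:R * (k.+1%:R + om) - om = D + (u + v) by rewrite -(natr1 k) /D /u /v; ring.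
have h1 : wsum A L (D + u) <= wsum A L (D + (u + v)) by apply: wsum_mono => //; rewrite lerD2l lerDl.
have h2 : wsum A L (D + v) <= wsum A L (D + (u + v)) by apply: wsum_mono => //; rewrite lerD2l lerDr.
have h3 := wsum_prod L A0 D u0 v0.
have S0 := wsum_ge0 L A0 (D + (u + v)).
have h4 : 2 * wsum A L D * wsum A L (D + (u + v)) <= 2 * B * wsum A L (D + (u + v)).
  by rewrite ler_wpM2r// ler_wpM2l// wsumD.
have B0 : 0 <= B by apply: le_trans wsumD; exact: wsum_ge0.
move: h1 h2 (le_trans h3 h4) S0 B0.
move: (wsum A L (D + u)) (wsum A L (D + v)) (wsum A L (D + (u + v))) B => a b c B'.
move=> *; rewrite mulrDl mul1r mulrDr mulr1; nra.
Qed.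

(** Interpolation with la = j / p between the summable weight D = d - 1 and the weight of M; the
    exponent d j required at level j is at most la (d p + 1 - omega). *)
Lemma Eerr_young j : (0 < j)%N -> j%:R <= p -> 0 < omega p <= 1 ->
  Eerr p r X 1 j <= (2 + B) * (#|` T|%:R `^ (- (j%:R / 2)) + M_coef X p r `^ (j%:R / p)).
Proof.
move=> j0 jp; pose om := omega p; rewrite -/om => /andP[om0 om1].
pose la : R := j%:R / p; rewrite -/la.
have la01 : 0 <= la <= 1 by rewrite divr_ge0 ?(ltW p0)//= ler_pdivrMr// mul1r.
pose z : R := dim%:R * p + 1 - om.
have B0 : 0 <= B by apply: le_trans wsumD; exact: wsum_ge0.
have h1 : mixS X p 1 r j <= wsum A L (D + la * z).
  rewrite mixSE; apply: wsum_mono => //; rewrite /D /z.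
  have -> : dim%:R - 1 + la * (dim%:R * p + 1 - om) = dim%:R * (j%:R + 1) - 1 + la * (1 - om).
    rewrite /la; field; exact: lt0r_neq0.
  by rewrite lerDl mulr_ge0 ?subr_ge0//; case/andP: la01.
have h2 := wsum_interp L A0 D z la01.
have ME : M_coef X p r = #|` T|%:R `^ (- (p / 2)) * wsum A L (D + z).
  rewrite /M_coef /wsum; congr (_ * _); apply: eq_bigr => l _; congr (_ `^ _ * _).
  by rewrite /D /z -/om; ring.
have cE : (#|` T|%:R `^ (- (p / 2))) `^ la = #|` T|%:R `^ (- (j%:R / 2)) :> R.
  rewrite -powRrM; congr (_ `^ _); rewrite /la; field; exact: lt0r_neq0.
rewrite ME powRM ?powR_ge0 ?wsum_ge0// cE /Eerr.
have -> : j%:R + 1 - 1 = j%:R :> R by ring.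
rewrite -{2}[#|` T|%:R `^ _]mulr1 -mulrDr [leRHS]mulrCA ler_wpM2l ?powR_ge0//.
have h3 := le_trans h1 h2.
have : (1 + wsum A L D) * wsum A L (D + z) `^ la <= (1 + B) * wsum A L (D + z) `^ la.
  by rewrite ler_wpM2r ?powR_ge0// lerD2l wsumD.
move: (powR_ge0 (wsum A L (D + z)) la) h3.
move: (wsum A L (D + z) `^ la) ((1 + wsum A L D) * _) (mixS _ _ _ _ _) => a b c a0 h3 h4.
rewrite mulrDr mulr1; move: B0; nra.
Qed.

End OneField.

Definition clsA (a : R) (q : nat) (om : R) (G : nat -> R -> R) : Prop :=
  (forall j, (j < q)%N -> forall x : R, is_derive x 1 (G j) (G j.+1 x)) /\
  (forall x y : R, `|G q x - G q y| <= a * `|x - y| `^ om).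

Lemma clsA_cls a q om G : 0 < a -> clsA a q om G -> cls q om (fun j x => a^-1 * G j x).
Proof.
move=> a0 [dG hG]; split; first by move=> j jq x; exact: is_derive_scale (dG j jq x).
move=> x y; rewrite -mulrBr normrM gtr0_norm ?invr_gt0// ler_pdivrMl//; exact: hG.
Qed.

Lemma clsA_shift a q v om G : (v <= q)%N -> clsA a q om G -> clsA a (q - v) om (fun j => G (j + v)%N).
Proof.
move=> vq [dG hG]; split; last by rewrite subnK.
by move=> j jq x; rewrite addSn; apply: dG; move: vq jq; clear; lia.
Qed.

(** Both sides solve the equation with right-hand side a (h - gaussE h), and [small_const0]
    identifies them. *)
Lemma Theta_scale (a : R) h N x : continuous h -> pgrow N h ->
  Theta (fun y => a * h y) x = a * Theta h x.
Proof.
move=> ch ph.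
have ga : gaussE (fun y => a * h y) = a * gaussE h.
  by rewrite !gaussE_ex exZ//; exact: pgrow_itg ch ph.
have ch' : continuous (fun y => a * h y).
  by move=> y; apply: cvgM; [exact: cvg_cst|exact: ch].
have ph' : pgrow N (fun y => a * h y).
  have [C hC] := ph; exists (`|a| * C) => y.
  by rewrite normrM -mulrA ler_wpM2l.
have d1 (z : R) := is_derive_Theta ch ph z.
have d2 (z : R) := is_derive_Theta ch' ph' z.
pose u z := Theta (fun y => a * h y) z - a * Theta h z.
have du (z : R) : is_derive z 1 u (z * u z + 0).
  have h1 := is_deriveB (d2 z) (is_derive_scale a (d1 z)).
  by apply: (is_derive_eq h1); rewrite ga /u; ring.
have sZ (f : R -> R) : small f -> small (fun z => - (a * f z)).
  move=> sf; apply: smallN; rewrite /small.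
  have hh : (a * (f n%:R * gker n%:R) : R) @[n --> \oo] --> a * 0.
    by apply: cvgM; [exact: cvg_cst|exact: sf].
  rewrite mulr0 in hh; apply: cvg_trans hh; apply: near_eq_cvg; near=> n.
  by rewrite mulrA.
apply/eqP; rewrite -subr_eq0; apply/eqP; apply: (@small_const0 _ u 0 du).
  apply: smallD; first exact: small_Theta ch' ph'.
  exact: sZ (small_Theta ch ph).
rewrite (_ : rfl u = fun z => rfl (Theta (fun y => a * h y)) z + - (a * rfl (Theta h) z)).
  apply: smallD; first exact: small_rfl_Theta ch' ph'.
  exact: sZ (small_rfl_Theta ch ph).
by apply/funext => z; rewrite /rfl /u; ring.
Unshelve. all: by end_near. Qed.

Lemma cls_pgrow q om (G : nat -> R -> R) : 0 < om <= 1 -> cls q om G -> pgrow q.+1 (G 0%N).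
Proof.
move=> /andP[om0 om1] cG; have [C C0 hC] := cls_growth om0 cG; exists C => z.
rewrite (le_trans (hC z))// ler_wpM2l//.
have x1 : 1 <= 1 + `|z| by rewrite lerDl.
by rewrite -powR_mulrn ?(le_trans _ x1)// ler_powR// -natr1 lerD2l.
Qed.

Lemma stein_regularA k om : 0 < om <= 1 -> exists2 A, 0 < A & forall a H, 0 < a -> clsA a k om H ->
  exists F, F 0%N = Theta (H 0%N) /\ clsA (a * A) k.+1 om F.
Proof.
move=> om01; have [A A0 hA] := stein_regular k om01; exists A => // a H a0 cH.
have om0 : 0 < om by case/andP: om01.
have cH' := clsA_cls a0 cH.
have [F [F0 dF hF]] := hA _ cH'; exists (fun j x => a * F j x); split.
  apply/funext => x; rewrite F0 -(Theta_scale a x (N := k.+1)).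
  - by congr (Theta _ x); apply/funext => y; rewrite mulVKf// gt_eqF.
  - exact: cls_continuous om0 cH' (leq0n _).
  - exact: cls_pgrow om01 cH'.
split; first by move=> j jq x; exact: is_derive_scale (dF j jq x).
move=> x y; rewrite -mulrBr normrM (gtr0_norm a0) -mulrA ler_wpM2l ?(ltW a0)//.
Qed.

Lemma expansionA (d : measure_display) (Omega : measurableType d)
   (T : {fset 'rV[int]_dim}) (P : probability Omega R) (X : T -> {RV P >-> R}) om q a G :
  good X -> 0 < om <= 1 -> q.+1%:R + om <= p + 2 -> (q < (ceiln p).+1)%N -> 0 < a -> clsA a q om G ->
  `|ex P (fun w => normalized_sum X w * G 0%N (normalized_sum X w)) -
    \sum_(j < q.+1) cumulant P (normalized_sum X) j.+1 / j`!%:R * ex P (fun w => G j (normalized_sum X w))|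
  <= a * (@fieldC R dim p K c0 om q * Eerr p r X om q).
Proof.
move=> gX om01 qp qc a0 cG; have cG' := clsA_cls a0 cG.
have om0 : 0 < om by case/andP: om01.
have := cumulant_expansion dim0 p0 pr K0 c00 gX om01 qp qc cG'.
have scl (F : Omega -> R) : itg P (fun w => a^-1 * F w) -> ex P (fun w => a^-1 * F w) = a^-1 * ex P F.
  move=> i; rewrite -(exZ a^-1)//; have := itgZ a i.
  by rewrite (_ : (fun w => a * _) = F)//; apply/funext => w; rewrite mulVKf// gt_eqF.
have i0 := itg_WW_cls p0 pr K0 c00 gX om0 qp cG'.
have -> : ex P (fun w => normalized_sum X w * (a^-1 * G 0%N (normalized_sum X w))) =
   a^-1 * ex P (fun w => normalized_sum X w * G 0%N (normalized_sum X w)).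
  rewrite -scl; first by congr (ex P _); apply/funext => w; rewrite mulrCA.
  by move: i0; rewrite (_ : (fun w => _ * (_ * _)) = (fun w => a^-1 * (normalized_sum X w * G 0%N (normalized_sum X w))))//; apply/funext => w; rewrite mulrCA.
rewrite (eq_bigr (fun j : 'I_q.+1 => a^-1 * (cumulant P (normalized_sum X) j.+1 / j`!%:R * ex P (fun w => G j (normalized_sum X w))))); last first.
  move=> j _; rewrite scl; first by rewrite mulrCA.
  apply: (itg_W_cls p0 pr K0 c00 gX om0 _ cG'); last by rewrite -ltnS.
  by rewrite (le_trans _ qp)// lerD2r ler_nat.
by rewrite -mulr_sumr -mulrBr normrM gtr0_norm ?invr_gt0// ler_pdivrMl.
Qed.

Definition eterm (kappa : nat -> R) (s : seq nat) (h : R -> R) : R :=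
  (-1) ^+ size s * (\prod_(sj <- s) (kappa (sj + 2)%N / (sj.+1)`!%:R)) * gaussE (Theta_comp s h).

Lemma eterm_rcons kappa t s h :
  eterm kappa (rcons t s) h = - (kappa (s + 2)%N / s.+1`!%:R) * eterm kappa t ((Theta h)^`(s.+1)%classic).
Proof.
rewrite /eterm size_rcons exprS big_rcons/= /Theta_comp foldr_rcons; ring.
Qed.

Lemma exponent_shift (x y z : R) : x + y <= z -> x + 1 + 1 + y <= z + 2.
Proof. by move=> h; lra. Qed.

Lemma big_ord2 n (F : nat -> R) : \sum_(j < n.+2) F j = F 0%N + F 1%N + \sum_(j < n) F j.+2.
Proof. by rewrite !big_ord_recl addrA; congr (_ + _). Qed.

(** For f = Theta h, kappa_1 = 0 and kappa_2 = 1 reduce the first two terms of the expansion of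
    E[W f(W)] to E[f'(W)], which cancels in Stein's equation. Each remaining f^(s+1) has s
    derivatives fewer than h, so the induction hypothesis applies to it, and [Eerr_prod] shows that
    its error weighted by the cumulant is no worse than that of the full level. *)
Lemma edgeworth_bound om : 0 < om <= 1 -> forall f k, (k < f)%N -> k%:R + om <= p -> (k < ceiln p)%N ->
  exists2 C, 0 <= C & forall (d : measure_display) (Omega : measurableType d)
   (T : {fset 'rV[int]_dim}) (P : probability Omega R) (X : T -> {RV P >-> R}), good X ->
   forall a H, 0 < a -> clsA a k om H ->
   `|ex P (fun w => H 0%N (normalized_sum X w)) -
      \sum_(t <- cs f k) eterm (cumulant P (normalized_sum X)) t (H 0%N)| <= C * a * Eerr p r X om k.+1.
Proof.
move=> om01; have om0 : 0 < om by case/andP: om01.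
elim=> [//|f IH] k kf kp kc.
have [A A0 hA] := stein_regularA k om01.
have step (j : nat) : exists C, (j < k)%N -> 0 <= C /\ forall (d : measure_display) (Omega : measurableType d)
   (T : {fset 'rV[int]_dim}) (P : probability Omega R) (X : T -> {RV P >-> R}), good X ->
   forall a H, 0 < a -> clsA a (k - j.+1) om H ->
   `|ex P (fun w => H 0%N (normalized_sum X w)) -
      \sum_(t <- cs f (k - j.+1)) eterm (cumulant P (normalized_sum X)) t (H 0%N)| <=
   C * a * Eerr p r X om (k - j.+1).+1.
  have [jk|kj] := ltnP j k; last by exists 0.
  have h1 : (k - j.+1 < f)%N by move: kf jk; clear; lia.
  have h2 : (k - j.+1)%:R + om <= p by rewrite (le_trans _ kp)// lerD2r ler_nat leq_subr.
  have h3 : (k - j.+1 < ceiln p)%N by rewrite (leq_ltn_trans _ kc)// leq_subr.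
  by have [C C0 hC] := IH _ h1 h2 h3; exists C.
(* The constants of the lower levels are fixed before any field is introduced, since the bound is
   uniform over good fields. *)
have {step}[Cs hCs] := choice step.
pose f0 := @fieldC R dim p K c0 om k.+1.
pose f1 j := @fieldC R dim p K c0 1 j.+1.
pose C := A * f0 + \sum_(j < k) f1 j * Cs j * A * (3 + 2 * B).
have f00 : 0 <= f0 by exact: fieldC_ge0.
have o1 : 0 < (1 : R) <= 1 by rewrite ltr01 lexx.
have f10 j : 0 <= f1 j by exact: fieldC_ge0.
exists `|C|; first by [].
move=> d Omega T P X gX a H a0 cH.
have [F [F0 cF]] := hA a H a0 cH.
have aA : 0 < a * A by exact: mulr_gt0.
have [dF hF] := cF.
set W := normalized_sum X; set kap := cumulant P W.
have cH' := clsA_cls a0 cH.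
have ch : continuous (H 0%N).
  have ch' : continuous (fun y => a^-1 * H 0%N y) := cls_continuous om0 cH' (leq0n _).
  move=> x; have h := ch' x.
  have -> : H 0%N = fun y => a * (a^-1 * H 0%N y) by apply/funext => y; rewrite mulVKf// gt_eqF.
  by apply: cvgM; [exact: cvg_cst|exact: h].
have ph : pgrow k.+1 (H 0%N).
  have [D hD] := cls_pgrow om01 cH'; exists (a * D) => x.
  by rewrite -mulrA -ler_pdivrMl// (le_trans _ (hD x))// normrM gtr0_norm// invr_gt0.
have F1 x : F 1%N x = x * F 0%N x + (H 0%N x - gaussE (H 0%N)).
  have h1 := is_derive_Theta ch ph x; have h2 := dF 0%N (ltn0Sn _) x.
  by rewrite F0 in h2 *; rewrite -(derive_val (is_derive := h2)) (derive_val (is_derive := h1)).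
have qp : k.+2%:R + om <= p + 2 by rewrite -2!natr1; exact: exponent_shift.
have qc : (k.+1 < (ceiln p).+1)%N by [].
have E1 := expansionA gX om01 qp qc aA cF.
have iF j : (j <= k.+1)%N -> itg P (fun w => F j (W w)).
  move=> jk; have cF' := clsA_cls aA cF.
  have qp' : k.+1%:R + om <= p + 2 by rewrite (le_trans _ qp)// lerD2r ler_nat.
  have := itgZ (a * A) (itg_W_cls p0 pr K0 c00 gX om0 qp' cF' jk).
  by rewrite (_ : (fun w => _) = (fun w => F j (W w)))//; apply/funext => w; rewrite mulVKf// gt_eqF.
have cFA := clsA_cls aA cF.
have iWF : itg P (fun w => W w * F 0%N (W w)).
  have := itgZ (a * A) (itg_WW_cls p0 pr K0 c00 gX om0 qp cFA).
  by rewrite (_ : (fun w => _) = (fun w => W w * F 0%N (W w)))//; apply/funext => w; rewrite mulrCA mulVKf// gt_eqF.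
have EH : ex P (fun w => H 0%N (W w)) = ex P (fun w => F 1%N (W w)) - ex P (fun w => W w * F 0%N (W w)) + gaussE (H 0%N).
  rewrite -exB//; last exact: iF.
  rewrite -[gaussE _](ex_cst P) -exD; [|apply: itgB => //; exact: iF|exact: itg_cst].
  by congr (ex P _); apply/funext => w; rewrite F1; ring.
have dT j : (j <= k.+1)%N -> (Theta (H 0%N))^`(j)%classic = F j.
  by rewrite -F0; move: j; exact: (derive1n_seq dF).2.
have ES : \sum_(t <- cs f.+1 k) eterm kap t (H 0%N) = gaussE (H 0%N) -
    \sum_(j < k) kap (j + 3)%N / j.+2`!%:R * \sum_(t <- cs f (k - j.+1)) eterm kap t (F j.+2).
  rewrite sum_cs; congr (_ + _).
    by rewrite /eterm big_nil expr0 !mul1r.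
  rewrite -sumrN; apply: eq_bigr => j _; rewrite -mulNr mulr_sumr; apply: eq_bigr => t _.
  have jk : (j.+2 <= k.+1)%N by rewrite ltnS.
  have e : (j.+1 + 2)%N = (j + 3)%N by clear; lia.
  by rewrite eterm_rcons (dT _ jk) e.
rewrite ES EH.
have k2 := cumulant2 p0 pr K0 c00 gX; have k1 := cumulant1 p0 pr K0 c00 gX.
move: E1; rewrite (big_ord2 _ (fun j => cumulant P W j.+1 / j`!%:R * ex P (fun w => F j (W w)))) k1 k2.
rewrite !mul0r add0r divr1 mul1r -/kap => E1.
set S := fun j : nat => \sum_(t <- cs f (k - j.+1)) eterm kap t (F j.+2).
set E2 := Eerr p r X om k.+1 in E1 *.
have E20 : 0 <= E2 by exact: Eerr_ge0.
have -> : ex P (fun w => F 1%N (W w)) - ex P (fun w => W w * F 0%N (W w)) + gaussE (H 0%N) -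
    (gaussE (H 0%N) - \sum_(j < k) kap (j + 3)%N / j.+2`!%:R * S j) =
  - (ex P (fun w => W w * F 0%N (W w)) - (ex P (fun w => F 1%N (W w)) +
      \sum_(j < k) kap j.+3 / j.+2`!%:R * ex P (fun w => F j.+2 (W w)))) +
  \sum_(j < k) kap j.+3 / j.+2`!%:R * (S j - ex P (fun w => F j.+2 (W w))).
  under [\sum_(j < k) _ * (_ - _)]eq_bigr do rewrite mulrBr.
  rewrite sumrB (eq_bigr (fun j : 'I_k => kap j.+3 / j.+2`!%:R * S j)); last by move=> j _; rewrite addn3.
  by ring.
rewrite (le_trans (ler_normD _ _))// normrN.
apply: (@le_trans _ _ (C * a * E2)); last by rewrite ler_wpM2r// ler_wpM2r ?(ltW a0)// ler_norm.
rewrite /C !mulrDl; apply: lerD.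
  by apply: (le_trans E1); rewrite le_eqVlt; apply/orP; left; apply/eqP; rewrite /f0; ring.
rewrite (le_trans (ler_norm_sum _ _ _))// !mulr_suml; apply: ler_sum => j _.
have [Cj0 hCj] := hCs j (ltn_ord j).
have jp : j.+1%:R <= p by rewrite (le_trans _ kp)// (le_trans _ (_ : k%:R <= _))// ?ler_nat// lerDl ltW.
have jc : (j.+1 < ceiln p)%N by rewrite (leq_ltn_trans _ kc).
have b1 : `|kap j.+3 / j.+2`!%:R| <= f1 j * Eerr p r X 1 j.+1.
  have := cumulant_bound dim0 p0 pr K0 c00 gX (ltn0Sn j) jc jp.
  rewrite addn2 normrM normfV (ger0_norm (ler0n _ _)) ler_pdivrMr ?ltr0n ?fact_gt0// => h.
  by rewrite (le_trans h)// le_eqVlt; apply/orP; left; apply/eqP; rewrite /f1; ring.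
have cFs : clsA (a * A) (k - j.+1) om (fun i => F (i + j.+2)%N).
  rewrite (_ : (k - j.+1 = k.+1 - j.+2)%N)//; apply: clsA_shift => //.
  by rewrite ltnS.
have b2 : `|S j - ex P (fun w => F j.+2 (W w))| <= Cs j * (a * A) * Eerr p r X om (k - j.+1).+1.
  by rewrite distrC; exact: (hCj _ _ _ _ _ gX _ _ aA cFs).
have jk : (0 < j.+1 <= k)%N by rewrite ltn_ord.
have b3 := Eerr_prod gX om01 jk.
rewrite normrM; apply: (@le_trans _ _ (f1 j * Eerr p r X 1 j.+1 * (Cs j * (a * A) * Eerr p r X om (k - j.+1).+1))).
  exact: ler_pM.
rewrite (_ : _ * (Cs j * _ * _) = f1 j * Cs j * (a * A) * (Eerr p r X 1 j.+1 * Eerr p r X om (k - j.+1).+1)); last by ring.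
rewrite (_ : f1 j * Cs j * A * _ * a * E2 = f1 j * Cs j * (a * A) * ((3 + 2 * B) * E2)); last by ring.
have c1 : 0 <= f1 j * Cs j * (a * A) by apply: mulr_ge0; [apply: mulr_ge0 (f10 j) Cj0|exact: ltW].
exact: (ler_wpM2l c1 b3).
Qed.

End EdgeworthExpansion.

(** * Gaussian integration by parts *)

Section GaussianIntegrationByParts.
Context {R : realType}.
Local Notation gauss := (std_normal R).
Implicit Types (h u : R -> R).

Lemma pgrow_le m n u : (m <= n)%N -> pgrow m u -> pgrow n u.
Proof.
move=> mn [C hC]; exists `|C| => x; apply: (le_trans (hC x)).
apply: (@le_trans _ _ (`|C| * (1 + `|x|) ^+ m)).
  by rewrite ler_wpM2r ?ler_norm// exprn_ge0// addr_ge0.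
by rewrite ler_wpM2l// ler_weXn2l// lerDl.
Qed.

Lemma pgrowD m n u v : pgrow m u -> pgrow n v -> pgrow (maxn m n) (fun x => u x + v x).
Proof.
move=> /(pgrow_le (leq_maxl m n))[C hC] /(pgrow_le (leq_maxr m n))[E hE].
exists (C + E) => x; rewrite mulrDl (le_trans (ler_normD _ _))// lerD//.
Qed.

Lemma pgrowM m n u v : pgrow m u -> pgrow n v -> pgrow (m + n) (fun x => u x * v x).
Proof.
move=> [C hC] [E hE]; exists (C * E) => x; rewrite normrM exprD mulrACA ler_pM//.
Qed.

Lemma pgrow_horner (q : {poly R}) : pgrow (size q) (fun x => q.[x]).
Proof. exact: poly_pgrow. Qed.

Lemma pgrow_id : pgrow 1 (fun x : R => x).
Proof. by exists 1 => x; rewrite mul1r expr1 lerDr. Qed.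

Lemma pgrowN n u : pgrow n u -> pgrow n (fun x => - u x).
Proof. by move=> [C hC]; exists C => x; rewrite normrN. Qed.

Lemma continuous_horner (q : {poly R}) : continuous (fun x : R => q.[x]).
Proof.
move=> x; apply: (@derive_continuous _ _ x q^`().[x]); exact: (derivn_is_derive q 0 x).
Qed.

Lemma pgrow_small n u : pgrow n u -> small u /\ small (rfl u).
Proof.
move=> [C hC]; split.
  by apply: (@small_growth _ _ C n) => x _; exact: hC.
by apply: (@small_growth _ _ C n) => x _; rewrite /rfl normrN -[X in _ <= _ * (1 + X) ^+ _]normrN; exact: hC.
Qed.

Lemma itg_norm_growth h n m : continuous h -> pgrow n h ->
  itg gauss (fun x => `|h x| * (1 + `|x|) ^+ m).
Proof.
move=> ch gh; apply: (@pgrow_itg _ (n + m)).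
  move=> x; apply: cvgM; first by apply: continuous_comp; [exact: ch|exact: norm_continuous].
  apply: (@continuous_comp _ _ _ (fun x : R => 1 + `|x|) (fun y => y ^+ m)).
    by apply: cvgD; [exact: cvg_cst|exact: norm_continuous].
  exact: exprn_continuous.
apply: pgrowM; first by case: gh => E hE; exists E => x; rewrite normr_id.
by exists 1 => x; rewrite mul1r ger0_norm// exprn_ge0// addr_ge0.
Qed.

(* u is compared with the solution Theta (du - x u) of the same equation: their difference
   solves w' = x w + c and is negligible at both ends, which forces c = 0. *)
Lemma stein_identity u du m n : (forall x : R, is_derive x 1 u (du x)) -> continuous du ->
  pgrow m u -> pgrow n du -> ex gauss (fun x => du x - x * u x) = 0.
Proof.
move=> hu cdu gu gdu.
have cu : continuous u by move=> x; exact: (derive_continuous (hu x)).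
pose q x := du x - x * u x.
have cq : continuous q.
  move=> x; apply: cvgB; first exact: cdu.
  by apply: cvgM; [exact: cvg_id|exact: cu].
have gq : pgrow (maxn n (1 + m)) q by apply: pgrowD => //; apply/pgrowN/pgrowM => //; exact: pgrow_id.
pose v := Theta q.
have hv := is_derive_Theta cq gq.
have [su sru] := pgrow_small gu.
have sv := small_Theta cq gq.
have srv := small_rfl_Theta cq gq.
have huv (x : R) : is_derive x 1 (fun y => u y - v y) (x * (u x - v x) + gaussE q).
  have -> : x * (u x - v x) + gaussE q = du x - (x * v x + (q x - gaussE q)) by rewrite /q; ring.
  exact: is_deriveB (hu x) (hv x).
have z0 := small_const0 huv.
have z1 : forall x, u x - v x = 0.
  apply: z0; first exact: smallB.
  have -> : rfl (fun y => u y - v y) = (fun y => rfl u y - rfl v y).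
    by apply/funext => y; rewrite /rfl; ring.
  exact: smallB.
rewrite -gaussE_ex -/q.
have := huv 0; rewrite mul0r add0r.
have -> : (fun y => u y - v y) = cst 0 by apply/funext => y; rewrite z1.
move=> hz; have [_ <-] := hz; exact: derive_cst.
Qed.

(** The adjoint of differentiation in L^2 of the standard normal law. *)
Definition ornstein (q : {poly R}) : {poly R} := 'X * q - q^`().

Section Family.
Variables (a om : R) (k : nat) (F : nat -> R -> R).
Hypothesis om01 : 0 < om <= 1.
Hypothesis a0 : 0 < a.
Hypothesis hF : clsA a k om F.

Lemma clsA_pgrow j : (j <= k)%N -> pgrow (k - j).+1 (F j).
Proof.
move=> jk; have := clsA_cls a0 (clsA_shift jk hF) => /(cls_pgrow om01)[C hC].
exists (a * C) => x; have := hC x; rewrite /= add0n normrM ger0_norm ?invr_ge0 ?(ltW a0)//.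
by rewrite ler_pdivrMl// mulrA.
Qed.

Lemma clsA_continuous j : (j <= k)%N -> continuous (F j).
Proof.
move=> jk x; have /andP[om0 _] := om01.
have := @cls_continuous _ _ _ _ j om0 (clsA_cls a0 hF) jk x => c.
have -> : F j = (fun y => a * (a^-1 * F j y)) by apply/funext => y; rewrite mulVKf ?gt_eqF.
by apply: cvgM => //; exact: cvg_cst.
Qed.

Lemma clsA_itgM j (q : {poly R}) : (j <= k)%N -> itg gauss (fun x => F j x * q.[x]).
Proof.
move=> jk; apply: (@pgrow_itg _ ((k - j).+1 + size q)).
  by move=> x; apply: cvgM; [exact: clsA_continuous|exact: continuous_horner].
by apply: pgrowM; [exact: clsA_pgrow|exact: pgrow_horner].
Qed.

Lemma ibp_poly j (q : {poly R}) : (j < k)%N ->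
  ex gauss (fun x => F j.+1 x * q.[x]) = ex gauss (fun x => F j x * (ornstein q).[x]).
Proof.
move=> jk; pose u x := F j x * q.[x]; pose du x := F j.+1 x * q.[x] + F j x * q^`().[x].
have hu (x : R) : is_derive x 1 u (du x).
  have -> : du x = F j x *: q^`().[x] + q.[x] *: F j.+1 x by rewrite /du /GRing.scale /=; ring.
  exact: is_deriveM (hF.1 j jk x) (derivn_is_derive q 0 x).
have gu : pgrow ((k - j).+1 + size q) u by apply: pgrowM; [apply: clsA_pgrow; exact: ltnW|exact: pgrow_horner].
have gdu : pgrow (maxn ((k - j.+1).+1 + size q) ((k - j).+1 + size q^`())) du.
  by apply: pgrowD; apply: pgrowM; [exact: clsA_pgrow|exact: pgrow_horner|apply: clsA_pgrow; exact: ltnW|exact: pgrow_horner].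
have cdu : continuous du.
  move=> x; apply: cvgD; apply: cvgM; [exact: clsA_continuous|exact: continuous_horner|apply: clsA_continuous; exact: ltnW|exact: continuous_horner].
have := stein_identity hu cdu gu gdu.
have -> : (fun x => du x - x * u x) = (fun x => F j.+1 x * q.[x] - F j x * (ornstein q).[x]).
  by apply/funext => x; rewrite /du /u /ornstein hornerD hornerN hornerM hornerX; ring.
rewrite exB; [|exact: clsA_itgM|by apply: clsA_itgM; exact: ltnW].
by move/eqP; rewrite subr_eq0 => /eqP.
Qed.

Lemma ibp_poly_iter s (q : {poly R}) : (s <= k)%N ->
  ex gauss (fun x => F s x * q.[x]) = ex gauss (fun x => F 0%N x * (iter s ornstein q).[x]).
Proof.
elim: s q => // s IH q sk.
by rewrite ibp_poly// IH ?(ltnW sk)// -iterSr.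
Qed.

End Family.

Lemma antiderivative_poly (q : {poly R}) : exists A : {poly R}, A^`() = q.
Proof.
exists (\poly_(i < (size q).+1) (q`_i.-1 / i%:R)); apply/polyP => i.
rewrite coef_deriv coef_poly ltnS; case: ltnP => [iq|qi] /=.
  by rewrite -[LHS]mulr_natr divfK// pnatr_eq0.
by rewrite mul0rn nth_default.
Qed.

Lemma itg_poly (q : {poly R}) : itg gauss (fun x => q.[x]).
Proof. exact: pgrow_itg (@continuous_horner q) (@pgrow_horner q). Qed.

Lemma Theta_comp_rcons t s h : Theta_comp (rcons t s) h = Theta_comp t ((Theta h)^`(s.+1)%classic).
Proof. by rewrite /Theta_comp foldr_rcons. Qed.

(* With f = Theta g, the derivatives of f are moved to the polynomial; then Stein's equation,
   integrated against an antiderivative A of the result, replaces f by - A g. *)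
Lemma gaussE_Theta_comp (t : seq nat) : exists J : {poly R},
  (t != [::] -> ex gauss (fun x => J.[x]) = 0) /\
  forall k om a H, 0 < om <= 1 -> (sumn t <= k)%N -> 0 < a -> clsA a k om H ->
    gaussE (Theta_comp t (H 0%N)) = ex gauss (fun x => H 0%N x * J.[x]).
Proof.
elim/last_ind: t => [|t s [J [_ hJ]]].
  exists 1; split=> // k om a H _ _ _ _; rewrite gaussE_ex /=; congr ex.
  by apply/funext => x; rewrite hornerC mulr1.
have [A0 hA0] := antiderivative_poly (iter s.+1 ornstein J).
pose A := A0 - (ex gauss (fun x => A0.[x]))%:P.
have hA : A^`() = iter s.+1 ornstein J by rewrite derivB derivC subr0.
have mA : ex gauss (fun x => A.[x]) = 0.
  have -> : (fun x => A.[x]) = (fun x => A0.[x] - ex gauss (fun x => A0.[x])).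
    by apply/funext => x; rewrite /A hornerD hornerN hornerC.
  by rewrite exB; [rewrite ex_cst subrr|exact: itg_poly|exact: itg_cst].
exists (- A); split=> [_|k om a H om01 stk a0 hH].
  under eq_fun => x do rewrite hornerN.
  by rewrite exN ?mA ?oppr0//; exact: itg_poly.
have sk : (s <= k)%N by move: stk; rewrite sumn_rcons; lia.
have tk : (sumn t <= k - s)%N by move: stk; rewrite sumn_rcons; lia.
have [A1 A10 hst] := @stein_regularA R k om om01.
have [F [F0 hF]] := hst a H a0 hH.
have aA : 0 < a * A1 by exact: mulr_gt0.
have Fn j : (j <= k.+1)%N -> (Theta (H 0%N))^`(j)%classic = F j.
  rewrite -F0; move: j; exact: (derive1n_seq hF.1).2.
have shF : clsA (a * A1) (k - s) om (fun j => F (j + s.+1)%N).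
  by have := @clsA_shift _ (a * A1) k.+1 s.+1 om F sk hF; rewrite subSS.
rewrite Theta_comp_rcons Fn ?ltnS//.
rewrite (hJ _ _ _ _ om01 tk aA shF) /= add0n (ibp_poly_iter om01 aA hF)//.
have cg := clsA_continuous om01 a0 hH (leq0n k).
have gg := clsA_pgrow om01 a0 hH (leq0n k).
pose c := gaussE (H 0%N).
have dF (x : R) : is_derive x 1 (F 0%N) (x * F 0%N x + (H 0%N x - c)).
  by rewrite F0; exact: (is_derive_Theta cg gg).
have F1 : F 1%N = (fun x => x * F 0%N x + (H 0%N x - c)).
  apply/funext => x; have [_ <-] := dF x; have [_ <-] := hF.1 0%N (ltn0Sn k) x => //.
have := ibp_poly om01 aA hF A (ltn0Sn k).
have -> : (fun x => F 1%N x * A.[x]) =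
  (fun x => F 0%N x * ('X * A).[x] + (H 0%N x * A.[x] - c * A.[x])).
  by apply/funext => x; rewrite F1 hornerM hornerX; ring.
have -> : (fun x => F 0%N x * (ornstein A).[x]) =
   (fun x => F 0%N x * ('X * A).[x] - F 0%N x * (iter s.+1 ornstein J).[x]).
  by apply/funext => x; rewrite /ornstein hA hornerD hornerN; ring.
have i1 := clsA_itgM om01 aA hF ('X * A) (leq0n _).
have i2 := clsA_itgM om01 aA hF (iter s.+1 ornstein J) (leq0n _).
have i3 := clsA_itgM om01 a0 hH A (leq0n _).
have i4 : itg gauss (fun x => c * A.[x]) by apply: itgZ; exact: itg_poly.
rewrite exD//; last exact: itgB.
rewrite (exB i1 i2) (exB i3 i4) exZ ?mA ?mulr0 ?subr0; last exact: itg_poly.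
move=> /addrI e.
have -> : (fun x => H 0%N x * (- A).[x]) = (fun x => - (H 0%N x * A.[x])).
  by apply/funext => x; rewrite hornerN mulrN.
by rewrite exN// e opprK.
Qed.

(** Since J has Gaussian mean 0, it is s' - x s for a polynomial s, and integration by parts turns
    E[H J] into - E[h' s]. This puts the derivative of the test function into the bound with a
    polynomial weight. *)
Lemma gaussE_Theta_comp_le (t : seq nat) : t != [::] -> exists C m, 0 <= C /\
  forall k om a H h' n, 0 < om <= 1 -> (sumn t <= k)%N -> 0 < a -> clsA a k om H ->
    (forall x : R, is_derive x 1 (H 0%N) (h' x)) -> continuous h' -> pgrow n h' ->
    `|gaussE (Theta_comp t (H 0%N))| <= C * ex gauss (fun x => `|h' x| * (1 + `|x|) ^+ m).
Proof.
move=> t0; have [J [mJ hJ]] := gaussE_Theta_comp t.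
have [s [c [ss hs]]] := @poly_stein R (size J) J (leqnSn _).
have ds (x : R) : is_derive x 1 (fun x => s.[x]) s^`().[x] by exact: (derivn_is_derive s 0 x).
have c0 : c = 0.
  have := stein_identity ds (@continuous_horner s^`()) (@pgrow_horner s) (@pgrow_horner s^`()).
  have -> : (fun x => s^`().[x] - x * s.[x]) = (fun x => J.[x] - c).
    by apply/funext => x; rewrite hs; ring.
  rewrite exB; [|exact: itg_poly|exact: itg_cst].
  by rewrite ex_cst mJ// sub0r => /eqP; rewrite oppr_eq0 => /eqP.
have [C hC] := pgrow_horner s.
exists `|C|, (size s); split=> // k om a H h' n om01 tk a0 hH hh' ch' gh'.
rewrite (hJ _ _ _ _ om01 tk a0 hH).
have g0 := clsA_pgrow om01 a0 hH (leq0n k).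
have ch := clsA_continuous om01 a0 hH (leq0n k).
have hu (x : R) : is_derive x 1 (fun x => H 0%N x * s.[x]) (h' x * s.[x] + H 0%N x * s^`().[x]).
  have -> : h' x * s.[x] + H 0%N x * s^`().[x] = H 0%N x *: s^`().[x] + s.[x] *: h' x.
    by rewrite /GRing.scale /=; ring.
  by apply: is_deriveM.
have chs : continuous (fun x => h' x * s.[x]).
  by move=> x; apply: cvgM; [exact: ch'|exact: continuous_horner].
have := stein_identity hu _ (pgrowM g0 (pgrow_horner s))
  (pgrowD (pgrowM gh' (pgrow_horner s)) (pgrowM g0 (pgrow_horner s^`()))).
have -> : (fun x => h' x * s.[x] + H 0%N x * s^`().[x] - x * (H 0%N x * s.[x])) =
   (fun x => h' x * s.[x] + H 0%N x * J.[x]).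
  by apply/funext => x; rewrite hs c0; ring.
have i1 : itg gauss (fun x => h' x * s.[x]).
  exact: pgrow_itg chs (pgrowM gh' (pgrow_horner s)).
have i2 := clsA_itgM om01 a0 hH J (leq0n _).
rewrite exD// => e.
have -> : ex gauss (fun x => H 0%N x * J.[x]) = - ex gauss (fun x => h' x * s.[x]).
  apply/eqP; rewrite -addr_eq0 addrC; apply/eqP; apply: e => x.
  apply: cvgD; first exact: chs.
  by apply: cvgM; [exact: ch|exact: continuous_horner].
have i3 := itg_norm_growth (size s) ch' gh'.
rewrite normrN -exZ//; apply: ex_norm_le => //; first exact: itgZ.
move=> x; rewrite normrM mulrCA ler_wpM2l// (le_trans (hC x))// ler_wpM2r ?ler_norm//.
Qed.

End GaussianIntegrationByParts.

(** * Test functions for the Wasserstein distance *)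

Section Calculus.
Context {R : realType}.

Lemma is_derive_const_gap (f : R -> R) (a b : R) : a <= b ->
  (forall x : R, a <= x <= b -> is_derive x 1 f 0) -> f b = f a.
Proof.
move=> ab h; apply/eqP; rewrite eq_le; apply/andP; split.
  by apply: (@MVT_le _ f (fun=> 0) a b).
rewrite -lerN2; apply: (@MVT_le _ (fun x => - f x) (fun=> 0) a b) => // x hx.
by rewrite -(oppr0 R); exact: is_deriveN (h x hx).
Qed.

(** The integrals from -n, normalized to vanish at 0, agree wherever two of them are primitives, so
    they patch to a primitive on the whole line. *)
Lemma continuous_antiderivative (f : R -> R) : continuous f ->
  exists h : R -> R, forall x : R, is_derive x 1 h (f x).
Proof.
move=> cf; pose F (n : nat) (x : R) : R := (\int[@lebesgue_measure R]_(w in `[- n%:R, x]) f w)%R.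
have dF n (x : R) : - n%:R < x -> is_derive x 1 (F n) (f x).
  move=> nx; have xx : x < x + 1 by rewrite ltrDl.
  have i : (@lebesgue_measure R).-integrable `[- n%:R, x + 1] (EFin \o f).
    apply: continuous_compact_integrable; first exact: segment_compact.
    exact: continuous_subspaceT.
  have [d1 d2] := @continuous_FTC1_closed R f (- n%:R) x (x + 1) xx i nx (cf x).
  by split; [exact: d1|rewrite -derive1E].
pose H n x := F n x - F n 0.
have dH n (x : R) : - n%:R < x -> is_derive x 1 (H n) (f x).
  move=> nx; have := is_deriveB (dF n x nx) (is_derive_cst (F n 0) x (1 : R)).
  by rewrite subr0.
have H0 n : H n 0 = 0 by rewrite /H subrr.
have HE n m (x : R) : (0 < n)%N -> (0 < m)%N -> - n%:R < x -> - m%:R < x -> H n x = H m x.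
  move=> n0 m0 nx mx; apply/eqP; rewrite -subr_eq0; apply/eqP.
  have dz (y : R) : - n%:R < y -> - m%:R < y -> is_derive y 1 (fun y => H n y - H m y) 0.
    by move=> ny my; rewrite -(subrr (f y)); exact: is_deriveB (dH n y ny) (dH m y my).
  have n0' : - n%:R < 0 :> R by rewrite oppr_lt0 ltr0n.
  have m0' : - m%:R < 0 :> R by rewrite oppr_lt0 ltr0n.
  have e0 : H n 0 - H m 0 = 0 by rewrite !H0 subrr.
  have [x0|x0] := leP 0 x.
    rewrite -e0; apply: (@is_derive_const_gap (fun y => H n y - H m y)) => // y /andP[y0 _].
    by apply: dz; [exact: lt_le_trans n0' y0|exact: lt_le_trans m0' y0].
  rewrite -e0; apply/esym; apply: (@is_derive_const_gap (fun y => H n y - H m y)); first exact: ltW.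
  move=> y /andP[xy _].
  by apply: dz; [exact: lt_le_trans nx xy|exact: lt_le_trans mx xy].
pose N (x : R) := (Num.truncn `|x|).+1.
have Nx (x : R) : - (N x)%:R < x.
  have := truncnS_gt `|x|; rewrite -/(N x) => h.
  by rewrite ltrNl (le_lt_trans _ h)// -normrN ler_norm.
exists (fun x => H (N x) x) => x.
have hx : - (N x).+1%:R < x by rewrite -natr1 opprD; have := Nx x; lra.
apply: near_eq_is_derive (dH _ x hx).
near=> y; apply: HE => //.
by near: y; exact: lt_nbhsr.
Unshelve. all: by end_near.
Qed.

Lemma is_derive_quadratic (f : R -> R) (x C : R) :
  (forall y : R, `|f y - f x| <= C * `|y - x| ^+ 2) -> is_derive x 1 f 0.
Proof.
move=> h; suff e : h^-1 *: (f (h *: (1 : R) + x) - f x) @[h --> (0 : R)^'] --> (0 : R).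
  split; first by apply/cvg_ex; exists 0.
  exact/cvg_lim.
apply/cvgr0Pnorm_le => e e0.
have d0 : 0 < (1 + `|C|)^-1 * e by rewrite mulr_gt0// invr_gt0 ltr_wpDr.
near=> t.
have t0 : t != 0 by near: t; exact: nbhs_dnbhs_neq.
have := h (t *: (1 : R) + x); rewrite addrK /GRing.scale /= mulr1 => ht.
rewrite normrM normfV ler_pdivrMl ?normr_gt0//; apply: (le_trans ht).
rewrite expr2 mulrA mulrC ler_wpM2l//.
apply: (@le_trans _ _ (`|C| * `|t|)); first by rewrite ler_wpM2r// ler_norm.
apply: (@le_trans _ _ ((1 + `|C|) * `|t|)); first by rewrite ler_wpM2r// lerDr.
rewrite -ler_pdivlMl ?ltr_wpDr//.
near: t; apply: dnbhs0_le; exact: d0.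
Unshelve. all: by end_near.
Qed.

End Calculus.

Section Bump.
Context {R : realType}.
Variable k : nat.

(** It vanishes to order k + 1 at 0 and at 1, so that its copies on intervals, extended by 0, have k
    continuous derivatives. *)
Definition bumpoly : {poly R} := ('X * (1 - 'X)) ^+ k.+1.

Lemma bump_derivn j : (j <= k.+1)%N -> exists q, bumpoly^`(j) = ('X * (1 - 'X)) ^+ (k.+1 - j) * q.
Proof.
elim: j => [|j IH] jk; first by exists 1; rewrite derivn0 mulr1.
have [q e] := IH (ltnW jk); rewrite derivnS e derivM deriv_exp subSS subSn//=.
set b := 'X * (1 - 'X).
exists (b^`() * q *+ (k - j).+1 + b * q^`()).
rewrite mulrDr mulrA -exprSr; congr (_ + _).
by rewrite mulrnAl mulrnAr; congr (_ *+ _); ring.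
Qed.

Lemma poly_bounded01 (q : {poly R}) : exists2 C : R, 0 <= C & forall u : R, 0 <= u <= 1 -> `|q.[u]| <= C.
Proof.
have [C hC] := poly_pgrow q; exists (`|C| * 2 ^+ size q); first by rewrite mulr_ge0// exprn_ge0.
move=> u /andP[u0 u1]; apply: (le_trans (hC u)).
apply: (@le_trans _ _ (`|C| * (1 + `|u|) ^+ size q)).
  by rewrite ler_wpM2r ?ler_norm// exprn_ge0// addr_ge0.
rewrite ler_wpM2l// lerXn2r ?nnegrE ?addr_ge0//.
by rewrite ger0_norm//; lra.
Qed.

Lemma uniform_constant (P : nat -> R -> Prop) n :
  (forall j (C C' : R), C <= C' -> P j C -> P j C') ->
  (forall j, (j <= n)%N -> exists C, P j C) -> exists2 C, 1 <= C & forall j, (j <= n)%N -> P j C.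
Proof.
move=> mono; elim: n => [|n IH] h.
  have [C hC] := h 0%N (leqnn _); exists (Num.max 1 C); first by rewrite le_max lexx.
  by move=> j; rewrite leqn0 => /eqP ->; apply: mono hC; rewrite le_max lexx orbT.
have [|C C1 hC] := IH; first by move=> j jn; apply: h; exact: leqW.
have [E hE] := h n.+1 (leqnn _); exists (Num.max C E); first by rewrite le_max C1.
move=> j; rewrite leq_eqVlt => /predU1P[->|jn].
  by apply: mono hE; rewrite le_max lexx orbT.
by apply: mono (hC j jn); rewrite le_max lexx.
Qed.

Lemma bump_edge j : (j <= k.+1)%N -> exists2 C : R, 0 <= C &
  forall u w : R, 0 <= u <= 1 -> w = u \/ w = 1 - u -> `|bumpoly^`(j).[u]| <= C * w ^+ (k.+1 - j).
Proof.
move=> jk; have [q ->] := bump_derivn jk; have [C C0 hC] := poly_bounded01 q.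
exists C => // u w u01 hw.
rewrite hornerM horner_exp normrM mulrC normrX; apply: ler_pM => //; first by exact: hC.
rewrite !hornerE; have [u0 u1] := andP u01.
have w0 : 0 <= w by case: hw => ->; lra.
rewrite lerXn2r ?nnegrE// ger0_norm; last by apply: mulr_ge0; lra.
by case: hw => ->; [rewrite ler_piMr|rewrite ler_piMl]; lra.
Qed.

(** The three bounds serve the Hoelder estimate across the edge of a gap, differentiability with
    derivative 0 at an edge, and the Hoelder estimate within a gap. *)
Lemma bump_bounds : exists2 C : R, 1 <= C & forall j, (j <= k)%N ->
  [/\ (forall u w : R, 0 <= u <= 1 -> w = u \/ w = 1 - u -> `|bumpoly^`(j).[u]| <= C * w),
   ((j < k)%N -> forall u w : R, 0 <= u <= 1 -> w = u \/ w = 1 - u -> `|bumpoly^`(j).[u]| <= C * w ^+ 2) &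
   (forall u v : R, 0 <= u <= 1 -> 0 <= v <= 1 -> `|bumpoly^`(j).[u] - bumpoly^`(j).[v]| <= C * `|u - v|)].
Proof.
apply: uniform_constant.
  move=> j C C' CC' [h1 h2 h3].
  have w0 (u w : R) : 0 <= u <= 1 -> w = u \/ w = 1 - u -> 0 <= w by move=> ? [] ->; lra.
  split=> [u w u1 hw|jk u w u1 hw|u v u1 v1].
  - by apply: (le_trans (h1 u w u1 hw)); rewrite ler_wpM2r// (w0 u w).
  - by apply: (le_trans (h2 jk u w u1 hw)); rewrite ler_wpM2r// exprn_ge0// (w0 u w).
  - by apply: (le_trans (h3 u v u1 v1)); rewrite ler_wpM2r.
move=> j jk; have [C C0 hC] := bump_edge (leqW jk).
have [E E0 hE] := poly_bounded01 bumpoly^`(j.+1).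
exists (C + E); split=> [u w u1 hw|jk' u w u1 hw|u v u1 v1].
- have w1 : 0 <= w <= 1 by case: hw => ->; lra.
  apply: (le_trans (hC u w u1 hw)); rewrite mulrDl subSn// exprS; have [w0 wl] := andP w1.
  have h : C * (w * w ^+ (k - j)) <= C * w by rewrite ler_wpM2l// ler_piMr// exprn_ile1.
  by apply: (le_trans h); rewrite lerDl mulr_ge0.
- have w1 : 0 <= w <= 1 by case: hw => ->; lra.
  apply: (le_trans (hC u w u1 hw)); rewrite mulrDl; have [w0 wl] := andP w1.
  have -> : (k.+1 - j = 2 + (k - j).-1)%N by lia.
  have h : C * (w ^+ (2 + (k - j).-1)) <= C * w ^+ 2.
    by rewrite ler_wpM2l// exprD ler_piMr ?exprn_ge0// exprn_ile1.
  by apply: (le_trans h); rewrite lerDl mulr_ge0// exprn_ge0.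
- wlog uv : u v u1 v1 / v <= u.
    move=> hw; have [vu|uv] := leP v u; first exact: hw.
    by rewrite distrC [X in _ <= _ * X]distrC; apply: hw => //; exact: ltW.
  have [c hc ->] : exists2 c : R, v <= c <= u & bumpoly^`(j).[u] - bumpoly^`(j).[v] = bumpoly^`(j.+1).[c] * (u - v).
    have [->|nuv] := eqVneq u v; first by exists v; rewrite ?lexx// !subrr mulr0.
    have vu : v < u by rewrite lt_neqAle eq_sym nuv.
    have [||c ci e] := @MVT R (fun x => bumpoly^`(j).[x]) (fun x => bumpoly^`(j.+1).[x]) v u vu.
    - by move=> x _; exact: derivn_is_derive.
    - by apply: continuous_subspaceT; exact: continuous_horner.
    exists c => //; move: ci; rewrite in_itv/= => /andP[a b]; by rewrite (ltW a) (ltW b).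
  rewrite normrM ler_wpM2r//; apply: (@le_trans _ _ E); last by rewrite lerDr.
  by apply: hE; move: u1 v1 hc; lra.
Qed.

Lemma bump_middle (u : R) : 1 / 4 <= u <= 3 / 4 -> (3 / 16) ^+ k.+1 <= bumpoly.[u].
Proof.
move=> u1; rewrite /bumpoly !hornerE lerXn2r ?nnegrE; nra.
Qed.

Lemma bump_le1 (u : R) : 0 <= u <= 1 -> 0 <= bumpoly.[u] <= 1.
Proof.
move=> u1; have : 0 <= u * (1 - u) <= 1 by nra.
rewrite /bumpoly !hornerE => /andP[h0 h1].
by rewrite exprn_ge0// exprn_ile1.
Qed.

End Bump.

(** * Sums of bumps over disjoint gaps *)

Section GapFunction.
Context {R : realType}.
Variables (k : nat) (p N l0 C : R) (sg a L : R -> R).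
Hypothesis l00 : 0 < l0.
Hypothesis gapL : forall x, sg x != 0 -> l0 <= L x <= N.
Hypothesis gapx : forall x, sg x != 0 -> a x <= x < a x + L x.
Hypothesis sg1 : forall x, `|sg x| <= 1.
Hypothesis gapc : forall x y, sg x != 0 -> a x <= y < a x + L x ->
  [/\ sg y = sg x, a y = a x & L y = L x].
Hypothesis C1 : 1 <= C.
Local Notation bumpoly := (@bumpoly R k).
Hypothesis hC : forall j, (j <= k)%N ->
  [/\ (forall u w : R, 0 <= u <= 1 -> w = u \/ w = 1 - u -> `|bumpoly^`(j).[u]| <= C * w),
   ((j < k)%N -> forall u w : R, 0 <= u <= 1 -> w = u \/ w = 1 - u -> `|bumpoly^`(j).[u]| <= C * w ^+ 2) &
   (forall u v : R, 0 <= u <= 1 -> 0 <= v <= 1 -> `|bumpoly^`(j).[u] - bumpoly^`(j).[v]| <= C * `|u - v|)].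

(* The gaps are the intervals [a x, a x + L x) with sg x != 0; gapfun j is the j-th derivative
   of a function equal to a bump of height L^(p-1) on each gap. *)
Definition gapfun j (x : R) : R := sg x * (L x `^ (p - 1 - j%:R) * bumpoly^`(j).[(x - a x) / L x]).

Let L0 x : sg x != 0 -> 0 < L x.
Proof. by move=> /gapL/andP[h _]; exact: lt_le_trans l00 h. Qed.

Let u01 x y : sg x != 0 -> a x <= y < a x + L x -> 0 <= (y - a x) / L x <= 1.
Proof.
move=> sx /andP[h1 h2]; have l := L0 sx.
by rewrite divr_ge0 ?(ltW l) ?subr_ge0//= ler_pdivrMr// mul1r lerBlDl (ltW h2).
Qed.

(** [w] is the distance from x to the edge of its gap facing y, in units of the length of the
    gap. *)
Lemma gap_edge x y : sg x != 0 -> ~ (a x < y < a x + L x) ->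
  exists2 w, (w = (x - a x) / L x \/ w = 1 - (x - a x) / L x) & 0 <= w <= 1 /\ w * L x <= `|x - y|.
Proof.
move=> sx nxy; have l := L0 sx; have xx := gapx sx; have uu := u01 sx xx.
have l' : L x != 0 by rewrite gt_eqF.
have [ya|ya] := leP y (a x).
  exists ((x - a x) / L x); first by left.
  split=> //; rewrite divfK// ger0_norm ?lerB// subr_ge0.
  by move: xx => /andP[h _]; exact: le_trans ya h.
exists (1 - (x - a x) / L x); first by right.
split; first by move: uu; lra.
rewrite mulrBl divfK// mul1r; have yL : a x + L x <= y.
  by rewrite leNgt; apply/negP => h; apply: nxy; rewrite ya h.
by rewrite distrC; apply: le_trans (ler_norm _); move: xx yL; lra.
Qed.

Lemma scale_holder (l e th w t : R) : 0 < l -> 0 <= th <= 1 -> 0 <= w <= 1 -> w * l <= t ->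
  l `^ e * w <= l `^ (e - th) * t `^ th.
Proof.
move=> l1 /andP[th0 th1] /andP[w0 w1] wt.
have -> : e = e - th + th by rewrite subrK.
rewrite powR_addr// addrK -mulrA ler_wpM2l ?powR_ge0//.
apply: (@le_trans _ _ ((w * l) `^ th)); last first.
  by apply: powR_mono => //; rewrite mulr_ge0// ltW.
rewrite mulrC powRM// ?(ltW l1)// ler_wpM2r ?powR_ge0//.
have [->|w00] := eqVneq w 0; first exact: powR_ge0.
have wpos : 0 < w by rewrite lt_neqAle eq_sym w00.
by rewrite -{1}(powRr1 w0); apply: ger_powR => //; rewrite wpos.
Qed.

Lemma gapfun_edge j th Bd x y : (j <= k)%N -> 0 <= th <= 1 ->
  (forall z, sg z != 0 -> L z `^ (p - 1 - j%:R - th) <= Bd) -> 0 <= Bd ->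
  ~ (a x < y < a x + L x) -> `|gapfun j x| <= C * Bd * `|x - y| `^ th.
Proof.
move=> jk th01 hB B0 nxy; have C0 : 0 <= C by apply: le_trans C1.
have [s0|sx] := eqVneq (sg x) 0.
  by rewrite /gapfun s0 mul0r normr0 !mulr_ge0// powR_ge0.
have [w hw [w01 wt]] := gap_edge sx nxy.
have [h1 _ _] := hC jk.
rewrite /gapfun !normrM (ger0_norm (powR_ge0 _ _)).
apply: (@le_trans _ _ (1 * (L x `^ (p - 1 - j%:R) * (C * w)))).
  apply: ler_pM => //; first by rewrite mulr_ge0 ?powR_ge0.
  rewrite ler_wpM2l ?powR_ge0//; apply: h1 hw; exact: u01 sx (gapx sx).
rewrite mul1r mulrCA -mulrA ler_wpM2l//.
apply: (le_trans (scale_holder _ (L0 sx) th01 w01 wt)).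
by rewrite ler_wpM2r ?powR_ge0// hB.
Qed.

(** Two points of one gap are compared by the Lipschitz bound. Otherwise an edge lies between the
    points and each value is small by its distance to that edge. The length of a gap enters only
    through its power p - 1 - j - th. *)
Lemma gapfun_holder j th Bd x y : (j <= k)%N -> 0 <= th <= 1 ->
  (forall z, sg z != 0 -> L z `^ (p - 1 - j%:R - th) <= Bd) -> 0 <= Bd ->
  `|gapfun j x - gapfun j y| <= 2 * C * Bd * `|x - y| `^ th.
Proof.
move=> jk th01 hB B0; have C0 : 0 <= C by apply: le_trans C1.
have [[sx xy]|nxy] := pselect (sg x != 0 /\ a x <= y < a x + L x).
  have [sy ay Ly] := gapc sx xy; have [_ _ h3] := hC jk.
  rewrite /gapfun sy ay Ly -mulrBr -mulrBr !normrM (ger0_norm (powR_ge0 _ _)).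
  have ux := u01 sx (gapx sx); have uy := u01 sx xy.
  set u := (x - a x) / L x in ux *; set v := (y - a x) / L x in uy *.
  apply: (@le_trans _ _ (1 * (L x `^ (p - 1 - j%:R) * (C * `|u - v|)))).
    apply: ler_pM => //; first by rewrite mulr_ge0 ?powR_ge0.
    by rewrite ler_wpM2l ?powR_ge0// h3.
  have uv : `|u - v| * L x = `|x - y|.
    rewrite -{1}(gtr0_norm (L0 sx)) -normrM /u /v -mulrBl divfK ?gt_eqF ?L0//.
    by congr (`|_|); ring.
  have uv1 : 0 <= `|u - v| <= 1 by rewrite normr_ge0 ler_norml; move: ux uy; lra.
  rewrite mul1r mulrCA -!mulrA; apply: (@le_trans _ _ (C * (Bd * `|x - y| `^ th))).
    rewrite ler_wpM2l//; apply: (le_trans (scale_holder _ (L0 sx) th01 uv1 _)); first by rewrite uv.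
    by rewrite ler_wpM2r ?powR_ge0// hB.
  have : 0 <= C * (Bd * `|x - y| `^ th) by rewrite !mulr_ge0// powR_ge0.
  by lra.
have [[sy yx]|nyx] := pselect (sg y != 0 /\ a y <= x < a y + L y).
  exfalso; have [sx ax Lx] := gapc sy yx; apply: nxy.
  by rewrite sx ax Lx; split=> //; exact: gapx.
have hx : `|gapfun j x| <= C * Bd * `|x - y| `^ th.
  have [s0|sx] := eqVneq (sg x) 0.
    by rewrite /gapfun s0 mul0r normr0 !mulr_ge0// powR_ge0.
  by apply: gapfun_edge => //; move=> /andP[h1 h2]; apply: nxy; split=> //; rewrite (ltW h1).
have hy : `|gapfun j y| <= C * Bd * `|x - y| `^ th.
  have [s0|sy] := eqVneq (sg y) 0.
    by rewrite /gapfun s0 mul0r normr0 !mulr_ge0// powR_ge0.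
  by rewrite distrC; apply: gapfun_edge => //; move=> /andP[h1 h2]; apply: nyx; split=> //; rewrite (ltW h1).
apply: (le_trans (ler_normB _ _)).
have -> : 2 * C * Bd * `|x - y| `^ th = C * Bd * `|x - y| `^ th + C * Bd * `|x - y| `^ th by ring.
exact: lerD.
Qed.

Lemma gapfun_edge0 j x : (j <= k)%N -> ~ (sg x != 0 /\ a x < x) -> gapfun j x = 0.
Proof.
move=> jk nx; have [s0|sx] := eqVneq (sg x) 0; first by rewrite /gapfun s0 mul0r.
have ax : x - a x = 0.
  have /andP[h _] := gapx sx; apply/eqP; rewrite subr_eq0 eq_le h andbT leNgt.
  by apply/negP => h'; apply: nx.
have [h1 _ _] := hC jk.
have := h1 0 0 _ (or_introl erefl); rewrite mulr0 lexx ler01 => /(_ isT).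
by rewrite normr_le0 => /eqP e; rewrite /gapfun ax mul0r e !mulr0.
Qed.

Lemma powR_range (l e : R) : l0 <= l <= N -> l `^ e <= l0 `^ e + N `^ e.
Proof.
move=> /andP[h1 h2]; have l1 : 0 < l by exact: lt_le_trans l00 h1.
have [e0|e0] := leP 0 e.
  by apply: (@le_trans _ _ (N `^ e)); [apply: powR_mono => //; exact: ltW|rewrite lerDr powR_ge0].
by apply: (@le_trans _ _ (l0 `^ e)); [apply: powR_anti => //; exact: ltW|rewrite lerDl powR_ge0].
Qed.

(** Inside a gap the function is a polynomial. At all other points, left endpoints included, it is 0
    and is bounded nearby by a multiple of the squared distance. The multiple depends on the
    shortest length, which is harmless as only the derivative is asserted. *)
Lemma gapfun_derive j (x : R) : (j < k)%N -> is_derive x 1 (gapfun j) (gapfun j.+1 x).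
Proof.
move=> jk; have [[sx ax]|nx] := pselect (sg x != 0 /\ a x < x).
  have l := L0 sx; have xL : x < a x + L x by have /andP[] := gapx sx.
  pose q : {poly R} := bumpoly^`(j) \Po ((L x)^-1 *: ('X - (a x)%:P)).
  have qE (y : R) : q.[y] = bumpoly^`(j).[(y - a x) / L x].
    by rewrite /q horner_comp !hornerE mulrC.
  have dq := is_derive_scale (sg x * L x `^ (p - 1 - j%:R)) (derivn_is_derive q 0 x).
  have -> : gapfun j.+1 x = sg x * L x `^ (p - 1 - j%:R) * q^`(1).[x].
    rewrite derivn1 /q deriv_comp hornerM horner_comp -derivnS derivZ derivB derivX derivC subr0 !hornerE.
    rewrite /gapfun -natr1 opprD addrA (@powR_addr _ (L x) (p - 1 - j%:R) (-1))// powR_inv1 ?(ltW l)// [(x - a x) / L x]mulrC /=.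
    ring.
  apply: near_eq_is_derive dq; near=> y.
  have yx : a x <= y < a x + L x.
    by apply/andP; split; near: y; [apply: filterS (lt_nbhsr ax) => ? /ltW|exact: lt_nbhsl].
  have [sy ay Ly] := gapc sx yx.
  by rewrite /gapfun sy ay Ly derivn0 qE mulrA.
rewrite (gapfun_edge0 jk nx); have g0 := gapfun_edge0 (ltnW jk) nx.
pose Bd := l0 `^ (p - 1 - j%:R - 2) + N `^ (p - 1 - j%:R - 2).
have B0 : 0 <= Bd by rewrite addr_ge0 ?powR_ge0.
have C0 : 0 <= C by apply: le_trans C1.
apply: (@is_derive_quadratic _ _ _ (C * Bd)) => y; rewrite g0 subr0.
have [s0|sy] := eqVneq (sg y) 0.
  by rewrite /gapfun s0 mul0r normr0 mulr_ge0 ?mulr_ge0// exprn_ge0.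
have nyx : ~ (a y < x < a y + L y).
  move=> /andP[h1 h2]; have [|sx ax Lx] := @gapc y x sy; first by rewrite (ltW h1).
  by apply: nx; rewrite sx ax.
have [w hw [w01 wt]] := gap_edge sy nyx.
have [_ /(_ jk) h2 _] := hC (ltnW jk).
rewrite /gapfun !normrM (ger0_norm (powR_ge0 _ _)).
apply: (@le_trans _ _ (1 * (L y `^ (p - 1 - j%:R) * (C * w ^+ 2)))).
  apply: ler_pM => //; first by rewrite mulr_ge0 ?powR_ge0.
  rewrite ler_wpM2l ?powR_ge0//; apply: h2 hw; exact: u01 sy (gapx sy).
rewrite mul1r mulrCA -mulrA ler_wpM2l//.
have -> : p - 1 - j%:R = (p - 1 - j%:R - 2) + 2%:R by rewrite subrK.
rewrite powR_addr ?L0// powR_mulrn ?(ltW (L0 sy))// -mulrA -exprMn.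
apply: ler_pM; [exact: powR_ge0|by rewrite exprn_ge0// mulr_ge0 ?(ltW (L0 sy))//; case/andP: w01| |].
  by apply: powR_range; exact: gapL.
by rewrite [L y * w]mulrC lerXn2r ?nnegrE ?mulr_ge0 ?(ltW (L0 sy))//; case/andP: w01.
Unshelve. all: by end_near.
Qed.

Lemma gapfun_le x : 1 <= p -> `|gapfun 0 x| <= if sg x == 0 then 0 else L x `^ (p - 1).
Proof.
move=> p1; rewrite /gapfun subr0 derivn0; case: ifPn => [/eqP ->|sx]; first by rewrite mul0r normr0.
have := bump_le1 k (u01 sx (gapx sx)) => /andP[b0 b1].
rewrite !normrM (ger0_norm (powR_ge0 _ _)) (ger0_norm b0) mulrCA ler_piMr ?powR_ge0//.
by rewrite -[leRHS]mulr1; apply: ler_pM.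
Qed.

End GapFunction.

Lemma MVT_lower (R : realType) (f f' : R -> R) (c x y : R) : x <= y ->
  (forall t : R, is_derive t 1 f (f' t)) -> (forall t, x <= t <= y -> c <= f' t) ->
  c * (y - x) <= f y - f x.
Proof.
move=> xy df hc.
have h := @MVT_le _ (fun t => c * t - f t) (fun t => c - f' t) x y xy.
have := h _ _; rewrite -subr_ge0 => k; suff : 0 <= c * x - f x - (c * y - f y) by lra.
apply: k => t ht; last by have := hc t ht; lra.
have := is_deriveB (is_derive_scale c (is_derive_id t (1 : R))) (df t).
by rewrite mulr1.
Qed.

(** * Selection of dyadic intervals *)

Section DyadicGaps.
Context {R : realType}.
Variables (V : R -> R) (N : R) (Mx : nat).
Hypothesis Vmono : forall x y, x <= y -> V x <= V y.
Hypothesis N0 : 0 < N.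

Definition dlen m : R := N / 2 ^+ m.
Definition didx m (x : R) : int := Num.floor (x / dlen m).
Definition dleft m (x : R) : R := dlen m * (didx m x)%:~R.

Lemma dlen_gt0 m : 0 < dlen m. Proof. by rewrite divr_gt0// exprn_gt0. Qed.

Lemma dlen0 : dlen 0 = N. Proof. by rewrite /dlen expr0 divr1. Qed.

Lemma dlenS m : dlen m = 2 * dlen m.+1.
Proof. by rewrite /dlen exprS invfM; field. Qed.

Lemma dlen_anti m n : (m <= n)%N -> dlen n <= dlen m.
Proof.
move=> mn; rewrite ler_wpM2l ?(ltW N0)// lef_pV2 ?posrE ?exprn_gt0//.
by rewrite ler_weXn2l// ler1n.
Qed.

Lemma dleft_itv m x : dleft m x <= x < dleft m x + dlen m.
Proof.
have l := dlen_gt0 m; have /andP[h1 h2] := real_floor_itv (num_real (x / dlen m)).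
rewrite /dleft mulrC -ler_pdivlMr// h1/=.
rewrite -[X in _ + X]mul1r -mulrDl -ltr_pdivrMr//.
by move: h2; rewrite intrD.
Qed.

Lemma didx_eq m x y : dleft m x <= y < dleft m x + dlen m -> didx m y = didx m x.
Proof.
have l := dlen_gt0 m; rewrite /dleft mulrC => /andP[h1 h2].
apply/eqP; rewrite floor_eq; apply/andP; split; first by rewrite ler_pdivlMr.
by rewrite ltr_pdivrMr// intrD mulrDl mul1r.
Qed.

Lemma didx_up m x y : didx m.+1 x = didx m.+1 y -> didx m x = didx m y.
Proof.
move=> e; apply: didx_eq.
have := dleft_itv m.+1 x; have := dleft_itv m.+1 y; have := dleft_itv m y.
rewrite /dleft e dlenS.
have l := dlen_gt0 m.+1; set t := dlen m.+1 in l *.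
set i := didx m.+1 y; set j := didx m y => h1 h2 h3.
have ij : (2 * j <= i)%R.
  rewrite -ltzD1 -(@ltr_int R) intrD intrM -(ltr_pM2l l).
  by move: h1 h2; rewrite mulrDr; lra.
have ji : (i <= 2 * j + 1)%R.
  rewrite -ltzD1 -(@ltr_int R) intrD intrD intrM -(ltr_pM2l l).
  by move: h1 h2; rewrite !mulrDr; lra.
have ij' : 2 * j%:~R <= i%:~R :> R by rewrite -(intrM R 2 j) ler_int.
have ji' : i%:~R <= 2 * j%:~R + 1 :> R by rewrite -(intrM R 2 j) -(intrD R _ 1) ler_int.
rewrite -(ler_pM2l l) in ij'; rewrite -(ler_pM2l l) in ji'.
by move: ij' ji' h1 h2 h3; rewrite !mulrDr; lra.
Qed.

Lemma didx_le m n x y : (n <= m)%N -> didx m x = didx m y -> didx n x = didx n y.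
Proof.
move=> nm; rewrite -(subnK nm); elim: (m - n)%N => //= i IH.
by rewrite addSn => /didx_up.
Qed.

(* The condition on the tripled interval ensures that a selected interval meeting the middle
   of ]z, V z[ is contained in it. *)
Definition separates (s l c : R) : Prop :=
  forall y, c - l <= y <= c + 2 * l -> 4 * l <= s * (V y - y).

Definition dgood m (x : R) : bool :=
  `[< separates 1 (dlen m) (dleft m x) \/ separates (-1) (dlen m) (dleft m x) >].

(** The first good level, hence the longest good interval containing x; [find] returns Mx + 1 when
    no level is good. *)
Definition dsel (x : R) : nat := find (dgood^~ x) (iota 0 Mx.+1).
Definition gapsg (x : R) : R :=
  if (dsel x <= Mx)%N then
    if `[< separates 1 (dlen (dsel x)) (dleft (dsel x) x) >] then 1 else -1
  else 0.
Definition gapa (x : R) : R := dleft (dsel x) x.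
Definition gaplen (x : R) : R := dlen (dsel x).

Lemma gapsg_neq0 x : (gapsg x != 0) = (dsel x <= Mx)%N.
Proof.
rewrite /gapsg; case: ifP => // _; last by rewrite eqxx.
by case: ifP => _; rewrite ?oppr_eq0 oner_eq0.
Qed.

Lemma gapsg_le1 x : `|gapsg x| <= 1.
Proof.
by rewrite /gapsg; case: ifP => _; [case: ifP => _; rewrite ?normrN1 ?normr1|rewrite normr0].
Qed.

Lemma gaplen_range x : gapsg x != 0 -> dlen Mx <= gaplen x <= N.
Proof. by rewrite gapsg_neq0 => h; rewrite dlen_anti//= -dlen0 dlen_anti. Qed.

Lemma gapa_itv x : gapsg x != 0 -> gapa x <= x < gapa x + gaplen x.
Proof. by move=> _; exact: dleft_itv. Qed.

Lemma dsel_good x : (dsel x <= Mx)%N -> dgood (dsel x) x.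
Proof.
move=> h; have hs : has (dgood^~ x) (iota 0 Mx.+1) by rewrite has_find size_iota.
by have := nth_find 0%N hs; rewrite nth_iota ?add0n.
Qed.

Lemma dsel_le m x : (m <= Mx)%N -> dgood m x -> (dsel x <= m)%N.
Proof.
move=> mM g; rewrite leqNgt; apply/negP => h.
by have := before_find 0%N h; rewrite nth_iota ?add0n// g.
Qed.

(** Points of one dyadic interval share all the longer ones, so the search for the first good level
    runs identically for both. *)
Lemma gap_const x y : gapsg x != 0 -> gapa x <= y < gapa x + gaplen x ->
  [/\ gapsg y = gapsg x, gapa y = gapa x & gaplen y = gaplen x].
Proof.
rewrite gapsg_neq0 => hx hy.
have e m : (m <= dsel x)%N -> didx m y = didx m x.
  by move=> mx; apply: didx_le mx _; exact: didx_eq.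
have eg m : (m <= dsel x)%N -> dgood m y = dgood m x by move=> mx; rewrite /dgood /dleft e.
have yx : (dsel y <= dsel x)%N by apply: dsel_le => //; rewrite eg// dsel_good.
have xy : (dsel x <= dsel y)%N.
  apply: dsel_le; first exact: leq_trans yx hx.
  by rewrite -eg// dsel_good// (leq_trans yx hx).
have s : dsel y = dsel x by apply/eqP; rewrite eqn_leq yx xy.
by rewrite /gapsg /gapa /gaplen s /dleft e.
Qed.

Lemma gap_separates x : gapsg x != 0 -> separates (gapsg x) (gaplen x) (gapa x).
Proof.
rewrite gapsg_neq0 => h; rewrite /gapsg h; have := dsel_good h.
by case: ifPn => [/asboolP//|/asboolPn n /asboolP[]].
Qed.

Lemma gap_dist x : gapsg x != 0 -> 4 * gaplen x <= gapsg x * (V x - x).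
Proof.
move=> h; apply: (gap_separates h); have := gapa_itv h; have := gaplen_range h.
have := dlen_gt0 Mx; lra.
Qed.

Lemma gapsg_sign x : gapsg x = 0 \/ gapsg x = 1 \/ gapsg x = -1.
Proof. by rewrite /gapsg; case: ifP => _; [case: ifP => _|]; tauto. Qed.

(** Take y midway between z and V z and the first level m with length at most D / 32. By
    monotonicity |V - id| >= D / 8 within D / 8 of y, so level m is good at y and the selected
    interval is at least as long. Minimality of m makes its length exceed D / 64, unless m = 0 and
    it is N. *)
Lemma gap_inside z (s : R) : s = 1 \/ s = -1 -> 0 < s * (V z - z) ->
  32 * dlen Mx <= s * (V z - z) ->
  exists y, [/\ gapsg y = s, Num.min (s * (V z - z)) N / 64 <= gaplen y &
    Num.min z (V z) <= gapa y /\ gapa y + gaplen y <= Num.max z (V z)].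
Proof.
move=> hs; set D := s * (V z - z) => D0 hM.
have ex_m : exists m, dlen m <= D / 32 by exists Mx; lra.
case: (ex_minnP ex_m) => m hm mmin.
have mM : (m <= Mx)%N by apply: mmin; lra.
have hl : Num.min D N / 64 <= dlen m.
  case: (m) mmin => [|m'] mmin.
    rewrite dlen0 ler_pdivrMr//; apply: (@le_trans _ _ N); first by rewrite ge_min lexx orbT.
    by have := N0; lra.
  have : ~ (dlen m' <= D / 32) by move=> /mmin; rewrite ltnn.
  move/negP; rewrite -ltNge dlenS => h; rewrite ler_pdivrMr//.
  by apply: (@le_trans _ _ D); [rewrite ge_min lexx|lra].
have lm := dlen_gt0 m.
have [y hy] : exists y, y = z + s * (D / 2) by exists (z + s * (D / 2)).
have /andP[y1 y2] := dleft_itv m y.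
have Dn t : y - D / 8 <= t <= y + D / 8 -> D / 8 <= s * (V t - t).
  move=> ht; have hD : D = s * (V z - z) by [].
  case: hs => e; rewrite e !(mul1r, mulN1r) in hy hD *.
    have : V z <= V t by apply: Vmono; lra.
    by lra.
  have : V t <= V z by apply: Vmono; lra.
  by lra.
have sm : separates s (dlen m) (dleft m y).
  by move=> t ht; apply: (@le_trans _ _ (D / 8)); [lra|apply: Dn; lra].
have gy : dgood m y by apply/asboolP; case: hs => <-; [left|right].
have my := dsel_le mM gy.
have sy0 : gapsg y != 0 by rewrite gapsg_neq0 (leq_trans my mM).
have Ly : dlen m <= gaplen y by exact: dlen_anti.
have sy := gap_separates sy0.
have /andP[ay1 ay2] := gapa_itv sy0.
have es : gapsg y = s.
  have := gap_dist sy0; have := Dn y; rewrite lerBlDr lerDl.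
  have D8 : 0 <= D / 8 by lra.
  rewrite D8 => /(_ isT) h1 h2.
  have [z0|[e|e]] := gapsg_sign y; first by rewrite z0 eqxx in sy0.
    by rewrite e in h2 *; case: hs h1 => -> //; lra.
  by rewrite e in h2 *; case: hs h1 => -> //; lra.
(* A selected interval of length at least D / 2 would have z in its triple, where |V z - z| = D is
   less than 4 times the length. *)
have LD : gaplen y < D / 2.
  rewrite ltNge; apply/negP => h.
  have := sy z; rewrite es -/D => k; have : 4 * gaplen y <= D.
    by apply: k; case: hs => e; rewrite e !(mul1r, mulN1r) in hy; lra.
  by lra.
exists y; split=> //; first exact: le_trans hl Ly.
have vz : V z = z + s * D.
  by rewrite /D mulrA; case: hs => ->; rewrite ?mulrNN mul1r ?mul1r addrC subrK.
rewrite vz.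
case: hs => e; rewrite e !(mul1r, mulN1r) in hy *.
  by split; [rewrite ge_min; apply/orP; left; lra|rewrite le_max; apply/orP; right; lra].
by split; [rewrite ge_min; apply/orP; right; lra|rewrite le_max; apply/orP; left; lra].
Qed.

End DyadicGaps.

Section TestFunction.
Context {R : realType}.
Variables (k : nat) (p C : R).
Hypothesis p1 : 1 <= p.
Hypothesis om01 : 0 < p - k%:R <= 1.
Hypothesis C1 : 1 <= C.
Local Notation bumpoly := (@bumpoly R k).
Hypothesis hC : forall j, (j <= k)%N ->
  [/\ (forall u w : R, 0 <= u <= 1 -> w = u \/ w = 1 - u -> `|bumpoly^`(j).[u]| <= C * w),
   ((j < k)%N -> forall u w : R, 0 <= u <= 1 -> w = u \/ w = 1 - u -> `|bumpoly^`(j).[u]| <= C * w ^+ 2) &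
   (forall u v : R, 0 <= u <= 1 -> 0 <= v <= 1 -> `|bumpoly^`(j).[u] - bumpoly^`(j).[v]| <= C * `|u - v|)].
Variables (V : R -> R) (N : R) (Mx : nat).
Hypothesis Vmono : forall x y, x <= y -> V x <= V y.
Hypothesis N0 : 0 < N.

Local Notation sg := (gapsg V N Mx).
Local Notation a := (gapa V N Mx).
Local Notation L := (gaplen V N Mx).
Local Notation g := (gapfun k p sg a L).
Let l00 : 0 < dlen N Mx := dlen_gt0 N0 Mx.
Let gapL := @gaplen_range R V N Mx N0.
Let gapx := @gapa_itv R V N Mx N0.
Let sg1 := @gapsg_le1 R V N Mx.
Let gapc := @gap_const R V N Mx N0.
Let C0 : 0 <= C. Proof. exact: le_trans C1. Qed.

(** 64 comes from the length in [gap_inside], (3/16)^(k+1) bounds the bump from below on the middle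
    half of a gap, and 1/2 is the length of this half relative to the gap. *)
Definition testC : R := (64%:R^-1) `^ p * (3 / 16) ^+ k.+1 / 2.

Lemma testC_gt0 : 0 < testC.
Proof. by rewrite /testC divr_gt0// mulr_gt0 ?powR_gt0 ?exprn_gt0. Qed.

Lemma gapfun0_continuous : continuous (g 0%N).
Proof.
have [k0|k0] := posnP k; last first.
  by move=> x; exact: derive_continuous (gapfun_derive p l00 gapL gapx sg1 gapc C1 hC x k0).
have e1 : p = 1 by move: p1 om01; rewrite k0 subr0; lra.
pose Bd := dlen N Mx `^ (p - 1 - 0 - 1) + N `^ (p - 1 - 0 - 1).
have B0 : 0 < Bd by rewrite ltr_pwDl ?powR_gt0 ?powR_ge0.
have K0 : 0 < 2 * C * Bd by rewrite !mulr_gt0// (lt_le_trans ltr01 C1).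
have hB z : sg z != 0 -> L z `^ (p - 1 - 0%:R - 1) <= Bd.
  by move=> sz; apply: powR_range => //; exact: gapL.
have c : continuous (fun x => (2 * C * Bd)^-1 * g 0%N x).
  apply: (@holder_continuous _ _ 1) => // x y.
  rewrite -mulrBr normrM gtr0_norm ?invr_gt0// ler_pdivrMl//.
  apply: (gapfun_holder l00 gapL gapx sg1 gapc C1 hC x y (leq0n k) _ hB (ltW B0)).
  by rewrite ler01 lexx.
move=> x; have -> : g 0%N = (fun x => 2 * C * Bd * ((2 * C * Bd)^-1 * g 0%N x)).
  by apply/funext => z; rewrite mulVKf// gt_eqF.
by apply: cvgM; [exact: cvg_cst|exact: c].
Qed.

Lemma gapfun0_bound x : `|g 0%N x| <= Num.min `|V x - x| N `^ (p - 1).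
Proof.
apply: (le_trans (gapfun_le k l00 gapL gapx sg1 x p1)).
case: ifPn => [_|sx]; first exact: powR_ge0.
have /andP[l1 l2] := gapL sx; have l := lt_le_trans l00 l1.
apply: powR_mono; [by rewrite subr_ge0|exact: ltW|].
rewrite le_min l2 andbT; have := gap_dist N0 sx.
have : sg x * (V x - x) <= `|V x - x|.
  by apply: (le_trans (ler_norm _)); rewrite normrM ler_piMl.
by lra.
Qed.

(** For x between y and V y, monotonicity gives V x on the same side of x as V y is of y, so a gap
    containing x carries the sign s. Thus h is monotone from y to V y. *)
Lemma gapfun0_sign x y (s : R) : s = 1 \/ s = -1 -> 0 < s * (V y - y) ->
  Num.min y (V y) <= x <= Num.max y (V y) -> 0 <= s * g 0%N x.
Proof.
move=> hs hV hx; have [s0|sx] := eqVneq (sg x) 0; first by rewrite /gapfun s0 mul0r mulr0.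
have h := gap_dist N0 sx; have /andP[l1 _] := gapL sx.
have es : sg x = s.
  have hk : 0 <= s * (V x - x).
    case: hs => e; rewrite e !(mul1r, mulN1r) in hV *.
      have yV : y <= V y by lra.
      move: hx; rewrite min_l// max_r// => /andP[h1 h2].
      by have := Vmono h1; lra.
    have yV : V y <= y by lra.
    move: hx; rewrite min_r// max_l// => /andP[h1 h2].
    by have := Vmono h2; lra.
  have := l00; case: (gapsg_sign V N Mx x) => [e|[e|e]]; first by rewrite e eqxx in sx.
    by rewrite e in h *; case: hs hk => -> //; lra.
  by rewrite e in h *; case: hs hk => -> //; lra.
rewrite /gapfun es mulrA.
have -> : s * s = 1 by case: hs => ->; rewrite ?mulrNN mul1r.
rewrite mul1r mulr_ge0 ?powR_ge0// derivn0.
have := @bump_le1 R k ((x - a x) / L x).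
have /andP[ax1 ax2] := gapx sx; have l := lt_le_trans l00 l1.
rewrite divr_ge0 ?subr_ge0 ?(ltW l)//= ler_pdivrMr// mul1r lerBlDl (ltW ax2) => /(_ isT).
by case/andP.
Qed.

Lemma gapfun_middle y x : sg y != 0 -> a y + L y / 4 <= x <= a y + 3 * L y / 4 ->
  L y `^ (p - 1) * (3 / 16) ^+ k.+1 <= sg y * g 0%N x.
Proof.
move=> sy hx; have /andP[l1 _] := gapL sy; have l := lt_le_trans l00 l1.
have [|sx ax Lx] := @gapc y x sy; first by lra.
rewrite /gapfun sx ax Lx derivn0 mulrA subr0.
have -> : sg y * sg y = 1.
  by case: (gapsg_sign V N Mx y) => [e|[->|->]]; [rewrite e eqxx in sy|rewrite mul1r|rewrite mulrNN mul1r].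
rewrite mul1r ler_wpM2l ?powR_ge0// bump_middle// ler_pdivlMr// ler_pdivrMr//; lra.
Qed.

Section Primitive.
Variable h : R -> R.
Hypothesis dh : forall x : R, is_derive x 1 h (g 0%N x).

Definition testH (j : nat) : R -> R := if j is j'.+1 then g j' else h.

(** The k-th derivative of h is the (k - 1)-th of the bumps, and the exponent p - 1 - (k - 1) - (p -
    k) of the length is 0: the height |I|^(p-1) is chosen so that the constant does not depend on
    the gaps. For k = 0 one has p = 1 and h is Lipschitz. *)
Lemma testH_cls : clsA (2 * C) k (p - k%:R) testH.
Proof.
split=> [[|j] jk x /=|x y]; first exact: dh.
  by apply: (gapfun_derive p l00 gapL gapx sg1 gapc C1 hC); exact: ltnW.
have om0 : 0 <= p - k%:R <= 1 by move: om01; lra.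
have [k0|k0] := posnP k.
  have e1 : p = 1 by move: p1 om01; rewrite k0 subr0; lra.
  have [c _ e] := MVT_any y x dh.
  rewrite k0 /= e normrM subr0.
  have -> : `|x - y| `^ p = `|x - y| by rewrite e1 powRr1.
  rewrite ler_wpM2r//; apply: (le_trans (gapfun0_bound c)).
  by rewrite (_ : p - 1 = 0) ?powRr0; [move: C1; lra|rewrite e1 subrr].
rewrite -[X in testH X](prednK k0) /=.
have kp : k.-1%:R = k%:R - 1 :> R by rewrite -[in RHS](prednK k0) -natr1 addrK.
have h1 z : sg z != 0 -> L z `^ (p - 1 - k.-1%:R - (p - k%:R)) <= 1.
  move=> _; rewrite kp (_ : p - 1 - (k%:R - 1) - (p - k%:R) = 0); last by ring.
  by rewrite powRr0.
have := gapfun_holder l00 gapL gapx sg1 gapc C1 hC x y (leq_pred k) om0 h1 ler01.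
by rewrite mulr1.
Qed.

Lemma monotone_middle (f f' : R -> R) (c x u v y : R) : (forall t : R, is_derive t 1 f (f' t)) ->
  x <= u -> u <= v -> v <= y -> (forall t, x <= t <= y -> 0 <= f' t) ->
  (forall t, u <= t <= v -> c <= f' t) -> c * (v - u) <= f y - f x.
Proof.
move=> df xu uv vy f0 fc.
have h1 := @MVT_lower R f f' 0 x u xu df.
have h2 := @MVT_lower R f f' c u v uv df fc.
have h3 := @MVT_lower R f f' 0 v y vy df.
have {}h1 : 0 <= f u - f x by rewrite -(mul0r (u - x)); apply: h1 => t ht; apply: f0; lra.
have {}h3 : 0 <= f y - f v by rewrite -(mul0r (y - v)); apply: h3 => t ht; apply: f0; lra.
by lra.
Qed.

Lemma testH_increment z c u v (s : R) : s = 1 \/ s = -1 -> 0 < s * (V z - z) ->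
  Num.min z (V z) <= u -> u <= v -> v <= Num.max z (V z) ->
  (forall t, u <= t <= v -> c <= s * g 0%N t) -> c * (v - u) <= h (V z) - h z.
Proof.
move=> hs hV zu uv vz hc.
have pos t : Num.min z (V z) <= t <= Num.max z (V z) -> 0 <= s * g 0%N t.
  by move=> ht; apply: gapfun0_sign hV ht.
have df (t : R) : is_derive t 1 (fun t => s * h t) (s * g 0%N t) by exact: is_derive_scale.
have := monotone_middle df zu uv vz pos hc.
case: hs => e; rewrite e !(mul1r, mulN1r) in hV *.
  have yV : z <= V z by lra.
  by rewrite min_l// max_r.
have yV : V z <= z by lra.
by rewrite min_r// max_l// opprK; lra.
Qed.

(** The additional term pays for displacements below 32 times the shortest length. For longer ones h
    increases along the way from z to V z, and the middle half of the gap given by [gap_inside]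
    alone contributes the left side. *)
Lemma testH_lower z : testC * (Num.min `|V z - z| N) `^ p <=
  h (V z) - h z + testC * (32 * dlen N Mx) `^ p.
Proof.
have c0 := testC_gt0; have p0 : 0 <= p by move: p1; lra.
have m0 : 0 <= Num.min `|V z - z| N by rewrite le_min normr_ge0 ltW.
have b0 : 0 <= testC * (32 * dlen N Mx) `^ p by rewrite mulr_ge0 ?powR_ge0 ?(ltW c0).
have [e|nz] := eqVneq (V z) z.
  rewrite e subrr normr0 min_l ?(ltW N0)// powR0 ?mulr0 ?subrr ?add0r//.
  by rewrite gt_eqF//; move: p1; lra.
have [s hs sD] : exists2 s : R, s = 1 \/ s = -1 & s * (V z - z) = `|V z - z|.
  have [h1|h1] := leP z (V z).
    by exists 1; [left|rewrite mul1r ger0_norm// subr_ge0].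
  by exists (-1); [right|rewrite mulN1r ltr0_norm// subr_lt0].
have sD0 : 0 < s * (V z - z) by rewrite sD normr_gt0 subr_eq0.
have minmax : Num.min z (V z) <= Num.max z (V z) by rewrite ge_min !le_max !lexx.
have inc0 : 0 <= h (V z) - h z.
  have := @testH_increment z 0 (Num.min z (V z)) (Num.min z (V z)) s hs sD0 (lexx _) (lexx _) minmax.
  rewrite mul0r; apply=> t ht; apply: gapfun0_sign hs sD0 _.
  by move: ht minmax => /andP[h1 h2] h3; rewrite h1 (le_trans h2 h3).
have [small|big] := ltP `|V z - z| (32 * dlen N Mx).
  rewrite -[leLHS]add0r lerD// ler_wpM2l ?(ltW c0)//; apply: powR_mono => //.
  by rewrite ge_min (ltW small).
rewrite -sD in big; have [y [sy Ly [zy yz]]] := gap_inside Vmono N0 hs sD0 big.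
have sy0 : sg y != 0 by rewrite sy; case: hs => ->; rewrite ?oppr_eq0 oner_eq0.
have /andP[l1 _] := gapL sy0; have l := lt_le_trans l00 l1.
have := @testH_increment z (L y `^ (p - 1) * (3 / 16) ^+ k.+1) (a y + L y / 4) (a y + 3 * L y / 4) s hs sD0.
move=> hh; rewrite -[leLHS]addr0; apply: lerD => //.
apply: le_trans (hh _ _ _ _); [|lra|lra|lra|by move=> t ht; rewrite -sy; exact: gapfun_middle].
have -> : a y + 3 * L y / 4 - (a y + L y / 4) = L y / 2 by field.
have -> : L y `^ (p - 1) * (3 / 16) ^+ k.+1 * (L y / 2) = L y `^ p * ((3 / 16) ^+ k.+1 / 2).
  by rewrite -{2}(subrK 1 p) (@powR_addr _ (L y) (p - 1) 1)// powRr1 ?(ltW l)//; field.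
rewrite -sD in m0 *; set m := Num.min _ N in m0 Ly *.
have -> : testC * m `^ p = (64%:R^-1 * m) `^ p * ((3 / 16) ^+ k.+1 / 2).
  by rewrite powRM ?invr_ge0// /testC; ring.
rewrite ler_wpM2r ?divr_ge0 ?exprn_ge0// mulrC.
by apply: powR_mono => //; rewrite divr_ge0.
Qed.

End Primitive.
End TestFunction.

(** * The quantile coupling *)

Section GaussianCdf.
Context {R : realType}.
Local Notation gauss := (std_normal R).
Local Notation mu := (@lebesgue_measure R).

Definition gcdf (z : R) : R := fine (gauss `]-oo, z]).

Lemma gcdf_integral z : gcdf z = gcst * (\int[mu]_(w in `]-oo, z]) gker w)%R.
Proof.
rewrite /gcdf -ex_indic; last exact: measurable_itv.
have i : itg gauss (\1_`]-oo, z] : R -> R).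
  apply: (@itg_bnd _ _ _ gauss _ 1); first exact: measurable_indic.
  by move=> w; rewrite indicE; case: (_ \in _); rewrite ?normr1 ?normr0.
have [_ ->] := std_normal_gker i; congr (_ * _).
rewrite Rintegral_mkcond; congr (fine (integral _ _ _)).
apply/funext => w; congr EFin; rewrite patchE indicE.
by case: (w \in _); rewrite ?mul1r ?mul0r.
Qed.

Lemma is_derive_gcdf (z : R) : is_derive z 1 gcdf (gcst * gker z).
Proof.
have ig : itg mu (@gker R).
  have -> : @gker R = (fun x => (1 + `|x|) ^+ 0 * gker x) by apply/funext => x; rewrite expr0 mul1r.
  exact: itg_pow_gker.
have i : mu.-integrable `]-oo, (z + 1)] (EFin \o @gker R) by apply: (integrableS measurableT _ _ ig).
have zz : z < z + 1 by rewrite ltrDl.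
have cz : {for z, continuous (@gker R)} by exact: derive_continuous (is_derive_gker z).
have [d1 d2] := @continuous_FTC1 R (@gker R) -oo%O z (z + 1) zz i (ltNyr _) cz.
have -> : gcdf = (fun z => gcst * (\int[mu]_(w in `]-oo, z]) gker w)%R).
  by apply/funext => x; exact: gcdf_integral.
apply: is_derive_scale; split; first exact: d1.
by rewrite -derive1E.
Qed.

Lemma gcdf_lt x y : x < y -> gcdf x < gcdf y.
Proof.
move=> xy; have [c _ e] := MVT_any x y is_derive_gcdf.
by rewrite -subr_gt0 e !mulr_gt0 ?gcst_gt0 ?gker_gt0// subr_gt0.
Qed.

Lemma gcdf_le x y : (gcdf x <= gcdf y) = (x <= y).
Proof.
have [xy|xy] := leP x y; last by apply/negbTE; rewrite -ltNge gcdf_lt.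
by move: xy; rewrite le_eqVlt => /predU1P[->|/gcdf_lt/ltW]; rewrite ?lexx.
Qed.

Lemma gcdf_range z : 0 < gcdf z < 1.
Proof.
have h x : 0 <= gcdf x <= 1.
  rewrite fine_ge0//= -(@lee_fin R) fineK ?fin_num_measure//; exact: probability_le1.
have /andP[_ h1] := h (z + 1); have /andP[h0 _] := h (z - 1).
apply/andP; split; first by apply: le_lt_trans h0 _; apply: gcdf_lt; lra.
by apply: lt_le_trans h1; apply: gcdf_lt; lra.
Qed.

End GaussianCdf.

Section CdfReal.
Context {d} {Omega : measurableType d} {R : realType}.
Variables (P : probability Omega R) (W : {RV P >-> R}).

Definition rcdf (x : R) : R := fine (cdf W x).

Lemma rcdf_le x y : x <= y -> rcdf x <= rcdf y.
Proof. by move=> xy; rewrite fine_le ?fin_num_measure// cdf_nondecreasing. Qed.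

Lemma rcdf_right x : rcdf y @[y --> x^'+] --> rcdf x.
Proof.
have h := @cdf_right_continuous _ _ _ P W x.
by apply: fine_cvg; rewrite fineK ?fin_num_measure.
Qed.

Lemma rcdf_lt_ex t : 0 < t -> exists x, rcdf x < t.
Proof.
move=> t0; have h : rcdf @ -oo --> (0 : R) by exact/fine_cvg/cvg_cdfNy0.
have /filter_ex : \forall x \near -oo, rcdf x < t by exact: (cvgr_lt _ h).
exact.
Qed.

Lemma rcdf_gt_ex t : t < 1 -> exists x, t < rcdf x.
Proof.
move=> t1; have h : rcdf @ +oo --> (1 : R) by exact/fine_cvg/cvg_cdfy1.
have /filter_ex : \forall x \near +oo, t < rcdf x by exact: (cvgr_gt _ h).
exact.
Qed.

(** The quantile transform: the generalized inverse of the distribution function of W at the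
    standard normal distribution function. *)
Definition quant (z : R) : R := sup [set x | rcdf x < gcdf z].

Lemma quant_has_sup z : has_sup [set x | rcdf x < gcdf z].
Proof.
have /andP[g0 g1] := gcdf_range z; split.
  by have [x hx] := rcdf_lt_ex g0; exists x.
have [x hx] := rcdf_gt_ex g1; exists x => y /= hy.
rewrite leNgt; apply/negP => /ltW/rcdf_le; lra.
Qed.

(** From left to right the inequality holds at every point beyond x, and right continuity of the
    distribution function carries it to x. *)
Lemma quant_le z x : (quant z <= x) = (gcdf z <= rcdf x).
Proof.
apply/idP/idP => h; last first.
  apply: ge_sup; first by case: (quant_has_sup z).
  move=> y /= hy; rewrite leNgt; apply/negP => /ltW/rcdf_le; lra.
have hr : \forall y \near x^'+, gcdf z <= rcdf y.
  near=> y; rewrite leNgt; apply/negP => hy.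
  have : y <= quant z by apply: ub_le_sup => //; case: (quant_has_sup z).
  by rewrite leNgt => /negP; apply; apply: (le_lt_trans h); near: y; exact: nbhs_right_gt.
have hx := @rcdf_right x.
exact: (cvgr_to_ge hx hr).
Unshelve. all: by end_near.
Qed.

Lemma quant_mono y z : y <= z -> quant y <= quant z.
Proof.
move=> yz; rewrite quant_le; have := lexx (quant z); rewrite {1}quant_le.
by apply: le_trans; rewrite gcdf_le.
Qed.

Lemma quant_measurable : measurable_fun (setT : set R) quant.
Proof. by apply: nondecreasing_measurable => // x y; exact: quant_mono. Qed.

HB.instance Definition _ := isMeasurableFun.Build _ _ _ _ quant quant_measurable.

End CdfReal.

Section QuantileLaw.
Context {d} {Omega : measurableType d} {R : realType}.
Variables (P : probability Omega R) (W : {RV P >-> R}).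
Local Notation gauss := (std_normal R).
Local Notation V := (quant W).

Definition std_id : R -> R := fun x => x.
HB.instance Definition _ := isMeasurableFun.Build _ _ _ _ std_id (@measurable_id _ R setT).

Lemma gcdf_surj (t : R) : 0 < t -> t < 1 -> exists z, gcdf z = t.
Proof.
move=> t0 t1; pose I := std_id : {RV gauss >-> R}.
have [a ha] := @rcdf_lt_ex _ _ _ gauss I t t0; have [b hb] := @rcdf_gt_ex _ _ _ gauss I t t1.
have ab : a <= b.
  by rewrite -(@gcdf_le R); apply: ltW; exact: lt_trans ha hb.
have cg : {within `[a, b], continuous (@gcdf R)}.
  by apply: continuous_subspaceT => x; exact: derive_continuous (is_derive_gcdf x).
have [|c _ hc] := @IVT R (@gcdf R) a b t ab cg; last by exists c.
have gab : gcdf a <= gcdf b by rewrite gcdf_le.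
by rewrite min_l// max_r// (ltW ha) (ltW hb).
Qed.

(** A value of the distribution function of W in (0, 1) is attained by [gcdf]; the values 0 and 1
    are not, but then the event is empty or certain. *)
Lemma quant_halfline (x : R) : gauss (V @^-1` `]-oo, x]) = P (W @^-1` `]-oo, x]).
Proof.
have Fx : P (W @^-1` `]-oo, x]) = (rcdf W x)%:E.
  by rewrite /rcdf fineK// fin_num_measure.
rewrite Fx; have -> : V @^-1` `]-oo, x] = [set z | gcdf z <= rcdf W x].
  by apply/seteqP; split=> z /=; rewrite in_itv/= quant_le.
have F0 : 0 <= rcdf W x by rewrite fine_ge0.
have F1 : rcdf W x <= 1.
  rewrite -(@lee_fin R) fineK ?fin_num_measure//; exact: probability_le1.
have [e0|n0] := eqVneq (rcdf W x) 0.
  rewrite (_ : [set _ | _] = set0) ?measure0 ?e0//.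
  apply/seteqP; split=> z //=; rewrite leNgt; have /andP[-> _] := gcdf_range z => //.
have [e1|n1] := eqVneq (rcdf W x) 1.
  rewrite (_ : [set _ | _] = setT) ?probability_setT ?e1//.
  by apply/seteqP; split=> z //= _; have /andP[_ /ltW] := gcdf_range z.
have [||z hz] := @gcdf_surj (rcdf W x).
- by rewrite lt_neqAle eq_sym n0.
- by rewrite lt_neqAle n1.
rewrite -hz (_ : [set _ | _] = `]-oo, z]%classic).
  by rewrite /gcdf fineK// fin_num_measure.
by apply/seteqP; split=> y /=; rewrite in_itv/= gcdf_le.
Qed.

Lemma quant_law (A : set R) : measurable A -> gauss (V @^-1` A) = P (W @^-1` A).
Proof.
move=> mA.
apply: (@measure_unique _ _ _ (@RGenOInfty.G R) (fun n => `]- n%:R, +oo[%classic) _ _ _ _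
  (distribution gauss V) (distribution P W) _ _ A mA).
- exact: RGenOInfty.measurableE.
- move=> _ _ [x ->] [y ->]; exists (Num.max x y).
  by apply/seteqP; split=> z /=; rewrite !in_itv/= !andbT gt_max; [case=> -> ->|case/andP].
- by move=> n; exists (- n%:R).
- apply/seteqP; split=> // z _; exists (Num.truncn `|z|).+1 => //=; rewrite in_itv/= andbT.
  have := truncnS_gt `|z| => h; rewrite ltrNl; apply: le_lt_trans h.
  by rewrite -normrN ler_norm.
- move=> _ [x ->]; change (gauss (V @^-1` `]x, +oo[) = P (W @^-1` `]x, +oo[)).
  have c (S : Type) (f : S -> R) : f @^-1` `]x, +oo[ = ~` (f @^-1` `]-oo, x]).
    by apply/seteqP; split=> z /=; rewrite !in_itv/= andbT ltNge => /negP.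
  have m : measurable (`]-oo, x]%classic : set R) by exact: measurable_itv.
  have mV : measurable (V @^-1` `]-oo, x]) by rewrite -[X in measurable X]setTI; exact: quant_measurable.
  have mW : measurable (W @^-1` `]-oo, x]) by rewrite -[X in measurable X]setTI; exact: measurable_funPT.
  transitivity (1 - gauss (V @^-1` `]-oo, x]))%E; first by rewrite (c _ V); exact: probability_setC.
  transitivity (1 - P (W @^-1` `]-oo, x]))%E; last by rewrite (c _ W); apply/esym; exact: probability_setC.
  by congr (_ - _)%E; exact: quant_halfline.
- by move=> n; rewrite (le_lt_trans (probability_le1 _ _)) ?ltry.
Qed.

Lemma quant_ex (h : R -> R) : measurable_fun setT h -> itg P (h \o W) ->
  itg gauss (h \o V) /\ ex gauss (h \o V) = ex P (h \o W).
Proof.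
move=> mh ih.
have mEh : measurable_fun setT (EFin \o h) by exact/measurable_EFinP.
have mV : measurable_fun setT (V : R -> R) by exact: quant_measurable.
have iV : itg gauss (h \o V).
  apply/integrableP; split; first by apply/measurable_EFinP; exact: measurableT_comp.
  have mn : measurable_fun setT (fun y => `|(h y)%:E|)%E by exact: measurableT_comp.
  have := @ge0_integral_distribution _ _ R _ _ gauss V (fun y => `|(h y)%:E|)%E mn (fun _ => abse_ge0 _).
  move=> <-; rewrite (@eq_measure_integral _ _ _ setT (distribution P W)); last first.
    by move=> A mA _; exact: quant_law.
  by rewrite ge0_integral_distribution//; case/integrableP: ih.
split=> //; congr fine.
transitivity (\int[distribution gauss V]_y (EFin \o h) y)%E.
  by apply/esym; exact: integral_distribution.
transitivity (\int[distribution P W]_y (EFin \o h) y)%E; last exact: integral_distribution.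
by apply: eq_measure_integral => A mA _; exact: quant_law.
Qed.

End QuantileLaw.

(** * From test functions to the Wasserstein distance *)

Section Wasserstein.
Context {R : realType}.
Local Notation gauss := (std_normal R).

Lemma measurable_powR_comp (d : measure_display) (T : measurableType d) (f : T -> R) (p : R) :
  measurable_fun setT f -> measurable_fun setT (fun x => f x `^ p).
Proof.
by move=> mf; apply: (@measurableT_comp _ _ _ _ _ _ (fun x : R => x `^ p)).
Qed.

(** The first term suffices if t y <= e x and the second otherwise. Arguing by cases covers p = 1,
    where there is no finite conjugate exponent. *)
Lemma young_powR (p e x y t : R) : 1 <= p -> 0 < e -> 0 <= x -> 0 <= y -> 0 <= t ->
  t * (x `^ (p - 1) * y) <= e * x `^ p + e `^ (1 - p) * (t `^ p * y `^ p).
Proof.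
move=> p1 e0 x0 y0 t0; set z := t * y.
have z0 : 0 <= z by exact: mulr_ge0.
rewrite -powRM// -/z mulrCA -/z.
have px (a : R) : 0 <= a -> a * a `^ (p - 1) = a `^ p.
  by move=> a0; rewrite mulr_powRB1//; move: p1; lra.
have [ze|ze] := leP z (e * x).
  apply: (@le_trans _ _ (e * x `^ p)); last by rewrite lerDl mulr_ge0 ?powR_ge0.
  by rewrite -(px x)// mulrA mulrC ler_wpM2r ?powR_ge0.
apply: (@le_trans _ _ (e `^ (1 - p) * z `^ p)); last by rewrite lerDr mulr_ge0 ?powR_ge0// ltW.
rewrite -(px z)//.
have -> : e `^ (1 - p) * (z * z `^ (p - 1)) = e `^ (1 - p) * z `^ (p - 1) * z by ring.
rewrite ler_wpM2r//.
have -> : 1 - p = - (p - 1) by ring.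
rewrite powRN ler_pdivlMl ?powR_gt0// -powRM ?(ltW e0)//.
by apply: powR_mono; [rewrite subr_ge0|rewrite mulr_ge0// ltW|exact: ltW].
Qed.

Section Coupling.
Context {d} {Omega : measurableType d}.
Variables (P : probability Omega R) (W : {RV P >-> R}).
Local Notation V := (quant W).

Definition qpair (z : R) : R * R := (V z, z).

Lemma qpair_measurable : measurable_fun setT qpair.
Proof. by apply: measurable_fun_pair => //; exact: quant_measurable. Qed.

HB.instance Definition _ := isMeasurableFun.Build _ _ _ _ qpair qpair_measurable.

Lemma wasserstein_quant (p : R) : 0 < p -> itg gauss (fun z => `|V z - z| `^ p) ->
  (wasserstein p (distribution P W) gauss <= ((ex gauss (fun z => `|V z - z| `^ p)) `^ p^-1)%:E)%E.
Proof.
move=> p0 i; apply: ereal_inf_lbound => /=.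
exists (distribution gauss qpair).
  move=> A mA; split; last by [].
  by rewrite -[RHS](quant_law W mA).
rewrite -poweR_EFin; congr (_ `^ _)%E.
rewrite unlock ge0_integral_distribution//; last first.
  apply/measurable_EFinP; apply: measurable_powR_comp.
  apply: measurableT_comp => //; apply: measurable_funB; [exact: measurable_fst|exact: measurable_snd].
rewrite /ex /Rintegral fineK//; exact: (integrable_fin_num measurableT i).
Qed.

Lemma itg_quant_dist (p : R) : 0 < p -> itg P (fun w => (1 + `|W w|) `^ p) ->
  itg gauss (fun z => `|V z - z| `^ p).
Proof.
move=> p0 iW.
have m1 : measurable_fun setT (fun y : R => (1 + `|y|) `^ p).
  apply: measurable_powR_comp.
  by apply: measurable_funD => //; exact: measurableT_comp.
have [i1 _] := quant_ex m1 iW.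
pose n := (Num.truncn p).+1.
have i2 : itg gauss (fun z => 2 `^ p * ((1 + `|V z|) `^ p + (1 + `|z|) ^+ n)).
  by apply: itgZ; apply: itgD => //; exact: std_normal_itg_pow.
apply: (itg_le _ i2).
  apply: measurable_powR_comp.
  apply: measurableT_comp => //; apply: measurable_funB => //; exact: quant_measurable.
move=> z; rewrite ger0_norm ?powR_ge0//.
have v1 : 1 <= 1 + `|V z| by rewrite lerDl.
have z1 : 1 <= 1 + `|z| by rewrite lerDl.
pose x := Num.max (1 + `|V z|) (1 + `|z|).
have x1 : `|V z - z| <= 2 * x.
  have h1 : 1 + `|V z| <= x by rewrite le_max lexx.
  have h2 : 1 + `|z| <= x by rewrite le_max lexx orbT.
  by have := ler_normB (V z) z; lra.
apply: (@le_trans _ _ ((2 * x) `^ p)); first by apply: powR_mono => //; exact: ltW.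
rewrite powRM//; last by rewrite le_max addr_ge0.
rewrite ler_wpM2l ?powR_ge0// /x; have [h|h] := leP (1 + `|V z|) (1 + `|z|).
  apply: (@le_trans _ _ ((1 + `|z|) ^+ n)); last by rewrite lerDr powR_ge0.
  rewrite -powR_mulrn ?addr_ge0//; apply: ler_powR => //; exact/ltW/truncnS_gt.
by rewrite lerDl exprn_ge0// addr_ge0.
Qed.

End Coupling.

(** The displacement is truncated at N, the longest length in the dyadic construction; this also
    makes h' bounded. The estimate for the truncated p-th moment does not depend on N, which then
    tends to infinity by dominated convergence. *)
Lemma wasserstein_test (k m : nat) (p C1 C2 : R) : 1 <= p -> 0 < p - k%:R <= 1 -> 0 <= C1 -> 0 <= C2 ->
  exists2 C : R, 0 <= C & forall (d : measure_display) (Omega : measurableType d)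
    (P : probability Omega R) (W : {RV P >-> R}) (t : R), 0 < t ->
    itg P (fun w => (1 + `|W w|) `^ p) ->
    (forall a H h', 0 < a -> clsA a k (p - k%:R) H -> (forall x : R, is_derive x 1 (H 0%N) (h' x)) ->
      continuous h' -> pgrow 0 h' ->
      itg P (H 0%N \o W) /\
      `|ex P (H 0%N \o W) - gaussE (H 0%N)| <=
         C1 * t * ex gauss (fun x => `|h' x| * (1 + `|x|) ^+ m) + C2 * a * t `^ p) ->
    (wasserstein p (distribution P W) gauss <= (C * t)%:E)%E.
Proof.
move=> p1 om01 C10 C20; have p0 : 0 < p by move: p1; lra.
have [C hC1 hC] := @bump_bounds R k.
pose c := @testC R k p; have c0 : 0 < c by exact: testC_gt0.
pose n := (m * (Num.truncn p).+1)%N.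
pose Y := ex gauss (fun x : R => (1 + `|x|) ^+ n).
have Y0 : 0 <= Y by apply: ex_ge0 => x; rewrite exprn_ge0// addr_ge0.
pose C3 := (c / 2) `^ (1 - p) * C1 `^ p.
have C30 : 0 <= C3 by rewrite mulr_ge0 ?powR_ge0.
pose C4 := 2 / c * (C3 * Y + C2 * (2 * C) + c).
have C40 : 0 <= C4.
  have C0 : 0 <= 2 * C by move: hC1; lra.
  have h1 := mulr_ge0 C30 Y0; have h2 := mulr_ge0 C20 C0.
  by rewrite mulr_ge0 ?divr_ge0 ?(ltW c0)//; lra.
exists (C4 `^ p^-1) => [|d Omega P W t t0 iW hH]; first exact: powR_ge0.
pose V := quant W.
have Vm : forall x y, x <= y -> V x <= V y by move=> x y; exact: quant_mono.
have iD := itg_quant_dist p0 iW.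
have mD : measurable_fun setT (fun z => `|V z - z|).
  by apply: measurableT_comp => //; apply: measurable_funB => //; exact: quant_measurable.
pose mN (N z : R) := (Num.min `|V z - z| N) `^ p.
have mmN N : measurable_fun setT (mN N).
  apply: measurable_powR_comp.
  exact: measurable_minr.
have key (N : R) : 0 < N -> ex gauss (mN N) <= C4 * t `^ p.
  move=> N0.
  (* The shortest length is made so small that displacements the construction cannot see cost at
     most c t^p. *)
  have [Mx hMx] : exists Mx, 32 * dlen N Mx <= t.
    have h0 : 0 < t / (32 * N) by rewrite divr_gt0// mulr_gt0.
    pose Mx := (Num.truncn (t / (32 * N))^-1).+1; exists Mx.
    have h1 : (t / (32 * N))^-1 < Mx%:R by exact: truncnS_gt.
    have h2 : Mx%:R <= 2 ^+ Mx :> R by rewrite -natrX ler_nat ltnW// ltn_expl.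
    have h3 := lt_le_trans h1 h2.
    rewrite /dlen mulrA ler_pdivrMr ?exprn_gt0//.
    by rewrite invf_div ltr_pdivrMr// in h3; rewrite [t * _]mulrC; exact: ltW.
  have cg := @gapfun0_continuous R k p C p1 om01 hC1 hC V N Mx N0.
  have [h dh] := continuous_antiderivative cg.
  pose H := testH k p V N Mx h.
  have clH := testH_cls p1 om01 hC1 hC N0 dh.
  have low := testH_lower p1 Vm N0 dh.
  have C0' : 0 < 2 * C by move: hC1; lra.
  pose g := gapfun k p (gapsg V N Mx) (gapa V N Mx) (gaplen V N Mx) 0.
  have gb z : `|g z| <= (Num.min `|V z - z| N) `^ (p - 1).
    exact: gapfun0_bound.
  have m0 z : 0 <= Num.min `|V z - z| N by rewrite le_min normr_ge0 ltW.
  have gp : pgrow 0 g.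
    exists (N `^ (p - 1)) => x; rewrite expr0 mulr1; apply: (le_trans (gb x)).
    by apply: powR_mono; rewrite ?subr_ge0// ge_min lexx orbT.
  have [ihW hW] := hH _ H g C0' clH dh cg gp.
  have ch : continuous h by move=> x; exact: derive_continuous (dh x).
  have mh : measurable_fun setT h by exact: continuous_measurable_fun.
  have [ihV eV] := quant_ex mh ihW.
  have om0' : 0 < p - k%:R <= 1 by [].
  have ih : itg gauss h.
    exact: pgrow_itg ch (clsA_pgrow om0' C0' clH (leq0n k)).
  have imN : itg gauss (mN N).
    apply: (@itg_bnd _ _ _ gauss _ (N `^ p)) => // z.
    rewrite ger0_norm ?powR_ge0//; apply: powR_mono => //; first exact: ltW.
    by rewrite ge_min lexx orbT.
  have s1 : c * ex gauss (mN N) <= ex gauss (h \o V) - ex gauss h + c * t `^ p.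
    rewrite -exZ// -exB// -[c * t `^ p](ex_cst gauss) -exD; [|exact: itgB|exact: itg_cst].
    apply: ex_le; [exact: itgZ|by apply: itgD; [exact: itgB|exact: itg_cst]|].
    move=> z; apply: (le_trans (low z)); rewrite lerD2l ler_wpM2l ?(ltW c0)//.
    apply: powR_mono; [exact: ltW|by rewrite mulr_ge0// ltW// dlen_gt0|exact: hMx].
  have s2 : ex gauss (h \o V) - ex gauss h <=
      C1 * t * ex gauss (fun x => `|g x| * (1 + `|x|) ^+ m) + C2 * (2 * C) * t `^ p.
    by rewrite eV -gaussE_ex; apply: (le_trans (ler_norm _)); exact: hW.
  have ig := itg_norm_growth m cg gp.
  have iY : itg gauss (fun x : R => (1 + `|x|) ^+ n) by exact: std_normal_itg_pow.
  (* Young's inequality with weight c / 2: the first term on the right is half of the left side of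
     [s1] and is absorbed there. *)
  have s3 : C1 * t * ex gauss (fun x => `|g x| * (1 + `|x|) ^+ m) <=
      c / 2 * ex gauss (mN N) + C3 * t `^ p * Y.
    rewrite -!exZ// -exD; [|exact: itgZ|exact: itgZ].
    apply: ex_le; [exact: itgZ|by apply: itgD; exact: itgZ|].
    move=> z; have b0 : 0 <= (1 + `|z|) ^+ m by rewrite exprn_ge0// addr_ge0.
    have t1 : 0 <= C1 * t by rewrite mulr_ge0// ltW.
    apply: (@le_trans _ _ (C1 * t * ((Num.min `|V z - z| N) `^ (p - 1) * (1 + `|z|) ^+ m))).
      by rewrite ler_wpM2l// ler_wpM2r.
    have c2 : 0 < c / 2 by rewrite divr_gt0.
    apply: (le_trans (young_powR p1 c2 (m0 z) b0 t1)).
    rewrite lerD2l (powRM p C10 (ltW t0)) mulrA [(c / 2) `^ _ * _]mulrA -/C3.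
    apply: ler_pM; [exact: mulr_ge0 C30 (powR_ge0 _ _)|exact: powR_ge0|exact: lexx|].
    rewrite /n exprM -[leRHS]powR_mulrn//.
    by apply: ler_powR; [rewrite exprn_ege1// lerDl|exact/ltW/truncnS_gt].
  have fin : c / 2 * ex gauss (mN N) <= (C3 * Y + C2 * (2 * C) + c) * t `^ p.
    by move: s1 s2 s3; lra.
  have eC : C4 * t `^ p = 2 / c * ((C3 * Y + C2 * (2 * C) + c) * t `^ p) by exact: esym (mulrA _ _ _).
  have -> : ex gauss (mN N) = 2 / c * (c / 2 * ex gauss (mN N)) by field; exact: lt0r_neq0.
  by rewrite eC ler_wpM2l// divr_ge0// ltW.
have lim : (ex gauss (mN n.+1%:R) : R) @[n --> \oo] --> ex gauss (fun z => `|V z - z| `^ p).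
  apply: (@ex_dct _ _ _ gauss _ _ (fun z => `|V z - z| `^ p)) => //.
  - by apply: measurable_powR_comp.
  - move=> z; apply: cvg_near_cst; exists (Num.truncn `|V z - z|) => // N /= hN.
    rewrite /mN min_l//; apply: (le_trans (ltW (truncnS_gt _))).
    by rewrite ler_nat ltnS.
  - move=> N z; rewrite ger0_norm ?powR_ge0//; apply: powR_mono; first exact: ltW.
      by rewrite le_min normr_ge0/=.
    by rewrite ge_min lexx.
have bound : ex gauss (fun z => `|V z - z| `^ p) <= C4 * t `^ p.
  apply: cvgr_to_le lim _; near=> N; exact: key.
apply: (le_trans (wasserstein_quant p0 iD)); rewrite lee_fin.
apply: (@le_trans _ _ ((C4 * t `^ p) `^ p^-1)).
  apply: powR_mono => //; first by rewrite invr_ge0 ltW.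
  by apply: ex_ge0 => z; exact: powR_ge0.
by rewrite powRM ?powR_ge0// -powRrM mulfV ?gt_eqF// powRr1// ltW.
Unshelve. all: by end_near.
Qed.

End Wasserstein.

Lemma omega_ceiln (R : realType) (p : R) : 0 < p ->
  [/\ 0 < omega p <= 1, p = (ceiln p).-1%:R + omega p & (0 < ceiln p)%N].
Proof.
move=> p0; have c0 : 0 < Num.ceil p by rewrite ceil_gt0.
have cE : (ceiln p)%:R = (Num.ceil p)%:~R :> R.
  by rewrite /ceiln natr_absz gtr0_norm.
have n0 : (0 < ceiln p)%N by rewrite /ceiln absz_gt0 gt_eqF.
have /andP[h1 h2] := real_ceil_itv (num_real p).
split=> //.
  rewrite /omega; move: h1 h2; rewrite intrD; lra.
rewrite /omega -cE -{2}(prednK n0) -natr1; ring.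
Qed.

(** * Rates for good fields *)

Section EdgeworthTerms.
Context {R : realType}.
Local Notation gauss := (std_normal R).

(** One factor supplies t, and each of the others is at most 2 A because t <= 2. *)
Lemma prod_cumulant_small (A t : R) (kappa : nat -> R) (s : seq nat) : 0 <= A -> 0 <= t <= 2 -> s != [::] ->
  (forall j, j \in s -> `|kappa (j + 2)%N| <= A * t) ->
  `|\prod_(j <- s) (kappa (j + 2)%N / (j.+1)`!%:R)| <= (2 * A) ^+ size s * t.
Proof.
move=> A0 /andP[t0 t2]; have one j : `|kappa (j + 2)%N| <= A * t -> `|kappa (j + 2)%N / (j.+1)`!%:R| <= A * t.
  move=> h; rewrite normrM normfV; apply: le_trans h.
  by rewrite ler_piMr// normr_nat invf_le1 ?ler1n ?ltr0n fact_gt0.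
elim: s => // j s IH _ h; rewrite big_cons normrM /=.
have hj := one j (h j (mem_head _ _)).
have At : A * t <= 2 * A by rewrite mulrC ler_wpM2r.
have [->|s0] := eqVneq s [::].
  by rewrite big_nil normr1 mulr1 expr1; apply: (le_trans hj); nra.
rewrite exprS -mulrA; apply: ler_pM => //; first exact: le_trans hj At.
by apply: IH => // i si; apply: h; rewrite inE si orbT.
Qed.

Lemma leq_sumn (j : nat) (s : seq nat) : j \in s -> (j <= sumn s)%N.
Proof.
elim: s => //= i s IH; rewrite inE => /orP[/eqP ->|/IH h]; first exact: leq_addr.
by rewrite (leq_trans h)// leq_addl.
Qed.

Lemma edgeworth_terms (k : nat) (om A : R) (l : seq (seq nat)) : 0 < om <= 1 -> 0 <= A ->
  (forall s, s \in l -> [/\ s != [::], all (fun j => 0 < j)%N s & (sumn s <= k)%N]) ->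
  exists C m, 0 <= C /\ forall (kappa : nat -> R) t a H h' n, 0 <= t <= 2 ->
    (forall j, (0 < j <= k)%N -> `|kappa (j + 2)%N| <= A * t) -> 0 < a -> clsA a k om H ->
    (forall x : R, is_derive x 1 (H 0%N) (h' x)) -> continuous h' -> pgrow n h' ->
    `|\sum_(s <- l) eterm kappa s (H 0%N)| <= C * t * ex gauss (fun x => `|h' x| * (1 + `|x|) ^+ m).
Proof.
move=> om01 A0; elim: l => [_|s l IH hl].
  exists 0, 0%N; split=> // *; by rewrite big_nil normr0 !mul0r.
have [|C [m [C0 hC]]] := IH; first by move=> i il; apply: hl; rewrite inE il orbT.
have [s0 sp sk] := hl s (mem_head _ _).
have [E [m' [E0 hE]]] := @gaussE_Theta_comp_le R s s0.
have B0 : 0 <= (2 * A) ^+ size s by rewrite exprn_ge0// mulr_ge0.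
exists (C + (2 * A) ^+ size s * E), (maxn m m'); split; first by rewrite addr_ge0// mulr_ge0.
move=> kappa t a H h' n t02 hk a0 hH dh ch gh; rewrite big_cons.
have /andP[t0 _] := t02.
have mono j : (j <= maxn m m')%N -> ex gauss (fun x => `|h' x| * (1 + `|x|) ^+ j) <=
    ex gauss (fun x => `|h' x| * (1 + `|x|) ^+ (maxn m m')).
  move=> jm; apply: ex_le; [exact: itg_norm_growth ch gh|exact: itg_norm_growth ch gh|].
  by move=> x; rewrite ler_wpM2l// ler_weXn2l// lerDl.
apply: (le_trans (ler_normD _ _)); rewrite addrC mulrDl mulrDl; apply: lerD.
  apply: (le_trans (hC kappa t a H h' n t02 hk a0 hH dh ch gh)).
  by rewrite ler_wpM2l ?mono ?leq_maxl// mulr_ge0.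
rewrite /eterm !normrM normrX normrN1 expr1n mul1r.
have hs : `|\prod_(j <- s) (kappa (j + 2)%N / (j.+1)`!%:R)| <= (2 * A) ^+ size s * t.
  apply: prod_cumulant_small => // j js; apply: hk; rewrite (allP sp _ js)/=.
  exact: leq_trans (leq_sumn js) sk.
have hg := hE k om a H h' n om01 sk a0 hH dh ch gh.
have -> : forall x, (2 * A) ^+ size s * E * t * x = ((2 * A) ^+ size s * t) * (E * x) by move=> x; ring.
apply: ler_pM => //; apply: (le_trans hg).
by rewrite ler_wpM2l// mono// leq_maxr.
Qed.

End EdgeworthTerms.

Section GoodFields.
Context {R : realType} {dim : nat}.
Variables (p K c0 B : R) (r : \bar R).
Hypothesis dim0 : (0 < dim)%N.
Hypothesis p0 : 0 < p.
Hypothesis pr : ((p + 2)%:E < r)%E.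
Hypothesis K0 : 0 < K.
Hypothesis c00 : 0 < c0.
Local Notation good := (good_field p K c0 B r).
Local Notation gauss := (std_normal R).
Let k := (ceiln p).-1.
Let om := omega p.
Let om01 : 0 < om <= 1. Proof. by have [] := omega_ceiln p0. Qed.
Let pk : p = k%:R + om. Proof. by have [] := omega_ceiln p0. Qed.
Let kc : (k < ceiln p)%N. Proof. by have [_ _ h] := omega_ceiln p0; rewrite prednK. Qed.

Lemma M_coef_ge0 (d : measure_display) (Omega : measurableType d)
    (T : {fset 'rV[int]_dim}) (P : probability Omega R) (X : T -> {RV P >-> R}) : 0 <= M_coef X p r.
Proof.
rewrite mulr_ge0 ?powR_ge0// sumr_ge0// => l _; by rewrite mulr_ge0 ?powR_ge0.
Qed.

Lemma Eerr_M_coef (d : measure_display) (Omega : measurableType d)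
    (T : {fset 'rV[int]_dim}) (P : probability Omega R) (X : T -> {RV P >-> R}) :
  Eerr p r X om k.+1 = #|` T|%:R `^ (- (p / 2)) + M_coef X p r.
Proof.
have e1 : (k.+1%:R + om - 1) / 2 = p / 2 by rewrite pk -natr1; congr (_ / _); ring.
rewrite /Eerr e1 mulrDr mulr1; congr (_ + _ * _); rewrite /mixS.
apply: eq_bigr => l _; congr (_ `^ _ * _); rewrite -/om [X in dim%:R * (X + 1)]pk -natr1; ring.
Qed.

Lemma cumulant_rate (j : nat) : (0 < j <= k)%N -> exists2 C, 0 <= C &
  forall (d : measure_display) (Omega : measurableType d)
    (T : {fset 'rV[int]_dim}) (P : probability Omega R) (X : T -> {RV P >-> R}), good X ->
    `|cumulant P (normalized_sum X) (j + 2)| <=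
      C * (#|` T|%:R `^ (- (j%:R / 2)) + M_coef X p r `^ (j%:R / p)).
Proof.
move=> /andP[j0 jk]; have jp : j%:R <= p.
  have : j%:R <= k%:R :> R by rewrite ler_nat.
  by rewrite pk; case/andP: om01; lra.
have jc : (j < ceiln p)%N by exact: leq_ltn_trans jk kc.
pose F := @fieldC R dim p K c0 1 j.
exists (`|j.+1`!%:R * F| * `|2 + B|) => [|d Omega T P X gX]; first by rewrite mulr_ge0.
apply: (le_trans (cumulant_bound dim0 p0 pr K0 c00 gX j0 jc jp)); rewrite -/F.
apply: (@le_trans _ _ (`|j.+1`!%:R * F| * Eerr p r X 1 j)).
  by rewrite ler_wpM2r ?ler_norm//; apply: Eerr_ge0.
rewrite -mulrA ler_wpM2l//; apply: (le_trans (Eerr_young dim0 p0 gX j0 jp om01)).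
by rewrite ler_wpM2r ?ler_norm// addr_ge0 ?powR_ge0.
Qed.

(** With t = u + v, the bound on M gives t <= 2, so that the rates u^j + v^j of all the cumulants
    are of order t. The remainder u^p + v^p is of order t^p, as [wasserstein_test] requires. *)
Lemma wasserstein_good : 1 <= p -> exists2 C, 0 <= C &
  forall (d : measure_display) (Omega : measurableType d)
    (T : {fset 'rV[int]_dim}) (P : probability Omega R) (X : T -> {RV P >-> R}), good X ->
    M_coef X p r <= 1 ->
    (wasserstein p (distribution P (normalized_sum X)) gauss <=
      (C * (#|` T|%:R `^ (- (1 / 2)) + M_coef X p r `^ p^-1))%:E)%E.
Proof.
move=> p1.
have om' : p - k%:R = om by rewrite {1}pk addrAC subrr add0r.
have kp : k%:R + om <= p by rewrite -pk.
have [C2 C20 hC2] := edgeworth_bound B dim0 p0 pr K0 c00 om01 (ltnSn k) kp kc.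
have [A A1 hA] : exists2 A, 1 <= A & forall j, (j <= k)%N -> (0 < j)%N ->
    forall (d : measure_display) (Omega : measurableType d)
    (T : {fset 'rV[int]_dim}) (P : probability Omega R) (X : T -> {RV P >-> R}), good X ->
    `|cumulant P (normalized_sum X) (j + 2)| <=
      A * (#|` T|%:R `^ (- (j%:R / 2)) + M_coef X p r `^ (j%:R / p)).
  apply: uniform_constant => [j C C' CC' h j0 d Omega T P X gX|j jk].
    by apply: (le_trans (h j0 d Omega T P X gX)); rewrite ler_wpM2r// addr_ge0 ?powR_ge0.
  have [->|j0] := posnP j; first by exists 0.
  by have [|C _ hC] := @cumulant_rate j; [rewrite j0|exists C].
(* u^j + v^j is at most 2 (u + v)^j, hence at most 2 * 2^k (u + v) for 1 <= j <= k, since u + v <=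
   2. *)
pose A' := A * (2 * 2 ^+ k).
have A'0 : 0 <= A' by rewrite !mulr_ge0 ?exprn_ge0//; exact: le_trans A1.
pose l := behead (cs k.+1 k).
have csl : cs k.+1 k = [::] :: l by [].
have hl s : s \in l -> [/\ s != [::], all (fun j => 0 < j)%N s & (sumn s <= k)%N].
  move=> sl; have : s \in cs k.+1 k by rewrite csl inE sl orbT.
  rewrite cs_mem// => /andP[h1 h2]; split=> //.
  by apply/negP => /eqP e; have := cs_uniq k.+1 k; rewrite csl /= -e sl.
have [C1 [m [C10 hC1]]] := edgeworth_terms om01 A'0 hl.
have C2' : 0 <= 2 * C2 by rewrite mulr_ge0.
have om01' : 0 < p - k%:R <= 1 by rewrite om'.
have [C C0 hC] := @wasserstein_test R k m p C1 (2 * C2) p1 om01' C10 C2'.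
exists C => // d Omega T P X gX M1.
have T1 : 1 <= #|` T|%:R :> R.
  by have [T0 _ _ _ _] := gX; rewrite ler1n cardfs_gt0.
have T0 : 0 < #|` T|%:R :> R by exact: lt_le_trans T1.
have M0 : 0 <= M_coef X p r by exact: M_coef_ge0.
set u := #|` T|%:R `^ (- (1 / 2)); set v := M_coef X p r `^ p^-1.
have u0 : 0 < u by exact: powR_gt0.
have v0 : 0 <= v by exact: powR_ge0.
have u1 : u <= 1.
  by rewrite /u powRN invf_le1 ?powR_gt0//; apply: powR_ge1 => //; lra.
have v1 : v <= 1 by apply: powR_le1; [rewrite invr_ge0 ltW|rewrite M0].
have t0 : 0 < u + v by rewrite ltr_pwDl.
have t02 : 0 <= u + v <= 2 by rewrite (ltW t0)/=; lra.
apply: (hC d Omega P (normalized_sum X)) => // [|a H h' a0 hH dh ch gh].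
  by apply: (itg_W_powR p0 pr K0 c00 gX); rewrite (ltW p0) lerDl ler0n.
have hu x : #|` T|%:R `^ (- (x / 2)) = u `^ x.
  by rewrite /u -powRrM; congr (_ `^ _); field.
have hv x : M_coef X p r `^ (x / p) = v `^ x.
  by rewrite /v -powRrM; congr (_ `^ _); rewrite mulrC.
have Mv : M_coef X p r = v `^ p by rewrite -hv divff ?lt0r_neq0// powRr1.
have uw x : 0 <= x -> u `^ x <= (u + v) `^ x by move=> x0; apply: powR_mono; rewrite ?(ltW u0) ?lerDl.
have vw x : 0 <= x -> v `^ x <= (u + v) `^ x by move=> x0; apply: powR_mono; rewrite ?lerDr ?(ltW u0).
rewrite om' in hH; split.
  have := @itg_W_cls _ _ _ _ _ _ _ p0 pr K0 c00 _ _ _ _ _ gX k om _ 0%N.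
  have [om0 om1] := andP om01.
  move=> /(_ _ om0 _ (clsA_cls a0 hH) (leq0n k)) i.
  have : itg P (fun w => a * (a^-1 * H 0%N (normalized_sum X w))) by apply: itgZ; apply: i; lra.
  by apply: eq_integrable => // w _ /=; rewrite mulVKf// gt_eqF.
have hE := hC2 d Omega T P X gX a H a0 hH.
rewrite csl big_cons Eerr_M_coef hu Mv in hE.
have e0 : eterm (cumulant P (normalized_sum X)) [::] (H 0%N) = gaussE (H 0%N).
  by rewrite /eterm big_nil expr0 !mul1r.
rewrite e0 in hE.
have hk j : (0 < j <= k)%N -> `|cumulant P (normalized_sum X) (j + 2)| <= A' * (u + v).
  move=> /andP[j0 jk]; apply: (le_trans (hA j jk j0 d Omega T P X gX)).
  rewrite hu hv /A' -mulrA ler_wpM2l//; first exact: le_trans A1.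
  have hw : (u + v) `^ j%:R <= 2 ^+ k * (u + v).
    rewrite powR_mulrn ?(ltW t0)// -(prednK j0) exprSr ler_wpM2r ?(ltW t0)//.
    have /andP[w0 w2] := t02; apply: (@le_trans _ _ (2 ^+ j.-1)); first by rewrite lerXn2r ?nnegrE.
    by rewrite ler_weXn2l ?ler1n// (leq_trans (leq_pred _) jk).
  rewrite -[2 * 2 ^+ k * _]mulrA mulr_natl mulr2n.
  by apply: lerD; apply: le_trans hw; [apply: uw|apply: vw].
have hS := hC1 _ _ a H h' _ t02 hk a0 hH dh ch gh.
set S := \sum_(j <- l) _ in hE hS.
set e := ex P _ in hE.
have -> : ex P (H 0%N \o normalized_sum X) - gaussE (H 0%N) = (e - (gaussE (H 0%N) + S)) + S.
  by rewrite -/e; ring.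
apply: (le_trans (ler_normD _ _)); rewrite addrC; apply: lerD => //.
apply: (le_trans hE); rewrite -mulrA [2 * C2]mulrC -!mulrA ler_wpM2l// mulrCA ler_wpM2l ?(ltW a0)//.
by rewrite mulr_natl mulr2n; apply: lerD; [apply: uw|apply: vw]; exact: ltW.
Qed.

End GoodFields.

(** * Application to the sequence of fields *)

Lemma limn_einf_gt0 (R : realType) (u : nat -> R) : (0 < limn_einf (fun n => (u n)%:E))%E ->
  exists2 c, 0 < c & \forall n \near \oo, c <= u n.
Proof.
rewrite limn_einf_lim (cvg_lim _ (ereal_nondecreasing_cvgn (nondecreasing_einfs _)))// => h.
have [x [N _ <-] xpos] := ereal_sup_gt h.
have le n : (N <= n)%N -> (einfs (fun n => (u n)%:E) N <= (u n)%:E)%E.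
  by move=> Nn; apply: ereal_inf_lbound; exists n.
have fx : einfs (fun n => (u n)%:E) N \is a fin_num.
  rewrite fin_numE gt_eqF ?(lt_trans _ xpos) ?ltNyr//= lt_eqF//.
  by rewrite (le_lt_trans (le N (leqnn _)))// ltry.
exists (fine (einfs (fun n => (u n)%:E) N)); first by rewrite fine_gt0// xpos/= ltey_eq fx.
by exists N => // n /= Nn; rewrite -lee_fin fineK// le.
Qed.

Lemma Lambda_clsA (R : realType) (p : R) (h : R -> R) : Lambda p h ->
  clsA 1 (ceiln p).-1 (omega p) (fun j => h^`(j)%classic).
Proof.
move=> [[[hd _] _] hs]; split=> [j jk x|x y].
  by rewrite derive1nS derive1E; apply: derivableP; exact: hd.
have [->|xy] := eqVneq x y; first by rewrite subrr normr0 mul1r powR_ge0.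
have xy0 : 0 < `|x - y| `^ omega p by rewrite powR_gt0// normr_gt0 subr_eq0.
rewrite -ler_pdivrMr// -lee_fin; apply: le_trans hs.
by apply: ereal_sup_ubound; exists x, y.
Qed.

Lemma ereal_sup_real_bound (R : realType) (S : set (\bar R)) : (ereal_sup S < +oo)%E ->
  exists2 K : R, 0 < K & forall x, S x -> (x <= K%:E)%E.
Proof.
move=> h; have ub x : S x -> (x <= ereal_sup S)%E by exact: ereal_sup_ubound.
case: (ereal_sup S) h ub => // [s _|_] ub.
  exists (`|s| + 1) => [|x /ub h]; first by rewrite ltr_pwDr.
  by apply: (le_trans h); rewrite lee_fin (le_trans (ler_norm s))// lerDl.
by exists 1 => // x /ub h; apply: (le_trans h); rewrite leNye.
Qed.

Lemma cvg_powR0 (R : realType) (u : nat -> R) (a : R) : 0 < a -> (forall n, 0 <= u n) ->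
  (u n : R) @[n --> \oo] --> (0 : R) -> (u n `^ a : R) @[n --> \oo] --> (0 : R).
Proof.
move=> a0 u0 hu; apply/cvgr0Pnorm_le => e e0.
have ea : 0 < e `^ a^-1 by exact: powR_gt0.
have h := cvgr_le _ hu _ ea.
near=> n; rewrite ger0_norm ?powR_ge0//.
have -> : e = (e `^ a^-1) `^ a by rewrite -powRrM mulVf ?gt_eqF// powRr1// ltW.
by apply: powR_mono; [exact: ltW|exact: u0|near: n; exact: h].
Unshelve. all: by end_near.
Qed.

Theorem theorem2p3 (R : realType) (d : nat) (hd : (0 < d)%N)
    (T : nat -> {fset 'rV[int]_d})
    (T_neq0 : forall n, T n != fset0)
    (T_incr : forall n, (T n `<=` T n.+1)%fset)
    (T_infty : (#|` T n|%:R : R) @[n --> \oo] --> +oo)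
    (disp : nat -> measure_display)
    (Omega : forall n, measurableType (disp n))
    (P : forall n, probability (Omega n) R)
    (X : forall n, T n -> {RV (P n) >-> R})
    (X_L2 : forall n i, (X n i : Omega n -> R) \in Lfun (P n) 2%:E)
    (X_mean0 : forall n i, ('E_(P n)[X n i] = 0)%E)
    (p : R) (hp : 0 < p)
    (r : \bar R) (hr : ((p + 2)%:E < r)%E)
    (sigma_liminf :
      (0 < limn_einf (fun n => (sum_var (X n) / #|` T n|%:R)%:E))%E)
    (X_Lr : (ereal_sup [set e | exists n (i : T n),
               e = ('N[P n]_r[EFin \o X n i])%E] < +oo)%E)
    (alpha_summable :
      (ereal_sup (range (fun n => (mix_sum (X n) p r)%:E)) < +oo)%E) :
  let W n : {RV (P n) >-> R} := normalized_sum (X n) in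
  let M n := M_coef (X n) p r in
  let card n : R := #|` T n|%:R in
  [/\ (exists C : R, \forall n \near \oo, forall h : R -> R, Lambda p h ->
        `|fine 'E_(P n)[h \o W n]%E - gaussE h
          - edgeworth_sum (ceiln p).-1 (cumulant (P n) (W n)) h|
        <= C * (card n `^ (- (p / 2)) + M n)),
      (forall j : nat, (1 <= j <= (ceiln p).-1)%N ->
        exists C : R, \forall n \near \oo,
          `|cumulant (P n) (W n) (j + 2)|
          <= C * (card n `^ (- (j%:R / 2)) + M n `^ (j%:R / p))) &
      (1 <= p -> M n @[n --> \oo] --> 0 ->
        (wasserstein p (distribution (P n) (W n)) (std_normal R)
           @[n --> \oo] --> 0%E) /\
        (exists C : R, \forall n \near \oo,
          (wasserstein p (distribution (P n) (W n)) (std_normal R)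
           <= (C * (card n `^ (- (1 / 2)) + M n `^ p^-1))%:E)%E))].
Proof.
move=> W M card.
have [c0 c00 hc0] := limn_einf_gt0 sigma_liminf.
have card1 n : 1 <= card n by rewrite /card ler1n cardfs_gt0.
have card0 n : 0 < card n by exact: lt_le_trans ltr01 (card1 n).
have [K K0 hK] : exists2 K : R, 0 < K & forall n i, ('N[P n]_r[EFin \o X n i] <= K%:E)%E.
  have [K K0 hK] := ereal_sup_real_bound X_Lr; exists K => // n i.
  by apply: hK; exists n, i.
have [B _ hB'] := ereal_sup_real_bound alpha_summable.
have hB n : mix_sum (X n) p r <= B by rewrite -lee_fin; apply: hB'; exists n.
(* The lower limit bounds the variance only from some index on, which is why the conclusions hold
   for large n. *)
have good : \forall n \near \oo, good_field p K c0 B r (X n).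
  near=> n; split=> //.
  rewrite -ler_pdivlMr ?card0//; near: n; exact: hc0.
have [om01 pk n0] := omega_ceiln hp.
have kc : ((ceiln p).-1 < ceiln p)%N by rewrite prednK.
have kp : (ceiln p).-1%:R + omega p <= p by rewrite -pk.
split.
- have [C C0 hC] := edgeworth_bound B hd hp hr K0 c00 om01 (ltnSn _) kp kc.
  exists C; near=> n => h hL.
  have g : good_field p K c0 B r (X n) by near: n.
  have := hC _ _ _ _ _ g 1 _ ltr01 (Lambda_clsA hL).
  rewrite mulr1 Eerr_M_coef// expectationE -addrA -opprD (Gamma_cs _ _ (leqnSn _)).
  exact.
- move=> j hj; have [C C0 hC] := @cumulant_rate R d p K c0 B r hd hp hr K0 c00 j hj.
  by exists C; near=> n; apply: hC; near: n.
move=> p1 M0.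
have [C C0 hC] := @wasserstein_good R d p K c0 B r hd hp hr K0 c00 p1.
have bound : \forall n \near \oo, (wasserstein p (distribution (P n) (W n)) (std_normal R)
           <= (C * (card n `^ (- (1 / 2)) + M n `^ p^-1))%:E)%E.
  near=> n; apply: hC; first by near: n.
  by near: n; apply: (cvgr_le _ M0); exact: ltr01.
split; last by exists C.
have lim : ((C * (card n `^ (- (1 / 2)) + M n `^ p^-1))%:E : \bar R) @[n --> \oo] --> (0 : \bar R)%E.
  have Minv : ((card n)^-1 : R) @[n --> \oo] --> (0 : R).
    by apply/gtr0_cvgV0 => //; near=> n; exact: card0.
  have h1 := @cvg_powR0 R _ (1 / 2) _ _ Minv.
  have h2 := @cvg_powR0 R M p^-1 _ _ M0.
  have h3 : (C * (card n `^ (- (1 / 2)) + M n `^ p^-1) : R) @[n --> \oo] --> (0 : R).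
    rewrite -(mulr0 C) -[in X in _ --> X](addr0 (0 : R)).
    apply: cvgM; first exact: cvg_cst.
    apply: cvgD.
      have e n : card n `^ (- (1 / 2)) = (card n)^-1 `^ (1 / 2).
        by rewrite -[(card n)^-1]powR_inv1 ?(ltW (card0 n))// -powRrM mulN1r.
      under eq_fun => n do rewrite e.
      by apply: h1 => // n; rewrite invr_ge0 ltW.
    apply: h2; first by rewrite invr_gt0.
    by move=> n; exact: M_coef_ge0.
  by apply: cvg_EFin => //; near=> n.
apply: (@squeeze_cvge _ _ _ _ (fun=> 0%E) _ _ _ _ _ lim); last exact: cvg_cst.
near=> n; apply/andP; split; last by near: n.
apply: le_ereal_inf_tmp => _ [g _ <-]; exact: poweR_ge0.
Unshelve. all: by end_near.
Qed.
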